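(* Suppose that $\rho_v=W(\rho_w)$ and that $v_n=L_v(n)n^{-b}\rho_v^{-n}$ $(n\ge1)$ and $w_n\sim c_wn^{-a}\rho_w^{-n}$ $(n\to\infty)$ for a slowly varying function $L_v$, a constant $c_w>0$, and exponents $1<a,b<2$ (with $0<\rho_v,\rho_w<\infty$). Let $\alpha=a-1$. Define the following point process on $]0,1]$: $$\Upsilon_n=\sum_{1\le i\le N_n,\ K_i>0}\delta_{K_i/n},$$ with $\delta$ referring to the Dirac measure. Then $$\Upsilon_n\xrightarrow{d}\Upsilon$$ as $n\to\infty$, for a point process $\Upsilon$ on $]0,1]$ with intensity $$\frac{x^{-\alpha-1}(1-x)^{\alpha(2-b)-1}}{B(1-\alpha,\alpha(2-b))}\,\mathrm dx,$$ where $B(\cdot,\cdot)$ denotes Euler's beta function. Almost surely, $\Upsilon$ has infinitely many points.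
   Context: Gibbs partitions. Let $(v_i)_{i\ge1}$, $(w_i)_{i\ge0}$ be sequences of non-negative reals, $V(x)=\sum_{i\ge1}v_ix^i$, $W(x)=\sum_{i\ge0}w_ix^i$, $U(x)=V(W(x))=\sum_{n\ge0}u_nx^n$, so that $u_n=\sum_{k\ge1}v_k\sum_{x_1+\dots+x_k=n}w_{x_1}\cdots w_{x_k}$ (sum over $x_i\in\mathbb N_0$). Let $\rho_v,\rho_w$ be the radii of convergence of $V,W$; $W(\rho_w)$ denotes the value of the series. For $n\ge1$ with $u_n>0$, the Gibbs partition $P_n$ is the random partition of $\{1,\dots,n\}$ with $\mathbb P(P_n=P)=\frac{1}{n!\,u_n}|P|!\,v_{|P|}\prod_{Q\in P}|Q|!\,w_{|Q|}$ (empty components are allowed if $w_0>0$). $N_n$ is its number of components and $K_1,\dots,K_{N_n}$ are their sizes listed in exchangeable order; precisely $\mathbb P(N_n=k,(K_1,\dots,K_k)=(x_1,\dots,x_k))=v_kw_{x_1}\cdots w_{x_k}/u_n$ for $k\ge1$, $x_i\in\mathbb N_0$, $\sum x_i=n$. A function $L:\mathbb R_{>0}\to\mathbb R_{>0}$ is slowly varying if $L(tx)/L(x)\to1$ as $x\to\infty$ for all $t>0$. Convergence in distribution of point processes on $]0,1]$ is with respect to the vague topology on locally finite measures on $]0,1]$; equivalently $\int\psi\,\mathrm d\Upsilon_n\xrightarrow{d}\int\psi\,\mathrm d\Upsilon$ for every continuous $\psi:]0,1]\to\mathbb R_{\ge0}$ with compact support in $]0,1]$. The intensity of $\Upsilon$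 is the measure $B\mapsto\mathbb E[\Upsilon(B)]$.
   Formalization: The slowly varying function L_v is additionally assumed measurable on ]0,∞[ (Karamata's standard definition); without measurability the claim fails, by a Hamel-basis counterexample in which v_n has dominating spikes along multiples of sparse primes. *)

(* Defs.v *)
From HB Require Import structures.
From mathcomp Require Import all_boot all_order all_algebra.
From mathcomp Require Import all_classical all_reals all_analysis.

Set Implicit Arguments.
Unset Strict Implicit.
Unset Printing Implicit Defensive.

Import Order.TTheory GRing.Theory Num.Theory.
Import numFieldNormedType.Exports.

Local Open Scope classical_set_scope.
Local Open Scope ring_scope.

(* Measurability is part of the classical (Karamata) notion and is not implied by
   the limit condition.  If f : R -> R is Q-linear, L x = 1 + |f (ln x)| / ln (2 + x)
   satisfies the limit condition, while the numbers f (ln p), p prime, can be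
   prescribed at will by means of a Hamel basis. *)
Definition slowly_varying (R : realType) (L : R -> R) : Prop :=
  [/\ measurable_fun (`]0, +oo[ : set R) L,
      forall x, 0 < x -> 0 < L x &
      forall t, 0 < t -> L (t * x) / L x @[x --> +oo] --> (1 : R)].

Definition conv_radius (R : realType) (c : nat -> R) : \bar R :=
  ereal_sup [set r%:E | r in
    [set r : R | 0 <= r /\ cvgn (series (fun i => `|c i| * r ^+ i))]].

(* The inner sum runs over the (x_1, ..., x_k) in nat^k with sum n; each entry
   is then at most n, which makes it a finite sum. *)
Definition gibbs_u (R : realType) (v w : nat -> R) (n : nat) : \bar R :=
  (\sum_(1 <= k <oo)
    (v k * \sum_(x : k.-tuple 'I_n.+1 | (\sum_(i < k) tnth x i == n)%N)
             \prod_(i < k) w (tnth x i))%:E)%E.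

(* K is the random sequence [:: K_1; ...; K_N] of component sizes, whose length
   N is the number of components. *)
Definition gibbs_sizes (R : realType) (v w : nat -> R) (n : nat)
    (d : measure_display) (T : measurableType d) (P : probability T R)
    (K : T -> seq nat) : Prop :=
  (forall x : seq nat, measurable (K @^-1` [set x])) /\
  (forall x : seq nat, (0 < size x)%N -> sumn x = n ->
    P (K @^-1` [set x]) =
      (v (size x) * \prod_(i <- x) w i / fine (gibbs_u v w n))%:E).

Definition sizes_measure (R : realType) (n : nat) (s : seq nat) :
    {measure set (measurableTypeR R) -> \bar R} :=
  let s' := [seq k <- s | (0 < k)%N] in
  msum (fun i => \d_((nth 0%N s' i)%:R / n%:R : measurableTypeR R)) (size s').

(* Point processes on ]0, 1], as integer-valued random measures on the line that
   are carried by ]0, 1] and finite on the compact subsets of ]0, 1]. *)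
Definition point_process (R : realType) (d : measure_display)
    (T : measurableType d) (Y : R.-ker T ~> measurableTypeR R) : Prop :=
  forall t : T,
  [/\ Y t (~` `]0, 1]) = 0%E,
      forall C : set R, compact C -> C `<=` `]0, 1] -> (Y t C < +oo)%E &
      forall B : set (measurableTypeR R), measurable B ->
        Y t B = +oo%E \/ exists m : nat, Y t B = (m%:R)%:E].

Definition cvg_in_distribution (R : realType) (d : nat -> measure_display)
    (T : forall n, measurableType (d n)) (P : forall n, probability (T n) R)
    (X : forall n, T n -> R)
    (d' : measure_display) (T' : measurableType d') (P' : probability T' R)
    (X' : T' -> R) : Prop :=
  forall f : R -> R, continuous f -> (exists M, forall x, `|f x| <= M) ->
    (expectation (P n) (f \o X n) @[n --> \oo] --> expectation P' (f \o X'))%E.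

Definition cvg_point_process (R : realType) (d : nat -> measure_display)
    (T : forall n, measurableType (d n)) (P : forall n, probability (T n) R)
    (Y : forall n, T n -> {measure set (measurableTypeR R) -> \bar R})
    (d' : measure_display) (T' : measurableType d') (P' : probability T' R)
    (Y' : T' -> {measure set (measurableTypeR R) -> \bar R}) : Prop :=
  forall psi : R -> R,
    {within `]0, 1], continuous psi} ->
    (forall x, x \in `]0, 1] -> 0 <= psi x) ->
    (exists C : set R, [/\ compact C, C `<=` `]0, 1] &
       forall x, x \in `]0, 1] -> ~ C x -> psi x = 0]) ->
    cvg_in_distribution P
      (fun n t => \int[Y n t]_(x in `]0, 1]) psi x)
      P' (fun t => \int[Y' t]_(x in `]0, 1]) psi x).

Definition has_intensity (R : realType) (d : measure_display)
    (T : measurableType d) (P : probability T R)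
    (Y : T -> {measure set (measurableTypeR R) -> \bar R}) (h : R -> R) : Prop :=
  forall B : set (measurableTypeR R), measurable B -> B `<=` `]0, 1] ->
    (\int[P]_t Y t B = \int[lebesgue_measure]_(x in B) (h x)%:E)%E.

(* The library's beta_fun only takes natural-number arguments. *)
Definition euler_beta (R : realType) (x y : R) : R :=
  \int[lebesgue_measure]_(t in `]0, 1[) (t `^ (x - 1) * (1 - t) `^ (y - 1)).

(* Main.v *)
Require Import Defs.
From HB Require Import structures.
From mathcomp Require Import all_boot all_order all_algebra.
From mathcomp Require Import all_classical all_reals all_analysis.
From mathcomp Require Import measurable_realfun ring lra zify.

Set Implicit Arguments.
Unset Strict Implicit.
Unset Printing Implicit Defensive.

Import Order.TTheory GRing.Theory Num.Theory.
Import numFieldNormedType.Exports.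

Local Open Scope classical_set_scope.
Local Open Scope ring_scope.


(** Revealing the components in size-biased order turns the Gibbs partition
    into a Markov chain, and this chain converges to stick breaking.

    Criticality makes p_x = w_x rho_w^x / rho_v a probability on the sizes;
    put a_k = v_k rho_v^k = Lv(k) k^-b.  Let W_r(m) be the total weight of the
    ways to complete a partition by components of total size m when r
    components have been revealed before: it is the sum over j of
    a_(j + r) (j + r) ... (j + 1) times the coefficient of z^m in the j-th power
    of the generating function of p ([gibbs_weight]).  Writing m as the sum of
    the sizes yields the identity
      m W_r(m) = sum_x x p_x W_(r + 1)(m - x)          ([seq_mix_size_bias]),
    so a component chosen with probability proportional to its size has size x
    with probability x p_x W_(r + 1)(m - x) / (m W_r(m)).

    The analytic core is that W_r varies regularly with index
    alpha (r + 1 - b) - 1 for every r ([pw_mix_regularly_varying]).  Generating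
    functions give the asymptotics of the Laplace sums of W_r ([abelian]), but
    no local information.  For large r the weights are so large that the
    crude bound [local_upper_bound] has the right order, and Karamata's
    Tauberian method in the form [tauberian_convolution] gives pointwise
    asymptotics for the convolution of W_(r + 1) with x p_x, that is, for W_r.
    The identity, read as a convolution, then descends to r = 0.
    Slow variation enters only through Potter bounds and uniform convergence
    ([slowly_varying_regularize]).

    It follows that the successive fractions taken by the size-biased chain
    converge to independent beta variables with parameters 1 - alpha and
    alpha (r + 2 - b), for r = 0, 1, ... ([chain_mass_cvg]).  The mean length
    left after n steps tends to 0 ([residual_product_cvg0]), and components of
    size at least d N that have not been revealed by then are rare by Markov's
    inequality; hence the law of a finite sum of psi(K_i / N), for psi
    vanishing near 0, is determined by finitely many steps up to a small error
    ([gibbs_chain_cvg]).  The limit is the point process of the lengths of a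
    stick broken by these beta fractions.  It is built on the unit interval
    with the uniform law, whose binary digits supply independent uniform
    variables ([integral_even_odd]).

    The lengths are positive with sum at most 1: there are infinitely many of
    them, and finitely many in any compact subset of ]0, 1].  For the intensity,
    summing psi over all components amounts to averaging psi(x) / x over one
    size-biased component, whose limit has the beta density with parameters
    1 - alpha and alpha (2 - b) ([mean_stick_sum]); division by x yields the
    stated density. *)

(** * Affine images of Lebesgue measure *)

Lemma lebesgue_measure_affine (R : realType) (a c : R) (B : set R) :
  0 < a -> measurable B ->
  (lebesgue_measure ((fun x : R => a * x + c)%R @^-1` B) =
   a^-1%:E * lebesgue_measure B)%E.
Proof.
move=> a0 mB.
pose f : measurableTypeR R -> measurableTypeR R := fun x => a * x + c.
have mf : measurable_fun setT f.
  by apply: measurable_funD => //; apply: measurable_funM => //; exact: measurable_id.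
pose m : {measure set (measurableTypeR R) -> \bar R} :=
  mscale (NngNum (ltW a0)) (pushforward (@lebesgue_measure R) f).
have -> : lebesgue_measure B = m mf B.
  apply: lebesgue_measure_unique => // X [[x y] _ /= <-].
  rewrite /m/= /mscale/= /pushforward/=.
  have -> : (fun x => a * x + c) @^-1` `]x, y] = `](x - c) / a, (y - c) / a]%classic.
    apply/seteqP; split => z /=; rewrite !in_itv/= ltr_pdivrMr// ler_pdivlMr//;
    by rewrite ltrBlDr lerBrDr (mulrC z).
  rewrite !lebesgue_measure_itv/= !lte_fin ltr_pM2r ?invr_gt0// ltrD2r.
  case: ifPn => // _; last by rewrite mule0.
  by rewrite -EFinM; congr (_%:E); field; rewrite gt_eqF.
by rewrite /m/= /mscale/= muleA -EFinM mulVf ?gt_eqF// mul1e.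
Qed.


(** * Uniform convergence for slowly varying functions *)

Lemma ge0_integral_translation (R : realType) (c : R) (D : set R) (f : R -> R) :
  measurable D -> measurable_fun setT f -> (forall x, 0 <= f x) ->
  (\int[lebesgue_measure]_(z in (fun z : R => z + c)%R @^-1` D) (f (z + c))%:E =
   \int[lebesgue_measure]_(z in D) (f z)%:E)%E.
Proof.
move=> mD mf f0.
pose phi : measurableTypeR R -> measurableTypeR R := fun z => z + c.
have mphi : measurable_fun setT phi.
  by apply: measurable_funD => //; exact: measurable_id.
have mfD : measurable_fun D (EFin \o f).
  by apply/measurable_EFinP; exact: measurable_funS mf.
rewrite -(@ge0_integral_pushforward _ _ _ _ R phi mphi lebesgue_measure D (EFin \o f))//; last first.
  by move=> x _; rewrite /= lee_fin.
apply: eq_measure_integral => A mA _; rewrite /= /pushforward.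
have := @lebesgue_measure_affine R 1 c A ltr01 mA.
rewrite invr1 mul1e => <-; congr (lebesgue_measure _).
by apply/seteqP; split => z /=; rewrite /phi mul1r.
Qed.

Lemma slowly_varying_log_measurable (R : realType) (L : R -> R) :
  slowly_varying L -> measurable_fun setT (fun x => ln (L (expR x))).
Proof.
case=> mL _ _.
apply: (measurableT_comp (@measurable_ln R)).
apply: (@measurable_comp _ _ _ _ _ _ (`]0, +oo[%classic : set R)) => //.
by move=> _ /= [x _ <-]; rewrite in_itv/= expR_gt0.
Qed.

Lemma slowly_varying_log_cvg (R : realType) (L : R -> R) (x : nat -> R) (y : R) :
  slowly_varying L -> x n @[n --> \oo] --> +oo ->
  ln (L (expR (x n + y))) - ln (L (expR (x n))) @[n --> \oo] --> 0.
Proof.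
case=> mL L0 Lt xoo.
have ex : expR (x n) @[n --> \oo] --> +oo.
  apply/cvgryPge => M; move/cvgryPge : xoo => /(_ M); apply: filterS => n Mx.
  by rewrite (le_trans Mx)// (le_trans _ (expR_ge1Dx _))// lerDr.
have := cvg_comp _ _ ex (Lt (expR y) (expR_gt0 _)) => H.
rewrite -(@ln1 R).
have := cvg_comp _ _ H (@continuous_ln R 1 ltr01).
apply: cvg_trans; apply: near_eq_cvg; near=> n => /=.
rewrite -ln_div ?posrE ?L0 ?expR_gt0//.
by rewrite expRD (mulrC (expR (x n))).
Unshelve. all: by end_near. Qed.

Lemma minr1_norm_cvg0 (R : realType) (f : nat -> R) :
  Num.min 1 `|f n| @[n --> \oo] --> 0 -> f n @[n --> \oo] --> 0.
Proof.
move=> H; apply/norm_cvg0P.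
apply: (@minr_cvg_0_cvg_0 R (fun n => `|f n|) 1) => //.
by under eq_fun do rewrite minC.
Qed.

(** Truncation at 1 supplies a constant dominating function, so that pointwise
    convergence of the increments integrates; here measurability of [L]
    enters. *)
Lemma slowly_varying_log_int_cvg (R : realType) (L : R -> R) (x : nat -> R) (A : R) :
  slowly_varying L -> x n @[n --> \oo] --> +oo ->
  let h := fun x => ln (L (expR x)) in
  (\int[lebesgue_measure]_(y in `[0%R, A])
     (Num.min 1 `|h (x n + y)%R - h (x n)|%R)%:E @[n --> \oo] --> 0)%E.
Proof.
move=> svL xoo h.
have mh := slowly_varying_log_measurable svL.
have -> : 0%E = (\int[lebesgue_measure]_(y in `[0%R, A]) (cst 0%E y))%E :> \bar R.
  by rewrite integral0.
apply: (@dominated_cvg _ _ R lebesgue_measure `[0, A]%classic _ _ _ (cst 1%E)) => //.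
- move=> n; apply/measurable_EFinP; apply: measurable_funTS.
  apply: measurable_minr => //; apply: measurableT_comp => //.
  apply: measurable_funB => //.
  apply: (measurableT_comp mh); apply: measurable_funD => //; exact: measurable_id.
- move=> y _; apply: cvg_EFin; first exact: nearW.
  rewrite [X in X @ _](_ : _ = fun n => Num.min 1 `|h (x n + y) - h (x n)|)//.
  have H := slowly_varying_log_cvg y svL xoo.
  have {}H : `|h (x n + y) - h (x n)| @[n --> \oo] --> 0 by apply/norm_cvg0P.
  apply: squeeze_cvgr; [|exact: cvg_cst|exact: H].
  by apply: nearW => n; rewrite le_min ler01 normr_ge0/= ge_min lexx orbT.
- apply/integrableP; split => //; rewrite integral_cst//= lebesgue_measure_itv/=.
  by case: ifP => _; rewrite ?mule0 ?normr1 ?mul1e ?oppr0 ?addr0 ltry.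
- move=> n y _; rewrite /= lee_fin ger0_norm; first by rewrite ge_min lexx.
  by rewrite le_min ler01 normr_ge0.
Qed.

Lemma minr1D (R : realType) (p q r : R) : 0 <= p -> 0 <= q -> r <= p + q ->
  Num.min 1 r <= Num.min 1 p + Num.min 1 q.
Proof.
move=> p0 q0 rpq; rewrite ge_min.
have [p1|p1] := leP 1 p; first by rewrite lerDl le_min ler01 q0.
have [q1|q1] := leP 1 q; first by rewrite lerDr p0.
by rewrite rpq orbT.
Qed.

(** Karamata's uniform convergence theorem for sequences, in logarithmic
    coordinates. For every [z] the triangle inequality bounds the increment over
    [u n] by the increments from [x n] to [x n + z] and from
    [x n + u n] to [x n + z]; averaging over a unit interval of [z] that
    keeps both steps in a fixed compact set reduces the claim to two averaged
    increments, which tend to 0. *)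
Lemma slowly_varying_log_uniform (R : realType) (L : R -> R) (x u : nat -> R) (U : R) :
  slowly_varying L -> x n @[n --> \oo] --> +oo -> (forall n, `|u n| <= U) ->
  ln (L (expR (x n + u n))) - ln (L (expR (x n))) @[n --> \oo] --> 0.
Proof.
move=> svL xoo uU.
pose h := fun x => ln (L (expR x)).
have mh : measurable_fun setT h := slowly_varying_log_measurable svL.
have U0 : 0 <= U by rewrite (le_trans _ (uU 0%N)).
have woo : x n + u n @[n --> \oo] --> +oo.
  apply/cvgryPge => M; move/cvgryPge : xoo => /(_ (M + U)).
  apply: filterS => n; move: (uU n); rewrite ler_norml => /andP[]; lra.
pose d (t : R) (y : R) := Num.min 1 `|h (t + y) - h t|.
have mshift c : measurable_fun setT (fun z : R => z + c).
  by apply: measurable_funD => //; exact: measurable_id.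
have d0 t y : 0 <= d t y by rewrite le_min ler01 normr_ge0.
have md t : measurable_fun setT (d t).
  apply: measurable_minr => //; apply: measurableT_comp => //.
  apply: measurable_funB => //.
  apply: (measurableT_comp mh); apply: measurable_funD => //; exact: measurable_id.
have H1 := slowly_varying_log_int_cvg (2 * U + 1) svL xoo.
have H2 := slowly_varying_log_int_cvg (2 * U + 1) svL woo.
have H : (\int[lebesgue_measure]_(y in `[0%R, (2 * U + 1)%R]) (d (x n) y)%:E +
   \int[lebesgue_measure]_(y in `[0%R, (2 * U + 1)%R]) (d (x n + u n)%R y)%:E
   @[n --> \oo] --> 0)%E.
  have K := cvgeD (isT : (0 : \bar R) +? 0)%E H1 H2; rewrite adde0 in K; exact: K.
apply: minr1_norm_cvg0.
suff K : ((Num.min 1 `|h (x n + u n)%R - h (x n)|%R)%:E @[n --> \oo] --> 0)%E.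
  exact: (fine_cvg K).
(* For z between U and U + 1, both z and z - u n lie between 0 and 2 U + 1. *)
have le n : ((Num.min 1 `|h (x n + u n)%R - h (x n)|%R)%:E <=
   \int[lebesgue_measure]_(y in `[0%R, (2 * U + 1)%R]) (d (x n) y)%:E +
   \int[lebesgue_measure]_(y in `[0%R, (2 * U + 1)%R]) (d (x n + u n)%R y)%:E)%E.
  have un := uU n; rewrite ler_norml in un; case/andP : un => un1 un2.
  have md' : measurable_fun setT (fun z : R => d (x n + u n) (z - u n)).
    exact: (measurableT_comp (md (x n + u n)) (mshift (- u n))).
  have m1 : measurable_fun `[U, U + 1]%classic (fun z : R => (d (x n) z)%:E).
    by apply/measurable_EFinP; apply: measurable_funTS; exact: md.
  have m2 : measurable_fun `[U, U + 1]%classic (fun z : R => (d (x n + u n) (z - u n)%R)%:E).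
    by apply/measurable_EFinP; apply: measurable_funTS.
  set c := Num.min _ _.
  have -> : c%:E = (\int[lebesgue_measure]_(z in `[U, (U + 1)%R]) c%:E)%E.
    rewrite integral_cst//= lebesgue_measure_itv/= lte_fin ltrDl ltr01.
    by rewrite -EFinD addrAC subrr add0r mule1.
  apply: (@le_trans _ _ (\int[lebesgue_measure]_(z in `[U, (U + 1)%R])
      ((d (x n) z)%:E + (d (x n + u n)%R (z + - u n)%R)%:E))%E).
    apply: ge0_le_integral => //=.
    - by move=> z _; rewrite lee_fin le_min ler01 normr_ge0.
    - exact: emeasurable_funD.
    move=> z _; rewrite -EFinD lee_fin /c /d.
    have -> : x n + u n + (z + - u n) = x n + z by ring.
    apply: minr1D => //; rewrite [leRHS]addrC (distrC (h (x n + z)) (h (x n + u n))).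
    exact: (ler_distD (h (x n + z)) (h (x n + u n)) (h (x n))).
  have p1 (z : R) : `[U, U + 1]%classic z -> (0 <= (d (x n) z)%:E)%E by rewrite lee_fin.
  have p2 (z : R) : `[U, U + 1]%classic z -> (0 <= (d (x n + u n) (z - u n)%R)%:E)%E.
    by rewrite lee_fin.
  have sub1 : `[U, U + 1]%classic `<=` `[0, 2 * U + 1]%classic.
    by move=> z /=; rewrite !in_itv/= => /andP[]; lra.
  have sub2 : `[U, U + 1]%classic `<=` (fun z : R => z - u n) @^-1` `[0, 2 * U + 1]%classic.
    by move=> z /=; rewrite !in_itv/= => /andP[]; lra.
  rewrite [leLHS](@ge0_integralD _ _ R (@lebesgue_measure R) _
    (measurable_itv _) _ _ p1 m1 p2 m2).
  apply: leeD.
    apply: ge0_subset_integral => //=.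
    - by apply/measurable_EFinP; apply: measurable_funTS; exact: md.
    - by move=> z _; rewrite lee_fin.
  rewrite -(@ge0_integral_translation R (- u n) `[0, 2 * U + 1]%classic (d (x n + u n)))//.
  apply: ge0_subset_integral => //=.
  - by rewrite -[X in measurable X]setTI; exact: (mshift (- u n)).
  - by apply/measurable_EFinP; apply: measurable_funTS.
  - by move=> z _; rewrite lee_fin.
apply: squeeze_cvge; [|exact: (cvg_cst 0%E)|exact: H].
by apply: nearW => n; rewrite le andbT lee_fin le_min ler01 normr_ge0.
Qed.


(** * Potter bounds *)

(** Potter's inequality with one exponent, imposed on all positive arguments and
    not only on large ones. *)
Definition potter (R : realType) (eta : R) (l : R -> R) :=
  exists2 C, 0 < C & forall x y, 0 < x -> 0 < y ->
    l y <= C * l x * Num.max (y / x) (x / y) `^ eta.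

(** Uniform slow variation along sequences: the form in which slow variation is
    used under sums. *)
Definition asymptotically_flat (R : realType) (l : R -> R) :=
  forall (x y : nat -> R) (t : R), x n @[n --> \oo] --> +oo -> 0 < t ->
    y n / x n @[n --> \oo] --> t -> l (y n) / l (x n) @[n --> \oo] --> (1 : R).

(** Otherwise there would be points [t] tending to infinity with steps [u]
    between 0 and 1 that violate the bound, against uniform convergence along
    sequences. *)
Lemma slowly_varying_log_unit_step (R : realType) (L : R -> R) (eta : R) :
  slowly_varying L -> 0 < eta ->
  exists2 T : R, 0 <= T & forall t u, T <= t -> 0 <= u <= 1 ->
    `|ln (L (expR (t + u))) - ln (L (expR t))| <= eta.
Proof.
move=> svL eta0; apply: contrapT => H.
have {}H (n : nat) : exists p : R * R, [/\ n%:R <= p.1, 0 <= p.2 <= 1 &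
    eta < `|ln (L (expR (p.1 + p.2))) - ln (L (expR p.1))|].
  apply: contrapT => K; apply: H; exists n%:R => // t u nt u01.
  by rewrite leNgt; apply/negP => L1; apply: K; exists (t, u).
have [p Hp] := choice H.
have xoo : (p n).1 @[n --> \oo] --> +oo.
  apply/cvgryPge => M; near=> n; have [+ _ _] := Hp n; apply: le_trans.
  near: n; exact: nbhs_infty_ger.
have ub n : `|(p n).2| <= 1.
  by have [_ /andP[p0 p1] _] := Hp n; rewrite ger0_norm.
have /cvgrPdist_lt /(_ _ eta0) [N _ /(_ N (leqnn _))] :=
  slowly_varying_log_uniform svL xoo ub.
rewrite /= sub0r normrN => lt1.
by have [_ _ /(lt_trans lt1)] := Hp N; rewrite ltxx.
Unshelve. all: by end_near. Qed.

(** Cut the segment from [x] to [y] into unit steps and at most one shorter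
    one. *)
Lemma unit_step_linear_growth (R : realType) (h : R -> R) (T eta : R) :
  0 < eta ->
  (forall t u, T <= t -> 0 <= u <= 1 -> `|h (t + u) - h t| <= eta) ->
  forall x y, T <= x -> T <= y -> `|h y - h x| <= eta * (`|y - x| + 1).
Proof.
move=> eta0 H.
have K n t s : T <= t -> 0 <= s <= n.+1%:R -> `|h (t + s) - h t| <= eta * n.+1%:R.
  move=> Tt; elim: n s => [|n IH] s /andP[s0 sn].
    by rewrite mulr1; apply: H; rewrite // s0.
  have [s1|s1] := leP s 1.
    rewrite (le_trans (H _ _ Tt _)) ?s0//.
    by rewrite ler_peMr ?(ltW eta0)// ler1n.
  have -> : eta * n.+2%:R = eta * n.+1%:R + eta by rewrite -(natr1 n.+1); ring.
  have -> : h (t + s) - h t = (h (t + (s - 1) + 1) - h (t + (s - 1))) + (h (t + (s - 1)) - h t).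
    have -> : t + (s - 1) + 1 = t + s by ring.
    by ring.
  rewrite (le_trans (ler_normD _ _))// addrC lerD//.
    by apply: IH; move: sn; rewrite -(natr1 n.+1); lra.
  by apply: H; lra.
have M t s : T <= t -> 0 <= s -> `|h (t + s) - h t| <= eta * (s + 1).
  move=> Tt s0; have := truncn_itv s0 => /andP[ns sn].
  rewrite (le_trans (K (Num.truncn s) t s Tt _)) ?s0 ?(ltW sn)//.
  by rewrite ler_pM2l// -natr1 lerD2r.
move=> x y Tx Ty; have [xy|yx] := leP x y.
  have := M x (y - x) Tx; rewrite subr_ge0 => /(_ xy).
  by rewrite (addrC x) subrK (ger0_norm (x := y - x)) ?subr_ge0.
have := M y (x - y) Ty; rewrite subr_ge0 => /(_ (ltW yx)).
rewrite (addrC y) subrK (distrC (h y)) (distrC y) (ger0_norm (x := x - y)) ?subr_ge0//.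
exact: ltW.
Qed.

(** Freezing [L] below a large [X] leaves the limit theory unchanged and makes
    Potter's bound global, because the frozen logarithm is a function of the
    1-Lipschitz map [x |-> ln (max x X)]. *)
Lemma slowly_varying_regularize (R : realType) (L : R -> R) (eta : R) :
  slowly_varying L -> 0 < eta ->
  exists l : R -> R, [/\ forall x, 0 < l x, potter eta l, asymptotically_flat l
    & exists X, forall x, X <= x -> l x = L x].
Proof.
move=> svL eta0.
have [T T0 HT] := slowly_varying_log_unit_step svL eta0.
pose h x := ln (L (expR x)).
have Hh := @unit_step_linear_growth R h T eta eta0 HT.
have L0 : forall x, 0 < x -> 0 < L x by case: svL.
pose X := expR T.
have X0 : 0 < X := expR_gt0 T.
have mX x : 0 < Num.max x X by rewrite lt_max X0 orbT.
have lE x : L (Num.max x X) = expR (h (ln (Num.max x X))).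
  by rewrite /h !lnK// posrE ?mX ?L0.
have Tln x : T <= ln (Num.max x X).
  by rewrite -[leLHS](expRK T) ler_ln ?posrE// le_max lexx orbT.
have lip x y : 0 < x -> 0 < y ->
    `|ln (Num.max y X) - ln (Num.max x X)| <= `|ln y - ln x|.
  have main x1 y1 : 0 < x1 -> x1 <= y1 ->
      `|ln (Num.max y1 X) - ln (Num.max x1 X)| <= `|ln y1 - ln x1|.
    move=> x10 xy1; have y10 := lt_le_trans x10 xy1.
    have A1 : ln x1 <= ln y1 by rewrite ler_ln.
    rewrite !ger0_norm ?subr_ge0//; last first.
      by rewrite ler_ln ?posrE// ge_max !le_max xy1/= lexx !orbT.
    have [xX|xX] := leP x1 X; have [yX|yX] := leP y1 X.
    - by rewrite subrr subr_ge0.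
    - by rewrite lerD2l lerN2 ler_ln.
    - by have := lt_le_trans xX (le_trans xy1 yX); rewrite ltxx.
    - by [].
  move=> x0 y0; have [xy|/ltW yx] := leP x y; first exact: main.
  by rewrite distrC (distrC (ln y)); exact: main.
exists (fun x => L (Num.max x X)); split.
- by move=> x; rewrite L0.
- exists (expR eta); first exact: expR_gt0.
  move=> x y x0 y0; rewrite !lE.
  have -> : Num.max (y / x) (x / y) `^ eta = expR (eta * `|ln y - ln x|).
    rewrite /powR gt_eqF; last by rewrite lt_max divr_gt0.
    congr (expR (_ * _)).
    have [xy|/ltW yx] := leP x y.
      rewrite max_l; last first.
        rewrite (@le_trans _ _ 1)// ?ler_pdivrMr ?ler_pdivlMr ?mul1r//.
      by rewrite ln_div ?posrE// ger0_norm// subr_ge0 ler_ln.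
    rewrite max_r; last first.
      rewrite (@le_trans _ _ 1)// ?ler_pdivrMr ?ler_pdivlMr ?mul1r//.
    by rewrite ln_div ?posrE// distrC ger0_norm// subr_ge0 ler_ln.
  rewrite -!expRD ler_expR.
  have := Hh _ _ (Tln x) (Tln y); have := lip _ _ x0 y0.
  set A := ln (Num.max _ _); set B := ln (Num.max _ _); set D := `|ln y - ln x|.
  move=> AB1 AB2; have AB3 := ler_norm (h A - h B).
  have : eta * (`|A - B| + 1) <= eta * (D + 1) by rewrite ler_pM2l// lerD2r.
  lra.
- move=> x y t xoo t0 xyt.
  have yxX : \forall n \near \oo, 0 < y n / x n.
    by move/cvgrPdist_lt : xyt => /(_ _ t0); apply: filterS => n; rewrite ltr_norml; lra.
  have lc : ln (y n / x n) @[n --> \oo] --> ln t.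
    by apply: cvg_comp xyt _; exact: continuous_ln.
  pose U := `|ln t| + 1.
  have bU : \forall n \near \oo, `|ln (y n / x n)| <= U.
    move/cvgrPdist_le : lc => /(_ _ ltr01); apply: filterS => n Hn.
    rewrite /U -[X in `|X|](subrK (ln t)) (le_trans (ler_normD _ _))//.
    by rewrite addrC lerD2l distrC.
  pose u n := if `|ln (y n / x n)| <= U then ln (y n / x n) else 0.
  have uU n : `|u n| <= U.
    by rewrite /u; case: ifP => // _; rewrite normr0 addr_ge0.
  have lxoo : ln (x n) @[n --> \oo] --> +oo.
    apply/cvgryPge => M; move/cvgryPge : xoo => /(_ (expR M)); apply: filterS => n Mx.
    by rewrite -[M]expRK ler_ln ?posrE ?expR_gt0// (lt_le_trans _ Mx) ?expR_gt0.
  have := slowly_varying_log_uniform svL lxoo uU.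
  move/(cvg_comp _ _)/(_ (@continuous_expR R 0)); rewrite expR0.
  apply: cvg_trans; apply: near_eq_cvg; near=> n => /=.
  have xX : X * expR U <= x n by near: n; move/cvgryPge : xoo => /(_ (X * expR U)).
  have U0 : 0 <= U by rewrite addr_ge0.
  have XX : X <= x n by rewrite (le_trans _ xX)// ler_peMr ?(ltW X0)// -[leLHS]expR0 ler_expR.
  have x0 : 0 < x n := lt_le_trans X0 XX.
  have yx0 : 0 < y n / x n by near: n.
  have y0 : 0 < y n by rewrite -(divfK (lt0r_neq0 x0) (y n)) mulr_gt0.
  have bb : `|ln (y n / x n)| <= U by near: n.
  have yX : X <= y n.
    rewrite -ler_ln ?posrE//; move: bb; rewrite ler_norml ln_div ?posrE// => /andP[b1 _].
    have : ln (X * expR U) <= ln (x n) by rewrite ler_ln ?posrE ?mulr_gt0 ?expR_gt0.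
    rewrite lnM ?posrE ?expR_gt0// expRK; lra.
  rewrite /u bb !max_l//.
  have -> : ln (x n) + ln (y n / x n) = ln (y n) by rewrite ln_div ?posrE//; ring.
  by rewrite expRB !lnK ?posrE ?L0 ?expR_gt0// lnK.
- by exists X => x Xx; rewrite max_l.
Unshelve. all: by end_near. Qed.


(** * Sums as integrals of step functions *)

Section step_functions.
Context (R : realType).
Implicit Types (G : nat -> R) (N : R).

Let cell N (k : nat) : set R := `[k%:R / N, k.+1%:R / N[%classic.

Let cellP N k t : 0 < N -> 0 <= t -> cell N k t <-> Num.truncn (N * t) = k.
Proof.
move=> N0 t0; rewrite /cell/= in_itv/= ler_pdivrMr// ltr_pdivlMr// (mulrC t).
split; first exact: truncn_def.
by move=> <-; apply: truncn_itv; rewrite mulr_ge0// ltW.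
Qed.

Let cell_cover N : 0 < N -> \bigcup_k cell N k = (`[0, +oo[%classic : set R).
Proof.
move=> N0; apply/seteqP; split => t /=.
  case=> k _; rewrite /cell/= !in_itv/= andbT => /andP[+ _]; apply: le_trans.
  by rewrite divr_ge0// ltW.
by rewrite in_itv/= andbT => t0; exists (Num.truncn (N * t)) => //; apply/cellP.
Qed.

Let cell_triv N : 0 < N -> trivIset setT (cell N).
Proof.
move=> N0; apply/trivIsetP => i j _ _; apply: contra_neqP.
case/eqP/set0P => t [ti tj].
have t0 : 0 <= t.
  move: ti; rewrite /cell/= in_itv/= => /andP[+ _]; apply: le_trans.
  by rewrite divr_ge0// ltW.
by rewrite -((cellP i N0 t0).1 ti) ((cellP j N0 t0).1 tj).
Qed.

Lemma measurable_step G N : 0 < N ->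
  measurable_fun (`[0, +oo[%classic : set R) (fun t => G (Num.truncn (N * t))).
Proof.
move=> N0; rewrite -(cell_cover N0); apply/measurable_fun_bigcup => k.
  exact: measurable_itv.
apply: (@eq_measurable_fun _ _ _ _ _ (cst (G k))); last exact: measurable_cst.
move=> t; rewrite inE => tk; congr (G _); apply/esym/(cellP k N0) => //.
move: tk; rewrite /cell/= in_itv/= => /andP[+ _]; apply: le_trans.
by rewrite divr_ge0// ltW.
Qed.

Lemma integral_step G N : 0 < N -> (forall k, 0 <= G k) ->
  (\int[lebesgue_measure]_(t in `]0%R, +oo[) (N * G (Num.truncn (N * t)%R))%:E =
   \sum_(0 <= k <oo) (G k)%:E)%E.
Proof.
move=> N0 G0.
have m1 : measurable_fun (`[0, +oo[%classic : set R)
    (fun t => (N * G (Num.truncn (N * t)))%:E).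
  by apply/measurable_EFinP; exact: (measurable_step (fun k => N * G k) N0).
rewrite integral_itv_obnd_cbnd; last first.
  apply: (measurable_funS _ _ m1) => //.
  by move=> t /=; rewrite !in_itv/= !andbT => /ltW.
rewrite -(cell_cover N0) ge0_integral_bigcup//=; last 4 first.
- by move=> k; exact: measurable_itv.
- by rewrite (cell_cover N0).
- by move=> t _; rewrite lee_fin mulr_ge0// ltW.
- exact: cell_triv.
apply: eq_eseriesr => k _.
rewrite (_ : (\int[_]_(t in _) _)%E =
   (\int[lebesgue_measure]_(t in cell N k) (cst (N * G k)%:E t))%E); last first.
  apply: eq_integral => t; rewrite inE => tk; congr (_ * G _)%:E.
  apply/(cellP k N0) => //.
  move: tk; rewrite /cell/= in_itv/= => /andP[+ _]; apply: le_trans.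
  by rewrite divr_ge0// ltW.
rewrite integral_cst/=; last exact: measurable_itv.
rewrite /cell lebesgue_measure_itv/= lte_fin ltr_pM2r ?invr_gt0// ltr_nat ltnSn.
rewrite -EFinB -EFinM; congr EFin.
by rewrite -(natr1 k); field; rewrite gt_eqF.
Qed.

(** A sum over [k] is the integral of a step function with cells of width
    [1 / N]; this turns limits of weighted sums into dominated convergence for
    Lebesgue measure. *)
Lemma riemann_sum_cvg (G : nat -> nat -> R) (N : nat -> R) (g D : R -> R) :
  (forall n, 0 < N n) -> (forall n k, 0 <= G n k) ->
  lebesgue_measure.-integrable (`]0, +oo[%classic : set R) (EFin \o D) ->
  (\forall n \near \oo, forall t, 0 < t ->
     N n * G n (Num.truncn (N n * t)) <= D t) ->
  (forall t, 0 < t -> N n * G n (Num.truncn (N n * t)) @[n --> \oo] --> g t) ->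
  lebesgue_measure.-integrable (`]0, +oo[%classic : set R) (EFin \o g) /\
  ((\sum_(0 <= k <oo) (G n k)%:E)%E @[n --> \oo] -->
     \int[lebesgue_measure]_(t in `]0%R, +oo[) (g t)%:E)%E.
Proof.
move=> N0 G0 iD [n0 _ dom] cv.
pose f n t := N (n + n0)%N * G (n + n0)%N (Num.truncn (N (n + n0)%N * t)).
have mf n : measurable_fun (`]0, +oo[%classic : set R) (f n).
  apply: (@measurable_funS _ _ _ _ (`[0, +oo[%classic : set R)) => //.
    by move=> t /=; rewrite !in_itv/= !andbT => /ltW.
  exact: (measurable_step (fun k => N (n + n0)%N * G (n + n0)%N k)).
have cf t : `]0, +oo[%classic t -> f n t @[n --> \oo] --> g t.
  rewrite /= in_itv/= andbT => t0.
  by move: (cv t t0); rewrite -(cvg_shiftn n0).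
have mg : measurable_fun (`]0, +oo[%classic : set R) g.
  exact: measurable_fun_cvg mf cf.
have f0 n t : 0 <= f n t by rewrite mulr_ge0// ltW.
have H := @dominated_convergence _ _ R (@lebesgue_measure R) `]0, +oo[%classic
  (measurable_itv _) (fun n t => (f n t)%:E) (EFin \o g) (EFin \o D).
case: H => //.
- by move=> n; apply/measurable_EFinP; exact: mf.
- by apply/measurable_EFinP; exact: mg.
- by apply: aeW => t Dt; apply: cvg_EFin; [exact: nearW|exact: cf].
- apply: aeW => t n; rewrite /= in_itv/= andbT => t0.
  by rewrite lee_fin ger0_norm//; apply: dom => //=; rewrite leq_addl.
move=> ig _ H; split => //.
rewrite -(cvg_shiftn n0).
apply: cvg_trans H; apply: near_eq_cvg; apply: nearW => n /=.
exact: integral_step.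
Qed.

End step_functions.

Lemma nneseries_finite (R : realType) (G : nat -> R) (m : nat) :
  (forall k, (m <= k)%N -> G k = 0) ->
  (\sum_(0 <= k <oo) (G k)%:E)%E = (\sum_(k < m) G k)%:E.
Proof.
move=> G0; apply/cvg_lim => //; apply: cvg_near_cst.
near=> n; have mn : (m <= n)%N by near: n; exact: nbhs_infty_ge.
rewrite (big_cat_nat (leq0n m) mn)//= [X in (_ + X)%E](_ : _ = 0%E).
  by rewrite adde0 sumEFin big_mkord.
by rewrite big_nat_cond big1// => i /andP[/andP[mi _] _]; rewrite G0.
Unshelve. all: by end_near. Qed.


(** * Power integrals *)

Lemma derivable1_cvg (R : realType) (F : R -> R) (x : R) :
  derivable F x 1 -> F y @[y --> x] --> F x.
Proof.
by move=> dF; apply: differentiable_continuous; apply/derivable1_diffP.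
Qed.

Lemma derivable_LRcontinuous (R : realType) (F : R -> R) (a b : R) :
  (forall x, a <= x -> x <= b -> derivable F x 1) -> a < b ->
  derivable_oo_LRcontinuous F a b.
Proof.
move=> dF ab.
have cF x : a <= x -> x <= b -> F y @[y --> x] --> F x.
  by move=> ax xb; apply: derivable1_cvg; exact: dF.
split.
- by move=> x; rewrite in_itv/= => /andP[/ltW ax /ltW xb]; exact: dF.
- by apply: cvg_at_right_filter; apply: cF => //; exact: ltW.
- by apply: cvg_at_left_filter; apply: cF => //; exact: ltW.
Qed.

Lemma powRN_cvg0 (R : realType) (k : R) : k < 0 -> t `^ k @[t --> +oo] --> (0 : R).
Proof.
move=> k0; apply/cvgrPdist_le => e e0; near=> t.
have t0 : 0 < t by near: t; exact: nbhs_pinfty_gt.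
have te : e `^ k^-1 <= t by near: t; apply: nbhs_pinfty_ge; rewrite num_real.
rewrite sub0r normrN ger0_norm ?powR_ge0//.
have -> : e = (e `^ k^-1) `^ k by rewrite -powRrM mulVf ?lt_eqF// powRr1// ltW.
rewrite -(opprK k) !(powRN _ (- k)) lef_pV2 ?posrE ?powR_gt0//.
by rewrite ge0_ler_powR ?nnegrE ?powR_ge0 ?oppr_ge0 ?(ltW k0) ?(ltW t0)// opprK.
Unshelve. all: by end_near. Qed.

Lemma integrable_powR0 (R : realType) (k : R) : k < 1 ->
  lebesgue_measure.-integrable (`]0, 1]%classic : set R) (fun t => (t `^ (- k))%:E).
Proof.
move=> k1.
have k10 : 0 < 1 - k by rewrite subr_gt0.
pose F (n : nat) : set R := `[n.+2%:R^-1, 1]%classic.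
have Fcup : \bigcup_n F n = (`]0, 1]%classic : set R).
  apply/seteqP; split => t /=.
    by case=> n _; rewrite /F/= !in_itv/= => /andP[+ ->]; rewrite andbT; apply: lt_le_trans.
  rewrite in_itv/= => /andP[t0 t1]; exists (Num.truncn t^-1) => //.
  rewrite /F/= in_itv/= t1 andbT.
  have /andP[_ tt] := truncn_itv (ltW (eqbRL (invr_gt0 t) t0)).
  rewrite -[leRHS]invrK lef_pV2 ?posrE ?invr_gt0// (le_trans (ltW tt))//.
  by rewrite ler_nat.
have mp (D : set R) : measurable_fun D (fun t : R => (t `^ (- k))%:E).
  by apply/measurable_EFinP; apply: measurable_funTS; exact: measurable_powR.
apply/integrableP; split; first exact: mp.
under eq_integral do rewrite gee0_abs ?lee_fin ?powR_ge0//.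
rewrite -Fcup.
have H : ((\int[lebesgue_measure]_(x in F i) (x `^ (- k))%:E)%E @[i --> \oo] -->
  \int[lebesgue_measure]_(x in \bigcup_i F i) (x `^ (- k))%:E)%E.
  apply: ge0_nondecreasing_set_cvg_integral.
  - apply/nondecreasing_seqP => n; rewrite subsetEset => t; rewrite /F/= !in_itv/=.
    move=> /andP[+ ->]; rewrite andbT; apply: le_trans.
    by rewrite lef_pV2 ?posrE// ler_nat.
  - by move=> n; exact: measurable_itv.
  - by move=> n; exact: mp.
  - by move=> n t _; rewrite lee_fin powR_ge0.
rewrite -(cvg_lim _ H)//.
apply: (@le_lt_trans _ _ ((1 - k)^-1)%:E); last by rewrite ltry.
apply: lime_le; first by apply/cvg_ex; eexists; exact: H.
apply: nearW => n.
have n0 : (0 : R) < n.+2%:R^-1 by rewrite invr_gt0.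
have n1 : (n.+2%:R^-1 : R) < 1 by rewrite invf_lt1// ltr1n.
rewrite (@continuous_FTC2 R (fun t => t `^ (- k))
  (fun t => (1 - k)^-1 * t `^ (1 - k)) _ _ n1).
- rewrite -EFinB lee_fin powR1 mulr1 gerBl.
  by rewrite mulr_ge0 ?powR_ge0// invr_ge0 ltW.
- apply: derivable_within_continuous => x; rewrite in_itv/= => /andP[x0 _].
  by apply: derivable_powR; rewrite in_itv/= andbT (lt_le_trans n0).
- apply: derivable_LRcontinuous => // x ax _; apply: derivableM => //.
  by apply: derivable_powR; rewrite in_itv/= andbT (lt_le_trans n0).
- move=> x; rewrite in_itv/= => /andP[x0 _].
  have x00 := lt_trans n0 x0.
  rewrite derive1E deriveZ/=; last by apply: derivable_powR; rewrite in_itv/= andbT.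
  have [_ ->] := is_derive1_powR (1 - k) x00.
  rewrite /GRing.scale/= mulrA mulVf ?gt_eqF// mul1r; congr (_ `^ _).
  by ring.
Qed.

Lemma integrable_powRy (R : realType) (k : R) : 1 < k ->
  lebesgue_measure.-integrable (`[1, +oo[%classic : set R) (fun t => (t `^ (- k))%:E).
Proof.
move=> k1.
have k10 : 0 < k - 1 by rewrite subr_gt0.
apply/integrableP; split.
  by apply/measurable_EFinP; apply: measurable_funTS; exact: measurable_powR.
under eq_integral do rewrite gee0_abs ?lee_fin ?powR_ge0//.
rewrite (@ge0_continuous_FTC2y R (fun t => t `^ (- k))
  (fun t => - (k - 1)^-1 * t `^ (1 - k)) 1 0).
- by rewrite -EFinB ltry.
- by move=> x _; exact: powR_ge0.
- apply: derivable_within_continuous => x; rewrite in_itv/= andbT => x0.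
  by apply: derivable_powR; rewrite in_itv/= andbT (lt_le_trans _ x0).
- rewrite -[X in _ --> X](mulr0 (- (k - 1)^-1)); apply: cvgMl_tmp.
  by apply: powRN_cvg0; rewrite subr_lt0.
- move=> x x1; apply: derivableM => //.
  by apply: derivable_powR; rewrite in_itv/= andbT (lt_trans _ x1).
- apply: cvg_at_right_filter; apply: cvgMl_tmp.
  apply: (@derivable1_cvg R (fun t => t `^ (1 - k))).
  by apply: derivable_powR; rewrite in_itv/= andbT.
- move=> x; rewrite in_itv/= andbT => x1.
  have x00 : 0 < x by rewrite (lt_trans _ x1).
  rewrite derive1E deriveZ/=; last by apply: derivable_powR; rewrite in_itv/= andbT.
  have [_ ->] := is_derive1_powR (1 - k) x00.
  have -> : 1 - k - 1 = - k by ring.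
  by rewrite /GRing.scale/= mulrA mulNr -mulrN opprB mulVf ?gt_eqF// mul1r.
Qed.

Lemma lebesgue_measure_onem (R : realType) (B : set R) : measurable B ->
  lebesgue_measure ((fun x : R => 1 - x) @^-1` B) = lebesgue_measure B.
Proof.
move=> mB.
have mB1 : measurable ((fun x : R => 1 * x + 1) @^-1` B).
  have m1 : measurable_fun setT (fun x : R => 1 * x + 1) by exact: measurable_funD.
  by rewrite -[X in measurable X]setTI; exact: m1.
rewrite -[RHS]mul1e -[X in (X%:E * _)%E]invr1 -(@lebesgue_measure_affine R 1 1 B)//.
rewrite -(lebesgue_measureN mB1) /pushforward; congr (lebesgue_measure _).
by apply/seteqP; split => x /=; rewrite mul1r addrC.
Qed.

Lemma ge0_integral_onem (R : realType) (D : set R) (f : R -> R) :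
  measurable D -> measurable_fun setT f -> (forall x, 0 <= f x) ->
  (\int[lebesgue_measure]_(z in (fun z : R => 1 - z)%R @^-1` D) (f (1 - z)%R)%:E =
   \int[lebesgue_measure]_(z in D) (f z)%:E)%E.
Proof.
move=> mD mf f0.
pose phi : measurableTypeR R -> measurableTypeR R := fun z => 1 - z.
have mphi : measurable_fun setT phi.
  by apply: measurable_funB => //; exact: measurable_id.
have mfD : measurable_fun D (EFin \o f).
  by apply/measurable_EFinP; exact: measurable_funS mf.
rewrite -(@ge0_integral_pushforward _ _ _ _ R phi mphi lebesgue_measure D (EFin \o f))//; last first.
  by move=> x _; rewrite /= lee_fin.
apply: eq_measure_integral => A mA _; rewrite /= /pushforward.
exact: lebesgue_measure_onem.
Qed.

Lemma integrable_disjointU d (T : measurableType d) (R : realType)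
    (mu : {measure set T -> \bar R}) (A B : set T) (f : T -> \bar R) :
  measurable A -> measurable B -> [disjoint A & B] ->
  mu.-integrable A f -> mu.-integrable B f -> mu.-integrable (A `|` B) f.
Proof.
move=> mA mB AB /integrableP[m1 i1] /integrableP[m2 i2].
have mf : measurable_fun (A `|` B) f by exact/measurable_funU.
apply/integrableP; split => //.
rewrite ge0_integral_setU//; first by rewrite lte_add_pinfty.
exact: measurableT_comp.
Qed.

(** Integrable over the half line as soon as [k < 1 < k']: one power near 0,
    the other at infinity. *)
Definition two_power_dominator (R : realType) (k k' t : R) :=
  if t <= 1 then t `^ (- k) else t `^ (- k').

Lemma integrable_two_power (R : realType) (k k' C : R) : k < 1 -> 1 < k' ->
  lebesgue_measure.-integrable (`]0, +oo[%classic : set R)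
    (fun t => (C * two_power_dominator k k' t)%:E).
Proof.
move=> k1 k1'.
have -> : (`]0, +oo[%classic : set R) = `]0, 1]%classic `|` `]1, +oo[%classic.
  apply/seteqP; split => t /=; rewrite !in_itv/= ?andbT.
    by move=> t0; have [t1|t1] := leP t 1; [left|right]; rewrite ?t0.
  by move=> [/andP[]//|]; apply: lt_trans.
have H1 : lebesgue_measure.-integrable (`]0, 1]%classic : set R)
    (fun t => (C * two_power_dominator k k' t)%:E).
  apply: (@eq_integrable _ _ _ _ _ _ (fun t : measurableTypeR R => C%:E * ((t : R) `^ (- k))%:E)%E) => //.
    by move=> t; rewrite inE/= in_itv/= => /andP[_ t1]; rewrite /two_power_dominator t1.
  by apply: integrableZl => //; exact: integrable_powR0.
have H2 : lebesgue_measure.-integrable (`]1, +oo[%classic : set R)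
    (fun t => (C * two_power_dominator k k' t)%:E).
  apply: (@eq_integrable _ _ _ _ _ _ (fun t : measurableTypeR R => C%:E * ((t : R) `^ (- k'))%:E)%E) => //.
    move=> t; rewrite inE/= in_itv/= andbT => t1; rewrite /two_power_dominator.
    by rewrite leNgt t1.
  apply: integrableZl => //.
  apply: (@integrableS _ _ _ _ (`[1, +oo[%classic : set (measurableTypeR R))) => //.
    by move=> t /=; rewrite !in_itv/= !andbT => /ltW.
  exact: integrable_powRy.
apply: integrable_disjointU => //.
apply/disj_set2P/seteqP; split => // t [/=]; rewrite !in_itv/= andbT.
by move=> /andP[_ a b]; have := le_lt_trans a b; rewrite ltxx.
Qed.

(** A separable bound for a beta density, with one singular term at each end
    point, integrable by the two power integrals. The value 0 beyond 1 makes it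
    a dominating function on the half line. *)
Definition beta_dominator (R : realType) (a b t : R) :=
  if t < 1 then 2 * t `^ (- a) + 2 * (1 - t) `^ (- b) else 0.

Lemma le_beta_dominator (R : realType) (a b t : R) :
  0 <= a < 1 -> 0 <= b < 1 -> 0 < t < 1 ->
  t `^ (- a) * (1 - t) `^ (- b) <= beta_dominator a b t.
Proof.
move=> /andP[a0 a1] /andP[b0 b1] /andP[t0 t1]; rewrite /beta_dominator t1.
have key (c s : R) : 0 <= c < 1 -> 2^-1 <= s -> s `^ (- c) <= 2.
  move=> /andP[c0 c1] s1; rewrite powRN -[leRHS]invrK lef_pV2 ?posrE ?invr_gt0 ?powR_gt0//; last first.
    by rewrite (lt_le_trans _ s1).
  apply: (@le_trans _ _ (2^-1 `^ c)).
    by apply: ger1_powR; [rewrite invr_gt0 invf_le1//= ltr0n ler1n|exact: ltW].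
  by rewrite ge0_ler_powR// nnegrE ?invr_ge0 ?(le_trans _ s1) ?invr_ge0.
have [tl|tl] := leP t 2^-1.
  rewrite (@le_trans _ _ (2 * t `^ (- a)))//; last first.
    by rewrite lerDl mulr_ge0 ?powR_ge0.
  rewrite mulrC ler_wpM2r ?powR_ge0// key ?b0//.
  by move: tl; lra.
rewrite (@le_trans _ _ (2 * (1 - t) `^ (- b)))//; last first.
  by rewrite lerDr mulr_ge0 ?powR_ge0.
by rewrite ler_wpM2r ?powR_ge0// key ?a0// ltW.
Qed.

Lemma integrable_beta_dominator (R : realType) (a b C : R) : a < 1 -> b < 1 ->
  lebesgue_measure.-integrable (`]0, +oo[%classic : set R)
    (fun t => (C * beta_dominator a b t)%:E).
Proof.
move=> a1 b1.
have mp (c : R) : measurable_fun setT (fun t : R => t `^ (- c)) by exact: measurable_powR.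
have mp' (c : R) : measurable_fun setT (fun t : R => (1 - t) `^ (- c)).
  have m1 : measurable_fun setT (fun t : R => 1 - t).
    by apply: measurable_funB => //; exact: measurable_id.
  exact: (measurableT_comp (mp c) m1).
have H1 : lebesgue_measure.-integrable (`]0, 1[%classic : set R) (fun t => (t `^ (- a))%:E).
  apply: (@integrableS _ _ _ _ (`]0, 1]%classic : set (measurableTypeR R))) => //.
    by move=> t /=; rewrite !in_itv/= => /andP[-> /ltW].
  exact: integrable_powR0.
have H2 : lebesgue_measure.-integrable (`]0, 1[%classic : set R) (fun t => ((1 - t) `^ (- b))%:E).
  apply/integrableP; split.
    by apply/measurable_EFinP; apply: measurable_funTS; exact: mp'.
  under eq_integral do rewrite gee0_abs ?lee_fin ?powR_ge0//.
  have -> : (`]0, 1[%classic : set R) = (fun z : R => 1 - z) @^-1` `]0, 1[%classic.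
    by apply/seteqP; split => t /=; rewrite !in_itv/=; lra.
  rewrite (@ge0_integral_onem R _ (fun t => t `^ (- b)))//; last by move=> x; exact: powR_ge0.
  have : lebesgue_measure.-integrable (`]0, 1[%classic : set R) (fun t => (t `^ (- b))%:E).
    apply: (@integrableS _ _ _ _ (`]0, 1]%classic : set (measurableTypeR R))) => //.
      by move=> t /=; rewrite !in_itv/= => /andP[-> /ltW].
    exact: integrable_powR0.
  move/integrableP => [_]; under eq_integral do rewrite gee0_abs ?lee_fin ?powR_ge0//.
  by [].
have H3 : lebesgue_measure.-integrable (`]0, 1[%classic : set R)
   (fun t => ((C * 2)%:E * (t `^ (- a))%:E + (C * 2)%:E * ((1 - t) `^ (- b))%:E)%E).
  by apply: integrableD => //; [exact: (integrableZl _ _ H1)|exact: (integrableZl _ _ H2)].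
have -> : (`]0, +oo[%classic : set R) = `]0, 1[%classic `|` `[1, +oo[%classic.
  apply/seteqP; split => t /=; rewrite !in_itv/= ?andbT.
    by move=> t0; have [t1|t1] := ltP t 1; [left|right]; rewrite ?t0.
  by move=> [/andP[]//|]; apply: lt_le_trans.
apply: integrable_disjointU => //.
- apply/disj_set2P/seteqP; split => // t [/=]; rewrite !in_itv/= andbT.
  by move=> /andP[_ a' b']; have := lt_le_trans a' b'; rewrite ltxx.
- apply: (eq_integrable _ _ _ _ H3) => // t; rewrite inE/= in_itv/= => /andP[_ t1].
  by rewrite /beta_dominator t1 -!EFinM -EFinD; congr EFin; ring.
- have H4 : lebesgue_measure.-integrable
      (`[1, +oo[%classic : set (measurableTypeR R)) (cst 0%E) by exact: integrable0.
  apply: (eq_integrable _ _ _ _ H4) => // t.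
  by rewrite inE/= in_itv/= andbT => t1; rewrite /beta_dominator ltNge t1 mulr0.
Qed.


(** * Regularly varying sequences and their convolutions *)

Lemma powR_div (R : realType) (x y g : R) : 0 <= x -> 0 < y ->
  (x / y) `^ g = x `^ g / y `^ g.
Proof.
move=> x0 y0; rewrite powRM ?invr_ge0 ?(ltW y0)//; congr (_ * _).
by rewrite -(powR_inv1 (ltW y0)) -powRrM mulN1r powRN.
Qed.

Section regular_variation.
Context (R : realType) (l : R -> R) (eta : R).
Hypothesis l_gt0 : forall x, 0 < l x.
Hypothesis l_potter : potter eta l.
Hypothesis l_flat : asymptotically_flat l.
Hypothesis eta_gt0 : 0 < eta.
Implicit Types (u : nat -> R) (g c t : R).

(** The index is shifted by one so that the reference sequence is positive at
    0. *)
Definition rv_ref g (n : nat) : R := n.+1%:R `^ g * l n.+1%:R.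

Definition regularly_varying g c u := u n / rv_ref g n @[n --> \oo] --> c.

Lemma rv_ref_gt0 g n : 0 < rv_ref g n.
Proof. by rewrite mulr_gt0// powR_gt0. Qed.

Lemma regularly_varying_le g c u : regularly_varying g c u ->
  exists2 C, 0 < C & forall n, u n <= C * rv_ref g n.
Proof.
move=> H; have /cvg_seq_bounded [M [_ HM]] : cvgn (fun n => u n / rv_ref g n).
  by apply/cvg_ex; exists c; exact: H.
exists (`|M| + 1) => [|n]; first by rewrite ltr_wpDl.
have /(_ (`|M| + 1)) := HM; rewrite (le_lt_trans (ler_norm M)) ?ltrDl// => /(_ isT n I).
rewrite /= => Hn; rewrite -ler_pdivrMr ?rv_ref_gt0//.
exact: le_trans (ler_norm _) Hn.
Qed.

Lemma powR_cvg (x : nat -> R) t g : 0 < t -> x n @[n --> \oo] --> t ->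
  x n `^ g @[n --> \oo] --> t `^ g.
Proof.
move=> t0 xt.
have dp : derivable (fun t : R => t `^ g) t 1.
  by apply: derivable_powR; rewrite in_itv/= andbT.
exact: (cvg_comp _ _ xt (derivable1_cvg dp)).
Qed.

Lemma nat_cvgy_of_ratio (N : nat -> R) (k : nat -> nat) t :
  N n @[n --> \oo] --> +oo -> 0 < t -> (k n).+1%:R / N n @[n --> \oo] --> t ->
  k n @[n --> \oo] --> \oo.
Proof.
move=> Noo t0 kt; apply/cvgnyPge => A; near=> n.
have N0 : 0 < N n by near: n; exact: (cvgryPgt _).1 Noo _.
have r0 : t / 2 <= (k n).+1%:R / N n.
  near: n; move/cvgrPdist_le : kt => /(_ (t / 2)); rewrite divr_gt0// => /(_ isT).
  by apply: filterS => n; rewrite ler_norml; lra.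
have NA : A.+1%:R / (t / 2) <= N n by near: n; exact: (cvgryPge _).1 Noo _.
rewrite -ltnS -(ltr_nat R); move: r0; rewrite ler_pdivlMr//.
move: NA; rewrite ler_pdivrMr ?divr_gt0// mulrC => NA /(le_trans NA).
by rewrite ler_nat ltr_nat.
Unshelve. all: by end_near. Qed.

(** Regular variation at index [k n] of order [t N n], normalised at [N n];
    flatness of [l] replaces [l (k n)] by [l (N n)]. *)
Lemma regularly_varying_scaled g c u (N : nat -> R) (k : nat -> nat) t :
  regularly_varying g c u -> N n @[n --> \oo] --> +oo -> 0 < t ->
  (k n).+1%:R / N n @[n --> \oo] --> t ->
  u (k n) / (N n `^ g * l (N n)) @[n --> \oo] --> c * t `^ g.
Proof.
move=> ru Noo t0 kt.
have koo := nat_cvgy_of_ratio Noo t0 kt.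
have H1 : u (k n) / rv_ref g (k n) @[n --> \oo] --> c by exact: (cvg_comp _ _ koo ru).
have H2 := powR_cvg (g := g) t0 kt.
have H3 := l_flat Noo t0 kt.
rewrite -[c * _]mulr1; apply: cvg_trans (cvgM (cvgM H1 H2) H3).
apply: near_eq_cvg; near=> n.
have N0 : 0 < N n by near: n; exact: (cvgryPgt _).1 Noo _.
rewrite /= /rv_ref powR_div//.
have l1 := lt0r_neq0 (l_gt0 (N n)); have l2 := lt0r_neq0 (l_gt0 (k n).+1%:R).
have p1 : N n `^ g != 0 by rewrite gt_eqF// powR_gt0.
have p2 : (k n).+1%:R `^ g != 0 :> R by rewrite gt_eqF// powR_gt0.
by field; rewrite p1 p2 l1 l2.
Unshelve. all: by end_near. Qed.

(** The version of the previous limit with a bound uniform in the ratio [t], by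
    Potter's inequality. *)
Lemma regularly_varying_potter g c u : regularly_varying g c u ->
  exists2 C, 0 < C & forall k N, 0 < N -> let t := k.+1%:R / N in
    u k <= C * (t `^ g * Num.max t t^-1 `^ eta) * (N `^ g * l N).
Proof.
move=> /regularly_varying_le[C C0 HC]; have [D D0 HD] := l_potter.
exists (C * D) => [|k N N0 /=]; first by rewrite mulr_gt0.
set t := _ / N.
rewrite (le_trans (HC k))// /rv_ref -!mulrA ler_pM2l//.
have := HD N k.+1%:R N0 (ltr0Sn _ k).
have -> : N / k.+1%:R = t^-1 by rewrite /t invf_div.
rewrite -/t => H.
apply: (@le_trans _ _ (k.+1%:R `^ g * (D * l N * Num.max t t^-1 `^ eta))).
  by rewrite ler_pM2l ?powR_gt0.
have -> : k.+1%:R `^ g = t `^ g * N `^ g.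
  by rewrite -powRM ?divr_ge0 ?(ltW N0)// divfK// gt_eqF.
by lra.
Qed.

End regular_variation.

Lemma truncn_ratio_bounds (R : realType) (N t : R) : 0 < N -> 0 <= t ->
  t < (Num.truncn (N * t)).+1%:R / N <= t + N^-1.
Proof.
move=> N0 t0; have := truncn_itv (mulr_ge0 (ltW N0) t0) => /andP[a b].
rewrite ltr_pdivlMr// mulrC b/= ler_pdivrMr// mulrDl mulVf ?gt_eqF//.
by rewrite -natr1 (mulrC t) lerD2r.
Qed.

Lemma truncn_ratio_cvg (R : realType) (N : nat -> R) (t : R) :
  N n @[n --> \oo] --> +oo -> 0 <= t ->
  (Num.truncn (N n * t)).+1%:R / N n @[n --> \oo] --> t.
Proof.
move=> Noo t0.
have Ninv : (N n)^-1 @[n --> \oo] --> 0.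
  by apply/gtr0_cvgV0 => //; exact: (cvgryPgt _).1 Noo _.
apply: (@squeeze_cvgr _ _ _ _ (cst t) (fun n => t + (N n)^-1)).
- near=> n; have N0 : 0 < N n by near: n; exact: (cvgryPgt _).1 Noo _.
  by have /andP[/ltW -> ->] := truncn_ratio_bounds N0 t0.
- exact: cvg_cst.
- by rewrite -[X in _ --> X]addr0; apply: cvgD => //; exact: cvg_cst.
Unshelve. all: by end_near. Qed.

Section convolution.
Context (R : realType) (l : R -> R) (eta : R).
Hypothesis l_gt0 : forall x, 0 < l x.
Hypothesis l_potter : potter eta l.
Hypothesis l_flat : asymptotically_flat l.
Hypothesis eta_gt0 : 0 < eta.
Context (F g : nat -> R) (alpha beta cF cg : R).
Hypothesis alpha01 : 0 <= alpha < 1.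
Hypothesis eta_beta : eta < beta.
Hypothesis F_ge0 : forall k, 0 <= F k.
Hypothesis g_ge0 : forall k, 0 <= g k.
Hypothesis cF_gt0 : 0 < cF.
Hypothesis cg_gt0 : 0 < cg.
Hypothesis F_cvg : F k * k.+1%:R `^ alpha @[k --> \oo] --> cF.
Hypothesis g_rv : regularly_varying l (beta - 1) cg g.

(** Bound on the summand of the convolution in the scaled variable [t]; the
    Potter exponent [eta] is absorbed by the room between [eta] and [beta]. *)
Lemma convolution_kernel_le : exists2 C, 0 < C & forall (m : nat) t,
  (0 < m)%N -> 0 < t < 1 -> let k := Num.truncn (m%:R * t) in
  m%:R * (m%:R `^ (alpha - beta) / l m%:R * (F k * g (m - 1 - k)%N)) <=
    C * beta_dominator alpha (Num.max 0 (1 - beta + eta)) t.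
Proof.
have [CF CF0 HF] : exists2 C, 0 < C & forall k, F k * k.+1%:R `^ alpha <= C.
  have /cvg_seq_bounded [M [_ HM]] : cvgn (fun k => F k * k.+1%:R `^ alpha).
    by apply/cvg_ex; exists cF; exact: F_cvg.
  exists (`|M| + 1) => [|n]; first by rewrite ltr_wpDl.
  have /(_ (`|M| + 1)) := HM; rewrite (le_lt_trans (ler_norm M)) ?ltrDl// => /(_ isT n I).
  by rewrite /=; exact: le_trans (ler_norm _).
have [Cg Cg0 Hg] := regularly_varying_potter l_gt0 l_potter g_rv.
exists (CF * Cg) => [|m t m0 /andP[t0 t1] /=]; first by rewrite mulr_gt0.
have mR : 0 < m%:R :> R by rewrite ltr0n.
set k := Num.truncn _; set kap := Num.max _ _.
have /andP[k1 k2] := truncn_itv (mulr_ge0 (ltW mR) (ltW t0)).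
rewrite -/k in k1 k2.
have km : (k < m)%N.
  by rewrite -(ltr_nat R) (le_lt_trans k1)// gtr_pMr.
have kap01 : 0 <= kap < 1.
  rewrite le_max lexx/= gt_max ltr01/=; move: eta_beta; lra.
have D := le_beta_dominator alpha01 kap01 (introT andP (conj t0 t1)).
rewrite (le_trans _ (ler_wpM2l (ltW (mulr_gt0 CF0 Cg0)) D))//.
have mEk : (m - 1 - k).+1 = (m - k)%N by rewrite subnAC subn1 prednK// subn_gt0.
have := Hg (m - 1 - k)%N m%:R mR; rewrite mEk/= natrB ?(ltnW km)//.
set s := (_ - _) / _ => gle.
have s1 : 1 - t <= s.
  by rewrite /s mulrBl divff ?gt_eqF// lerB// ler_pdivrMr// mulrC.
have s0 : 0 < s by rewrite (lt_le_trans _ s1)// subr_gt0.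
have sle1 : s <= 1 by rewrite /s ler_pdivrMr// mul1r gerBl.
have gle2 : g (m - 1 - k)%N <= Cg * (1 - t) `^ (- kap) * (m%:R `^ (beta - 1) * l m%:R).
  rewrite (le_trans gle)// ler_wpM2r ?mulr_ge0 ?powR_ge0 ?(ltW (l_gt0 _))// ler_pM2l//.
  have -> : Num.max s s^-1 = s^-1.
    by rewrite max_r// (le_trans sle1)// -[leLHS]invr1 lef_pV2 ?posrE.
  rewrite -[s^-1]powR_inv1 ?(ltW s0)// -powRrM mulN1r -powRD; last by rewrite (gt_eqF s0) implybT.
  apply: (@le_trans _ _ (s `^ (- kap))).
    apply: ger_powR; first by rewrite s0.
    by rewrite lerNl opprB opprB /kap le_max; apply/orP; right; lra.
  rewrite !powRN lef_pV2 ?posrE ?powR_gt0 ?subr_gt0//.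
  by rewrite ge0_ler_powR ?nnegrE ?(ltW s0) ?subr_ge0 ?(ltW t1)//; case/andP: kap01.
have Fle : F k <= CF * (t `^ (- alpha) * m%:R `^ (- alpha)).
  have p0 : 0 < k.+1%:R `^ alpha :> R by rewrite powR_gt0.
  have := HF k; rewrite -ler_pdivlMr// => /le_trans; apply.
  rewrite ler_pM2l// -powRM ?(ltW t0)// powRN lef_pV2 ?posrE ?powR_gt0 ?mulr_gt0//.
  have [a0 _] := andP alpha01.
  by rewrite ge0_ler_powR ?nnegrE ?mulr_ge0 ?(ltW t0) ?(ltW mR)// mulrC ltW.
have FG : F k * g (m - 1 - k)%N <= CF * (t `^ (- alpha) * m%:R `^ (- alpha)) *
   (Cg * (1 - t) `^ (- kap) * (m%:R `^ (beta - 1) * l m%:R)).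
  exact: ler_pM.
have pre : 0 <= m%:R * (m%:R `^ (alpha - beta) / l m%:R).
  by rewrite mulr_ge0 ?(ltW mR)// divr_ge0 ?powR_ge0// ltW.
rewrite mulrA (le_trans (ler_wpM2l pre FG))//.
have pm : m%:R * m%:R `^ (alpha - beta) * m%:R `^ (- alpha) * m%:R `^ (beta - 1) = 1 :> R.
  rewrite -{1}(powRr1 (ltW mR)) -!powRD ?(gt_eqF mR) ?implybT//.
  have -> : 1 + (alpha - beta) + - alpha + (beta - 1) = 0 by ring.
  by rewrite powRr0.
have l0 := lt0r_neq0 (l_gt0 m%:R).
have -> : CF * Cg * (t `^ (- alpha) * (1 - t) `^ (- kap)) =
  (m%:R * m%:R `^ (alpha - beta) * m%:R `^ (- alpha) * m%:R `^ (beta - 1)) *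
  (CF * Cg * (t `^ (- alpha) * (1 - t) `^ (- kap))) by rewrite pm mul1r.
rewrite le_eqVlt; apply/orP; left; apply/eqP; field.
by rewrite l0.
Qed.

(** With [t = k / m], the normalised summand converges to the beta density
    times [H t] and is dominated by a multiple of [beta_dominator]. The bounded
    factor [h] carries a test function or the continuation of a chain. *)
Lemma convolution_cvg (m : nat -> nat) (h : nat -> nat -> R) (H : R -> R) (M : R) :
  m n @[n --> \oo] --> \oo -> (forall n k, 0 <= h n k <= M) ->
  (forall t, 0 < t < 1 ->
     h n (Num.truncn ((m n)%:R * t)) @[n --> \oo] --> H t) ->
  lebesgue_measure.-integrable (`]0, 1[%classic : set R)
    (fun t => (t `^ (- alpha) * (1 - t) `^ (beta - 1) * H t)%:E) /\
  (m n)%:R `^ (alpha - beta) / l (m n)%:R *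
    \sum_(k < m n) F k * g (m n - 1 - k)%N * h n k @[n --> \oo] -->
  cF * cg * \int[lebesgue_measure]_(t in `]0, 1[)
    (t `^ (- alpha) * (1 - t) `^ (beta - 1) * H t).
Proof.
move=> moo hM hH.
have M0 : 0 <= M by have /andP[a b] := hM 0%N 0%N; exact: le_trans a b.
have [C C0 HC] := convolution_kernel_le.
have moR : (m n)%:R @[n --> \oo] --> (+oo : set_system R).
  by apply: cvg_comp moo _; exact: cvgr_idn.
have mpos : \forall n \near \oo, (0 < m n)%N by exact: (cvgnyPgt _).1 moo 0%N.
pose N n : R := (maxn (m n) 1)%:R.
have N0 n : 0 < N n by rewrite ltr0n leq_max orbT.
have NE n : (0 < m n)%N -> N n = (m n)%:R by move=> m0; rewrite /N (maxn_idPl _).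
pose G n k := if (k < m n)%N then (m n)%:R `^ (alpha - beta) / l (m n)%:R *
    (F k * g (m n - 1 - k)%N * h n k) else 0.
have G0 n k : 0 <= G n k.
  rewrite /G; case: ifP => // _; have /andP[hh _] := hM n k.
  apply: mulr_ge0; last by rewrite !mulr_ge0.
  by rewrite divr_ge0 ?powR_ge0// ltW.
pose gg t := if t < 1 then cF * cg * (t `^ (- alpha) * (1 - t) `^ (beta - 1) * H t) else 0.
pose kap := Num.max 0 (1 - beta + eta).
pose D t := (C * M) * beta_dominator alpha kap t.
have alpha1 : alpha < 1 by case/andP: alpha01.
have iD : lebesgue_measure.-integrable (`]0, +oo[%classic : set R) (EFin \o D).
  apply: integrable_beta_dominator => //.
  by rewrite /kap gt_max ltr01/=; move: eta_beta; lra.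
have GD : \forall n \near \oo, forall t, 0 < t -> N n * G n (Num.truncn (N n * t)) <= D t.
  near=> n; have m0 : (0 < m n)%N by near: n.
  move=> t t0; rewrite NE// /G.
  have mR : 0 < (m n)%:R :> R by rewrite ltr0n.
  have [t1|t1] := ltP t 1; last first.
    rewrite ltnNge -ltnS -(ltr_nat R).
    have /andP[_ k2] := truncn_itv (mulr_ge0 (ltW mR) (ltW t0)).
    rewrite (le_lt_trans _ k2)/=; last by rewrite ler_peMr// ltW.
    by rewrite mulr0 /D /beta_dominator ltNge t1 mulr0.
  case: ifP => _; last first.
    rewrite mulr0 /D /beta_dominator t1 mulr_ge0 ?mulr_ge0 ?(ltW C0)//.
    by rewrite addr_ge0// mulr_ge0 ?powR_ge0.
  have := HC (m n) t m0; rewrite t0 t1 => /(_ isT)/=.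
  set k := Num.truncn _ => Hk.
  have /andP[h0 hm] := hM n k.
  rewrite !mulrA; rewrite !mulrA in Hk.
  rewrite /D (mulrAC C).
  apply: ler_pM => //; rewrite ?mulr_ge0 ?invr_ge0 ?powR_ge0 ?(ltW mR)//.
  exact: ltW.
have Gg t : 0 < t -> N n * G n (Num.truncn (N n * t)) @[n --> \oo] --> gg t.
  move=> t0; rewrite /gg; case: ifPn => [t1|]; last first.
    rewrite -leNgt => t1; apply: cvg_near_cst; near=> n.
    have m0 : (0 < m n)%N by near: n.
    have mR : 0 < (m n)%:R :> R by rewrite ltr0n.
    rewrite NE// /G ltnNge -ltnS -(ltr_nat R).
    have /andP[_ k2] := truncn_itv (mulr_ge0 (ltW mR) (ltW t0)).
    rewrite (le_lt_trans _ k2)/= ?mulr0//.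
    by rewrite ler_peMr// ltW.
  pose k n := Num.truncn ((m n)%:R * t).
  have kt : (k n).+1%:R / (m n)%:R @[n --> \oo] --> t.
    exact: truncn_ratio_cvg moR (ltW t0).
  have koo := nat_cvgy_of_ratio moR t0 kt.
  have c1 : F (k n) * (k n).+1%:R `^ alpha @[n --> \oo] --> cF.
    exact: (cvg_comp _ _ koo F_cvg).
  have c2 := powR_cvg (g := - alpha) t0 kt.
  have s0 : 0 < 1 - t by rewrite subr_gt0.
  have km : \forall n \near \oo, (k n < m n)%N.
    near=> n; have m0 : (0 < m n)%N by near: n.
    have mR : 0 < (m n)%:R :> R by rewrite ltr0n.
    have /andP[k1 _] := truncn_itv (mulr_ge0 (ltW mR) (ltW t0)).
    by rewrite -(ltr_nat R) (le_lt_trans k1)// gtr_pMr.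
  have kt' : (m n - 1 - k n).+1%:R / (m n)%:R @[n --> \oo] --> 1 - t.
    have i0 : (m n)%:R^-1 @[n --> \oo] --> (0 : R).
      by apply/gtr0_cvgV0 => //; exact: (cvgryPgt _).1 moR _.
    have cc : 1 - ((k n).+1%:R / (m n)%:R - (m n)%:R^-1) @[n --> \oo] --> 1 - t.
      apply: cvgB; first exact: cvg_cst.
      by rewrite -[X in _ --> X]subr0; exact: cvgB.
    apply: cvg_trans cc; apply: near_eq_cvg; near=> n.
    have m0 : (0 < m n)%N by near: n.
    have kn : (k n < m n)%N by near: n.
    have mR : (m n)%:R != 0 :> R by rewrite pnatr_eq0 -lt0n.
    have -> : (m n - 1 - k n).+1 = (m n - k n)%N by rewrite subnAC subn1 prednK// subn_gt0.
    by rewrite natrB ?(ltnW kn)// -natr1; field.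
  have c3 := regularly_varying_scaled l_gt0 l_flat g_rv moR s0 kt'.
  have c4 := hH t (introT andP (conj t0 t1)).
  have -> : cF * cg * (t `^ (- alpha) * (1 - t) `^ (beta - 1) * H t) =
     cF * t `^ (- alpha) * (cg * (1 - t) `^ (beta - 1)) * H t by ring.
  apply: cvg_trans (cvgM (cvgM (cvgM c1 c2) c3) c4).
  apply: near_eq_cvg; near=> n.
  have m0 : (0 < m n)%N by near: n.
  have kn : (k n < m n)%N by near: n.
  have mR : 0 < (m n)%:R :> R by rewrite ltr0n.
  rewrite NE// /G -/(k n) kn /=.
  rewrite powR_div// !powRN powRD ?(gt_eqF mR) ?implybT// powRN powRD ?(gt_eqF mR) ?implybT//.
  rewrite powRN powRr1 ?(ltW mR)//.
  have p1 : (m n)%:R `^ beta != 0 :> R by rewrite gt_eqF// powR_gt0.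
  have p2 : (m n)%:R `^ alpha != 0 :> R by rewrite gt_eqF// powR_gt0.
  have p3 : (k n).+1%:R `^ alpha != 0 :> R by rewrite gt_eqF// powR_gt0.
  have p4 := lt0r_neq0 (l_gt0 (m n)%:R).
  have p5 := lt0r_neq0 mR.
  by field; rewrite p1 p2 p3 p4 p5.
have [ig cvg] := riemann_sum_cvg N0 G0 iD GD Gg.
have gcc : cF * cg != 0 by rewrite mulf_neq0// gt_eqF.
have sub01 : `]0, 1[%classic `<=` (`]0, +oo[%classic : set (measurableTypeR R)).
  by move=> t /=; rewrite !in_itv/= andbT => /andP[].
have ig1 : lebesgue_measure.-integrable (`]0, 1[%classic : set R) (EFin \o gg).
  by apply: (@integrableS _ _ _ _ (`]0, +oo[%classic : set (measurableTypeR R))) => //; exact: sub01.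
have ggE : {in (`]0, 1[%classic : set R), forall t, gg t =
    cF * cg * (t `^ (- alpha) * (1 - t) `^ (beta - 1) * H t)}.
  by move=> t; rewrite inE/= in_itv/= => /andP[_ t1]; rewrite /gg t1.
have ig2 : lebesgue_measure.-integrable (`]0, 1[%classic : set R)
    (fun t => (t `^ (- alpha) * (1 - t) `^ (beta - 1) * H t)%:E).
  have := @integrableZl _ _ R lebesgue_measure _ (measurable_itv _) (cF * cg)^-1 _ ig1.
  apply: eq_integrable => // t t01.
  by rewrite /= (ggE t t01) -EFinM mulKf.
split => //.
have intE : (\int[lebesgue_measure]_(t in `]0%R, +oo[) (gg t)%:E =
  (cF * cg * \int[lebesgue_measure]_(t in `]0%R, 1%R[)
    (t `^ (- alpha) * (1 - t) `^ (beta - 1) * H t)%R)%:E)%E.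
  have -> : (\int[lebesgue_measure]_(t in `]0%R, +oo[) (gg t)%:E =
     \int[lebesgue_measure]_(t in `]0%R, 1%R[) (gg t)%:E)%E.
    rewrite [LHS]integral_mkcond [RHS]integral_mkcond; apply: eq_integral => t _.
    rewrite !patchE !mem_setE !in_itv/= andbT /gg.
    by case: (0 < (t : R)) => //=; case: ltP.
  rewrite -RintegralZl// /Rintegral fineK; last first.
    apply: (@integrable_fin_num _ _ R lebesgue_measure) => //.
    by apply: (eq_integrable _ _ _ _ ig1) => // t t01; rewrite /= (ggE t t01).
  by apply: eq_integral => t t01; rewrite (ggE t t01).
rewrite intE in cvg.
move/fine_cvg : cvg => /=; apply: cvg_trans; apply: near_eq_cvg; near=> n => /=.
rewrite (@nneseries_finite R (G n) (m n)); last first.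
  by move=> k mk; rewrite /G ltnNge mk.
rewrite /= mulr_sumr; apply: eq_bigr => k _.
by rewrite /G ltn_ord.
Unshelve. all: by end_near. Qed.

End convolution.


(** * Laplace sums of regularly varying sequences *)

Lemma Rintegral_gt0 (R : realType) (D : set R) (f : R -> R) (a b e : R) :
  measurable D -> lebesgue_measure.-integrable D (EFin \o f) ->
  (forall x, D x -> 0 <= f x) -> a < b -> 0 < e ->
  (forall x, a <= x <= b -> D x /\ e <= f x) ->
  0 < \int[lebesgue_measure]_(x in D) f x.
Proof.
move=> mD fi f0 ab e0 H.
have sub : `[a, b]%classic `<=` D.
  by move=> x /=; rewrite in_itv/= => xab; have [] := H x xab.
have mf : measurable_fun D (EFin \o f) by exact: measurable_int fi.
apply: (@lt_le_trans _ _ (e * (b - a))); first by rewrite mulr_gt0// subr_gt0.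
rewrite -lee_fin /Rintegral fineK; last exact: (@integrable_fin_num _ _ R lebesgue_measure).
apply: (@le_trans _ _ (\int[lebesgue_measure]_(x in `[a, b]) (cst e%:E x))%E).
  by rewrite integral_cst//= lebesgue_measure_itv/= lte_fin ab -EFinB -EFinM.
apply: (@le_trans _ _ (\int[lebesgue_measure]_(x in `[a, b]) (f x)%:E)%E).
  apply: ge0_le_integral => //=.
  - by move=> x _; rewrite lee_fin ltW.
  - exact: measurable_funS mf.
  - by move=> x; rewrite in_itv/= => xab; rewrite lee_fin; have [] := H x xab.
by apply: ge0_subset_integral => //=.
Qed.

Lemma powR_le_expR (R : realType) (p : R) :
  exists2 K, 0 < K & forall x : R, 1 <= x -> x `^ p <= K * expR x.
Proof.
pose n := Num.truncn `|p|.
exists n.+1`!%:R => [|x x1]; first by rewrite ltr0n fact_gt0.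
have x0 : 0 <= x by rewrite (le_trans _ x1).
apply: (@le_trans _ _ (x ^+ n.+1)).
  rewrite -powR_mulrn//; apply: ler_powR => //.
  have /andP[_ pn] := truncn_itv (normr_ge0 p).
  by rewrite (le_trans (ler_norm p))// ltW.
have := expR_ge1Dxn n x0 => H.
rewrite mulrC -ler_pdivrMr ?ltr0n ?fact_gt0//.
by rewrite (le_trans _ H)// lerDr.
Qed.

Definition gamma_int (R : realType) (g : R) : R :=
  \int[lebesgue_measure]_(t in `]0, +oo[) (t `^ (g - 1) * expR (- t)).

(** Finite exactly for [0 < a < 1]; it is the Laplace exponent at 1 of the
    stable subordinator of index [a]. *)
Definition laplace_int (R : realType) (a : R) : R :=
  \int[lebesgue_measure]_(t in `]0, +oo[) (t `^ (- (1 + a)) * (1 - expR (- t))).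

Lemma two_power_dominator_le (R : realType) (k k' C s t : R) (v : R) :
  0 <= k -> 0 <= k' -> 0 <= C -> 0 < t -> t <= s ->
  v <= C * s `^ (- k) -> v <= C * s `^ (- k') ->
  v <= C * two_power_dominator k k' t.
Proof.
move=> k0 k'0 C0 t0 ts v1 v2; rewrite /two_power_dominator.
have s0 := lt_le_trans t0 ts.
have key (q : R) : 0 <= q -> s `^ (- q) <= t `^ (- q).
  move=> q0; rewrite !powRN lef_pV2 ?posrE ?powR_gt0//.
  by rewrite ge0_ler_powR ?nnegrE ?(ltW s0) ?(ltW t0).
by case: ifP => _; [rewrite (le_trans v1)|rewrite (le_trans v2)]; rewrite // ler_wpM2l// key.
Qed.

Section abelian.
Context (R : realType) (l : R -> R) (eta : R).
Hypothesis l_gt0 : forall x, 0 < l x.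
Hypothesis l_potter : potter eta l.
Hypothesis l_flat : asymptotically_flat l.
Hypothesis eta_gt0 : 0 < eta.

(** In the variable [t = k / N] the sum is a Riemann sum for the Gamma
    integral. *)
Lemma abelian (g : nat -> R) (gam c : R) (N : nat -> R) :
  (forall k, 0 <= g k) -> 0 < c -> regularly_varying l (gam - 1) c g ->
  1 + eta <= gam -> (forall n, 0 < N n) -> N n @[n --> \oo] --> +oo ->
  0 < gamma_int gam /\
  ((\sum_(0 <= k <oo) (g k * expR (- (k%:R / N n)) / (N n `^ gam * l (N n)))%:E)
     @[n --> \oo] --> (c * gamma_int gam)%:E)%E.
Proof.
move=> g0 c0 rg gam1 N0 Noo.
have [C C0 HC] := regularly_varying_potter l_gt0 l_potter rg.
have [K K0 HK] := powR_le_expR (gam + 1 + eta).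
pose G n k := g k * expR (- (k%:R / N n)) / (N n `^ gam * l (N n)).
have G0 n k : 0 <= G n k by rewrite !mulr_ge0 ?invr_ge0 ?mulr_ge0 ?expR_ge0 ?powR_ge0// ltW.
pose B := C * expR 1 * (1 + K).
have B0 : 0 < B by rewrite !mulr_gt0 ?expR_gt0 ?addr_gt0.
have iD := @integrable_two_power R 0 2 B ltr01 (ltr1n R 2).
have NGE n k : N n * G n k = (g k / (N n `^ (gam - 1) * l (N n))) * expR (- (k%:R / N n)).
  rewrite /G powRB; last by rewrite (gt_eqF (N0 n)) implybT.
  rewrite powRr1 ?(ltW (N0 n))//.
  have p1 : N n `^ gam != 0 by rewrite gt_eqF// powR_gt0.
  have p2 := lt0r_neq0 (l_gt0 (N n)); have p3 := lt0r_neq0 (N0 n).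
  by field; rewrite p1 p2 p3.
have kE n (k : nat) : - (k%:R / N n) = (N n)^-1 - k.+1%:R / N n by rewrite -natr1 mulrDl mul1r; ring.
have GD : \forall n \near \oo, forall t, 0 < t ->
    N n * G n (Num.truncn (N n * t)) <= B * two_power_dominator 0 2 t.
  near=> n.
  have N1 : 1 <= N n by near: n; exact: (cvgryPge _).1 Noo _.
  move=> t t0; have /andP[ts _] := truncn_ratio_bounds (N0 n) (ltW t0).
  set k := Num.truncn _ in ts *; set s := k.+1%:R / N n in ts.
  have s0 : 0 < s := lt_trans t0 ts.
  rewrite NGE kE -/s expRD.
  have e1 : expR (N n)^-1 <= expR 1 by rewrite ler_expR invf_le1.
  have g1 : g k / (N n `^ (gam - 1) * l (N n)) <= C * (s `^ (gam - 1) * Num.max s s^-1 `^ eta).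
    by rewrite ler_pdivrMr ?mulr_gt0 ?powR_gt0//; have := HC k (N n) (N0 n).
  set v := s `^ (gam - 1) * Num.max s s^-1 `^ eta in g1.
  have v0 : 0 <= v by rewrite mulr_ge0 ?powR_ge0.
  have first_step : g k / (N n `^ (gam - 1) * l (N n)) * (expR (N n)^-1 * expR (- s)) <=
      C * expR 1 * (v * expR (- s)).
    have -> : C * expR 1 * (v * expR (- s)) = (C * v) * (expR 1 * expR (- s)) by ring.
    apply: ler_pM => //; first by rewrite divr_ge0// mulr_ge0 ?powR_ge0// ltW.
    by rewrite ler_wpM2r ?expR_ge0.
  apply: (le_trans first_step); rewrite /B -[leRHS]mulrA ler_pM2l ?mulr_gt0 ?expR_gt0//.
  have [s1|s1] := leP s 1.
    have vle : v * expR (- s) <= 1.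
      apply: mulr_ile1; rewrite ?expR_ge0//; last by rewrite expR_le1 oppr_le0 ltW.
      rewrite /v max_r; last by rewrite (le_trans s1)// -[leLHS]invr1 lef_pV2 ?posrE.
      rewrite -[s^-1]powR_inv1 ?(ltW s0)// -powRrM mulN1r -powRD; last by rewrite (gt_eqF s0) implybT.
      rewrite -[leRHS](powRr0 s); apply: ger_powR; first by rewrite s0.
      by lra.
    rewrite /two_power_dominator (le_trans (ltW ts) s1) oppr0 powRr0 mulr1.
    by rewrite (le_trans vle)// lerDl ltW.
  have s1' := ltW s1.
  have vle : v * expR (- s) <= K * s `^ (- 2).
    rewrite /v max_l; last by rewrite (le_trans _ s1')// invf_le1.
    rewrite -powRD; last by rewrite (gt_eqF s0) implybT.
    rewrite expRN ler_pdivrMr ?expR_gt0//.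
    have -> : K * s `^ (- 2) * expR s = (K * expR s) * s `^ (- 2) by ring.
    rewrite powRN ler_pdivlMr ?powR_gt0// -powRD; last by rewrite (gt_eqF s0) implybT.
    have -> : gam - 1 + eta + 2 = gam + 1 + eta by ring.
    exact: HK.
  apply: (@two_power_dominator_le _ 0 2 (1 + K) s t) => //.
  - by rewrite addr_ge0// ltW.
  - exact: ltW.
  - rewrite oppr0 powRr0 mulr1 (le_trans vle)// (le_trans _ (_ : K * 1 <= _))//.
      rewrite ler_pM2l// powRN invf_le1 ?powR_gt0//.
      by rewrite -[leLHS](powRr0 s) ler_powR.
    by rewrite mulr1 lerDr.
  - by rewrite (le_trans vle)// ler_wpM2r ?powR_ge0// lerDr.
have Gg t : 0 < t -> N n * G n (Num.truncn (N n * t)) @[n --> \oo] -->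
    c * (t `^ (gam - 1) * expR (- t)).
  move=> t0; under eq_fun do rewrite NGE kE.
  have kt := truncn_ratio_cvg Noo (ltW t0).
  have c1 := regularly_varying_scaled l_gt0 l_flat rg Noo t0 kt.
  rewrite mulrA; apply: cvgM => //.
  have Ninv : (N n)^-1 @[n --> \oo] --> 0.
    by apply/gtr0_cvgV0 => //; exact: nearW.
  have c2 : (N n)^-1 - (Num.truncn (N n * t)).+1%:R / N n @[n --> \oo] --> - t.
    by rewrite -[X in _ --> X]add0r; exact: cvgB.
  exact: (cvg_comp _ _ c2 (@continuous_expR R (- t))).
have [ig cvg] := riemann_sum_cvg N0 G0 iD GD Gg.
have c00 := lt0r_neq0 c0.
have ig2 : lebesgue_measure.-integrable (`]0, +oo[%classic : set R)
    (EFin \o (fun t => t `^ (gam - 1) * expR (- t))).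
  have := @integrableZl _ _ R lebesgue_measure _ (measurable_itv _) c^-1 _ ig.
  by apply: eq_integrable => // t t01; rewrite /= -EFinM mulKf.
split.
  apply: (Rintegral_gt0 (a := 1) (b := 2) (e := expR (- 2)) _ ig2) => //.
  - by move=> x _; rewrite mulr_ge0 ?powR_ge0 ?expR_ge0.
  - by rewrite ltr1n.
  - move=> x /andP[x1 x2]; split; first by rewrite /= in_itv/= andbT (lt_le_trans _ x1).
    rewrite -[leLHS]mul1r ler_pM ?expR_ge0//; last by rewrite ler_expR lerN2.
    by rewrite -[leLHS](powRr0 x) ler_powR//; move: gam1 eta_gt0; lra.
have E : (\int[lebesgue_measure]_(t in `]0%R, +oo[) (c * (t `^ (gam - 1) * expR (- t)))%:E)%E =
    (c * gamma_int gam)%:E.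
  rewrite /gamma_int -RintegralZl// /Rintegral fineK//.
  exact: (@integrable_fin_num _ _ R lebesgue_measure).
by rewrite E in cvg; exact: cvg.
Unshelve. all: by end_near. Qed.

End abelian.

(** The defect [1 - E exp(- X / N)] of a heavy-tailed law: since
    [alpha < 1], small jumps have a negligible contribution and the normalised
    sum converges to [laplace_int]. *)
Lemma small_laplace_cvg (R : realType) (p : nat -> R) (alpha c : R) (N : nat -> R) :
  (forall k, 0 <= p k) -> 0 < c -> 0 < alpha < 1 ->
  p k.+1 * k.+1%:R `^ (1 + alpha) @[k --> \oo] --> c ->
  (forall n, 0 < N n) -> N n @[n --> \oo] --> +oo ->
  0 < laplace_int alpha /\
  ((\sum_(0 <= k <oo) (N n `^ alpha * (p k.+1 * (1 - expR (- (k.+1%:R / N n)))))%:E)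
     @[n --> \oo] --> (c * laplace_int alpha)%:E)%E.
Proof.
move=> p0 c0 /andP[a0 a1] pc N0 Noo.
have [C C0 HC] : exists2 C, 0 < C & forall k, p k.+1 * k.+1%:R `^ (1 + alpha) <= C.
  have /cvg_seq_bounded [M [_ HM]] : cvgn (fun k => p k.+1 * k.+1%:R `^ (1 + alpha)).
    by apply/cvg_ex; exists c; exact: pc.
  exists (`|M| + 1) => [|n]; first by rewrite ltr_wpDl.
  have /(_ (`|M| + 1)) := HM; rewrite (le_lt_trans (ler_norm M)) ?ltrDl// => /(_ isT n I).
  by rewrite /=; exact: le_trans (ler_norm _).
pose G n k := N n `^ alpha * (p k.+1 * (1 - expR (- (k.+1%:R / N n)))).
have e1 (x : R) : 0 <= x -> 0 <= 1 - expR (- x) by move=> x0; rewrite subr_ge0 expR_le1 oppr_le0.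
have G0 n k : 0 <= G n k.
  by rewrite mulr_ge0 ?powR_ge0// mulr_ge0// e1// divr_ge0// ltW.
have iD := @integrable_two_power R alpha (1 + alpha) C a1.
have {}iD := iD (ltac:(lra) : 1 < 1 + alpha).
have NGE n k : N n * G n k = (p k.+1 * k.+1%:R `^ (1 + alpha)) *
    ((k.+1%:R / N n) `^ (- (1 + alpha)) * (1 - expR (- (k.+1%:R / N n)))).
  rewrite /G powRN powR_div// (powRD (x := N n)); last by rewrite (gt_eqF (N0 n)) implybT.
  rewrite powRr1 ?(ltW (N0 n))//.
  have q1 : N n `^ alpha != 0 by rewrite gt_eqF// powR_gt0.
  have q2 : k.+1%:R `^ (1 + alpha) != 0 :> R by rewrite gt_eqF// powR_gt0.
  have q3 := lt0r_neq0 (N0 n).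
  by field; rewrite q1 q2 q3.
have GD : \forall n \near \oo, forall t, 0 < t ->
    N n * G n (Num.truncn (N n * t)) <= C * two_power_dominator alpha (1 + alpha) t.
  apply: nearW => n t t0; have /andP[ts _] := truncn_ratio_bounds (N0 n) (ltW t0).
  set k := Num.truncn _ in ts *; set s := k.+1%:R / N n in ts.
  have s0 : 0 < s := lt_trans t0 ts.
  rewrite NGE -/s.
  have es : 1 - expR (- s) <= s by have := expR_ge1Dx (- s); lra.
  have es1 : 1 - expR (- s) <= 1 by have := expR_ge0 (- s); lra.
  have es0 := e1 s (ltW s0).
  apply: (@two_power_dominator_le _ alpha (1 + alpha) C s t) => //; try (exact: ltW).
  - by rewrite addr_ge0// ltW.
  - apply: ler_pM => //; first by rewrite mulr_ge0 ?powR_ge0.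
      by rewrite mulr_ge0 ?powR_ge0.
    have -> : s `^ (- alpha) = s `^ (- (1 + alpha)) * s.
      rewrite -{3}(powRr1 (ltW s0)) -powRD; last by rewrite (gt_eqF s0) implybT.
      by congr (_ `^ _); ring.
    by rewrite ler_wpM2l ?powR_ge0.
  - apply: ler_pM => //; first by rewrite mulr_ge0 ?powR_ge0.
      by rewrite mulr_ge0 ?powR_ge0.
    by rewrite -[leRHS]mulr1 ler_wpM2l ?powR_ge0.
have Gg t : 0 < t -> N n * G n (Num.truncn (N n * t)) @[n --> \oo] -->
    c * (t `^ (- (1 + alpha)) * (1 - expR (- t))).
  move=> t0; under eq_fun do rewrite NGE.
  have kt := truncn_ratio_cvg Noo (ltW t0).
  have koo := nat_cvgy_of_ratio Noo t0 kt.
  apply: cvgM; first exact: (cvg_comp _ _ koo pc).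
  apply: cvgM; first exact: powR_cvg.
  apply: cvgB; first exact: cvg_cst.
  have ktN : - ((Num.truncn (N n * t)).+1%:R / N n) @[n --> \oo] --> - t by exact: cvgN.
  exact: (cvg_comp _ _ ktN (@continuous_expR R (- t))).
have [ig cvg] := riemann_sum_cvg N0 G0 iD GD Gg.
have c00 := lt0r_neq0 c0.
have ig2 : lebesgue_measure.-integrable (`]0, +oo[%classic : set R)
    (EFin \o (fun t => t `^ (- (1 + alpha)) * (1 - expR (- t)))).
  have := @integrableZl _ _ R lebesgue_measure _ (measurable_itv _) c^-1 _ ig.
  by apply: eq_integrable => // t t01; rewrite /= -EFinM mulKf.
split.
  apply: (Rintegral_gt0 (a := 1) (b := 2)
    (e := 2 `^ (- (1 + alpha)) * (1 - expR (- 1))) _ ig2) => //.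
  - move=> x /=; rewrite in_itv/= andbT => x0.
    by rewrite mulr_ge0 ?powR_ge0// e1// ltW.
  - by rewrite ltr1n.
  - move=> x /andP[x1 x2]; have x0 : 0 < x by rewrite (lt_le_trans _ x1).
    split; first by rewrite /= in_itv/= andbT.
    apply: ler_pM; rewrite ?powR_ge0 ?e1//; last by rewrite lerD2l lerN2 ler_expR lerN2.
    rewrite !powRN lef_pV2 ?posrE ?powR_gt0//.
    by rewrite ge0_ler_powR ?nnegrE ?(ltW x0)// addr_ge0// ltW.
have E : (\int[lebesgue_measure]_(t in `]0%R, +oo[) (c * (t `^ (- (1 + alpha)) * (1 - expR (- t))))%:E)%E =
    (c * laplace_int alpha)%:E.
  rewrite /laplace_int -RintegralZl// /Rintegral fineK//.
  exact: (@integrable_fin_num _ _ R lebesgue_measure).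
by rewrite E in cvg; exact: cvg.
Qed.


(** * Weights of sequences of component sizes *)

Lemma triangle_exchange (V : nmodType) (m : nat) (f : nat -> nat -> V) :
  \sum_(x < m.+1) \sum_(y < (m - x).+1) f x y =
  \sum_(y < m.+1) \sum_(x < (m - y).+1) f x y.
Proof.
have E (h : nat -> nat -> V) : \sum_(x < m.+1) \sum_(y < (m - x).+1) h x y =
    \sum_(x < m.+1) \sum_(y < m.+1 | (x + y <= m)%N) h x y.
  apply: eq_bigr => x _.
  rewrite (big_ord_widen m.+1 (fun y => h x y)); last by rewrite ltnS leq_subr.
  by apply: eq_bigl => y; rewrite ltnS -(leq_add2l x) subnKC// -ltnS.
rewrite E (E (fun x y => f y x)) (exchange_big_dep xpredT)//=.
by apply: eq_bigr => y _; apply: eq_bigl => x; rewrite addnC.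
Qed.

Section weighted_sequences.
Context (R : realType).
Implicit Types (p phi : nat -> R) (G : R -> R).

(** Sum over the sequences of [k] sizes with total [m], weighted by the product
    of the [p], of [G] evaluated at [s] plus the total of [phi]. The accumulator
    [s] makes revealing one component a substitution. *)
Fixpoint seq_sum p phi G (k m : nat) (s : R) : R :=
  if k is k'.+1 then \sum_(x < m.+1) p x * seq_sum p phi G k' (m - x) (s + phi x)
  else if m == 0%N then G s else 0.

(** Coefficient of [z ^+ m] in the [k]-th power of the generating function of
    [p]. *)
Fixpoint pw p (k m : nat) : R :=
  if k is k'.+1 then \sum_(x < m.+1) p x * pw p k' (m - x) else (m == 0%N)%:R.

Lemma seq_sum_cst p phi c k m s : seq_sum p phi (fun=> c) k m s = c * pw p k m.
Proof.
elim: k m s => [|k IH] m s /=; first by case: eqP => _; rewrite ?mulr1 ?mulr0.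
by rewrite mulr_sumr; apply: eq_bigr => x _; rewrite IH mulrCA.
Qed.

Lemma seq_sum_le p phi G G' k m s : (forall x, 0 <= p x) ->
  (forall s, G s <= G' s) -> seq_sum p phi G k m s <= seq_sum p phi G' k m s.
Proof.
move=> p0 GG; elim: k m s => [|k IH] m s /=; first by case: eqP.
by apply: ler_sum => x _; rewrite ler_wpM2l.
Qed.

Lemma pw_ge0 p k m : (forall x, 0 <= p x) -> 0 <= pw p k m.
Proof.
move=> p0; elim: k m => [|k IH] m /=; first by [].
by apply: sumr_ge0 => x _; rewrite mulr_ge0.
Qed.

Lemma seq_sum_ge0 p phi G k m s : (forall x, 0 <= p x) ->
  (forall s, 0 <= G s) -> 0 <= seq_sum p phi G k m s.
Proof.
move=> p0 G0; elim: k m s => [|k IH] m s /=; first by case: eqP.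
by apply: sumr_ge0 => x _; rewrite mulr_ge0.
Qed.

(** Write [m] as the sum of the [k] sizes; by symmetry each contributes the same
    amount, so one marked component of size [x] can be put first with weight
    [x * p x]. *)
Lemma seq_sum_size_bias p phi G k m s :
  m%:R * seq_sum p phi G k m s =
  k%:R * \sum_(x < m.+1) x%:R * p x * seq_sum p phi G k.-1 (m - x) (s + phi x).
Proof.
elim: k m s => [|k IH] m s.
  by rewrite mul0r /=; case: eqP => [->|]; rewrite ?mul0r ?mulr0.
rewrite [seq_sum _ _ _ k.+1 _ _]/= mulr_sumr.
have E1 (x : 'I_m.+1) : m%:R * (p x * seq_sum p phi G k (m - x) (s + phi x)) =
    x%:R * p x * seq_sum p phi G k (m - x) (s + phi x) +
    p x * ((m - x)%:R * seq_sum p phi G k (m - x) (s + phi x)).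
  have xm : (x <= m)%N by rewrite -ltnS.
  by rewrite natrB//; ring.
rewrite (eq_bigr _ (fun x _ => E1 x)) big_split/=.
have -> : \sum_(x < m.+1) p x * ((m - x)%:R * seq_sum p phi G k (m - x) (s + phi x)) =
    k%:R * \sum_(x < m.+1) x%:R * p x * seq_sum p phi G k (m - x) (s + phi x).
  under eq_bigr do rewrite IH.
  case: k {IH E1} => [|k]; first by rewrite mul0r big1// => i _; rewrite mul0r mulr0.
  rewrite [k.+1.-1]/= mulr_sumr.
  pose f x y := k.+1%:R * (p x * (y%:R * p y) * seq_sum p phi G k (m - x - y) (s + phi x + phi y)).
  transitivity (\sum_(x < m.+1) \sum_(y < (m - x).+1) f x y).
    apply: eq_bigr => x _; rewrite mulrCA !mulr_sumr; apply: eq_bigr => y _.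
    by rewrite /f; ring.
  rewrite triangle_exchange; apply: eq_bigr => y _ /=.
  rewrite !mulr_sumr; apply: eq_bigr => x _.
  by rewrite /f subnAC (addrAC s); ring.
by rewrite -natr1 mulrDl mul1r addrC.
Qed.

(** For linear [G] the components contribute separately, and by symmetry
    equally. *)
Lemma seq_sum_linear p phi k m s :
  seq_sum p phi id k m s =
  s * pw p k m + k%:R * \sum_(x < m.+1) phi x * p x * pw p k.-1 (m - x).
Proof.
elim: k m s => [|k IH] m s /=.
  by rewrite mul0r addr0; case: eqP => _; rewrite ?mulr1 ?mulr0.
have E1 (x : 'I_m.+1) : p x * seq_sum p phi id k (m - x) (s + phi x) =
    s * (p x * pw p k (m - x)) + phi x * p x * pw p k (m - x) +
    p x * (k%:R * \sum_(y < (m - x).+1) phi y * p y * pw p k.-1 (m - x - y)).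
  by rewrite IH; ring.
rewrite (eq_bigr _ (fun x _ => E1 x)) 2!big_split/= -mulr_sumr -addrA; congr (_ + _).
have -> : \sum_(x < m.+1) p x * (k%:R * \sum_(y < (m - x).+1) phi y * p y * pw p k.-1 (m - x - y))
    = k%:R * \sum_(x < m.+1) phi x * p x * pw p k (m - x).
  case: k {IH E1} => [|k]; first by rewrite mul0r big1// => i _; rewrite mul0r mulr0.
  pose f x y := k.+1%:R * (p x * (phi y * p y) * pw p k (m - x - y)).
  transitivity (\sum_(x < m.+1) \sum_(y < (m - x).+1) f x y).
    apply: eq_bigr => x _; rewrite mulrCA !mulr_sumr; apply: eq_bigr => y _.
    by rewrite /f; ring.
  rewrite triangle_exchange mulr_sumr; apply: eq_bigr => y _ /=.
  rewrite !mulr_sumr; apply: eq_bigr => x _.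
  by rewrite /f subnAC; ring.
by rewrite -natr1 mulrDl mul1r addrC.
Qed.

Lemma seq_sum_no_jump p phi G k m s :
  (forall x, (x <= m)%N -> phi x = 0) -> seq_sum p phi G k m s = G s * pw p k m.
Proof.
elim: k m s => [|k IH] m s phi0 /=.
  by case: eqP => _; rewrite ?mulr1 ?mulr0.
rewrite mulr_sumr; apply: eq_bigr => x _.
have xm : (x <= m)%N by rewrite -ltnS.
rewrite phi0// addr0 IH; first by ring.
by move=> y ym; apply: phi0; rewrite (leq_trans ym)// leq_subr.
Qed.

Lemma pw_sum_le p (S : R) k n : (forall x, 0 <= p x) -> 
  (forall n, \sum_(x < n) p x <= S) -> \sum_(m < n) pw p k m <= S ^+ k.
Proof.
move=> p0 pS; have S0 : 0 <= S by have := pS 0%N; rewrite big_ord0.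
elim: k n => [|k IH] n.
  rewrite expr0; case: n => [|n]; first by rewrite big_ord0.
  by rewrite big_ord_recl/= big1 ?addr0// => i _.
case: n => [|n]; first by rewrite big_ord0 exprn_ge0.
pose f (x y : nat) := p x * pw p k (n - y - x).
have -> : \sum_(m < n.+1) pw p k.+1 m =
    \sum_(x < n.+1) \sum_(y < (n - x).+1) p x * pw p k y.
  have -> : \sum_(m < n.+1) pw p k.+1 m =
     \sum_(y < n.+1) \sum_(x < (n - y).+1) p x * pw p k (n - y - x).
    rewrite [LHS](reindex_inj rev_ord_inj); apply: eq_bigr => y _.
    by rewrite /= subSS.
  rewrite -(triangle_exchange n f); apply: eq_bigr => x _.
  rewrite [LHS](reindex_inj rev_ord_inj); apply: eq_bigr => y _.
  have yx : (y <= n - x)%N by rewrite -ltnS.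
  have xn : (x <= n)%N by rewrite -ltnS.
  rewrite /f/= subSS; congr (_ * pw _ _ _); lia.
rewrite exprS; apply: (@le_trans _ _ (\sum_(x < n.+1) p x * S ^+ k)).
  by apply: ler_sum => x _; rewrite -mulr_sumr ler_wpM2l.
by rewrite -mulr_suml ler_wpM2r// exprn_ge0.
Qed.

Definition trunc_weight p (y x : nat) : R := if (x <= y)%N then p x else 0.

Lemma trunc_weight_ge0 p y x : (forall x, 0 <= p x) -> 0 <= trunc_weight p y x.
Proof. by move=> p0; rewrite /trunc_weight; case: ifP. Qed.

Lemma pw_trunc p y k m : (m <= y)%N -> pw (trunc_weight p y) k m = pw p k m.
Proof.
elim: k m => //= k IH m my; apply: eq_bigr => x _.
have xm : (x <= m)%N by rewrite -ltnS.
rewrite /trunc_weight (leq_trans xm my) IH//.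
by rewrite (leq_trans _ my)// leq_subr.
Qed.

Lemma trunc_weight_sum p y n : (forall x, 0 <= p x) ->
  \sum_(x < n) trunc_weight p y x <= \sum_(x < y.+1) p x.
Proof.
move=> p0.
apply: (@le_trans _ _ (\sum_(x < n + y.+1) trunc_weight p y x)).
  rewrite (big_ord_widen (n + y.+1) (trunc_weight p y)) ?leq_addr//.
  rewrite [leRHS](bigID (fun x : 'I__ => (x < n)%N))/= lerDl sumr_ge0// => x _.
  exact: trunc_weight_ge0.
rewrite (big_ord_widen (n + y.+1) p) ?leq_addl// [leRHS]big_mkcond/=.
by apply: ler_sum => x _; rewrite /trunc_weight ltnS; case: ifP.
Qed.

Lemma pw_le_pow p k m : (forall x, 0 <= p x) -> pw p k m <= (\sum_(x < m.+1) p x) ^+ k.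
Proof.
move=> p0; rewrite -(pw_trunc p k (leqnn m)).
have t0 := fun x => trunc_weight_ge0 m x p0.
have := @pw_sum_le (trunc_weight p m) (\sum_(x < m.+1) p x) k m.+1 t0
  (fun n => trunc_weight_sum m n p0).
apply: le_trans; rewrite big_ord_recr/= lerDr sumr_ge0// => i _.
exact: pw_ge0.
Qed.

(** Raising the truncation level from [y] to [z] adds the sequences with an
    entry above [y]; that entry costs at most [s] by itself, can be at [k]
    places and is determined by the others. *)
Lemma pw_trunc_step p (y z k m : nat) (s : R) : (forall x, 0 <= p x) -> (y <= z)%N ->
  (forall x, (y < x)%N -> p x <= s) -> 0 <= s ->
  pw (trunc_weight p z) k m <= pw (trunc_weight p y) k m +
    k%:R * s * (\sum_(x < z.+1) p x) ^+ k.-1.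
Proof.
move=> p0 yz ps s0; set F := \sum_(x < z.+1) p x.
have F0 : 0 <= F by exact: sumr_ge0.
have tz0 := fun x => trunc_weight_ge0 z x p0.
have ty0 := fun x => trunc_weight_ge0 y x p0.
elim: k m => [|k IH] m /=; first by rewrite !mul0r addr0.
have split_w x : trunc_weight p z x <= trunc_weight p y x + (if (y < x)%N && (x <= z)%N then s else 0).
  rewrite /trunc_weight; have [xy|xy] := leqP x y.
    by rewrite (leq_trans xy yz)/= addr0.
  by case: ifP => _ /=; rewrite ?add0r ?ps// addr0.
have pwz m' := pw_ge0 k m' tz0.
apply: (@le_trans _ _ (\sum_(x < m.+1) (trunc_weight p y x * pw (trunc_weight p z) k (m - x) +
     s * pw (trunc_weight p z) k (m - x)))).
  apply: ler_sum => x _; rewrite -mulrDl ler_wpM2r// (le_trans (split_w x))// lerD2l.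
  by case: ifP.
rewrite big_split/=.
have tail : \sum_(x < m.+1) s * pw (trunc_weight p z) k (m - x) <= s * F ^+ k.
  rewrite -mulr_sumr ler_wpM2l//.
  rewrite (reindex_inj rev_ord_inj)/=.
  under eq_bigr do rewrite subSS subKn ?leq_ord//.
  by apply: pw_sum_le => // n; exact: trunc_weight_sum.
have head : \sum_(x < m.+1) trunc_weight p y x * pw (trunc_weight p z) k (m - x) <=
    \sum_(x < m.+1) trunc_weight p y x * pw (trunc_weight p y) k (m - x) + F * (k%:R * s * F ^+ k.-1).
  apply: (@le_trans _ _ (\sum_(x < m.+1) (trunc_weight p y x * pw (trunc_weight p y) k (m - x) +
     trunc_weight p y x * (k%:R * s * F ^+ k.-1)))).
    by apply: ler_sum => x _; rewrite -mulrDr ler_wpM2l.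
  rewrite big_split/= lerD2l -mulr_suml ler_wpM2r ?mulr_ge0 ?exprn_ge0//.
  rewrite (le_trans (trunc_weight_sum y m.+1 p0))// /F.
  rewrite (big_ord_widen z.+1 p) ?ltnS// [leRHS](bigID (fun x : 'I_z.+1 => (x < y.+1)%N))/=.
  by rewrite lerDl sumr_ge0.
have E : F * (k%:R * s * F ^+ k.-1) = k%:R * s * F ^+ k.
  by case: k {IH pwz tail head} => [|k] /=; rewrite ?mul0r ?mulr0// exprS; ring.
rewrite E in head; rewrite -(natr1 k) !mulrDl mul1r.
move: head tail; lra.
Qed.

End weighted_sequences.


(** * A local upper bound for mixtures of convolution powers *)

Lemma ler_powR_base (R : realType) (x y g : R) : 0 <= g -> 0 <= x -> x <= y ->
  x `^ g <= y `^ g.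
Proof.
by move=> g0 x0 xy; rewrite ge0_ler_powR ?nnegrE//; exact: le_trans xy.
Qed.

Section local_upper_bound.
Context (R : realType) (l : R -> R) (eta : R).
Hypothesis l_gt0 : forall x, 0 < l x.
Hypothesis l_potter : potter eta l.
Hypothesis l_flat : asymptotically_flat l.
Hypothesis eta_gt0 : 0 < eta.

(** The limit [abelian] controls large integers [N]; the sum is monotone in [N],
    and passing to a larger comparable integer costs a constant factor by
    Potter's inequality. *)
Lemma abelian_bound (A : nat -> R) (gam cA : R) :
  (forall j, 0 <= A j) -> 0 < cA -> regularly_varying l (gam - 1) cA A -> 1 + eta <= gam ->
  exists2 C, 0 < C & forall N, 1 <= N ->
    (\sum_(0 <= j <oo) (A j * expR (- (j%:R / N)))%:E <= (C * (N `^ gam * l N))%:E)%E.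
Proof.
move=> A0 cA0 rA gam1.
have gam0 : 0 <= gam by rewrite (le_trans _ gam1)// addr_ge0// ltW.
have Noo : n.+1%:R @[n --> \oo] --> (+oo : set_system R).
  by have := @cvgr_idn R; rewrite -(cvg_shiftS _).
have [Gam0 cv] := abelian l_gt0 l_potter l_flat eta_gt0 A0 cA0 rA gam1 (fun n => ltr0Sn R n) Noo.
set S := (fun n : nat => _) in cv.
have [n0 _ Hn0] : \forall n \near \oo, (S n <= (cA * gamma_int gam + 1)%:E)%E.
  have/fine_cvgP[fS /cvgrPdist_le/(_ _ ltr01) H] := cv.
  near=> n; have fn : S n \is a fin_num by near: n.
  rewrite -(fineK fn) lee_fin.
  have : `|cA * gamma_int gam - (fine \o S) n| <= 1 by near: n.
  by rewrite ler_norml /=; lra.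
have [D D0 HD] := l_potter.
pose K : R := n0.+2%:R.
have K1 : 1 <= K by rewrite ler1n.
exists ((cA * gamma_int gam + 1) * (K `^ gam * (D * K `^ eta))) => [|N N1].
  by rewrite !mulr_gt0 ?powR_gt0 ?addr_gt0 ?mulr_gt0// (lt_le_trans _ K1).
have N0 : 0 < N by rewrite (lt_le_trans _ N1).
pose n := maxn (Num.truncn N) n0.
have Nn : N <= n.+1%:R.
  have /andP[_ /ltW H] := truncn_itv (ltW N0); rewrite (le_trans H)// ler_nat ltnS.
  by rewrite leq_max leqnn.
have nN : n.+1%:R <= K * N.
  have /andP[H _] := truncn_itv (ltW N0).
  have n0N : n0%:R <= n0%:R * N by rewrite ler_peMr.
  have : n%:R <= (n0.+1)%:R * N.
    rewrite /n /maxn; case: ifP => _.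
      by rewrite (le_trans n0N)// ler_wpM2r ?(ltW N0)// ler_nat.
    by rewrite (le_trans H)// ler_peMl ?(ltW N0)// ler1n.
  rewrite /K -!natr1 => H1; rewrite !mulrDl !mul1r; rewrite mulrDl mul1r in H1.
  by lra.
have n1 : 0 < n.+1%:R :> R by rewrite ltr0Sn.
have ln : l n.+1%:R <= D * K `^ eta * l N.
  rewrite (le_trans (HD N n.+1%:R N0 n1))// mulrAC ler_wpM2r ?(ltW (l_gt0 _))// ler_pM2l//.
  have q1 : n.+1%:R / N <= K by rewrite ler_pdivrMr.
  have q2 : N / n.+1%:R <= K by rewrite (le_trans _ K1)// ler_pdivrMr// mul1r.
  apply: ler_powR_base; first exact: ltW.
    by rewrite le_max divr_ge0// ltW.
  by rewrite ge_max q1 q2.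
have np : n.+1%:R `^ gam <= K `^ gam * N `^ gam.
  rewrite -powRM ?(le_trans _ K1)// ?(ltW N0)//.
  exact: ler_powR_base.
have Sn : (S n <= (cA * gamma_int gam + 1)%:E)%E by apply: Hn0; rewrite /= leq_max leqnn orbT.
have w0 : 0 < n.+1%:R `^ gam * l n.+1%:R by rewrite mulr_gt0 ?powR_gt0.
apply: (@le_trans _ _ ((n.+1%:R `^ gam * l n.+1%:R)%:E * S n)%E).
  rewrite /S -nneseriesZl//; last first.
    by move=> i _; rewrite lee_fin !mulr_ge0 ?expR_ge0 ?invr_ge0 ?(ltW w0).
  apply: lee_nneseries => j _; first by rewrite lee_fin mulr_ge0 ?expR_ge0.
  rewrite -EFinM lee_fin.
  rewrite [leRHS]mulrC divfK ?gt_eqF// ler_wpM2l// ler_expR lerN2.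
  by rewrite ler_wpM2l// lef_pV2 ?posrE.
apply: (@le_trans _ _ ((n.+1%:R `^ gam * l n.+1%:R)%:E * (cA * gamma_int gam + 1)%:E)%E).
  by rewrite lee_wpmul2l// lee_fin ltW.
rewrite -EFinM lee_fin mulrC -!mulrA ler_pM2l; last by rewrite addr_gt0// mulr_gt0.
have -> : K `^ gam * (D * (K `^ eta * (N `^ gam * l N))) =
   (K `^ gam * N `^ gam) * (D * K `^ eta * l N) by ring.
by apply: ler_pM => //; rewrite ?powR_ge0// ltW.
Unshelve. all: by end_near. Qed.

Context (p : nat -> R) (alpha cp : R).
Hypothesis p_ge0 : forall x, 0 <= p x.
Hypothesis p_sum : forall n, \sum_(x < n) p x <= 1.
Hypothesis alpha01 : 0 < alpha < 1.
Hypothesis cp_gt0 : 0 < cp.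
Hypothesis p_cvg : p k.+1 * k.+1%:R `^ (1 + alpha) @[k --> \oo] --> cp.

(** The tail of [p] beyond [y] is at least of order [y ^ - alpha], and
    [1 - z <= exp (- z)]. *)
Lemma partial_mass_le : exists2 c, 0 < c <= 1 & forall y, (0 < y)%N ->
  \sum_(x < y.+1) p x <= expR (- (c * y%:R `^ (- alpha))).
Proof.
have [a0 a1] := andP alpha01.
have [K0 _ HK] : \forall k \near \oo, cp / 2 <= p k.+1 * k.+1%:R `^ (1 + alpha).
  move/cvgrPdist_le : p_cvg => /(_ (cp / 2)); rewrite divr_gt0// => /(_ isT).
  by apply: filterS => n; rewrite ler_norml; lra.
pose c1 := cp / 2 * 2 `^ (- (1 + alpha)).
have c10 : 0 < c1 by rewrite mulr_gt0 ?powR_gt0 ?divr_gt0.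
have big_y y : (K0 < y)%N -> \sum_(x < y.+1) p x <= 1 - c1 * y%:R `^ (- alpha).
  move=> Ky; have y0 : 0 < y%:R :> R by rewrite ltr0n (leq_ltn_trans _ Ky).
  have := p_sum (y.+1 + y).
  rewrite big_split_ord/= => H.
  suff : c1 * y%:R `^ (- alpha) <= \sum_(i < y) p (y.+1 + i)%N by move: H; lra.
  apply: (@le_trans _ _ (\sum_(i < y) (cp / 2 * (2 * y%:R) `^ (- (1 + alpha))))).
    rewrite sumr_const card_ord -[leRHS]mulr_natr /c1 powRM ?(ltW y0)//.
    have -> : y%:R `^ (- alpha) = y%:R `^ (- (1 + alpha)) * y%:R :> R.
      rewrite -[X in _ * X](powRr1 (ltW y0)) -powRD; last by rewrite (gt_eqF y0) implybT.
      by congr (_ `^ _); ring.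
    by rewrite !mulrA.
  apply: ler_sum => i _.
  have := HK (y + i)%N (leq_trans (ltnW Ky) (leq_addr _ _)); rewrite /= addSn => Hk.
  have p0 : 0 < (y + i).+1%:R `^ (1 + alpha) :> R by rewrite powR_gt0.
  have XP : (2 * y%:R) `^ (- (1 + alpha)) * (y + i).+1%:R `^ (1 + alpha) <= 1 :> R.
    rewrite powRN mulrC ler_pdivrMr ?powR_gt0 ?mulr_gt0// mul1r.
    apply: ler_powR_base => //; first by rewrite addr_ge0// ltW.
    by rewrite mulr_natl mulr2n -natrD ler_nat -addnS leq_add2l.
  rewrite -(ler_pM2r p0) (le_trans _ Hk)// -[leLHS]mulrA -[leRHS]mulr1.
  by rewrite ler_wpM2l// divr_ge0// ltW.
pose Y0 := K0.+1.
have Yp : 0 < (Y0%:R : R) `^ (- alpha) <= 1.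
  rewrite powR_gt0//= powRN invf_le1 ?powR_gt0//.
  by rewrite -[leLHS](powRr0 Y0%:R) ler_powR ?(ltW a0)// ler1n.
have [Yp0 Yp1] := andP Yp.
exists (Num.min 1 (c1 * Y0%:R `^ (- alpha))).
  by rewrite lt_min ltr01 mulr_gt0//= ge_min lexx.
move=> y y0.
have yp : 0 < (y%:R : R) `^ (- alpha) <= 1.
  rewrite powR_gt0 ?ltr0n//= powRN invf_le1 ?powR_gt0 ?ltr0n//.
  by rewrite -[leLHS](powRr0 y%:R) ler_powR ?(ltW a0)// ler1n.
have [yp0 yp1] := andP yp.
apply: le_trans (expR_ge1Dx _).
set c := Num.min _ _.
have cc : c <= c1 * Y0%:R `^ (- alpha) by rewrite ge_min lexx orbT.
have c0 : 0 <= c by rewrite le_min ler01 mulr_ge0 ?ltW.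
have [yK|yK] := ltnP K0 y.
  rewrite (le_trans (big_y y yK))// lerD2l lerN2 ler_wpM2r ?(ltW yp0)//.
  by rewrite (le_trans cc)// ler_piMr// ltW.
apply: (@le_trans _ _ (\sum_(x < Y0.+1) p x)).
  rewrite (big_ord_widen Y0.+1 p) ?ltnS ?(leq_trans yK)//.
  rewrite [leRHS](bigID (fun x : 'I_Y0.+1 => (x < y.+1)%N))/=.
  by rewrite lerDl sumr_ge0.
rewrite (le_trans (big_y Y0 (ltnSn _)))// lerD2l lerN2.
by rewrite (le_trans _ cc)// ler_piMr.
Qed.

Context (A A' : nat -> R) (gam cA cA' : R).
Hypothesis A_ge0 : forall j, 0 <= A j.
Hypothesis A'E : forall j, A' j = A j.+1 * j.+1%:R.
Hypothesis cA_gt0 : 0 < cA.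
Hypothesis cA'_gt0 : 0 < cA'.
Hypothesis A_rv : regularly_varying l (gam - 1) cA A.
Hypothesis A'_rv : regularly_varying l gam cA' A'.
Hypothesis gam_large : 2 + eta <= alpha * gam.

(** Contribution of the dyadic block [i], compared with the target at [M] by
    Potter's inequality. The remaining factor grows geometrically in [i], so
    that the sum over blocks is governed by the last one, of order [M]. *)
Lemma dyadic_term_bound (C c : R) : 0 <= C -> 0 < c <= 1 ->
  exists2 C', 0 <= C' & forall (i M : nat), (2 ^ i <= M)%N ->
  let N := (2 ^ i.+1)%:R `^ alpha / c in
  (2 ^ i)%:R `^ (- (1 + alpha)) * (C * (N `^ (gam + 1) * l N)) <=
  C' * (M%:R `^ eta * l (M%:R `^ alpha)) * (2 `^ (alpha * gam - 1 - eta)) ^+ i.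
Proof.
move=> C0 /andP[c0 c1].
have [a0 a1] := andP alpha01.
have [D D0 HD] := l_potter.
pose kap := 2 `^ alpha / c.
have kap1 : 1 <= kap.
  rewrite /kap ler_pdivlMr// mul1r (le_trans c1)//.
  by rewrite -[leLHS](powRr0 2) ler_powR ?ler1n// ltW.
have kap0 : 0 < kap by rewrite (lt_le_trans _ kap1).
exists (C * kap `^ (gam + 1) * (D * kap `^ eta)).
  by rewrite !mulr_ge0 ?powR_ge0// ltW.
move=> i M iM /=.
set x : R := (2 ^ i)%:R.
have x0 : 0 < x by rewrite ltr0n expn_gt0.
have Mx : x <= M%:R by rewrite ler_nat.
have M0 : 0 < M%:R :> R by rewrite (lt_le_trans x0).
have -> : (2 ^ i.+1)%:R `^ alpha / c = kap * x `^ alpha.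
  rewrite expnS natrM powRM ?(ltW x0)// /kap /x; ring.
set N := kap * x `^ alpha.
have xa : 0 < x `^ alpha by rewrite powR_gt0.
have Ma : 0 < M%:R `^ alpha :> R by rewrite powR_gt0.
have N0 : 0 < N by rewrite mulr_gt0.
have Mx1 : 1 <= M%:R / x by rewrite ler_pdivlMr// mul1r.
have Mxa : 1 <= (M%:R / x) `^ alpha by rewrite -[leLHS](powRr0 (M%:R / x)) ler_powR// ltW.
have Mxa' : (M%:R / x) `^ alpha <= M%:R / x.
  by apply: ler1_powR => //; exact: ltW.
have lN : l N <= D * kap `^ eta * (M%:R / x) `^ eta * l (M%:R `^ alpha).
  rewrite (le_trans (HD _ _ Ma N0))// mulrAC ler_wpM2r ?(ltW (l_gt0 _))// -mulrA ler_pM2l//.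
  rewrite -powRM ?(ltW kap0) ?divr_ge0 ?(ltW x0) ?(ltW M0)//.
  apply: ler_powR_base; first exact: ltW.
    by rewrite le_max (divr_ge0 (ltW N0) (ltW Ma)).
  rewrite ge_max; apply/andP; split.
    apply: (@le_trans _ _ kap); last by rewrite ler_peMr// ltW.
    by rewrite ler_pdivrMr// /N ler_pM2l// ler_powR_base// ltW.
  apply: (@le_trans _ _ (M%:R / x)); last by rewrite ler_peMl// divr_ge0// ltW.
  apply: le_trans Mxa'; rewrite powR_div ?(ltW M0)// ler_pM2l// lef_pV2 ?posrE//.
  by rewrite /N ler_peMl// ltW.
have NE : N `^ (gam + 1) = kap `^ (gam + 1) * x `^ (alpha * gam + alpha).
  by rewrite /N powRM ?(ltW kap0) ?(ltW xa)// -powRrM mulrDr mulr1.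
have qE : (2 `^ (alpha * gam - 1 - eta)) ^+ i = x `^ (alpha * gam - 1 - eta).
  by rewrite -powR_mulrn ?powR_ge0// -powRrM mulrC powRrM powR_mulrn// /x natrX.
rewrite qE NE.
apply: (@le_trans _ _ (x `^ (- (1 + alpha)) * (C * (kap `^ (gam + 1) * x `^ (alpha * gam + alpha) *
   (D * kap `^ eta * (M%:R / x) `^ eta * l (M%:R `^ alpha)))))).
  by rewrite ler_wpM2l ?powR_ge0// ler_wpM2l// ler_wpM2l ?mulr_ge0 ?powR_ge0.
rewrite (powR_div eta (ltW M0) x0).
have -> : x `^ (alpha * gam - 1 - eta) = x `^ (- (1 + alpha)) * x `^ (alpha * gam + alpha) / x `^ eta.
  rewrite -powRD; last by rewrite (gt_eqF x0) implybT.
  rewrite -powRB; last by rewrite (gt_eqF x0) implybT.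
  by congr (_ `^ _); ring.
by rewrite le_eqVlt; apply/orP; left; apply/eqP; ring.
Qed.

(** Iterated truncation: a sequence whose largest entry is in the dyadic block
    [i] has that entry bounded by [s i], all the others staying below the next
    level. *)
Lemma pw_dyadic_bound (s : nat -> R) (I j m : nat) :
  (forall i, 0 <= s i) -> (forall i x, (2 ^ i < x)%N -> p x <= s i) ->
  pw (trunc_weight p (2 ^ I)) j m <= (\sum_(x < 2) p x) ^+ j +
    \sum_(i < I) j%:R * s i * (\sum_(x < (2 ^ i.+1).+1) p x) ^+ j.-1.
Proof.
move=> s0 ps; elim: I => [|I IH].
  rewrite big_ord0 addr0 expn0.
  have t0 := fun x => trunc_weight_ge0 1 x p_ge0.
  rewrite (le_trans (pw_le_pow j m t0))// lerXn2r ?nnegrE ?sumr_ge0//.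
  exact: trunc_weight_sum.
rewrite [X in _ <= _ + X]big_ord_recr/= addrA.
have := @pw_trunc_step R p (2 ^ I) (2 ^ I.+1) j m (s I) p_ge0 _ (ps I) (s0 I).
rewrite leq_exp2l// => /(_ (leqnSn I)) /le_trans; apply.
by rewrite lerD2r.
Qed.

Lemma geometric_sum_le (q : R) (n : nat) : 2 <= q -> \sum_(i < n) q ^+ i <= q ^+ n.
Proof.
move=> q2; elim: n => [|n IH]; first by rewrite big_ord0.
have q0 : 0 <= q ^+ n by rewrite exprn_ge0// (le_trans _ q2).
rewrite big_ord_recr/= exprS (le_trans (lerD IH (lexx _)))//.
by rewrite -mulr2n -mulr_natl ler_wpM2r.
Qed.

(** Generating functions only bound averages over [m]. Sequences with sum [m]
    are classified by the dyadic block of their largest entry: by the tail of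
    [p] that entry costs a power of [2 ^ i], while the other ones stay below
    [2 ^ i.+1], an event of exponentially small weight in [j]. Summing over
    [j] by [abelian_bound] and over the blocks geometrically gives the right
    order; [gam] is so large that the last block dominates. *)
Lemma local_upper_bound : exists2 C, 0 < C & forall m,
  (\sum_(0 <= j <oo) (A j * pw p j m)%:E <=
    (C * (m.+1%:R `^ (alpha * gam - 1) * l (m.+1%:R `^ alpha)))%:E)%E.
Proof.
have [a0 a1] := andP alpha01.
have gam2 : 2 + eta <= gam.
  apply: (le_trans gam_large); rewrite ler_piMl ?(ltW a1)//.
  have : 0 < alpha * gam by move: gam_large eta_gt0; lra.
  by rewrite pmulr_rgt0// => /ltW.
have A'0 j : 0 <= A' j by rewrite A'E mulr_ge0.
have [c c01 Hc] := partial_mass_le.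
have [c0 c1] := andP c01.
have [CA CA0 HCA] := abelian_bound A_ge0 cA_gt0 A_rv (ltac:(lra) : 1 + eta <= gam).
have A'_rv' : regularly_varying l (gam + 1 - 1) cA' A' by rewrite addrK.
have [CB CB0 HCB] := abelian_bound A'0 cA'_gt0 A'_rv' (ltac:(move: eta_gt0; lra) : 1 + eta <= gam + 1).
have [Cp Cp0 HCp] : exists2 C, 0 < C & forall k, p k.+1 * k.+1%:R `^ (1 + alpha) <= C.
  have /cvg_seq_bounded [M [_ HM]] : cvgn (fun k => p k.+1 * k.+1%:R `^ (1 + alpha)).
    by apply/cvg_ex; exists cp; exact: p_cvg.
  exists (`|M| + 1) => [|n]; first by rewrite ltr_wpDl.
  have /(_ (`|M| + 1)) := HM; rewrite (le_lt_trans (ler_norm M)) ?ltrDl// => /(_ isT n I).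
  by rewrite /=; exact: le_trans (ler_norm _).
pose s i : R := Cp * (2 ^ i)%:R `^ (- (1 + alpha)).
have s0 i : 0 <= s i by rewrite mulr_ge0 ?powR_ge0// ltW.
have ps i x : (2 ^ i < x)%N -> p x <= s i.
  case: x => // x ix.
  have x0 : 0 < x.+1%:R `^ (1 + alpha) :> R by rewrite powR_gt0.
  have := HCp x; rewrite -ler_pdivlMr// => /le_trans; apply.
  rewrite /s ler_pM2l// powRN lef_pV2 ?posrE ?powR_gt0 ?ltr0n ?expn_gt0//.
  by apply: ler_powR_base; rewrite ?addr_ge0 ?(ltW a0)// ler_nat ltnW.
have [C' C'0 HC'] := dyadic_term_bound (ltW CB0) c01.
pose F1 : R := \sum_(x < 2) p x.
have F10 : 0 <= F1 by exact: sumr_ge0.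
pose F i : R := \sum_(x < (2 ^ i.+1).+1) p x.
have F0 i : 0 <= F i by exact: sumr_ge0.
have f0 i j : (0 <= (A j * (j%:R * s i * F i ^+ j.-1))%:E)%E.
  rewrite lee_fin; apply: mulr_ge0 => //; apply: mulr_ge0; last by rewrite exprn_ge0.
  exact: mulr_ge0.
have ci1 : 1 <= c^-1 by rewrite invf_ge1.
have S1 : (\sum_(0 <= j <oo) (A j * F1 ^+ j)%:E <= (CA * (c^-1 `^ gam * l c^-1))%:E)%E.
  apply: le_trans (HCA _ ci1); apply: lee_nneseries => j _.
    by rewrite lee_fin mulr_ge0// exprn_ge0.
  rewrite lee_fin ler_wpM2l// invrK.
  have := Hc 1%N isT; rewrite powR1 mulr1 -/F1 => HF1.
  have -> : - (j%:R * c) = j%:R * (- c) by ring.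
  by rewrite expRM_natl lerXn2r ?nnegrE ?expR_ge0.
have S2 i : (\sum_(0 <= j <oo) (A j * (j%:R * s i * F i ^+ j.-1))%:E <=
    (s i * (CB * (((2 ^ i.+1)%:R `^ alpha / c) `^ (gam + 1) * l ((2 ^ i.+1)%:R `^ alpha / c))))%:E)%E.
  have N1 : 1 <= (2 ^ i.+1)%:R `^ alpha / c.
    rewrite ler_pdivlMr// mul1r (le_trans c1)//.
    by rewrite -[leLHS](powRr0 (2 ^ i.+1)%:R) ler_powR ?ler1n ?expn_gt0// ltW.
  have s0E : (0 <= (s i)%:E)%E by rewrite lee_fin.
  have := lee_wpmul2l s0E (HCB _ N1).
  rewrite -EFinM; apply: le_trans.
  rewrite -nneseriesZl; last by move=> j _; rewrite lee_fin mulr_ge0 ?expR_ge0.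
  rewrite (nneseries_split 0 1)// big_mkord big_ord1 !mul0r mulr0 add0e add0n.
  rewrite -(nneseries_addn 1)//.
  apply: lee_nneseries => j _; first by move=> *; exact: (f0 i (j + 1)%N).
  rewrite -EFinM lee_fin addn1 A'E.
  have -> : A j.+1 * (j.+1%:R * s i * F i ^+ j.+1.-1) = s i * (A j.+1 * j.+1%:R * F i ^+ j) by rewrite /=; ring.
  rewrite ler_wpM2l// ler_wpM2l ?mulr_ge0//.
  have := Hc (2 ^ i.+1)%N; rewrite expn_gt0 => /(_ isT); rewrite -/(F i) => HF.
  have -> : - (j%:R / ((2 ^ i.+1)%:R `^ alpha / c)) = j%:R * - (c * (2 ^ i.+1)%:R `^ (- alpha)).
    rewrite powRN; have : (2 ^ i.+1)%:R `^ alpha != 0 :> R by rewrite gt_eqF// powR_gt0// ltr0n expn_gt0.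
    by move=> q0; field; rewrite q0 gt_eqF.
  by rewrite expRM_natl lerXn2r ?nnegrE ?expR_ge0.
have [D D0 HD] := l_potter.
pose q : R := 2 `^ (alpha * gam - 1 - eta).
have q2 : 2 <= q.
  rewrite /q -[leLHS](@powRr1 _ 2)// ler_powR ?ler1n//.
  by move: gam_large; lra.
pose W (m : nat) : R := m.+1%:R `^ (alpha * gam - 1) * l (m.+1%:R `^ alpha).
have W1 m : l 1 / D <= W m.
  have x1 : 1 <= m.+1%:R :> R by rewrite ler1n.
  have xa : 0 < m.+1%:R `^ alpha :> R by rewrite powR_gt0.
  have xa1 : 1 <= m.+1%:R `^ alpha :> R by rewrite -[leLHS](powRr0 m.+1%:R) ler_powR// ltW.
  have := HD _ _ xa ltr01; rewrite div1r divr1 max_r; last first.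
    by rewrite (le_trans _ xa1)// invf_le1.
  rewrite ler_pdivrMr// mulrC /W => /le_trans; apply.
  rewrite -powRrM -[leRHS]mulrA (mulrC (l _) D) ler_wpM2r ?mulr_ge0 ?(ltW D0) ?(ltW (l_gt0 _))//.
  apply: ler_powR => //.
  have : alpha * eta <= eta by rewrite ler_piMl ?ltW.
  by move: gam_large; lra.
pose E1 := CA * (c^-1 `^ gam * l c^-1).
have E10 : 0 <= E1 by rewrite !mulr_ge0 ?powR_ge0 ?(ltW CA0) ?(ltW (l_gt0 _)).
exists (E1 * (D / l 1) + Cp * C' * 2 `^ (alpha * gam - 1 - eta) + 1).
  have h1 : 0 <= D / l 1 by rewrite divr_ge0 ?ltW.
  have h2 : 0 <= Cp * C' * 2 `^ (alpha * gam - 1 - eta).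
    by apply: mulr_ge0; [apply: mulr_ge0 => //; exact: ltW|exact: powR_ge0].
  by rewrite ltr_wpDl// addr_ge0// mulr_ge0.
move=> m; rewrite -/(W m).
have Wm0 : 0 < W m by rewrite mulr_gt0// powR_gt0.
(* The least power of 2 above m.+1: truncation at it does not affect sequences with sum m. *)
pose I := (trunc_log 2 m.+1).+1.
have I1 : (m.+1 < 2 ^ I)%N by exact: trunc_log_ltn.
have I2 i : (i < I)%N -> (2 ^ i <= m.+1)%N.
  rewrite ltnS => iI; apply: (leq_trans _ (@trunc_logP 2 m.+1 isT isT)).
  by rewrite leq_exp2l.
apply: (@le_trans _ _ (\sum_(0 <= j <oo) ((A j * F1 ^+ j)%:E +
    \sum_(i < I) (A j * (j%:R * s i * F i ^+ j.-1))%:E))%E).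
  apply: lee_nneseries => j _; first by rewrite lee_fin mulr_ge0// pw_ge0.
  rewrite sumEFin -EFinD lee_fin -mulr_sumr -mulrDr ler_wpM2l//.
  have := pw_dyadic_bound I j m s0 ps; rewrite pw_trunc//.
  by rewrite ltnW// (ltn_trans _ I1).
rewrite nneseriesD; last 2 first.
  by move=> j _ _; rewrite lee_fin mulr_ge0// exprn_ge0.
  by move=> j _ _; apply: sume_ge0 => i _; exact: f0.
rewrite nneseries_sum; last by move=> i j _; exact: f0.
have tail : (\sum_(i < I) \sum_(0 <= j <oo) (A j * (j%:R * s i * F i ^+ j.-1))%:E <=
    (Cp * C' * 2 `^ (alpha * gam - 1 - eta) * W m)%:E)%E.
  apply: (@le_trans _ _ (\sum_(i < I) (Cp * (C' * (m.+1%:R `^ eta * l (m.+1%:R `^ alpha)) * q ^+ i))%:E)%E).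
    apply: lee_sum => i _; apply: (le_trans (S2 i)); rewrite lee_fin /s -[leLHS]mulrA ler_pM2l//.
    exact: HC' (I2 i (ltn_ord i)).
  rewrite sumEFin lee_fin -mulr_sumr -mulr_sumr -!mulrA ler_pM2l// ler_wpM2l//.
  have qI : \sum_(i < I) q ^+ i <= 2 `^ (alpha * gam - 1 - eta) * m.+1%:R `^ (alpha * gam - 1 - eta).
    apply: (le_trans (geometric_sum_le I q2)).
    rewrite -powRM// /q -powR_mulrn ?powR_ge0// -powRrM mulrC powRrM powR_mulrn//.
    apply: ler_powR_base; rewrite ?exprn_ge0//; first by move: gam_large; lra.
    by rewrite -natrX -natrM ler_nat /I expnS leq_pmul2l// (@trunc_logP 2 m.+1 isT isT).
  apply: (@le_trans _ _ (m.+1%:R `^ eta * (l (m.+1%:R `^ alpha) * (2 `^ (alpha * gam - 1 - eta) * m.+1%:R `^ (alpha * gam - 1 - eta))))).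
    by rewrite ler_wpM2l ?powR_ge0// ler_wpM2l// ltW.
  have -> : W m = m.+1%:R `^ eta * m.+1%:R `^ (alpha * gam - 1 - eta) * l (m.+1%:R `^ alpha).
    rewrite /W -powRD; last by rewrite pnatr_eq0 implybT.
    by congr (_ `^ _ * _); ring.
  by rewrite le_eqVlt; apply/orP; left; apply/eqP; ring.
apply: (le_trans (leeD S1 tail)); rewrite -EFinD lee_fin -/E1.
have : E1 <= E1 * (D / l 1) * W m.
  rewrite -mulrA ler_peMr// mulrC.
  have := W1 m; rewrite ler_pdivrMr// => H.
  by rewrite mulrA ler_pdivlMr// mul1r.
by rewrite !mulrDl mul1r; move: Wm0; lra.
Qed.

End local_upper_bound.


(** * Approximation by polynomials and a Tauberian theorem *)

Section bernstein.
Context (R : realType).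

(** Mean of [f] under the binomial law, defined by conditioning on the first
    trial; moments follow by induction. *)
Fixpoint binomial_mean (n : nat) (f : nat -> R) (x : R) : R :=
  if n is n'.+1 then x * binomial_mean n' (f \o succn) x + (1 - x) * binomial_mean n' f x
  else f 0%N.

Fixpoint bernstein_poly (n : nat) (f : nat -> R) : {poly R} :=
  if n is n'.+1 then 'X * bernstein_poly n' (f \o succn) + (1 - 'X) * bernstein_poly n' f
  else (f 0%N)%:P.

Lemma horner_bernstein n f x : (bernstein_poly n f).[x] = binomial_mean n f x.
Proof. by elim: n f => [|n IH] f /=; rewrite !hornerE// !IH. Qed.

Lemma binomial_mean_le n (f g : nat -> R) x : 0 <= x <= 1 ->
  (forall k, (k <= n)%N -> f k <= g k) -> binomial_mean n f x <= binomial_mean n g x.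
Proof.
move=> /andP[x0 x1]; elim: n f g => [|n IH] f g fg /=; first exact: fg.
apply: lerD; rewrite ler_wpM2l ?subr_ge0//; apply: IH => k kn /=; apply: fg => //.
exact: leqW.
Qed.

Lemma binomial_meanD n (f g : nat -> R) x :
  binomial_mean n (fun k => f k + g k) x = binomial_mean n f x + binomial_mean n g x.
Proof.
elim: n f g => [|n IH] f g //=.
have := IH (f \o succn) (g \o succn); rewrite /comp => ->; rewrite IH; ring.
Qed.

Lemma binomial_meanZ n (f : nat -> R) c x :
  binomial_mean n (fun k => c * f k) x = c * binomial_mean n f x.
Proof.
elim: n f => [|n IH] f //=.
have := IH (f \o succn); rewrite /comp => ->; rewrite IH; ring.
Qed.

Lemma binomial_mean_cst n c x : binomial_mean n (fun=> c) x = c.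
Proof. by elim: n => [|n IH] //=; have := IH; rewrite /comp => ->; ring. Qed.

Lemma binomial_mean_sqr n c x :
  binomial_mean n (fun k => (k%:R - c) ^+ 2) x = n%:R * x * (1 - x) + (n%:R * x - c) ^+ 2.
Proof.
elim: n c => [|n IH] c /=; first by ring.
have -> : (fun k : nat => (k%:R - c) ^+ 2) \o succn = (fun k : nat => (k%:R - (c - 1)) ^+ 2).
  by apply/funext => k /=; rewrite -natr1; congr (_ ^+ 2); ring.
by rewrite !IH -natr1; ring.
Qed.

(** Uniform continuity in the form needed against a variance: otherwise a
    sequence of violations would have [s - x] tending to 0 while the
    increments of [g] stay above [e]. *)
Lemma quadratic_modulus (g : R -> R) (M e : R) : continuous g -> (forall x, `|g x| <= M) ->
  0 < e -> exists2 C, 0 <= C & forall s x, 0 <= x <= 1 ->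
  `|g s - g x| <= e + C * (s - x) ^+ 2.
Proof.
move=> cg gM e0; apply: contrapT => H.
have {}H (n : nat) : exists q : R * R, 0 <= q.2 <= 1 /\
    e + n%:R * (q.1 - q.2) ^+ 2 < `|g q.1 - g q.2|.
  apply: contrapT => K; apply: H; exists n%:R => // s x x01.
  by rewrite leNgt; apply/negP => L; apply: K; exists (s, x).
have [q Hq] := choice H.
have M0 : 0 <= M by rewrite (le_trans _ (gM 0)).
have [f fi fc] : exists2 f : nat -> nat, increasing_seq f & cvgn ((fun n => (q n).2) \o f).
  apply: bolzano_weierstrass; exists 1; split => // y y1 n _ /=.
  by have [/andP[a b] _] := Hq n; rewrite ger0_norm// (le_trans b)// ltW.
move/cvg_ex : fc => [x /= xc].
have fge n : (n <= f n)%N.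
  elim: n => // n IH; apply: (leq_ltn_trans IH).
  by move/increasing_seqP : fi => /(_ n).
have foo : f n @[n --> \oo] --> \oo.
  apply/cvgnyPge => A; near=> n; apply: (@leq_trans n); first by near: n; exact: nbhs_infty_ge.
  exact: fge.
have d2 n : n%:R * ((q n).1 - (q n).2) ^+ 2 <= 2 * M.
  have [_ /ltW H1] := Hq n.
  have := ler_normB (g (q n).1) (g (q n).2).
  have := gM (q n).1; have := gM (q n).2; move: H1 e0; lra.
have d0 : (q (f n)).1 - (q (f n)).2 @[n --> \oo] --> 0.
  apply/cvgrPdist_le => d dd; near=> n.
  have fn : 2 * M / d ^+ 2 <= (f n)%:R.
    near: n; have fR : (f n)%:R @[n --> \oo] --> (+oo : set_system R).
      by apply: cvg_comp foo _; exact: cvgr_idn.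
    exact: (cvgryPge _).1 fR _.
  have fp : 0 < (f n)%:R :> R.
    near: n; have fR : (f n)%:R @[n --> \oo] --> (+oo : set_system R).
      by apply: cvg_comp foo _; exact: cvgr_idn.
    exact: (cvgryPgt _).1 fR _.
  rewrite sub0r normrN leNgt; apply/negP => dlt.
  have : d ^+ 2 < `|(q (f n)).1 - (q (f n)).2| ^+ 2 by rewrite ltr_pXn2r// nnegrE// ltW.
  rewrite -normrX ger0_norm ?sqr_ge0// -(ltr_pM2l fp) => /lt_le_trans/(_ (d2 (f n))).
  by rewrite ltNge -ler_pdivrMr ?exprn_gt0// fn.
have sc : (q (f n)).1 @[n --> \oo] --> x.
  rewrite -[X in _ --> X]add0r; apply: cvg_trans (cvgD d0 xc); apply: near_eq_cvg.
  by apply: nearW => n; rewrite !fctE/= subrK.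
have g1 := cvg_comp _ _ sc (cg x); have g2 := cvg_comp _ _ xc (cg x).
have g12 : (g (q (f n)).1 - g (q (f n)).2) @[n --> \oo] --> g x - g x by exact: cvgB g1 g2.
move/cvgrPdist_lt : g12 => /(_ _ e0) [n0 _ /(_ n0 (leqnn _))].
rewrite subrr sub0r normrN /= => lt1.
have [_ H2] := Hq (f n0).
have : 0 <= (f n0)%:R * ((q (f n0)).1 - (q (f n0)).2) ^+ 2 by rewrite mulr_ge0// sqr_ge0.
by move: lt1 H2; lra.
Unshelve. all: by end_near. Qed.

(** Bernstein's proof: [quadratic_modulus] and the variance of the binomial
    law. *)
Lemma weierstrass_approximation (g : R -> R) (M e : R) : continuous g ->
  (forall x, `|g x| <= M) -> 0 < e ->
  exists P : {poly R}, forall x, 0 <= x <= 1 -> `|g x - P.[x]| <= e.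
Proof.
move=> cg gM e0.
have e20 : 0 < e / 2 by rewrite divr_gt0.
have [C C0 HC] := quadratic_modulus cg gM e20.
(* The variance contributes C / n times x (1 - x). *)
pose n := (Num.truncn (C / (e / 2))).+1.
have n0 : 0 < n%:R :> R by rewrite ltr0n.
have Cn : C / n%:R <= e / 2.
  rewrite ler_pdivrMr// mulrC -ler_pdivrMr//.
  by have /andP[_ /ltW] := truncn_itv (divr_ge0 C0 (ltW e20)).
exists (bernstein_poly n (fun k => g (k%:R / n%:R))) => x x01.
rewrite horner_bernstein.
have [x0 x1] := andP x01.
have bd k : `|g (k%:R / n%:R) - g x| <= e / 2 + C / n%:R ^+ 2 * (k%:R - n%:R * x) ^+ 2.
  rewrite (le_trans (HC (k%:R / n%:R) x x01))// lerD2l.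
  rewrite le_eqVlt; apply/orP; left; apply/eqP; field.
  by rewrite gt_eqF.
have mE : binomial_mean n (fun k => e / 2 + C / n%:R ^+ 2 * (k%:R - n%:R * x) ^+ 2) x =
    e / 2 + C / n%:R * (x * (1 - x)).
  rewrite binomial_meanD binomial_mean_cst binomial_meanZ binomial_mean_sqr; field.
  by rewrite gt_eqF.
have mle : e / 2 + C / n%:R * (x * (1 - x)) <= e.
  have : x * (1 - x) <= 1 by nra.
  move=> xx; have : C / n%:R * (x * (1 - x)) <= C / n%:R by rewrite ler_piMr// divr_ge0// ltW.
  move: Cn; lra.
have up : binomial_mean n (fun k => g (k%:R / n%:R)) x <= g x + (e / 2 + C / n%:R * (x * (1 - x))).
  rewrite -{1}mE -[X in X + _](binomial_mean_cst n (g x) x) -binomial_meanD.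
  apply: binomial_mean_le => // k _.
  by have := bd k; rewrite ler_norml => /andP[_]; lra.
have lo : g x <= binomial_mean n (fun k => g (k%:R / n%:R)) x + (e / 2 + C / n%:R * (x * (1 - x))).
  rewrite -{1}mE -binomial_meanD -[leLHS](binomial_mean_cst n (g x) x).
  apply: binomial_mean_le => // k _.
  by have := bd k; rewrite ler_norml => /andP[+ _]; lra.
by rewrite ler_norml; move: up lo mle; lra.
Qed.

End bernstein.

Lemma nneseries_fine_cvg (R : realType) (a : nat -> R) : (forall m, 0 <= a m) ->
  (\sum_(0 <= m <oo) (a m)%:E < +oo)%E ->
  \sum_(m < M) a m @[M --> \oo] --> fine (\sum_(0 <= m <oo) (a m)%:E)%E.
Proof.
move=> a0 afin.
have cv : ((\sum_(0 <= m < n) (a m)%:E) @[n --> \oo] --> \sum_(0 <= m <oo) (a m)%:E)%E.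
  by apply: is_cvg_nneseries => n _ _; rewrite lee_fin.
have fin : (\sum_(0 <= m <oo) (a m)%:E)%E \is a fin_num.
  rewrite ge0_fin_numE//; apply: nneseries_ge0 => n _ _; by rewrite lee_fin.
rewrite -(fineK fin) in cv.
move/fine_cvg : cv; apply: cvg_trans; apply: near_eq_cvg; apply: nearW => n /=.
by rewrite sumEFin big_mkord.
Qed.

Lemma le_fine_nneseries (R : realType) (a : nat -> R) (M : nat) : (forall m, 0 <= a m) ->
  (\sum_(0 <= m <oo) (a m)%:E < +oo)%E ->
  \sum_(m < M) a m <= fine (\sum_(0 <= m <oo) (a m)%:E)%E.
Proof.
move=> a0 afin.
have fin : (\sum_(0 <= m <oo) (a m)%:E)%E \is a fin_num.
  rewrite ge0_fin_numE//; apply: nneseries_ge0 => n _ _; by rewrite lee_fin.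
rewrite -lee_fin fineK// -sumEFin -(big_mkord xpredT (fun m => (a m)%:E)).
by apply: nneseries_lim_ge => n _; rewrite lee_fin.
Qed.

Section tauberian.
Context (R : realType).

(** [i] counts the extra powers of the exponential: polynomials in
    [exp (- m / n)] without constant term are combinations of these
    terms. *)
Definition laplace_term (u : nat -> R) (n i m : nat) : R :=
  u m * expR (- (m%:R / n.+1%:R)) ^+ i.+1.

Definition laplace_sum (u : nat -> R) (n i : nat) : R :=
  fine (\sum_(0 <= m <oo) (laplace_term u n i m)%:E)%E.

Context (u B : nat -> R) (kappa : R).
Hypothesis u_ge0 : forall m, 0 <= u m.
Hypothesis B_ge0 : forall m, 0 <= B m.
Hypothesis u_fin : forall n i, (\sum_(0 <= m <oo) (laplace_term u n i m)%:E < +oo)%E.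
Hypothesis B_fin : forall n i, (\sum_(0 <= m <oo) (laplace_term B n i m)%:E < +oo)%E.
Hypothesis B_pos : forall n i, 0 < laplace_sum B n i.
Hypothesis kappa_ge0 : 0 <= kappa.
Hypothesis ratio_cvg : forall i,
  laplace_sum u n i / laplace_sum B n i @[n --> \oo] --> kappa.

Let lt0 (v : nat -> R) n i m : 0 <= v m -> 0 <= laplace_term v n i m.
Proof. by move=> v0; rewrite mulr_ge0// exprn_ge0// expR_ge0. Qed.

Lemma laplace_sum_mono n i : laplace_sum B n i <= laplace_sum B n 0.
Proof.
apply: fine_le; rewrite ?ge0_fin_numE ?nneseries_ge0//;
  try by move=> m _ _; rewrite lee_fin lt0.
apply: lee_nneseries => m; first by move=> *; rewrite lee_fin lt0.
move=> _; rewrite lee_fin ler_wpM2l// ler_wiXn2l ?expR_ge0//.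
Qed.

(** Every Laplace sum of [B] is at most the one of lowest frequency, so a single
    normalisation serves all monomials. *)
Lemma laplace_poly_cvg (P : {poly R}) (e : R) : 0 < e ->
  \forall n \near \oo,
   `|\sum_(i < size P) P`_i * (laplace_sum u n i - kappa * laplace_sum B n i)|
    <= e * laplace_sum B n 0.
Proof.
move=> e0.
have S0 : 0 <= \sum_(i < size P) `|P`_i| by exact: sumr_ge0.
pose d := e / (\sum_(i < size P) `|P`_i| + 1).
have d0 : 0 < d by rewrite divr_gt0// ltr_wpDl.
have : \forall n \near \oo, forall i : 'I_(size P),
    `|laplace_sum u n i - kappa * laplace_sum B n i| <= d * laplace_sum B n 0.
  apply: filter_forall => i.
  have /cvgrPdist_le/(_ _ d0) := ratio_cvg i; apply: filterS => n Hn.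
  rewrite (le_trans _ (ler_wpM2l (ltW d0) (laplace_sum_mono n i)))//.
  have p := B_pos n i.
  have -> : laplace_sum u n i - kappa * laplace_sum B n i =
      - (kappa - laplace_sum u n i / laplace_sum B n i) * laplace_sum B n i.
    by field; rewrite gt_eqF.
  by rewrite normrM normrN (gtr0_norm p) ler_wpM2r// ltW.
apply: filterS => n Hn.
apply: (le_trans (ler_norm_sum _ _ _)).
apply: (@le_trans _ _ (\sum_(i < size P) `|P`_i| * (d * laplace_sum B n 0))).
  by apply: ler_sum => i _; rewrite normrM ler_wpM2l.
rewrite -mulr_suml mulrA ler_wpM2r ?(ltW (B_pos n 0))//.
rewrite /d mulrA ler_pdivrMr ?ltr_wpDl// mulrC ler_pM2l// lerDl//.
Qed.

(** Karamata's method. Ratios of Laplace sums at all integer multiples of the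
    frequency determine the limit for polynomial test functions without constant
    term, hence for continuous ones; the test functions vanish on [m > n],
    which makes the sum finite. *)
Lemma tauberian_test (g : R -> R) (M e : R) : continuous g -> (forall x, `|g x| <= M) ->
  (forall y, y <= expR (- 1) -> g y = 0) -> 0 < e ->
  \forall n \near \oo,
    `|\sum_(m < n.+1) (u m - kappa * B m) * (expR (- (m%:R / n.+1%:R)) *
        g (expR (- (m%:R / n.+1%:R))))| <= e * laplace_sum B n 0.
Proof.
move=> cg gM gz e0.
pose d := e / (2 * (2 * kappa + 1) + 1).
have kk : 0 < 2 * (2 * kappa + 1) + 1 by move: kappa_ge0; lra.
have d0 : 0 < d by rewrite divr_gt0.
have [P HP] := weierstrass_approximation cg gM d0.
have e20 : 0 < e / 2 by rewrite divr_gt0.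
have uk : \forall n \near \oo, laplace_sum u n 0 <= (kappa + 1) * laplace_sum B n 0.
  have /cvgrPdist_le/(_ _ ltr01) := ratio_cvg 0; apply: filterS => n.
  by rewrite ler_norml => /andP[h _]; rewrite -ler_pdivrMr//; move: h; lra.
near=> n.
have Hu : laplace_sum u n 0 <= (kappa + 1) * laplace_sum B n 0 by near: n.
have HPn : `|\sum_(i < size P) P`_i * (laplace_sum u n i - kappa * laplace_sum B n i)|
    <= e / 2 * laplace_sum B n 0 by near: n; exact: laplace_poly_cvg.
pose y (m : nat) : R := expR (- (m%:R / n.+1%:R)).
have y01 m : 0 <= y m <= 1 by rewrite expR_ge0/= expR_le1 oppr_le0 divr_ge0.
pose w m := u m - kappa * B m.
set S := \sum_(m < n.+1) _.
have SE K : (n.+1 <= K)%N -> S = \sum_(m < K) w m * (y m * g (y m)).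
  move=> nK; rewrite /S (big_ord_widen K (fun m => w m * (y m * g (y m))) nK) big_mkcond/=.
  apply: eq_bigr => m _; case: ifPn => //; rewrite -leqNgt => nm.
  rewrite gz ?mulr0// ler_expR lerN2 ler_pdivlMr// mul1r ler_nat//.
have bound K : `|\sum_(m < K) w m * (y m * (g (y m) - P.[y m]))| <=
    d * (laplace_sum u n 0 + kappa * laplace_sum B n 0).
  apply: (le_trans (ler_norm_sum _ _ _)).
  apply: (@le_trans _ _ (\sum_(m < K) d * (laplace_term u n 0 m + kappa * laplace_term B n 0 m))).
    apply: ler_sum => m _; have [ym0 ym1] := andP (y01 m).
    rewrite !normrM (ger0_norm ym0).
    have H1 : `|w m| <= u m + kappa * B m.
      rewrite (le_trans (ler_normB _ _))// ger0_norm// (ger0_norm (x := kappa * _))//.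
      exact: mulr_ge0.
    have H2 := HP (y m) (y01 m).
    rewrite /laplace_term !expr1 -/(y m).
    apply: (@le_trans _ _ ((u m + kappa * B m) * (y m * d))).
      by apply: ler_pM => //; rewrite ?mulr_ge0// ler_wpM2l.
    by rewrite le_eqVlt; apply/orP; left; apply/eqP; ring.
  rewrite -mulr_sumr ler_pM2l// big_split/= -mulr_sumr lerD//.
    by apply: le_fine_nneseries => // m; exact: lt0.
  by rewrite ler_wpM2l//; apply: le_fine_nneseries => // m; exact: lt0.
have polyE K : \sum_(m < K) w m * (y m * P.[y m]) =
    \sum_(i < size P) P`_i * (\sum_(m < K) laplace_term u n i m - kappa * \sum_(m < K) laplace_term B n i m).
  transitivity (\sum_(m < K) \sum_(i < size P) P`_i * (laplace_term u n i m - kappa * laplace_term B n i m)).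
    apply: eq_bigr => m _; rewrite horner_coef !mulr_sumr; apply: eq_bigr => i _.
    by rewrite /laplace_term -/(y m) exprS /w; ring.
  rewrite exchange_big/=; apply: eq_bigr => i _.
  by rewrite [in RHS]mulr_sumr -sumrB -mulr_sumr.
have cvP : \sum_(m < K) w m * (y m * P.[y m]) @[K --> \oo] -->
    \sum_(i < size P) P`_i * (laplace_sum u n i - kappa * laplace_sum B n i).
  under eq_fun do rewrite polyE.
  have cvg_ord_sum (f : nat -> nat -> R) (l : nat -> R) N : (forall i, f i K @[K --> \oo] --> l i) ->
      \sum_(i < N) f i K @[K --> \oo] --> \sum_(i < N) l i.
    move=> H; elim: N => [|N IH].
      by rewrite big_ord0; under eq_fun do rewrite big_ord0; exact: cvg_cst.
    by rewrite big_ord_recr; under eq_fun do rewrite big_ord_recr/=; apply: cvgD.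
  apply: (cvg_ord_sum (fun i K => P`_i * (\sum_(m < K) laplace_term u n i m -
    kappa * \sum_(m < K) laplace_term B n i m))
    (fun i => P`_i * (laplace_sum u n i - kappa * laplace_sum B n i))) => i.
  apply: cvgMl_tmp; apply: cvgB; first by apply: nneseries_fine_cvg => // m; exact: lt0.
  by apply: cvgMl_tmp; apply: nneseries_fine_cvg => // m; exact: lt0.
have cvS : S - \sum_(m < K) w m * (y m * P.[y m]) @[K --> \oo] -->
    S - \sum_(i < size P) P`_i * (laplace_sum u n i - kappa * laplace_sum B n i).
  by apply: cvgB => //; exact: cvg_cst.
have close : `|S - \sum_(i < size P) P`_i * (laplace_sum u n i - kappa * laplace_sum B n i)|
    <= d * (laplace_sum u n 0 + kappa * laplace_sum B n 0).
  apply: (closed_cvg (fun z : R => z <= _)) (cvg_norm cvS); first exact: closed_le.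
  near=> K; have nK : (n.+1 <= K)%N by near: K; exact: nbhs_infty_ge.
  rewrite /= (SE K nK) -sumrB.
  by under eq_bigr do rewrite -mulrBr -mulrBr.
have LB := B_pos n 0.
have dle : d * (laplace_sum u n 0 + kappa * laplace_sum B n 0) <= e / 2 * laplace_sum B n 0.
  apply: (@le_trans _ _ (d * ((2 * kappa + 1) * laplace_sum B n 0))).
    by rewrite ler_pM2l//; move: Hu; lra.
  rewrite mulrA ler_pM2r// /d mulrAC ler_pdivrMr//.
  by move: e0 kappa_ge0; nra.
rewrite -[S](subrK (\sum_(i < size P) P`_i * (laplace_sum u n i - kappa * laplace_sum B n i))).
apply: (le_trans (ler_normD _ _)).
by move: close HPn dle; lra.
Unshelve. all: by end_near. Qed.

End tauberian.


(** * From Laplace sums to convolutions *)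

Lemma Rintegral_dominated_cvg d (T : measurableType d) (R : realType)
    (mu : {measure set T -> \bar R}) (D : set T) (f_ : nat -> T -> R) (f g : T -> R) :
  measurable D -> (forall n, mu.-integrable D (EFin \o f_ n)) ->
  measurable_fun D f -> mu.-integrable D (EFin \o g) ->
  (forall x, D x -> f_ n x @[n --> \oo] --> f x) ->
  (forall n x, D x -> `|f_ n x| <= g x) ->
  mu.-integrable D (EFin \o f) /\
  \int[mu]_(x in D) f_ n x @[n --> \oo] --> \int[mu]_(x in D) f x.
Proof.
move=> mD fi mf gi ff fg.
have [i1 _ c1] : [/\ mu.-integrable D (EFin \o f),
  ([sequence \int[mu]_(x in D) `|(f_ n x)%:E - (f x)%:E| ]_n @ \oo --> 0)%E &
  ([sequence \int[mu]_(x in D) (f_ n x)%:E]_n @ \oo --> \int[mu]_(x in D) (f x)%:E)%E].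
  apply: (@dominated_convergence _ T R mu D mD (fun n => EFin \o f_ n) (EFin \o f) (EFin \o g)).
  - by move=> n; apply: measurable_int (fi n).
  - exact/measurable_EFinP.
  - by apply: aeW => x Dx /=; apply: cvg_EFin; [exact: nearW|exact: ff].
  - exact: gi.
  - by apply: aeW => x n Dx /=; rewrite lee_fin fg.
split => //; apply: fine_cvg; rewrite fineK//.
by apply: integrable_fin_num.
Qed.

Lemma succn_cvgy : (n.+1 @[n --> \oo] --> \oo)%N.
Proof. by rewrite (cvg_shiftS id); exact: cvg_id. Qed.

Lemma natSr_cvgy (R : realType) : n.+1%:R @[n --> \oo] --> (+oo : set_system R).
Proof. by apply: (cvg_comp _ _ succn_cvgy); exact: cvgr_idn. Qed.

Lemma powR_continuous (R : realType) (g t : R) : 0 < t -> s `^ g @[s --> t] --> t `^ g.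
Proof.
by move=> t0; apply: derivable1_cvg; apply: derivable_powR; rewrite in_itv/= andbT.
Qed.

Section tauberian_convolution.
Context (R : realType) (l : R -> R) (eta : R).
Hypothesis l_gt0 : forall x, 0 < l x.
Hypothesis l_potter : potter eta l.
Hypothesis l_flat : asymptotically_flat l.
Hypothesis eta_gt0 : 0 < eta.
Context (F u : nat -> R) (alpha beta cF kappa : R).
Hypothesis alpha01 : 0 <= alpha < 1.
Hypothesis eta_beta : 1 + eta <= beta.
Hypothesis F_ge0 : forall k, 0 <= F k.
Hypothesis cF_gt0 : 0 < cF.
Hypothesis F_cvg : F k * k.+1%:R `^ alpha @[k --> \oo] --> cF.
Hypothesis kappa_ge0 : 0 <= kappa.
Hypothesis u_ge0 : forall m, 0 <= u m.
Hypothesis u_le : exists2 C, 0 < C & forall m, u m <= C * rv_ref l (beta - 1) m.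
Hypothesis u_ratio : forall i,
  laplace_sum u n i / laplace_sum (rv_ref l (beta - 1)) n i @[n --> \oo] --> kappa.

Let B := rv_ref l (beta - 1).
Let B_gt0 m : 0 < B m. Proof. exact: rv_ref_gt0. Qed.
Let B_ge0 m : 0 <= B m. Proof. exact/ltW. Qed.

Lemma regularly_varying_ref g : regularly_varying l g 1 (rv_ref l g).
Proof.
apply: cvg_near_cst; apply: nearW => n.
by rewrite divff// gt_eqF// rv_ref_gt0.
Qed.

Let laplace_term_ge0 (v : nat -> R) n i m : 0 <= v m -> 0 <= laplace_term v n i m.
Proof. by move=> v0; rewrite mulr_ge0// exprn_ge0// expR_ge0. Qed.

Let laplace_le n i m : laplace_term B n i m <= laplace_term B n 0 m.
Proof.
rewrite ler_wpM2l// ler_wiXn2l ?expR_ge0//.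
Qed.

Let B_bound : exists2 C, 0 < C & forall n i,
  (\sum_(0 <= m <oo) (laplace_term B n i m)%:E <= (C * (n.+1%:R `^ beta * l n.+1%:R))%:E)%E.
Proof.
have [C C0 HC] := abelian_bound l_gt0 l_potter l_flat eta_gt0 B_ge0 ltr01
  (regularly_varying_ref (beta - 1)) eta_beta.
exists C => // n i; apply: le_trans (HC n.+1%:R _); last by rewrite ler1n.
apply: lee_nneseries => m; first by move=> *; rewrite lee_fin laplace_term_ge0.
by move=> _; rewrite lee_fin (le_trans (laplace_le _ _ _))// /laplace_term expr1.
Qed.

Let B_fin n i : (\sum_(0 <= m <oo) (laplace_term B n i m)%:E < +oo)%E.
Proof. by have [C _ H] := B_bound; rewrite (le_lt_trans (H n i))// ltry. Qed.

Let B_pos n i : 0 < laplace_sum B n i.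
Proof.
apply: (lt_le_trans (B_gt0 0)).
apply: le_trans (le_fine_nneseries 1 _ (B_fin n i)); last first.
  by move=> m; apply: laplace_term_ge0.
by rewrite big_ord1 /laplace_term mul0r oppr0 expR0 expr1n mulr1.
Qed.

Let u_fin n i : (\sum_(0 <= m <oo) (laplace_term u n i m)%:E < +oo)%E.
Proof.
have [C C0 HC] := u_le; have [C' C'0 HC'] := B_bound.
apply: (@le_lt_trans _ _ (C%:E * \sum_(0 <= m <oo) (laplace_term B n i m)%:E)%E).
  rewrite -nneseriesZl//; last by move=> m _; rewrite lee_fin laplace_term_ge0.
  apply: lee_nneseries => m; first by move=> *; rewrite lee_fin laplace_term_ge0.
  by move=> _; rewrite -EFinM lee_fin /laplace_term mulrA ler_wpM2r.
rewrite (le_lt_trans (lee_wpmul2l _ (HC' n i)))// ?lee_fin ?ltW//.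
by rewrite -EFinM ltry.
Qed.

(** Unlike the power [s ^ - alpha] that it approximates, it vanishes at 0, so
    that the test function made of it is continuous. *)
Let phi (eps s : R) := s * (s + eps) `^ (- (1 + alpha)).

Let phi_le eps s : 0 < eps -> 0 <= s -> 0 <= s `^ alpha * phi eps s <= 1.
Proof.
move=> e0 s0; rewrite /phi; apply/andP; split.
  by rewrite !mulr_ge0 ?powR_ge0.
have se : 0 < s + eps by rewrite ltr_wpDl.
move: s0; rewrite le_eqVlt => /orP[/eqP<-|s0]; first by rewrite mul0r mulr0.
rewrite mulrA -{2}(powRr1 (ltW s0)) -powRD ?(gt_eqF s0) ?implybT//.
rewrite powRN ler_pdivrMr ?powR_gt0// mul1r addrC.
by case/andP: alpha01 => a0 _; apply: ler_powR_base; rewrite ?addr_ge0 ?(ltW s0)// lerDl ltW.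
Qed.

Let phi_bound eps s : 0 < eps -> 0 <= s <= 1 -> 0 <= phi eps s <= eps `^ (- (1 + alpha)).
Proof.
move=> e0 /andP[s0 s1]; rewrite /phi mulr_ge0 ?powR_ge0//=.
have [a0 _] := andP alpha01.
rewrite -[leRHS]mul1r; apply: ler_pM; rewrite ?powR_ge0//.
rewrite !powRN lef_pV2 ?posrE ?powR_gt0 ?ltr_wpDl//.
by apply: ler_powR_base; rewrite ?addr_ge0 ?(ltW e0)// lerDr.
Qed.

Let phi_cvg (s : R) : 0 < s -> s `^ alpha * phi n.+1%:R^-1 s @[n --> \oo] --> (1 : R).
Proof.
move=> s0.
have c1 : s + n.+1%:R^-1 @[n --> \oo] --> s.
  rewrite -[X in _ --> X]addr0; apply: cvgD; first exact: cvg_cst.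
  by apply/gtr0_cvgV0; [apply: nearW => n; rewrite ltr0n|exact: natSr_cvgy].
have := powR_cvg (g := - (1 + alpha)) s0 c1 => c2.
have E : 1 = s `^ alpha * (s * s `^ (- (1 + alpha))).
  rewrite mulrA -{2}(powRr1 (ltW s0)) -!powRD ?(gt_eqF s0) ?implybT//.
  by rewrite (_ : _ + _ = 0) ?powRr0//; ring.
by rewrite [X in _ --> X]E; apply: cvgMl_tmp; apply: cvgMl_tmp.
Qed.

(** The exponential [y] is clamped to its range for indices at most [n]; the
    division by [z] compensates for the factor [y] in [tauberian_test], and
    [1 + ln z] turns the index [n - k] into [k]. *)
Let test (eps y : R) :=
  let z := Num.min 1 (Num.max y (expR (- 1))) in phi eps (1 + ln z) / z.

Let test_range (y : R) : let z := Num.min 1 (Num.max y (expR (- 1))) in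
  [/\ expR (- 1) <= z, 0 < z & 0 <= 1 + ln z <= 1].
Proof.
move=> z; have z1 : expR (- 1) <= z.
  by rewrite /z le_min le_max lexx orbT andbT expR_le1; lra.
have z0 : 0 < z by rewrite (lt_le_trans (expR_gt0 _) z1).
split => //; apply/andP; split.
  by move: z1; rewrite -{1}(lnK z0) ler_expR; lra.
have : z <= 1 by rewrite /z ge_min lexx.
by move=> zz; have := ln_le0 zz; lra.
Qed.

Let test_continuous eps : 0 < eps -> continuous (test eps).
Proof.
move=> e0 y.
pose z (y : R) := Num.min 1 (Num.max y (expR (- 1))).
have [z1 z0 /andP[l0 l1]] := test_range y.
have cz : z y' @[y' --> y] --> z y.
  apply: (@continuous_min R R (fun=> 1) (fun y' => Num.max y' (expR (- 1)))).
    exact: cvg_cst.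
  by apply: (@continuous_max R R id (fun=> expR (- 1))); [exact: cvg_id|exact: cvg_cst].
have cl : 1 + ln (z y') @[y' --> y] --> 1 + ln (z y).
  by apply: cvgD; [exact: cvg_cst|apply: (cvg_comp _ _ cz); exact: continuous_ln].
have pe : 0 < 1 + ln (z y) + eps by rewrite ltr_wpDl.
have ce : 1 + ln (z y') + eps @[y' --> y] --> 1 + ln (z y) + eps.
  by apply: cvgD => //; exact: cvg_cst.
have cp : (1 + ln (z y') + eps) `^ (- (1 + alpha)) @[y' --> y] -->
    (1 + ln (z y) + eps) `^ (- (1 + alpha)).
  by apply: (cvg_comp _ (fun s : R => s `^ (- (1 + alpha))) ce); exact: powR_continuous.
apply: cvgM; last by apply: cvgV cz; rewrite gt_eqF.
exact: cvgM cl cp.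
Qed.

Let test_bound eps y : 0 < eps -> `|test eps y| <= eps `^ (- (1 + alpha)) * expR 1.
Proof.
move=> e0; have [z1 z0 zz] := test_range y.
have /andP[p0 p1] := phi_bound e0 zz.
rewrite /test ger0_norm ?divr_ge0 ?(ltW z0)//; apply: ler_pM => //.
  by rewrite invr_ge0 ltW.
by rewrite -[expR 1]invrK -expRN lef_pV2// posrE// expR_gt0.
Qed.

Let test0 eps y : y <= expR (- 1) -> test eps y = 0.
Proof.
move=> ye; have e1 : expR (- 1) <= 1 :> R by rewrite expR_le1; lra.
by rewrite /test (max_idPr ye) (min_idPr e1) expRK subrr /phi mul0r mul0r.
Qed.

Let testE eps (n k : nat) : (k <= n)%N -> let y := expR (- ((n - k)%:R / n.+1%:R)) in
  y * test eps y = phi eps (k.+1%:R / n.+1%:R).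
Proof.
move=> kn y; have n0 : 0 < n.+1%:R :> R by rewrite ltr0n.
have y1 : y <= 1 by rewrite expR_le1 oppr_le0 divr_ge0.
have ye : expR (- 1) <= y.
  by rewrite ler_expR lerN2 ler_pdivrMr// mul1r ler_nat leqW// leq_subr.
rewrite /test (max_idPl ye) (min_idPr y1) mulrC divfK ?gt_eqF ?expR_gt0//.
rewrite expRK natrB// -!natr1; congr (phi _ _).
by field; rewrite natr1 gt_eqF.
Qed.

Let w (t : R) := t `^ (- alpha) * (1 - t) `^ (beta - 1).

Let eta_lt_beta : eta < beta. Proof. by move: eta_beta; lra. Qed.

Let unit_conv (h : nat -> nat -> R) (H : R -> R) (M : R) :
  (forall n k, 0 <= h n k <= M) ->
  (forall t, 0 < t < 1 -> h n (Num.truncn (n.+1%:R * t)) @[n --> \oo] --> H t) ->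
  lebesgue_measure.-integrable (`]0, 1[%classic : set R) (fun t => (w t * H t)%:E) /\
  n.+1%:R `^ (alpha - beta) / l n.+1%:R *
    \sum_(k < n.+1) k.+1%:R `^ (- alpha) * B (n - k)%N * h n k @[n --> \oo] -->
  \int[lebesgue_measure]_(t in `]0, 1[) (w t * H t).
Proof.
move=> hM hH.
have F1 k : 0 <= k.+1%:R `^ (- alpha) :> R by exact: powR_ge0.
have F2 : k.+1%:R `^ (- alpha) * k.+1%:R `^ alpha @[k --> \oo] --> (1 : R).
  apply: cvg_near_cst; apply: nearW => k.
  by rewrite -powRD ?addNr ?powRr0// pnatr_eq0 implybT.
have [] := convolution_cvg l_gt0 l_potter l_flat alpha01 eta_lt_beta F1 B_ge0
  ltr01 ltr01 F2 (regularly_varying_ref (beta - 1)) succn_cvgy hM hH.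
move=> i1 c1; split => //; rewrite -[X in _ --> X]mul1r -{1}[1 in X in _ --> X]mulr1.
apply: cvg_trans c1; apply: near_eq_cvg; apply: nearW => n.
by congr (_ * _); apply: eq_bigr => k _; rewrite subn1.
Qed.

Let F_bound : exists2 C, 0 < C & forall k, F k * k.+1%:R `^ alpha <= C.
Proof.
have [|C C0 HC] := @regularly_varying_le R (fun=> 1) (fun=> ltr01) (- alpha) cF F.
  apply: cvg_trans F_cvg; apply: near_eq_cvg; apply: nearW => k.
  by rewrite /rv_ref mulr1 powRN invrK.
exists C => // k; have := HC k; rewrite /rv_ref mulr1 powRN.
by rewrite -ler_pdivlMr// ?powR_gt0.
Qed.

Let err (eps : R) (n k : nat) :=
  `|F k * k.+1%:R `^ alpha - cF * ((k.+1%:R / n.+1%:R) `^ alpha * phi eps (k.+1%:R / n.+1%:R))|.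

Let err_conv eps : 0 < eps ->
  lebesgue_measure.-integrable (`]0, 1[%classic : set R)
    (fun t => (w t * `|cF - cF * (t `^ alpha * phi eps t)|)%:E) /\
  n.+1%:R `^ (alpha - beta) / l n.+1%:R *
    \sum_(k < n.+1) k.+1%:R `^ (- alpha) * B (n - k)%N * err eps n k @[n --> \oo] -->
  \int[lebesgue_measure]_(t in `]0, 1[) (w t * `|cF - cF * (t `^ alpha * phi eps t)|).
Proof.
move=> e0; have [C C0 HC] := F_bound.
apply: (unit_conv (M := C + cF)).
  move=> n k; rewrite /err normr_ge0/=.
  have s0 : 0 <= k.+1%:R / n.+1%:R :> R by rewrite divr_ge0.
  have /andP[p0 p1] := phi_le e0 s0.
  rewrite (le_trans (ler_normB _ _))// ger0_norm ?mulr_ge0 ?powR_ge0//.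
  rewrite lerD// (ger0_norm (mulr_ge0 (ltW cF_gt0) p0)).
  by rewrite -[leRHS]mulr1 ler_pM2l.
move=> t /andP[t0 t1]; apply: cvg_norm.
have kt := truncn_ratio_cvg (@natSr_cvgy R) (ltW t0).
have koo := nat_cvgy_of_ratio (@natSr_cvgy R) t0 kt.
apply: cvgB; first exact: (cvg_comp _ _ koo F_cvg).
apply: cvgMl_tmp; apply: cvgM; first exact: powR_cvg.
apply: cvgM => //; apply: powR_cvg; first by rewrite addr_gt0.
by apply: cvgD => //; exact: cvg_cst.
Qed.

Let err_cvg0 :
  \int[lebesgue_measure]_(t in `]0, 1[) (w t * `|cF - cF * (t `^ alpha * phi n.+1%:R^-1 t)|)
    @[n --> \oo] --> (0 : R).
Proof.
have e0 n : 0 < n.+1%:R^-1 :> R by rewrite invr_gt0 ltr0n.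
have [ig _] := unit_conv (h := fun _ _ => cF) (H := fun=> cF) (M := cF)
  (fun n k => introT andP (conj (ltW cF_gt0) (lexx cF))) (fun t _ => cvg_cst cF).
rewrite [X in _ --> X](_ : _ = \int[lebesgue_measure]_(t in (`]0, 1[%classic : set R)) (0 : R)).
  apply: (proj2 (@Rintegral_dominated_cvg _ _ R lebesgue_measure (`]0, 1[%classic : set R)
    (fun n t => w t * `|cF - cF * (t `^ alpha * phi n.+1%:R^-1 t)|) (fun=> 0)
    (fun t => w t * cF) (measurable_itv _) (fun n => (err_conv (e0 n)).1)
    (measurable_cst _) ig _ _)).
    move=> t /=; rewrite in_itv/= => /andP[t0 t1].
    rewrite [X in _ --> X](_ : 0 = w t * `|cF - cF * 1|); last first.
      by rewrite mulr1 subrr normr0 mulr0.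
    apply: cvgMl_tmp; apply: cvg_norm.
    apply: cvgB; first exact: cvg_cst.
    by apply: cvgMl_tmp; exact: phi_cvg.
  move=> n t /=; rewrite in_itv/= => /andP[t0 t1].
  have w0 : 0 <= w t by rewrite mulr_ge0 ?powR_ge0.
  have /andP[p0 p1] := phi_le (e0 n) (ltW t0).
  rewrite normrM normr_id (ger0_norm w0) ler_wpM2l// -{1}(mulr1 cF) -mulrBr.
  rewrite normrM gtr0_norm// ger0_norm ?subr_ge0// -[leRHS]mulr1 ler_pM2l//.
  by rewrite gerBl.
by rewrite Rintegral_cst//= mul0r.
Qed.

(** For fixed [eps] the kernel is split into a test function, handled by
    [tauberian_test], and an error weighted by the reference sequence; then
    [eps] tends to 0. *)
Let error_cvg0 : n.+1%:R `^ (alpha - beta) / l n.+1%:R *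
  \sum_(k < n.+1) F k * (u (n - k)%N - kappa * B (n - k)%N) @[n --> \oo] --> (0 : R).
Proof.
have [Cu Cu0 HCu] := u_le; have [CB CB0 HCB] := B_bound.
apply/cvgrPdist_le => d d0.
have D0 : 0 < Cu + kappa by rewrite ltr_wpDr.
have d1 : 0 < d / 4 / (Cu + kappa) by rewrite !divr_gt0.
have [q Hq] : exists q : nat, \int[lebesgue_measure]_(t in `]0, 1[)
    (w t * `|cF - cF * (t `^ alpha * phi q.+1%:R^-1 t)|) <= d / 4 / (Cu + kappa).
  have /cvgrPdist_le/(_ _ d1) [q _ /(_ q (leqnn _))] := err_cvg0.
  by rewrite sub0r normrN => /(le_trans (ler_norm _)) => h; exists q.
pose eps : R := q.+1%:R^-1; rewrite -/eps in Hq.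
have e0 : 0 < eps by rewrite invr_gt0 ltr0n.
have [_ /cvgrPdist_le/(_ _ d1) Herr] := err_conv e0.
have d2 : 0 < d / 2 / (cF * CB) by rewrite !divr_gt0// mulr_gt0.
have Htest := tauberian_test u_ge0 B_ge0 u_fin B_fin B_pos kappa_ge0 u_ratio
  (test_continuous e0) (fun y => test_bound y e0) (fun y => @test0 eps y) d2.
near=> n.
have H1 : n.+1%:R `^ (alpha - beta) / l n.+1%:R *
    \sum_(k < n.+1) k.+1%:R `^ (- alpha) * B (n - k)%N * err eps n k <= d / 2 / (Cu + kappa).
  have : `|\int[lebesgue_measure]_(t in `]0, 1[)
    (w t * `|cF - cF * (t `^ alpha * phi eps t)|) - n.+1%:R `^ (alpha - beta) / l n.+1%:R *
    \sum_(k < n.+1) k.+1%:R `^ (- alpha) * B (n - k)%N * err eps n k| <= d / 4 / (Cu + kappa).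
    by near: n.
  rewrite ler_norml => /andP[h _].
  have -> : d / 2 / (Cu + kappa) = d / 4 / (Cu + kappa) + d / 4 / (Cu + kappa).
    by field; rewrite gt_eqF.
  by move: h Hq; lra.
have H2 : `|\sum_(m < n.+1) (u m - kappa * B m) * (expR (- (m%:R / n.+1%:R)) *
    test eps (expR (- (m%:R / n.+1%:R))))| <= d / 2 / (cF * CB) * laplace_sum B n 0.
  by near: n.
pose N : R := n.+1%:R; have N0 : 0 < N by rewrite ltr0n.
have lN := l_gt0 N.
have L : laplace_sum B n 0 <= CB * (N `^ beta * l N).
  rewrite -lee_fin fineK; last first.
    rewrite ge0_fin_numE ?B_fin//; apply: nneseries_ge0 => m _ _.
    by rewrite lee_fin laplace_term_ge0.
  exact: HCB.
pose v k := u (n - k)%N - kappa * B (n - k)%N.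
have vE k : `|v k| <= (Cu + kappa) * B (n - k)%N.
  rewrite (le_trans (ler_normB _ _))// ger0_norm// mulrDl lerD ?HCu//.
  by rewrite ger0_norm// mulr_ge0.
pose ps k := cF * N `^ (- alpha) * phi eps (k.+1%:R / N).
have E1 : \sum_(k < n.+1) v k * ps k = cF * N `^ (- alpha) *
   \sum_(m < n.+1) (u m - kappa * B m) * (expR (- (m%:R / n.+1%:R)) *
    test eps (expR (- (m%:R / n.+1%:R)))).
  rewrite mulr_sumr [in RHS](reindex_inj rev_ord_inj)/=; apply: eq_bigr => k _.
  rewrite subSS (testE eps (ltnSE (ltn_ord k))).
  by rewrite /v /ps; ring.
have E2 k : (k <= n)%N -> `|F k - ps k| = k.+1%:R `^ (- alpha) * err eps n k.
  move=> kn; rewrite /err -[k.+1%:R `^ (- alpha)]ger0_norm ?powR_ge0// -normrM.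
  congr (`| _ |); rewrite /ps powR_div// !powRN.
  have p1 : k.+1%:R `^ alpha != 0 :> R by rewrite gt_eqF// powR_gt0.
  have p2 : N `^ alpha != 0 by rewrite gt_eqF// powR_gt0.
  by field; rewrite p1 p2.
rewrite sub0r normrN.
have -> : \sum_(k < n.+1) F k * (u (n - k)%N - kappa * B (n - k)%N) =
   \sum_(k < n.+1) v k * (F k - ps k) + \sum_(k < n.+1) v k * ps k.
  by rewrite -big_split/=; apply: eq_bigr => k _; rewrite /v; ring.
have r0 : 0 <= N `^ (alpha - beta) / l N by rewrite divr_ge0 ?powR_ge0// ltW.
rewrite mulrDr (le_trans (ler_normD _ _))//.
rewrite (_ : d = d / 2 + d / 2); last by field.
apply: lerD.
  rewrite normrM (ger0_norm r0).
  apply: (@le_trans _ _ (N `^ (alpha - beta) / l N *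
    ((Cu + kappa) * \sum_(k < n.+1) k.+1%:R `^ (- alpha) * B (n - k)%N * err eps n k))).
    rewrite ler_wpM2l// (le_trans (ler_norm_sum _ _ _))// mulr_sumr.
    apply: ler_sum => k _; rewrite normrM E2 ?(ltnSE (ltn_ord k))//.
    rewrite mulrCA [leRHS]mulrA [leRHS]mulrAC; rewrite -!mulrA.
    rewrite [leRHS](_ : _ = k.+1%:R `^ (- alpha) * (((Cu + kappa) * B (n - k)%N) * err eps n k)); last by ring.
    by rewrite ler_wpM2l ?powR_ge0//; apply: ler_wpM2r; [exact: normr_ge0|exact: vE].
  by rewrite mulrCA mulrC -ler_pdivlMr.
rewrite E1 normrM (ger0_norm r0) normrM ger0_norm ?mulr_ge0 ?powR_ge0 ?(ltW cF_gt0)//.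
apply: (@le_trans _ _ (N `^ (alpha - beta) / l N * (cF * N `^ (- alpha) *
  (d / 2 / (cF * CB) * (CB * (N `^ beta * l N)))))).
  rewrite ler_wpM2l// ler_wpM2l ?mulr_ge0 ?powR_ge0 ?(ltW cF_gt0)//.
  by rewrite (le_trans H2)// ler_pM2l.
rewrite powRD ?(gt_eqF N0) ?implybT// !powRN le_eqVlt; apply/orP; left; apply/eqP.
have p1 : N `^ beta != 0 by rewrite gt_eqF// powR_gt0.
have p2 : N `^ alpha != 0 by rewrite gt_eqF// powR_gt0.
by field; rewrite p1 p2 !gt_eqF.
Unshelve. all: by end_near. Qed.

(** The kernel [F k] behaves like [cF * k ^ - alpha], which is singular at
    0 and not an admissible test function. Replace it by the continuous
    [phi eps]; the replacement error is a convolution with the reference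
    sequence, controlled by [u_le], and its limit vanishes with [eps] by
    dominated convergence. *)
Lemma tauberian_convolution :
  n.+1%:R `^ (alpha - beta) / l n.+1%:R * \sum_(k < n.+1) F k * u (n - k)%N
    @[n --> \oo] -->
  kappa * (cF * \int[lebesgue_measure]_(t in `]0, 1[) (t `^ (- alpha) * (1 - t) `^ (beta - 1))).
Proof.
have [_ c1] := convolution_cvg l_gt0 l_potter l_flat alpha01 eta_lt_beta F_ge0 B_ge0
  cF_gt0 ltr01 F_cvg (regularly_varying_ref (beta - 1)) (h := fun _ _ => 1) (H := fun=> 1)
  (M := 1) succn_cvgy (fun n k => introT andP (conj ler01 (lexx 1))) (fun t _ => cvg_cst (1 : R)).
have -> : \int[lebesgue_measure]_(t in `]0, 1[) (t `^ (- alpha) * (1 - t) `^ (beta - 1)) =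
  \int[lebesgue_measure]_(t in `]0, 1[) (t `^ (- alpha) * (1 - t) `^ (beta - 1) * 1).
  by apply: eq_Rintegral => t _; rewrite mulr1.
have c2 : kappa * (n.+1%:R `^ (alpha - beta) / l n.+1%:R * \sum_(k < n.+1) F k * B (n - k)%N)
    @[n --> \oo] --> kappa * (cF *
    \int[lebesgue_measure]_(t in `]0, 1[) (t `^ (- alpha) * (1 - t) `^ (beta - 1) * 1)).
  apply: cvgMl_tmp; rewrite mulr1 in c1.
  apply: cvg_trans c1; apply: near_eq_cvg; apply: nearW => n /=.
  by congr (_ * _); apply: eq_bigr => k _; rewrite mulr1 subn1.
rewrite -[X in _ --> X]add0r; apply: cvg_trans (cvgD error_cvg0 c2).
apply: near_eq_cvg; apply: nearW => n /=.
rewrite fctE mulrCA -mulrDr; congr (_ * _).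
rewrite mulr_sumr -big_split/=; apply: eq_bigr => k _.
ring.
Qed.

End tauberian_convolution.


(** * Mixtures over the number of components *)

(** Exchange of a double series with non-negative terms over a triangle. *)
Lemma nneseries_cauchy_product (R : realType) (a b : nat -> R) (B : R) :
  (forall x, 0 <= a x) -> (forall x, 0 <= b x) ->
  (\sum_(0 <= x <oo) (b x)%:E = B%:E)%E ->
  (\sum_(0 <= m <oo) (\sum_(x < m.+1) a x * b (m - x)%N)%:E =
   B%:E * \sum_(0 <= x <oo) (a x)%:E)%E.
Proof.
move=> a0 b0 bB.
pose f (m x : nat) : \bar R := (if (x <= m)%N then a x * b (m - x)%N else 0)%:E.
have f0 m x : (0 <= f m x)%E by rewrite /f lee_fin; case: ifP => // _; rewrite mulr_ge0.
transitivity (\sum_(0 <= m <oo) \sum_(0 <= x <oo) f m x)%E.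
  apply: eq_eseriesr => m _; rewrite (@nneseries_finite R (fun x => _) m.+1).
    by congr EFin; apply: eq_bigr => x _; rewrite -ltnS ltn_ord.
  by move=> k mk; rewrite leqNgt mk.
rewrite nneseries_interchange//.
rewrite -nneseriesZl; last by move=> x _; rewrite lee_fin.
apply: eq_eseriesr => x _; rewrite muleC -bB -nneseriesZl; last by move=> m _; rewrite lee_fin.
rewrite (nneseries_split 0 x)// big_nat big1 ?add0e; last first.
  by move=> m /andP[_ mx]; rewrite /f leqNgt mx.
rewrite add0n -(nneseries_addn x)//.
by apply: eq_eseriesr => m _; rewrite /f leq_addl addnK EFinM.
Qed.

Section mixtures.
Context (R : realType).
Implicit Types (A p phi a : nat -> R) (G : R -> R).

Definition seq_mix A p phi G (m : nat) (s : R) : R :=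
  fine (\sum_(0 <= j <oo) (A j * seq_sum p phi G j m s)%:E)%E.

Definition pw_mix A p (m : nat) : R := fine (\sum_(0 <= j <oo) (A j * pw p j m)%:E)%E.

(** Weights after [r] components have been singled out: [a (j + r)] times the
    number of ways to choose them in order among the [j + r]. *)
Definition descend a (r j : nat) : R := a (j + r)%N * ((j + r) ^_ r)%:R.

Lemma descendS a r j : descend a r.+1 j = descend a r j.+1 * j.+1%:R.
Proof.
rewrite /descend addnS addSn ffactnSr subSn ?leq_addl// addnK -mulrA.
by rewrite -natrM.
Qed.

Lemma descend_ge0 a r j : (forall k, 0 <= a k) -> 0 <= descend a r j.
Proof. by move=> a0; rewrite mulr_ge0. Qed.

(** Powers of a generating function, by the Cauchy product. *)
Lemma pw_generating p (y w : R) (j : nat) : (forall x, 0 <= p x) -> 0 <= y ->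
  (\sum_(0 <= x <oo) (p x * y ^+ x)%:E = w%:E)%E ->
  (\sum_(0 <= m <oo) (pw p j m * y ^+ m)%:E = (w ^+ j)%:E)%E.
Proof.
move=> p0 y0 pw1; elim: j => [|j IH].
  rewrite (@nneseries_finite R (fun m => pw p 0 m * y ^+ m) 1).
    by rewrite big_ord1/= mul1r.
  by move=> k; rewrite /pw lt0n => /negbTE ->; rewrite mul0r.
rewrite exprSr EFinM -pw1 -(nneseries_cauchy_product _ _ IH); last 2 first.
- by move=> x; rewrite mulr_ge0// exprn_ge0.
- by move=> x; rewrite mulr_ge0// ?exprn_ge0// pw_ge0.
apply: eq_eseriesr => m _; congr EFin; rewrite /= mulr_suml; apply: eq_bigr => x _.
have -> : y ^+ m = y ^+ x * y ^+ (m - x) by rewrite -exprD subnKC// -ltnS.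
by ring.
Qed.

Section finite.
Context (A p : nat -> R).
Hypothesis A_ge0 : forall j, 0 <= A j.
Hypothesis p_ge0 : forall x, 0 <= p x.
Hypothesis A_fin : forall m, (\sum_(0 <= j <oo) (A j * pw p j m)%:E < +oo)%E.

Lemma pw_mix_ge0 m : 0 <= pw_mix A p m.
Proof.
rewrite /pw_mix fine_ge0//; apply: nneseries_ge0 => j _ _.
by rewrite lee_fin mulr_ge0// pw_ge0.
Qed.

Lemma pw_mixE m : (\sum_(0 <= j <oo) (A j * pw p j m)%:E = (pw_mix A p m)%:E)%E.
Proof.
rewrite /pw_mix fineK// ge0_fin_numE//; apply: nneseries_ge0 => j _ _.
by rewrite lee_fin mulr_ge0// pw_ge0.
Qed.

Lemma pw_mix_generating (y w : R) : 0 <= y ->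
  (\sum_(0 <= x <oo) (p x * y ^+ x)%:E = w%:E)%E ->
  (\sum_(0 <= m <oo) (pw_mix A p m * y ^+ m)%:E = \sum_(0 <= j <oo) (A j * w ^+ j)%:E)%E.
Proof.
move=> y0 wE.
transitivity (\sum_(0 <= m <oo) \sum_(0 <= j <oo) (A j * (pw p j m * y ^+ m))%:E)%E.
  apply: eq_eseriesr => m _; rewrite mulrC EFinM -pw_mixE -nneseriesZl.
    by apply: eq_eseriesr => j _; rewrite -EFinM; congr EFin; ring.
  by move=> j _; rewrite lee_fin mulr_ge0// pw_ge0.
rewrite nneseries_interchange; last first.
  by move=> i j; rewrite lee_fin !mulr_ge0 ?exprn_ge0// pw_ge0.
apply: eq_eseriesr => j _; rewrite EFinM -(pw_generating j p_ge0 y0 wE) -nneseriesZl//.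
by move=> m _; rewrite lee_fin mulr_ge0 ?exprn_ge0// pw_ge0.
Qed.

Context (phi : nat -> R) (G : R -> R) (M : R).
Hypothesis G_bound : forall s, 0 <= G s <= M.

Let G_ge0 s : 0 <= G s. Proof. by case/andP: (G_bound s). Qed.

Let seq_sum_bound j m s : seq_sum p phi G j m s <= M * pw p j m.
Proof.
rewrite -(seq_sum_cst p phi M j m s); apply: seq_sum_le => // t.
by case/andP: (G_bound t).
Qed.

Lemma seq_mix_fin m s : (\sum_(0 <= j <oo) (A j * seq_sum p phi G j m s)%:E < +oo)%E.
Proof.
apply: (@le_lt_trans _ _ (\sum_(0 <= j <oo) (M%:E * (A j * pw p j m)%:E))%E).
  apply: lee_nneseries => j; first by move=> *; rewrite lee_fin mulr_ge0// seq_sum_ge0.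
  by move=> _; rewrite -EFinM lee_fin mulrCA ler_wpM2l.
rewrite nneseriesZl; last by move=> j _; rewrite lee_fin mulr_ge0// pw_ge0.
by rewrite pw_mixE -EFinM ltry.
Qed.

Lemma seq_mixE m s :
  (\sum_(0 <= j <oo) (A j * seq_sum p phi G j m s)%:E = (seq_mix A p phi G m s)%:E)%E.
Proof.
rewrite /seq_mix fineK// ge0_fin_numE ?seq_mix_fin//; apply: nneseries_ge0 => j _ _.
by rewrite lee_fin mulr_ge0// seq_sum_ge0.
Qed.

Lemma seq_mix_ge0 m s : 0 <= seq_mix A p phi G m s.
Proof.
rewrite /seq_mix fine_ge0//; apply: nneseries_ge0 => j _ _.
by rewrite lee_fin mulr_ge0// seq_sum_ge0.
Qed.

Lemma seq_mix_le m s : seq_mix A p phi G m s <= M * pw_mix A p m.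
Proof.
rewrite -lee_fin -seq_mixE EFinM -pw_mixE -nneseriesZl; last first.
  by move=> j _; rewrite lee_fin mulr_ge0// pw_ge0.
apply: lee_nneseries => j; first by move=> *; rewrite lee_fin mulr_ge0// seq_sum_ge0.
by move=> _; rewrite -EFinM lee_fin mulrCA ler_wpM2l.
Qed.

End finite.

Lemma seq_mix_cst A p phi c m s : (forall x, 0 <= p x) -> (forall j, 0 <= A j) -> 0 <= c ->
  (\sum_(0 <= j <oo) (A j * pw p j m)%:E < +oo)%E ->
  seq_mix A p phi (fun=> c) m s = c * pw_mix A p m.
Proof.
move=> p0 A0 c0 fin; rewrite /seq_mix /pw_mix.
under eq_eseriesr do rewrite seq_sum_cst mulrCA EFinM.
rewrite nneseriesZl; last by move=> j _; rewrite lee_fin mulr_ge0// pw_ge0.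
rewrite fineM//= ge0_fin_numE//; apply: nneseries_ge0 => j _ _.
by rewrite lee_fin mulr_ge0// pw_ge0.
Qed.

Lemma seq_mix_no_jump A p phi G m s : (forall x, 0 <= p x) -> (forall j, 0 <= A j) -> 0 <= G s ->
  (\sum_(0 <= j <oo) (A j * pw p j m)%:E < +oo)%E ->
  (forall x, (x <= m)%N -> phi x = 0) ->
  seq_mix A p phi G m s = G s * pw_mix A p m.
Proof.
move=> p0 A0 G0 fin ph0; rewrite -(seq_mix_cst phi (m := m) s p0 A0 G0 fin).
rewrite /seq_mix; congr fine; apply: eq_eseriesr => j _.
by rewrite !seq_sum_no_jump.
Qed.

(** Size-biased choice of one component. The number of choices turns the weight
    with [r] components revealed into the one with [r.+1]. *)
Lemma seq_mix_size_bias a p phi G M (r m : nat) (s : R) :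
  (forall k, 0 <= a k) -> (forall x, 0 <= p x) -> (forall s, 0 <= G s <= M) ->
  (forall r m, (\sum_(0 <= j <oo) (descend a r j * pw p j m)%:E < +oo)%E) ->
  m%:R * seq_mix (descend a r) p phi G m s =
  \sum_(x < m.+1) x%:R * p x * seq_mix (descend a r.+1) p phi G (m - x) (s + phi x).
Proof.
move=> a0 p0 GM fin.
have G0 t : 0 <= G t by case/andP: (GM t).
have A0 r' j := descend_ge0 r' j a0.
apply: EFin_inj; rewrite EFinM -(seq_mixE (A0 r) p0 (fin r) phi GM) -nneseriesZl; last first.
  by move=> j _; rewrite lee_fin mulr_ge0// seq_sum_ge0.
rewrite (nneseries_split 0 1); last by move=> j _; rewrite -EFinM lee_fin !mulr_ge0// seq_sum_ge0.
rewrite add0n big_nat1 -EFinM mulrCA seq_sum_size_bias mul0r mulr0 add0e.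
rewrite -(nneseries_addn 1); last by move=> j; rewrite -EFinM lee_fin !mulr_ge0// seq_sum_ge0.
transitivity (\sum_(0 <= j <oo) \sum_(x < m.+1)
   (x%:R * p x * (descend a r.+1 j * seq_sum p phi G j (m - x) (s + phi x)))%:E)%E.
  apply: eq_eseriesr => j _; rewrite -EFinM mulrCA seq_sum_size_bias addn1/= sumEFin.
  congr EFin; rewrite descendS mulrA mulr_sumr; apply: eq_bigr => x _; ring.
rewrite nneseries_sum; last first.
  by move=> x j _; rewrite lee_fin !mulr_ge0// seq_sum_ge0.
rewrite -sumEFin; apply: eq_bigr => x _.
rewrite EFinM -(seq_mixE (A0 r.+1) p0 (fin r.+1) phi GM) -nneseriesZl.
  by apply: eq_eseriesr => j _; rewrite -EFinM.
by move=> j _; rewrite lee_fin mulr_ge0// seq_sum_ge0.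
Qed.

Lemma pw_mix_size_bias a p (r m : nat) :
  (forall k, 0 <= a k) -> (forall x, 0 <= p x) ->
  (forall r m, (\sum_(0 <= j <oo) (descend a r j * pw p j m)%:E < +oo)%E) ->
  m%:R * pw_mix (descend a r) p m =
  \sum_(x < m.+1) x%:R * p x * pw_mix (descend a r.+1) p (m - x).
Proof.
move=> a0 p0 fin; have A0 r' j := descend_ge0 r' j a0.
have := @seq_mix_size_bias a p (fun=> 0) (fun=> 1) 1 r m 0 a0 p0 _ fin.
rewrite seq_mix_cst ?ler01// mul1r => ->.
  apply: eq_bigr => x _; by rewrite seq_mix_cst ?ler01// mul1r.
by move=> _; rewrite lexx.
Qed.

End mixtures.


(** * Regular variation of the partition functions *)

Lemma natD_ratio_cvg (R : realType) (r : nat) :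
  (n + r)%:R / n.+1%:R @[n --> \oo] --> (1 : R).
Proof.
have i0 : (n.+1%:R : R)^-1 @[n --> \oo] --> (0 : R).
  by apply/gtr0_cvgV0; [apply: nearW => n; rewrite ltr0n|exact: natSr_cvgy].
have : 1 + (r%:R - 1) * (n.+1%:R : R)^-1 @[n --> \oo] --> (1 : R).
  rewrite -[X in _ --> X]addr0; apply: cvgD; first exact: cvg_cst.
  by rewrite -(mulr0 (r%:R - 1)); exact: cvgMl_tmp.
apply: cvg_trans; apply: near_eq_cvg; apply: nearW => n /=.
have n0 : n.+1%:R != 0 :> R by rewrite pnatr_eq0.
have -> : (n + r)%:R = n.+1%:R + (r%:R - 1) :> R by rewrite natrD -natr1; ring.
by rewrite [RHS]mulrDl divff.
Qed.

Lemma regularly_varying_shift (R : realType) (l : R -> R) (g c : R) (u : nat -> R) (r : nat) :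
  (forall x, 0 < l x) -> asymptotically_flat l ->
  regularly_varying l g c (fun k => u k.+1) -> regularly_varying l g c (fun n => u (n + r)%N).
Proof.
move=> l0 lf rv.
have kt : ((n + r).-1).+1%:R / n.+1%:R @[n --> \oo] --> (1 : R).
  apply: cvg_trans (@natD_ratio_cvg R r); apply: near_eq_cvg; near=> n.
  by rewrite prednK// ltn_addr//; near: n; exact: nbhs_infty_gt.
have := regularly_varying_scaled l0 lf rv (@natSr_cvgy R) ltr01 kt.
rewrite powR1 mulr1; apply: cvg_trans; apply: near_eq_cvg; near=> n.
by rewrite /= prednK// ltn_addr//; near: n; exact: nbhs_infty_gt.
Unshelve. all: by end_near. Qed.

Section powered_slow_variation.
Context (R : realType) (l : R -> R) (eta alpha : R).
Hypothesis l_gt0 : forall x, 0 < l x.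
Hypothesis alpha01 : 0 < alpha < 1.
Hypothesis eta_gt0 : 0 < eta.

(** Slowly varying correction in the variable [m], when the number of components
    is of order [m ^ alpha]. *)
Definition power_arg (x : R) : R := l (x `^ alpha).

Lemma power_arg_gt0 x : 0 < power_arg x.
Proof. exact: l_gt0. Qed.

Lemma power_arg_potter : potter eta l -> potter eta power_arg.
Proof.
have [a0 a1] := andP alpha01.
move=> [C C0 HC]; exists C => // x y x0 y0; rewrite /power_arg.
apply: le_trans (HC _ _ (powR_gt0 alpha x0) (powR_gt0 alpha y0)) _.
rewrite ler_wpM2l ?mulr_ge0 ?(ltW C0) ?(ltW (l_gt0 _))//.
rewrite -!powR_div ?(ltW x0) ?(ltW y0)//.
set m := Num.max (y / x) (x / y).
have m1 : 1 <= m.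
  rewrite /m le_max; have [xy|yx] := leP x y.
    by rewrite ler_pdivlMr// mul1r xy.
  by rewrite orbC ler_pdivlMr// mul1r (ltW yx).
have mm z : 0 < z -> z <= m -> z `^ alpha <= m.
  move=> z0 zm; apply: (@le_trans _ _ (m `^ alpha)).
    by apply: ler_powR_base => //; exact: ltW.
  by rewrite -[leRHS]powRr1 ?(le_trans ler01)//; apply: ler_powR => //; exact: ltW.
apply: ler_powR_base; [exact: ltW|by rewrite le_max powR_ge0|].
by rewrite ge_max !mm ?divr_gt0// /m le_max lexx ?orbT.
Qed.

Lemma power_arg_flat : asymptotically_flat l -> asymptotically_flat power_arg.
Proof.
have [a0 a1] := andP alpha01.
move=> lf x y t xoo t0 yx; rewrite /power_arg.
apply: (lf _ _ (t `^ alpha)); rewrite ?powR_gt0//.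
  apply/cvgryPge => A.
  have : \forall n \near \oo, Num.max A 1 `^ alpha^-1 <= x n by exact: (cvgryPge _).1 xoo _.
  apply: filterS => n; have m0 : 0 < Num.max A 1 by rewrite lt_max ltr01 orbT.
  move=> /(ler_powR_base (ltW a0) (powR_ge0 _ _)).
  rewrite -powRrM mulVf ?gt_eqF// powRr1 ?(ltW m0)//; apply: le_trans.
  by rewrite le_max lexx.
apply: cvg_trans (powR_cvg (g := alpha) t0 yx); apply: near_eq_cvg; near=> n.
have x0 : 0 < x n by near: n; exact: (cvgryPgt _).1 xoo _.
have y0 : 0 < y n / x n by near: n; exact: (cvgr_gt _ yx).
rewrite powR_div// ltW// -(divfK (lt0r_neq0 x0) (y n)) mulr_gt0//.
Unshelve. all: by end_near. Qed.

End powered_slow_variation.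

Lemma fine_cvg_scaled (R : realType) (S : nat -> nat -> R) (D : nat -> R) (c : R) :
  (forall n, 0 < D n) -> (forall n k, 0 <= S n k) ->
  ((\sum_(0 <= k <oo) (S n k / D n)%:E) @[n --> \oo] --> c%:E)%E ->
  fine (\sum_(0 <= k <oo) (S n k)%:E)%E / D n @[n --> \oo] --> c.
Proof.
move=> D0 S0 /fine_cvg; apply: cvg_trans; apply: near_eq_cvg; apply: nearW => n /=.
have -> : (\sum_(0 <= k <oo) (S n k / D n)%:E = ((D n)^-1)%:E * \sum_(0 <= k <oo) (S n k)%:E)%E.
  rewrite -nneseriesZl; last by move=> k _; rewrite lee_fin.
  by apply: eq_eseriesr => k _; rewrite -EFinM mulrC.
have : (0 <= \sum_(0 <= k <oo) (S n k)%:E)%E.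
  by apply: nneseries_ge0 => k _ _; rewrite lee_fin.
case: (\sum_(0 <= k <oo) (S n k)%:E)%E => [s| |] //= s0; first by rewrite mulrC.
by rewrite gt0_muley ?lte_fin ?invr_gt0//= mul0r.
Qed.

Lemma beta_int_gt0 (R : realType) (x y : R) : 0 <= x ->
  lebesgue_measure.-integrable (`]0, 1[%classic : set R)
    (fun t => (t `^ (- x) * (1 - t) `^ y)%:E) ->
  0 < \int[lebesgue_measure]_(t in `]0, 1[) (t `^ (- x) * (1 - t) `^ y).
Proof.
move=> x0 ig.
apply: (Rintegral_gt0 (a := 4^-1) (b := 2^-1) (e := (2^-1) `^ `|y|) _ ig) => //.
- by move=> t _; rewrite mulr_ge0 ?powR_ge0.
- by rewrite ltf_pV2 ?posrE// ltr_nat.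
move=> t /andP[t1 t2]; split; first by rewrite /= in_itv/=; move: t1 t2; lra.
have t0 : 0 < t by move: t1; lra.
have s1 : 2^-1 <= 1 - t by move: t2; lra.
have s0 : 0 < 1 - t by move: s1; lra.
rewrite -[leLHS]mul1r; apply: ler_pM; rewrite ?powR_ge0//.
  rewrite powRN invf_ge1 ?powR_gt0//.
  have := ler_powR_base x0 (ltW t0) (_ : t <= 1); rewrite powR1; apply.
  by move: t2; lra.
apply: (@le_trans _ _ ((1 - t) `^ `|y|)).
  by apply: ler_powR_base => //; rewrite invr_ge0.
rewrite -(invrK (1 - t)) -powR_inv1 ?invr_ge0 ?(ltW s0)// -!powRrM.
by apply: ler_powR; [rewrite invf_ge1//; lra|rewrite !mulN1r lerN2 ler_norm].
Qed.

Section gibbs_asymptotics.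
Context (R : realType) (l : R -> R) (eta : R).
Hypothesis l_gt0 : forall x, 0 < l x.
Hypothesis l_potter : potter eta l.
Hypothesis l_flat : asymptotically_flat l.
Hypothesis eta_gt0 : 0 < eta.
Context (alpha b cp : R) (p a : nat -> R).
Hypothesis alpha01 : 0 < alpha < 1.
Hypothesis b12 : 1 < b < 2.
Hypothesis eta_small : eta < alpha * (2 - b).
Hypothesis p_ge0 : forall x, 0 <= p x.
Hypothesis p_sum : (\sum_(0 <= x <oo) (p x)%:E = 1)%E.
Hypothesis cp_gt0 : 0 < cp.
Hypothesis p_cvg : p k.+1 * k.+1%:R `^ (1 + alpha) @[k --> \oo] --> cp.
Hypothesis a_ge0 : forall k, 0 <= a k.
Hypothesis a_rv : regularly_varying l (- b) 1 (fun k => a k.+1).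

Let L := power_arg l alpha.
Let L_gt0 x : 0 < L x. Proof. exact: l_gt0. Qed.
Let L_potter : potter eta L. Proof. exact: power_arg_potter. Qed.
Let L_flat : asymptotically_flat L. Proof. exact: (power_arg_flat alpha01). Qed.

Let p_partial n : \sum_(x < n) p x <= 1.
Proof.
rewrite -lee_fin -p_sum -sumEFin -(big_mkord xpredT (fun m => (p m)%:E)).
by apply: nneseries_lim_ge => m _; rewrite lee_fin.
Qed.

Lemma descend_rv r : regularly_varying l (r%:R - b) 1 (descend a r).
Proof.
have c1 := @regularly_varying_shift _ _ _ _ a r l_gt0 l_flat a_rv.
have c2 : ((n + r) ^_ r)%:R / n.+1%:R ^+ r @[n --> \oo] --> (1 : R).
  elim: {c1} r => [|r IH].
    by apply: cvg_near_cst; apply: nearW => n; rewrite ffactn0 expr0 divr1.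
  rewrite -[X in _ --> X]mulr1; apply: cvg_trans (cvgM (@natD_ratio_cvg R r.+1) IH).
  apply: near_eq_cvg; apply: nearW => n /=.
  by rewrite addnS ffactSS natrM exprS invfM; ring.
rewrite /regularly_varying -[X in _ --> X]mulr1; apply: cvg_trans (cvgM c1 c2).
apply: near_eq_cvg; apply: nearW => n /=.
rewrite /rv_ref /descend -powR_mulrn//.
have n0 : 0 < n.+1%:R :> R by rewrite ltr0n.
rewrite [n.+1%:R `^ (r%:R - b)]powRD ?(gt_eqF n0) ?implybT//.
by field; rewrite !gt_eqF ?powR_gt0.
Qed.

(** The weights grow polynomially, so that any exponential factor makes them
    summable. *)
Lemma descend_exp_fin r d : 0 < d <= 1 ->
  (\sum_(0 <= j <oo) (descend a r j * expR (- (d * j%:R)))%:E < +oo)%E.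
Proof.
move=> /andP[d0 d1].
have [a0 a1] := andP alpha01; have [b1 b2] := andP b12.
have eta2 : eta <= 2 - b.
  rewrite (le_trans (ltW eta_small))// -[leRHS]mul1r ler_wpM2r ?(ltW a1)//.
  by move: b2; lra.
have [C C0 HC] := regularly_varying_le l_gt0 (descend_rv r).
have gl : 1 + eta <= r%:R + 3 - b by have := ler0n R r; move: eta2; lra.
have [C' C'0 HC'] := abelian_bound l_gt0 l_potter l_flat eta_gt0
  (fun j => ltW (rv_ref_gt0 l_gt0 _ j)) ltr01 (regularly_varying_ref l_gt0 _) gl.
have d1' : 1 <= d^-1 by rewrite invf_ge1.
apply: (@le_lt_trans _ _ (C%:E * \sum_(0 <= j <oo)
   (rv_ref l (r%:R + 3 - b - 1) j * expR (- (j%:R / d^-1)))%:E)%E).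
  rewrite -nneseriesZl; last first.
    by move=> j _; rewrite lee_fin mulr_ge0 ?expR_ge0// ltW// rv_ref_gt0.
  apply: lee_nneseries => j.
    by move=> *; rewrite lee_fin mulr_ge0 ?expR_ge0// descend_ge0.
  move=> _; rewrite -EFinM lee_fin invrK (mulrC j%:R) mulrA ler_wpM2r ?expR_ge0//.
  rewrite (le_trans (HC j))// ler_pM2l// ler_wpM2r ?(ltW (l_gt0 _))//.
  by apply: ler_powR; [rewrite ler1n|lra].
apply: (@le_lt_trans _ _ (C%:E * (C' * (d^-1 `^ (r%:R + 3 - b) * l d^-1))%:E)%E).
  by apply: lee_wpmul2l; [rewrite lee_fin ltW|exact: HC'].
by rewrite -EFinM ltry.
Qed.

(** The mass of [p] up to [m] is less than 1, and its [j]-th power bounds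
    [pw p j m]: this decays exponentially in [j]. *)
Lemma descend_pw_fin r m : (\sum_(0 <= j <oo) (descend a r j * pw p j m)%:E < +oo)%E.
Proof.
have [c /andP[c0 c1] Hc] := partial_mass_le p_ge0 p_partial alpha01 cp_gt0 p_cvg.
pose d := c * m.+1%:R `^ (- alpha).
have d01 : 0 < d <= 1.
  rewrite mulr_gt0 ?powR_gt0//= -[leRHS]mulr1 ler_pM// ?powR_ge0 ?(ltW c0)//.
  rewrite powRN invf_le1 ?powR_gt0// -[leLHS](powRr0 m.+1%:R).
  by apply: ler_powR; [rewrite ler1n|case/andP: alpha01 => /ltW].
apply: le_lt_trans (descend_exp_fin r d01); apply: lee_nneseries => j.
  by move=> *; rewrite lee_fin mulr_ge0 ?descend_ge0// pw_ge0.
move=> _; rewrite lee_fin ler_wpM2l ?descend_ge0//.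
rewrite (le_trans (pw_le_pow _ _ p_ge0))// mulrC -mulrN expRM_natl lerXn2r//.
- by rewrite nnegrE sumr_ge0.
- by rewrite nnegrE expR_ge0.
- by rewrite (le_trans _ (Hc m.+1 isT))// [leRHS]big_ord_recr/= lerDl.
Qed.

(** The generating function of [p] at [exp (- 1 / N)]. *)
Definition gf (N : R) : R := fine (\sum_(0 <= x <oo) (p x * expR (- N^-1) ^+ x)%:E)%E.

Let gf_term_le N x : 0 < N -> p x * expR (- N^-1) ^+ x <= p x.
Proof.
move=> N0; rewrite ler_piMr// exprn_ile1 ?expR_ge0// expR_le1 oppr_le0 invr_ge0.
exact: ltW.
Qed.

Let gf_term_ge0 N x : 0 <= p x * expR (- N^-1) ^+ x.
Proof. by rewrite mulr_ge0// exprn_ge0// expR_ge0. Qed.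

Lemma gfE N : 0 < N -> (\sum_(0 <= x <oo) (p x * expR (- N^-1) ^+ x)%:E = (gf N)%:E)%E.
Proof.
move=> N0; rewrite /gf fineK// ge0_fin_numE; last first.
  by apply: nneseries_ge0 => x _ _; rewrite lee_fin.
apply: (@le_lt_trans _ _ (\sum_(0 <= x <oo) (p x)%:E)%E); last by rewrite p_sum ltry.
apply: lee_nneseries => x; first by move=> *; rewrite lee_fin.
by move=> _; rewrite lee_fin gf_term_le.
Qed.

Lemma onem_gfE N : 0 < N ->
  (\sum_(0 <= k <oo) (p k.+1 * (1 - expR (- (k.+1%:R / N))))%:E = (1 - gf N)%:E)%E.
Proof.
move=> N0.
pose f x := p x * (1 - expR (- N^-1) ^+ x).
have f0 x : 0 <= f x by rewrite /f mulrBr mulr1 subr_ge0 gf_term_le.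
have H : (\sum_(0 <= x <oo) (f x)%:E + (gf N)%:E = 1)%E.
  rewrite -gfE// -nneseriesD//; try by move=> x _; rewrite lee_fin.
  rewrite -p_sum; apply: eq_eseriesr => x _; rewrite -EFinD /f; congr EFin; ring.
transitivity (\sum_(0 <= x <oo) (f x)%:E)%E.
  rewrite [RHS](nneseries_split 0 1)//; last by move=> x _; rewrite lee_fin.
  rewrite add0n big_nat1 /f expr0 subrr mulr0 add0e -(nneseries_addn 1); last first.
    by move=> x; rewrite lee_fin; exact: f0.
  by apply: eq_eseriesr => x _; rewrite addn1 -expRM_natl mulrN.
rewrite EFinB -H addeK//.
Qed.

Lemma p_pos : exists k, 0 < p k.+1.
Proof.
have [k _ /(_ k (leqnn _)) Hk] : \forall k \near \oo, 0 < p k.+1 * k.+1%:R `^ (1 + alpha).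
  exact: (cvgr_gt _ p_cvg).
by exists k; move: Hk; rewrite pmulr_lgt0// powR_gt0.
Qed.

Lemma gf_bounds N : 0 < N -> 0 < gf N < 1.
Proof.
move=> N0; have [k pk] := p_pos.
apply/andP; split.
  rewrite -lte_fin -gfE//.
  apply: (@lt_le_trans _ _ (p k.+1 * expR (- N^-1) ^+ k.+1)%:E).
    by rewrite lte_fin mulr_gt0// exprn_gt0// expR_gt0.
  rewrite (nneseries_split 0 k.+2)//; last by move=> *; rewrite lee_fin.
  rewrite big_nat_recr//= addeAC leeDr// adde_ge0//.
    by apply: sume_ge0 => *; rewrite lee_fin.
  by apply: nneseries_ge0 => *; rewrite lee_fin.
have f0 j : 0 <= p j.+1 * (1 - expR (- (j.+1%:R / N))).
  by rewrite mulr_ge0// subr_ge0 expR_le1 oppr_le0 divr_ge0// ltW.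
rewrite -subr_gt0 -lte_fin -onem_gfE//.
apply: (@lt_le_trans _ _ (p k.+1 * (1 - expR (- (k.+1%:R / N))))%:E).
  by rewrite lte_fin mulr_gt0// subr_gt0 expR_lt1 oppr_lt0 divr_gt0.
rewrite (nneseries_split 0 k.+1)//; last by move=> *; rewrite lee_fin.
rewrite big_nat_recr//= addeAC leeDr// adde_ge0//.
  by apply: sume_ge0 => *; rewrite lee_fin.
by apply: nneseries_ge0 => *; rewrite lee_fin.
Qed.

Let K := cp * laplace_int alpha.

Lemma laplace_int_gt0 : 0 < laplace_int alpha.
Proof.
by have [] := small_laplace_cvg p_ge0 cp_gt0 alpha01 p_cvg (fun n => ltr0Sn R n) (@natSr_cvgy R).
Qed.

Let K_gt0 : 0 < K. Proof. by rewrite mulr_gt0// laplace_int_gt0. Qed.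

(** [- ln] of the generating function and its defect from 1 are equivalent. *)
Lemma log_gf_cvg (N : nat -> R) : (forall n, 0 < N n) -> N n @[n --> \oo] --> +oo ->
  N n `^ alpha * - ln (gf (N n)) @[n --> \oo] --> K.
Proof.
move=> N0 Noo; have [a0 a1] := andP alpha01.
have [_ c0] := small_laplace_cvg p_ge0 cp_gt0 alpha01 p_cvg N0 Noo.
have c1 : N n `^ alpha * (1 - gf (N n)) @[n --> \oo] --> K.
  move/fine_cvg : c0; apply: cvg_trans; apply: near_eq_cvg; apply: nearW => n /=.
  under eq_eseriesr do rewrite EFinM.
  rewrite nneseriesZl; last first.
    by move=> k _; rewrite lee_fin mulr_ge0// subr_ge0 expR_le1 oppr_le0 divr_ge0// ltW.
  by rewrite onem_gfE.
have x0 : 1 - gf (N n) @[n --> \oo] --> (0 : R).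
  have i0 : (N n `^ alpha)^-1 @[n --> \oo] --> (0 : R).
    have := cvg_comp _ _ Noo (powRN_cvg0 (k := - alpha) ltac:(lra)).
    by apply: cvg_trans; apply: near_eq_cvg; apply: nearW => n /=; rewrite powRN.
  rewrite -(mulr0 K); apply: cvg_trans (cvgM c1 i0); apply: near_eq_cvg.
  by apply: nearW => n /=; rewrite mulrAC mulfV ?mul1r// gt_eqF// powR_gt0.
have w1 : gf (N n) @[n --> \oo] --> (1 : R).
  rewrite -[X in _ --> X]subr0; apply: cvg_trans (cvgB (cvg_cst (1 : R)) x0).
  by apply: near_eq_cvg; apply: nearW => n /=; rewrite subKr.
have c2 : N n `^ alpha * (1 - gf (N n)) / gf (N n) @[n --> \oo] --> K.
  by rewrite -[X in _ --> X]divr1; apply: cvgM => //; apply: cvgV.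
apply: (squeeze_cvgr _ c1 c2); apply: nearW => n.
have /andP[g0 g1] := gf_bounds (N0 n).
rewrite -mulrA !ler_pM2l ?powR_gt0//; apply/andP; split.
  have := @le_ln1Dx R (gf (N n) - 1) ltac:(lra).
  by rewrite addrC subrK; lra.
have := @le_ln1Dx R ((gf (N n))^-1 - 1) ltac:(have := invr_gt0 (gf (N n)); lra).
rewrite addrC subrK lnV ?posrE// => h; rewrite (le_trans h)//.
by rewrite mulrBl mul1r divff// gt_eqF.
Qed.

(** Makes the Laplace sum over sizes a Laplace sum over the number of
    components, at the scale [- 1 / ln (gf N)], of order [N ^ alpha]. *)
Lemma gf_powE N j : 0 < N -> gf N ^+ j = expR (- (j%:R / (- ln (gf N))^-1)).
Proof.
move=> N0; have /andP[g0 _] := gf_bounds N0.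
by rewrite invrK mulrN opprK expRM_natl lnK.
Qed.

Let gam (r : nat) : R := r%:R + 1 - b.

(** Abelian theorem for the number of components, at the scale of the preceding
    identity. *)
Lemma laplace_mix_cvg r (N : nat -> R) : 1 + eta <= gam r ->
  (forall n, 0 < N n) -> N n @[n --> \oo] --> +oo ->
  fine (\sum_(0 <= m <oo) (pw_mix (descend a r) p m * expR (- (m%:R / N n)))%:E)%E /
    (N n `^ (alpha * gam r) * L (N n)) @[n --> \oo] --> gamma_int (gam r) * K `^ (- gam r).
Proof.
move=> gl N0 Noo; have [a0 a1] := andP alpha01.
pose N' n := (- ln (gf (N n)))^-1.
have N'0 n : 0 < N' n by rewrite invr_gt0 oppr_gt0 ln_lt0// gf_bounds.
have Na0 n : 0 < N n `^ alpha by rewrite powR_gt0.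
have Naoo : N n `^ alpha @[n --> \oo] --> +oo.
  apply/cvgryPge => A.
  have : \forall n \near \oo, Num.max A 1 `^ alpha^-1 <= N n by exact: (cvgryPge _).1 Noo _.
  apply: filterS => n; have m0 : 0 < Num.max A 1 by rewrite lt_max ltr01 orbT.
  move=> /(ler_powR_base (ltW a0) (powR_ge0 _ _)).
  rewrite -powRrM mulVf ?gt_eqF// powRr1 ?(ltW m0)//; apply: le_trans.
  by rewrite le_max lexx.
have ratio : N' n / N n `^ alpha @[n --> \oo] --> K^-1.
  apply: cvg_trans (cvgV (lt0r_neq0 K_gt0) (log_gf_cvg N0 Noo)).
  by apply: near_eq_cvg; apply: nearW => n; rewrite /N' /= invfM mulrC.
have N'oo : N' n @[n --> \oo] --> +oo.
  have Ki : 0 < K^-1 / 2 by rewrite divr_gt0 ?invr_gt0.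
  apply/cvgryPge => A.
  have h1 : \forall n \near \oo, `|A| / (K^-1 / 2) <= N n `^ alpha by exact: (cvgryPge _).1 Naoo _.
  have h2 : \forall n \near \oo, K^-1 / 2 <= N' n / N n `^ alpha.
    by apply: (cvgr_ge _ ratio); rewrite gtr_pMr ?invr_gt0// invf_lt1 ?ltr1n.
  apply: filterS2 h1 h2 => n; rewrite ler_pdivrMr// ler_pdivlMr// => h1 h2.
  by rewrite (le_trans (ler_norm A))// (le_trans h1)// mulrC.
have A0 j : 0 <= descend a r j by exact: descend_ge0.
have rv : regularly_varying l (gam r - 1) 1 (descend a r).
  by rewrite (_ : gam r - 1 = r%:R - b); [exact: descend_rv|rewrite /gam; ring].
have [_ c1] := abelian l_gt0 l_potter l_flat eta_gt0 A0 ltr01 rv gl N'0 N'oo.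
have D0 n : 0 < N' n `^ gam r * l (N' n) by rewrite mulr_gt0// powR_gt0.
have S0 n j : 0 <= descend a r j * expR (- (j%:R / N' n)) by rewrite mulr_ge0// expR_ge0.
have {}c1 := fine_cvg_scaled D0 S0 c1.
rewrite mul1r in c1.
have c2 := powR_cvg (g := gam r) (_ : 0 < K^-1) ratio.
have {}c2 := c2 ltac:(by rewrite invr_gt0).
have c3 := l_flat Naoo (_ : 0 < K^-1) ratio.
have {}c3 := c3 ltac:(by rewrite invr_gt0).
have -> : gamma_int (gam r) * K `^ (- gam r) = gamma_int (gam r) * (K^-1 `^ gam r * 1).
  by rewrite mulr1 -powR_inv1 ?(ltW K_gt0)// -powRrM mulN1r.
apply: cvg_trans (cvgM c1 (cvgM c2 c3)); apply: near_eq_cvg; apply: nearW => n.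
rewrite /= powR_div ?(ltW (N'0 n))// -powRrM.
have -> : (\sum_(0 <= m <oo) (pw_mix (descend a r) p m * expR (- (m%:R / N n)))%:E =
    \sum_(0 <= j <oo) (descend a r j * expR (- (j%:R / N' n)))%:E)%E.
  transitivity (\sum_(0 <= j <oo) (descend a r j * gf (N n) ^+ j)%:E)%E.
    rewrite -(pw_mix_generating A0 p_ge0 (descend_pw_fin r) (expR_ge0 (- (N n)^-1)) (gfE (N0 n))).
    by apply: eq_eseriesr => m _; rewrite -expRM_natl mulrN.
  by apply: eq_eseriesr => j _; rewrite gf_powE.
rewrite /L /power_arg.
field; rewrite !gt_eqF ?powR_gt0//.
Qed.

Let bet (r : nat) : R := alpha * gam r.

Let F (k : nat) : R := k.+1%:R * p k.+1.

Let F_ge0 k : 0 <= F k. Proof. by rewrite mulr_ge0. Qed.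

Let F_cvg : F k * k.+1%:R `^ alpha @[k --> \oo] --> cp.
Proof.
apply: cvg_trans p_cvg; apply: near_eq_cvg; apply: nearW => k /=.
have k0 : 0 < k.+1%:R :> R by rewrite ltr0n.
by rewrite powRD ?(gt_eqF k0) ?implybT// powRr1// /F; ring.
Qed.

Let u r := pw_mix (descend a r) p.

Let u_ge0 r m : 0 <= u r m.
Proof. by apply: pw_mix_ge0 => // j; exact: descend_ge0. Qed.

Let size_bias_sum r n : n.+1%:R * u r n.+1 = \sum_(k < n.+1) F k * u r.+1 (n - k)%N.
Proof.
rewrite /u pw_mix_size_bias//; last by move=> *; exact: descend_pw_fin.
by rewrite big_ord_recl/= !mul0r add0r.
Qed.

Let alpha01' : 0 <= alpha < 1.
Proof. by case/andP: alpha01 => a0 ->; rewrite ltW. Qed.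

Let betS r : bet r.+1 - alpha = bet r.
Proof. by rewrite /bet /gam -natr1; ring. Qed.

Let rv_of_sum r c :
  n.+1%:R `^ (alpha - bet r.+1) / L n.+1%:R * \sum_(k < n.+1) F k * u r.+1 (n - k)%N
    @[n --> \oo] --> c ->
  regularly_varying L (bet r - 1) c (u r).
Proof.
move=> H; have -> : u r = (fun n => u r (n + 0)%N) by apply/funext => n; rewrite addn0.
apply: (regularly_varying_shift (u := u r) 0 L_gt0 L_flat); apply: cvg_trans H.
apply: near_eq_cvg; apply: nearW => n; rewrite -size_bias_sum /rv_ref.
have n0 : 0 < n.+1%:R :> R by rewrite ltr0n.
rewrite -opprB betS powRN powRD ?(gt_eqF n0) ?implybT// powR_inv1//.
by field; rewrite nat1r !gt_eqF ?powR_gt0.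
Qed.

Let unit_h (n k : nat) : 0 <= (1 : R) <= 1. Proof. by rewrite ler01 lexx. Qed.

Let eta_bet r : eta < bet r.+1.
Proof.
apply: lt_le_trans eta_small _; rewrite /bet /gam ler_pM2l; last by case/andP: alpha01.
by rewrite -natr1; have := ler0n R r; lra.
Qed.

Let bet_int r : 0 < \int[lebesgue_measure]_(t in `]0, 1[) (t `^ (- alpha) * (1 - t) `^ (bet r.+1 - 1)).
Proof.
have [ig _] := convolution_cvg L_gt0 L_potter L_flat alpha01' (eta_bet r) F_ge0
  (fun j => ltW (rv_ref_gt0 L_gt0 _ j)) cp_gt0 ltr01 F_cvg
  (regularly_varying_ref L_gt0 (bet r.+1 - 1)) (h := fun _ _ => 1) (H := fun=> 1)
  (M := 1) succn_cvgy unit_h (fun t _ => cvg_cst (1 : R)).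
apply: beta_int_gt0; first by case/andP: alpha01'.
by apply: (eq_integrable _ _ _ _ ig) => // t _; rewrite mulr1.
Qed.

(** The size-biased identity as a convolution. *)
Let rv_down r c : 0 < c -> regularly_varying L (bet r.+1 - 1) c (u r.+1) ->
  exists2 c', 0 < c' & regularly_varying L (bet r - 1) c' (u r).
Proof.
move=> c0 rv.
have [_ c1] := convolution_cvg L_gt0 L_potter L_flat alpha01' (eta_bet r) F_ge0
  (u_ge0 r.+1) cp_gt0 c0 F_cvg rv (h := fun _ _ => 1) (H := fun=> 1)
  (M := 1) succn_cvgy unit_h (fun t _ => cvg_cst (1 : R)).
exists (cp * c * \int[lebesgue_measure]_(t in `]0, 1[) (t `^ (- alpha) * (1 - t) `^ (bet r.+1 - 1))).
  by apply: mulr_gt0; [exact: mulr_gt0|exact: bet_int].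
rewrite (_ : \int[_]_(t in _) _ = \int[lebesgue_measure]_(t in `]0, 1[)
  (t `^ (- alpha) * (1 - t) `^ (bet r.+1 - 1) * 1)); last first.
  by apply: eq_Rintegral => t _; rewrite mulr1.
apply: rv_of_sum.
apply: cvg_trans c1; apply: near_eq_cvg; apply: nearW => n /=.
by congr (_ * _); apply: eq_bigr => k _; rewrite mulr1 subn1.
Qed.

Let laplace_sumE (v : nat -> R) n i :
  laplace_sum v n i = fine (\sum_(0 <= m <oo) (v m * expR (- (m%:R / (n.+1%:R / i.+1%:R))))%:E)%E.
Proof.
rewrite /laplace_sum; congr fine; apply: eq_eseriesr => m _.
rewrite /laplace_term -expRM_natl; congr (_ * expR _)%:E.
by rewrite invf_div mulrN mulrCA.
Qed.

(** Abelian theorem, local bound and Tauberian theorem together: the Laplace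
    sums at level [r.+1] give the pointwise asymptotics at level [r]. *)
Let rv_large r : 2 + eta <= bet r.+1 ->
  exists2 c, 0 < c & regularly_varying L (bet r - 1) c (u r).
Proof.
move=> bl; have [a0 a1] := andP alpha01.
have g0 : 0 < gam r.+1.
  have b0 : 0 < bet r.+1 by rewrite (lt_le_trans _ bl)// addr_gt0.
  by move: b0; rewrite /bet pmulr_rgt0.
have gl : 1 + eta <= gam r.+1.
  have : bet r.+1 <= gam r.+1 by rewrite /bet ler_piMl// ltW.
  by move: bl; lra.
have bl1 : 1 + eta <= bet r.+1 by move: bl; lra.
pose kappa := gamma_int (gam r.+1) * K `^ (- gam r.+1) / gamma_int (bet r.+1).
have rvA s : regularly_varying l (gam s - 1) 1 (descend a s).
  by rewrite (_ : gam s - 1 = s%:R - b); [exact: descend_rv|rewrite /gam; ring].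
have B0 j := ltW (rv_ref_gt0 L_gt0 (bet r.+1 - 1) j).
have rvB := regularly_varying_ref L_gt0 (bet r.+1 - 1).
have N0 i n : 0 < n.+1%:R / i.+1%:R :> R by rewrite divr_gt0.
have Noo i : n.+1%:R / i.+1%:R @[n --> \oo] --> (+oo : set_system R).
  apply/cvgryPge => A; have : \forall n \near \oo, A * i.+1%:R <= n.+1%:R.
    exact: (cvgryPge _).1 (@natSr_cvgy R) _.
  by apply: filterS => n h; rewrite ler_pdivlMr.
have gb : 0 < gamma_int (bet r.+1).
  by have [] := abelian L_gt0 L_potter L_flat eta_gt0 B0 ltr01 rvB bl1 (N0 0%N) (Noo 0%N).
have gg : 0 < gamma_int (gam r.+1).
  have A0 j : 0 <= descend a r.+1 j by exact: descend_ge0.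
  by have [] := abelian l_gt0 l_potter l_flat eta_gt0 A0 ltr01 (rvA r.+1) gl (N0 0%N) (Noo 0%N).
have kappa0 : 0 < kappa by apply: divr_gt0 => //; apply: mulr_gt0 => //; exact: powR_gt0.
have ratio i : laplace_sum (u r.+1) n i / laplace_sum (rv_ref L (bet r.+1 - 1)) n i
    @[n --> \oo] --> kappa.
  have [_ c2] := abelian L_gt0 L_potter L_flat eta_gt0 B0 ltr01 rvB bl1 (N0 i) (Noo i).
  have D0 n : 0 < (n.+1%:R / i.+1%:R) `^ bet r.+1 * L (n.+1%:R / i.+1%:R).
    by rewrite mulr_gt0// powR_gt0.
  have {}c2 := fine_cvg_scaled D0 (fun n k => mulr_ge0 (B0 k) (expR_ge0 _)) c2.
  rewrite mul1r in c2.
  have c1 := laplace_mix_cvg gl (N0 i) (Noo i).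
  apply: cvg_trans (cvgM c1 (cvgV (lt0r_neq0 gb) c2)).
  apply: near_eq_cvg; apply: nearW => n; rewrite /= !laplace_sumE.
  have cancel X Y D : D != 0 -> X / D / (Y / D) = X / Y :> R.
    by move=> D1; rewrite invf_div mulrA mulfVK.
  by apply: cancel; rewrite gt_eqF.
have u_le : exists2 C, 0 < C & forall m, u r.+1 m <= C * rv_ref L (bet r.+1 - 1) m.
  have rvA' : regularly_varying l (gam r.+1) 1 (descend a r.+2).
    by rewrite (_ : gam r.+1 = gam r.+2 - 1) ?rvA// /gam -(natr1 r.+1); ring.
  have [C C0 HC] := local_upper_bound l_gt0 l_potter l_flat eta_gt0 p_ge0 p_partial alpha01
    cp_gt0 p_cvg (fun j => descend_ge0 r.+1 j a_ge0) (descendS a r.+1) ltr01 ltr01 (rvA r.+1)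
    rvA' bl.
  exists C => // m; rewrite -lee_fin -pw_mixE//.
  - by move=> j; exact: descend_ge0.
  - exact: descend_pw_fin.
have c3 := tauberian_convolution L_gt0 L_potter L_flat eta_gt0 alpha01' bl1 F_ge0 cp_gt0 F_cvg
  (ltW kappa0) (u_ge0 r.+1) u_le ratio.
exists (kappa * (cp * \int[lebesgue_measure]_(t in `]0, 1[) (t `^ (- alpha) * (1 - t) `^ (bet r.+1 - 1)))).
  by apply: mulr_gt0 => //; apply: mulr_gt0 => //; exact: bet_int.
exact: rv_of_sum.
Qed.

(** For large [r] the level [r.+1] obeys both a limit theorem for Laplace sums
    and [local_upper_bound]; the size-biased identity writes the level [r] as
    its convolution with the jump weights, and [tauberian_convolution] turns the
    averaged asymptotics of one level into pointwise asymptotics of the next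
    lower one. The same identity, with [convolution_cvg], then descends to
    [r = 0]. *)
Lemma pw_mix_regularly_varying r : exists2 c, 0 < c &
  regularly_varying (power_arg l alpha) (alpha * (r%:R + 1 - b) - 1) c (pw_mix (descend a r) p).
Proof.
have [a0 a1] := andP alpha01; have [b1 b2] := andP b12.
pose r0 := (Num.truncn ((2 + eta) / alpha)).+1.
have large s : (r0 <= s)%N -> 2 + eta <= bet s.+1.
  move=> rs; rewrite /bet mulrC -ler_pdivrMr//.
  have h0 : 0 <= (2 + eta) / alpha by rewrite divr_ge0 ?addr_ge0// ltW.
  have /andP[_ h] := truncn_itv h0.
  rewrite (le_trans (ltW h))// /gam -natr1.
  have : r0%:R <= s%:R :> R by rewrite ler_nat.
  by rewrite /r0; move: b2; lra.
suff H n : forall s, (r0 <= s + n)%N -> exists2 c, 0 < c & regularly_varying L (bet s - 1) c (u s).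
  by apply: (H r0); exact: leq_addl.
elim: n => [|n IH] s rs; first by apply: rv_large; apply: large; rewrite addn0 in rs.
have [c c0 rv] := IH s.+1 ltac:(by rewrite addSnnS).
exact: rv_down rv.
Qed.

End gibbs_asymptotics.


(** * A recursion between beta integrals *)

(** The function [t ^ (1 - a) * (1 - t) ^ b] vanishes at both ends;
    integrate its derivative. *)
Lemma beta_recursion (R : realType) (a b : R) : 0 <= a < 1 -> 0 < b ->
  lebesgue_measure.-integrable (`]0, 1[%classic : set R)
    (fun t => (t `^ (- a) * (1 - t) `^ (b - 1))%:E) ->
  lebesgue_measure.-integrable (`]0, 1[%classic : set R)
    (fun t => (t `^ (- a) * (1 - t) `^ (b - 1) * (1 - t))%:E) ->
  (b + 1 - a) * \int[lebesgue_measure]_(t in `]0, 1[) (t `^ (- a) * (1 - t) `^ (b - 1) * (1 - t)) =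
  b * \int[lebesgue_measure]_(t in `]0, 1[) (t `^ (- a) * (1 - t) `^ (b - 1)).
Proof.
move=> /andP[a0 a1] b0 ig1 ig2.
pose w (t : R) := t `^ (- a) * (1 - t) `^ (b - 1).
pose g (t : R) := (b + 1 - a) * (w t * (1 - t)) - b * w t.
pose G (t : R) := t `^ (1 - a) * (1 - t) `^ b.
have dG (t : R) : 0 < t < 1 -> is_derive t 1 G (g t).
  move=> /andP[t0 t1]; have s0 : 0 < 1 - t by rewrite subr_gt0.
  have d1 := is_derive1_powR (1 - a) t0.
  have d2 : is_derive t 1 (fun t : R => (1 - t) `^ b) (- (b * (1 - t) `^ (b - 1))).
    have d3 := is_derive1_powR b s0.
    have d4 : is_derive t 1 (fun t : R => 1 - t) (- 1).
      by apply: (is_derive_eq (is_deriveB (is_derive_cst _ _ _) (is_derive_id _ _))); rewrite sub0r.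
    apply: (is_derive_eq (@is_derive1_comp R (fun s : R => s `^ b) (fun t : R => 1 - t) t _ _ d3 d4)).
    by rewrite mulrN1.
  apply: (is_derive_eq (is_deriveM d1 d2)).
  rewrite /GRing.scale/= /g /w.
  have -> : 1 - a - 1 = - a by ring.
  have -> : t `^ (1 - a) = t `^ (- a) * t.
    by rewrite -[X in _ * X](powRr1 (ltW t0)) -powRD ?(gt_eqF t0) ?implybT// addrC.
  have -> : (1 - t) `^ b = (1 - t) `^ (b - 1) * (1 - t).
    rewrite -[X in _ * X](powRr1 (ltW s0)) -powRD ?(gt_eqF s0) ?implybT//.
    by rewrite subrK.
  by ring.
pose d (n : nat) : R := n.+3%:R^-1.
have d0 n : 0 < d n by rewrite invr_gt0.
have d2 n : d n < 1 - d n.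
  have : d n < 2^-1 by rewrite ltf_pV2 ?posrE// ltr_nat.
  by lra.
have sub n (t : R) : d n <= t -> t <= 1 - d n -> 0 < t < 1.
  by move=> h1 h2; have := d0 n; move: h1 h2; lra.
have cg (t : R) : 0 < t < 1 -> g z @[z --> t] --> g t.
  move=> /andP[t0 t1].
  have c0 : 1 - z @[z --> t] --> 1 - t by apply: cvgB; [exact: cvg_cst|exact: cvg_id].
  have c1 : (1 - z) `^ (b - 1) @[z --> t] --> (1 - t) `^ (b - 1).
    apply: (cvg_comp _ (fun s : R => s `^ (b - 1)) c0).
    by apply: powR_continuous; rewrite subr_gt0.
  have c2 : w z @[z --> t] --> w t by apply: cvgM; [exact: powR_continuous|exact: c1].
  apply: cvgB; last by apply: cvgMl_tmp; exact: c2.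
  by apply: cvgMl_tmp; apply: cvgM; [exact: c2|exact: c0].
have ftc n : \int[lebesgue_measure]_(t in `[d n, 1 - d n]) g t = G (1 - d n) - G (d n).
  rewrite /Rintegral (@continuous_FTC2 R g G (d n) (1 - d n))//.
  - apply: continuous_in_subspaceT => t; rewrite inE/= in_itv/= => /andP[h1 h2].
    exact: cg (sub n t h1 h2).
  - apply: derivable_LRcontinuous => // t h1 h2.
    by have [] := dG t (sub n t h1 h2).
  - move=> t; rewrite in_itv/= => /andP[h1 h2].
    have [_ <-] := dG t (sub n t (ltW h1) (ltW h2)); by rewrite derive1E.
have ig : lebesgue_measure.-integrable (`]0, 1[%classic : set R) (EFin \o g).
  apply: (@integrableB _ _ R lebesgue_measure (`]0, 1[%classic : set (measurableTypeR R)) _ 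
    (fun t : measurableTypeR R => ((b + 1 - a) * (w (t : R) * (1 - (t : R))))%:E)
    (fun t : measurableTypeR R => (b * w (t : R))%:E)) => //.
    exact: (@integrableZl _ _ R lebesgue_measure _ (measurable_itv _) (b + 1 - a) _ ig2).
  exact: (@integrableZl _ _ R lebesgue_measure _ (measurable_itv _) b _ ig1).
have d_cvg : d n @[n --> \oo] --> (0 : R).
  have : (n.+1%:R : R)^-1 @[n --> \oo] --> (0 : R).
    by apply/gtr0_cvgV0; [apply: nearW => n; rewrite ltr0n|exact: natSr_cvgy].
  by rewrite -(cvg_shiftn 2); under eq_fun do rewrite addn2.
have lim0 : G (1 - d n) - G (d n) @[n --> \oo] --> (0 : R).
  have dk (k : R) : 0 < k -> d n `^ k @[n --> \oo] --> (0 : R).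
    move=> k0; have noo : n.+3%:R @[n --> \oo] --> (+oo : set_system R).
      rewrite -(cvg_shiftn 2) in d_cvg; have := @natSr_cvgy R; rewrite -(cvg_shiftn 2).
      by under eq_fun do rewrite addn2.
    apply: cvg_trans (cvg_comp _ _ noo (powRN_cvg0 (k := - k) _)); last by rewrite oppr_lt0.
    by apply: near_eq_cvg; apply: nearW => n /=; rewrite /d -powR_inv1// -powRrM mulN1r.
  have bnd (x y t : R) : 0 <= x -> 0 <= y -> 0 < t < 1 -> 0 <= t `^ x * (1 - t) `^ y <= t `^ x.
    move=> x0 y0 /andP[t0 t1]; rewrite mulr_ge0 ?powR_ge0//= ler_piMr ?powR_ge0//.
    have s0 : 0 <= 1 - t by lra.
    by have := ler_powR_base y0 s0 (_ : 1 - t <= 1); rewrite powR1; apply; lra.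
  have a1' : 0 < 1 - a by rewrite subr_gt0.
  have h1 : G (d n) @[n --> \oo] --> (0 : R).
    apply: (squeeze_cvgr _ (cvg_cst 0) (dk _ a1')); apply: nearW => n.
    by apply: bnd; [exact: ltW|exact: ltW|apply: (sub n); [|exact: ltW]].
  have h2 : G (1 - d n) @[n --> \oo] --> (0 : R).
    apply: (squeeze_cvgr _ (cvg_cst 0) (dk _ b0)); apply: nearW => n.
    rewrite /G subKr mulrC -{1 3}[d n](subKr 1); rewrite subKr.
    have := bnd b (1 - a) (d n) (ltW b0) (ltW a1').
    by apply; apply: (sub n); [|exact: ltW].
  by rewrite -[X in _ --> X](subrr 0); exact: cvgB.
pose f n (t : R) := if (d n <= t) && (t <= 1 - d n) then g t else 0.
have fE n : f n = g \_ (`[d n, 1 - d n]%classic : set R).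
  apply/funext => t; rewrite /f patchE mem_setE in_itv/=; by [].
have mg : measurable_fun (`]0, 1[%classic : set R) g.
  by apply/measurable_EFinP; exact: measurable_int ig.
have sub01 n : `[d n, 1 - d n]%classic `<=` (`]0, 1[%classic : set R).
  by move=> t /=; rewrite !in_itv/= => /andP[h1 h2]; exact: sub h1 h2.
have intf n : \int[lebesgue_measure]_(t in `]0, 1[) f n t = \int[lebesgue_measure]_(t in `[d n, 1 - d n]) g t.
  by rewrite fE -Rintegral_mkcondr (setIidr (sub01 n)).
have c' : \int[lebesgue_measure]_(t in `]0, 1[) f n t @[n --> \oo] --> (0 : R).
  by under eq_fun do rewrite intf ftc.
have c : \int[lebesgue_measure]_(t in `]0, 1[) f n t @[n --> \oo] -->
    \int[lebesgue_measure]_(t in `]0, 1[) g t.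
  apply: (proj2 (@Rintegral_dominated_cvg _ _ R lebesgue_measure (`]0, 1[%classic : set R) f g
    (fun t => `|g t|) (measurable_itv _) _ mg (integrable_norm ig) _ _)).
  - move=> n; rewrite fE -restrict_EFin.
    apply: (proj1 (@integrable_restrict _ _ R lebesgue_measure
      (`[d n, 1 - d n]%classic : set (measurableTypeR R)) (measurable_itv _)
      (`]0, 1[%classic : set (measurableTypeR R)) (measurable_itv _) _)).
    rewrite (setIidr (@sub01 n)).
    exact: (@integrableS _ _ R lebesgue_measure (`]0, 1[%classic : set (measurableTypeR R))
      (`[d n, 1 - d n]%classic : set (measurableTypeR R)) _ (measurable_itv _) (measurable_itv _) (@sub01 n) ig).
  - move=> t /=; rewrite in_itv/= => /andP[t0 t1].
    apply: cvg_near_cst; near=> n; rewrite /f ifT//; apply/andP; split.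
      by near: n; apply: (cvgr_le _ d_cvg).
    suff : d n <= 1 - t by lra.
    by near: n; apply: (cvgr_le _ d_cvg); rewrite subr_gt0.
  - by move=> n t _; rewrite /f; case: ifP; rewrite ?normr0.
have g0 : \int[lebesgue_measure]_(t in `]0, 1[) g t = 0 by exact: (cvg_unique _ c c').
have : \int[lebesgue_measure]_(t in `]0, 1[) g t =
  (b + 1 - a) * (\int[lebesgue_measure]_(t in `]0, 1[) (w t * (1 - t))) -
  b * \int[lebesgue_measure]_(t in `]0, 1[) w t.
  rewrite -!RintegralZl// -RintegralB//.
    exact: (@integrableZl _ _ R lebesgue_measure _ (measurable_itv _) (b + 1 - a) _ ig2).
  exact: (@integrableZl _ _ R lebesgue_measure _ (measurable_itv _) b _ ig1).
by rewrite g0 => h; apply/eqP; rewrite -subr_eq0; apply/eqP.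
Unshelve. all: by end_near. Qed.

(** The factors are [1 - d / (c * i + x + d)], and the harmonic series
    diverges. *)
Lemma prod_ratio_cvg0 (R : realType) (c d x : R) : 0 < c -> 0 < d -> 0 < x ->
  \prod_(i < n) ((c * i%:R + x) / (c * i%:R + x + d)) @[n --> \oo] --> (0 : R).
Proof.
move=> c0 d0 x0.
pose y (i : nat) := c * i%:R + x.
have y0 i : 0 < y i by rewrite ltr_wpDl// mulr_ge0// ltW.
have k0 : 0 < c + x + d by rewrite !addr_gt0.
pose e := d / (c + x + d).
have e0 : 0 < e by rewrite divr_gt0.
have bnd n : \prod_(i < n) (y i / (y i + d)) <= (1 + e * \sum_(i < n) i.+1%:R^-1)^-1.
  elim: n => [|n IH]; first by rewrite !big_ord0 mulr0 addr0 invr1.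
  have h0 : 0 <= \sum_(i < n) i.+1%:R^-1 :> R by rewrite sumr_ge0// => i _; rewrite invr_ge0.
  rewrite !big_ord_recr/=; set S := \sum_(i < n) _ in h0 IH *.
  have p1 : 0 < 1 + e * S by rewrite ltr_pwDl// mulr_ge0// ltW.
  have r1 : y n / (y n + d) <= (1 + e * n.+1%:R^-1)^-1.
    have yn := y0 n.
    have yd : 0 < y n + d by exact: addr_gt0.
    have en : 0 < e * n.+1%:R^-1 by rewrite mulr_gt0// invr_gt0.
    rewrite -[y n / _]invrK invf_div lef_pV2 ?posrE ?(divr_gt0 yd yn) ?(addr_gt0 ltr01 en)//.
    rewrite [leRHS]mulrDl divff ?gt_eqF// lerD2l /e -mulrA ler_pM2l// -invfM.
    rewrite lef_pV2 ?posrE ?mulr_gt0// /y -natr1.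
    by have := ler0n R n; move: c0 x0 d0; nra.
  apply: (@le_trans _ _ ((1 + e * S)^-1 * (1 + e * n.+1%:R^-1)^-1)).
    apply: ler_pM => //; last by rewrite divr_ge0 ?ltW// addr_gt0.
    by apply: prodr_ge0 => i _; rewrite divr_ge0 ?ltW// addr_gt0.
  have q0 : 0 < e * n.+1%:R^-1 by rewrite mulr_gt0// invr_gt0.
  have q1 : 0 < 1 + e * n.+1%:R^-1 by rewrite addr_gt0.
  have q2 : 0 <= (e * S) * (e * n.+1%:R^-1) by apply: mulr_ge0; [apply: mulr_ge0 => //; exact: ltW|exact: ltW].
  rewrite -invfM lef_pV2 ?posrE ?mulr_gt0//.
    rewrite -subr_ge0 (_ : _ - _ = e * S * (e * n.+1%:R^-1))//; ring.
  by rewrite mulrDr addrA addr_gt0.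
have S_oo : 1 + e * \sum_(i < n) i.+1%:R^-1 @[n --> \oo] --> (+oo : set_system R).
  have : series (@harmonic R) n @[n --> \oo] --> +oo.
    apply: nondecreasing_dvgn_lt (@dvg_harmonic R) => m n mn.
    by rewrite /series/= (big_cat_nat (leq0n m) mn)/= lerDl; apply: sumr_ge0.
  move=> hoo; apply/cvgryPge => A.
  have : \forall n \near \oo, `|A| / e <= series (@harmonic R) n by exact: (cvgryPge _).1 hoo _.
  apply: filterS => n; rewrite /series/= big_mkord ler_pdivrMr// mulrC => h.
  by rewrite (le_trans (ler_norm A))// (le_trans h)// lerDr.
have i0 : (1 + e * \sum_(i < n) i.+1%:R^-1)^-1 @[n --> \oo] --> (0 : R).
  apply/gtr0_cvgV0 => //; apply: nearW => n.
  by apply: ltr_pwDl => //; apply: mulr_ge0; [exact: ltW|exact: sumr_ge0].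
apply: (squeeze_cvgr _ (cvg_cst 0) i0); apply: nearW => n; rewrite bnd andbT.
by apply: prodr_ge0 => i _; exact: (divr_ge0 (ltW (y0 i)) (ltW (addr_gt0 (y0 i) d0))).
Qed.


(** * The size-biased chain and its limit *)

Section chain.
Context (R : realType) (l : R -> R) (eta : R).
Hypothesis l_gt0 : forall x, 0 < l x.
Hypothesis l_potter : potter eta l.
Hypothesis l_flat : asymptotically_flat l.
Context (alpha cF : R) (F : nat -> R) (u : nat -> nat -> R) (bet : nat -> R).
Hypothesis alpha01 : 0 <= alpha < 1.
Hypothesis F_ge0 : forall k, 0 <= F k.
Hypothesis cF_gt0 : 0 < cF.
Hypothesis F_cvg : F k * k.+1%:R `^ alpha @[k --> \oo] --> cF.
Hypothesis u_ge0 : forall r m, 0 <= u r m.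
Hypothesis u_rv : forall r, exists2 c, 0 < c & regularly_varying l (bet r - 1) c (u r).
Hypothesis eta_bet : forall r, eta < bet r.+1.
Hypothesis size_bias : forall r m,
  m.+1%:R * u r m.+1 = \sum_(k < m.+1) F k * u r.+1 (m - k)%N.

Definition beta_weight (r : nat) (t : R) : R := t `^ (- alpha) * (1 - t) `^ (bet r.+1 - 1).

Definition beta_mass (r : nat) : R := \int[lebesgue_measure]_(t in `]0, 1[) beta_weight r t.

Definition beta_mean (r : nat) (H : R -> R) : R :=
  (\int[lebesgue_measure]_(t in `]0, 1[) (beta_weight r t * H t)) / beta_mass r.

(** Mass of the size-biased chain run for at most [n] steps from [m], with [g]
    as terminal payoff; the phi-values of the revealed sizes are accumulated in
    [s]. *)
Fixpoint chain_mass (phi : nat -> R) (g : nat -> R -> R) (n r m : nat) (s : R) : R :=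
  match n, m with
  | n'.+1, m'.+1 => m%:R^-1 *
      \sum_(k < m) F k * chain_mass phi g n' r.+1 (m' - k) (s + phi k.+1)
  | _, _ => u r m * g m s
  end.

(** The same recursion for the limit, in which the fraction taken off the
    remaining length [y] is beta distributed. *)
Fixpoint chain_lim (psi : R -> R) (g : R -> R -> R) (n r : nat) (y s : R) : R :=
  if n is n'.+1 then
    beta_mean r (fun t => chain_lim psi g n' r.+1 (y * (1 - t)) (s + psi (y * t)))
  else g y s.

(** Continuous convergence: the natural mode for a chain whose starting point
    depends on [n] as well. *)
Definition cvg_along (f_ : nat -> nat -> R -> R) (f : R -> R -> R) :=
  forall (m : nat -> nat) (s : nat -> R) (y t : R), (forall n, (m n <= n)%N) -> 0 < y ->
    (m n)%:R / n%:R @[n --> \oo] --> y -> s n @[n --> \oo] --> t ->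
    f_ n (m n) (s n) @[n --> \oo] --> f y t.

Let ratio_cvgy (m : nat -> nat) (y : R) : 0 < y ->
  (m n)%:R / n%:R @[n --> \oo] --> y -> m n @[n --> \oo] --> \oo.
Proof.
move=> y0 my; have noo : n%:R @[n --> \oo] --> (+oo : set_system R) by exact: cvgr_idn.
apply: (nat_cvgy_of_ratio noo y0).
have i0 : n%:R^-1 @[n --> \oo] --> (0 : R).
  by apply/gtr0_cvgV0 => //; near=> n; rewrite ltr0n; near: n; exact: nbhs_infty_gt.
rewrite -[X in _ --> X]addr0; apply: cvg_trans (cvgD my i0).
by apply: near_eq_cvg; apply: nearW => n /=; rewrite -natr1 mulrDl mul1r.
Unshelve. all: by end_near. Qed.

Let u_pos r : \forall m \near \oo, 0 < u r m.
Proof.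
have [c c0 rv] := u_rv r.
have : \forall m \near \oo, 0 < u r m / rv_ref l (bet r - 1) m by exact: (cvgr_gt _ rv).
apply: filterS => m.
by rewrite pmulr_lgt0// invr_gt0 rv_ref_gt0.
Qed.

(** Integrability of the beta weight is part of the limit theorem for
    convolutions. *)
Lemma beta_mass_gt0 r : 0 < beta_mass r /\
  lebesgue_measure.-integrable (`]0, 1[%classic : set R) (fun t => (beta_weight r t)%:E).
Proof.
have [c c0 rv] := u_rv r.+1.
have [ig _] := convolution_cvg l_gt0 l_potter l_flat alpha01 (eta_bet r) F_ge0
  (u_ge0 r.+1) cF_gt0 c0 F_cvg rv (h := fun _ _ => 1) (H := fun=> 1)
  (M := 1) succn_cvgy (fun _ _ => introT andP (conj ler01 (lexx (1 : R))))
  (fun t _ => cvg_cst (1 : R)).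
have ig' : lebesgue_measure.-integrable (`]0, 1[%classic : set R) (fun t => (beta_weight r t)%:E).
  by apply: (eq_integrable _ _ _ _ ig) => // t _; rewrite mulr1.
split => //; apply: beta_int_gt0 => //; by case/andP: alpha01.
Qed.

(** One step of the chain: a size [k.+1] has weight
    [F k * u r.+1 (m - 1 - k)], which is asymptotically the beta weight
    at [k / m]. *)
Lemma chain_step_cvg (r : nat) (f_ : nat -> nat -> R -> R) (f : R -> R -> R) (psi : R -> R) (M : R)
    (m : nat -> nat) (s : nat -> R) (y t : R) :
  cvg_along f_ f -> (forall n m s, (m <= n)%N -> 0 <= f_ n m s <= M) ->
  (forall x, 0 < x -> {for x, continuous psi}) ->
  (forall n, (m n <= n)%N) -> 0 < y ->
  (m n)%:R / n%:R @[n --> \oo] --> y -> s n @[n --> \oo] --> t ->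
  lebesgue_measure.-integrable (`]0, 1[%classic : set R)
    (fun x => (beta_weight r x * f (y * (1 - x)) (t + psi (y * x)))%:E) /\
  (\sum_(k < m n) F k * u r.+1 (m n - 1 - k)%N * f_ n (m n - 1 - k)%N (s n + psi (k.+1%:R / n%:R)))
    / (\sum_(k < m n) F k * u r.+1 (m n - 1 - k)%N) @[n --> \oo] -->
  beta_mean r (fun x => f (y * (1 - x)) (t + psi (y * x))).
Proof.
move=> ff fM cpsi mn y0 my st.
have moo := ratio_cvgy y0 my.
have moR : (m n)%:R @[n --> \oo] --> (+oo : set_system R).
  by apply: cvg_comp moo _; exact: cvgr_idn.
have mpos : \forall n \near \oo, (0 < m n)%N by exact: (cvgnyPgt _).1 moo 0%N.
have [c c0 rv] := u_rv r.+1.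
have [_ c1] := convolution_cvg l_gt0 l_potter l_flat alpha01 (eta_bet r) F_ge0
  (u_ge0 r.+1) cF_gt0 c0 F_cvg rv (h := fun _ _ => 1) (H := fun=> 1)
  (M := 1) moo (fun _ _ => introT andP (conj ler01 (lexx (1 : R))))
  (fun t _ => cvg_cst (1 : R)).
have hM n k : 0 <= f_ n (m n - 1 - k)%N (s n + psi (k.+1%:R / n%:R)) <= M.
  by apply: fM; rewrite (leq_trans _ (mn n))// -subnDA leq_subr.
have hcv x : 0 < x < 1 -> (fun n k => f_ n (m n - 1 - k)%N (s n + psi (k.+1%:R / n%:R)))
    n (Num.truncn ((m n)%:R * x)) @[n --> \oo] --> f (y * (1 - x)) (t + psi (y * x)).
  move=> /andP[x0 x1] /=.
  pose k n := Num.truncn ((m n)%:R * x).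
  have kt : (k n).+1%:R / (m n)%:R @[n --> \oo] --> x by exact: truncn_ratio_cvg moR (ltW x0).
  have km : \forall n \near \oo, (k n < m n)%N.
    near=> n; have m0 : (0 < m n)%N by near: n.
    have mR : 0 < (m n)%:R :> R by rewrite ltr0n.
    have /andP[k1 _] := truncn_itv (mulr_ge0 (ltW mR) (ltW x0)).
    by rewrite -(ltr_nat R) (le_lt_trans k1)// gtr_pMr.
  apply: (ff (fun n => (m n - 1 - k n)%N)).
  - by move=> n; rewrite (leq_trans _ (mn n))// -subnDA leq_subr.
  - by rewrite mulr_gt0// subr_gt0.
  - apply: cvg_trans (cvgM my (cvgB (cvg_cst (1 : R)) kt)).
    apply: near_eq_cvg; near=> n; rewrite /=.
    have m0 : (m n)%:R != 0 :> R by rewrite pnatr_eq0 -lt0n; near: n.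
    have kn : (k n < m n)%N by near: n.
    rewrite -subnDA add1n natrB// fctE/= mulrAC; congr (_ / _).
    by rewrite mulrBr mulr1 mulrC divfK.
  apply: cvgD => //; apply: (cvg_comp _ psi); last by apply: cpsi; rewrite mulr_gt0.
  apply: cvg_trans (cvgM my kt); apply: near_eq_cvg; near=> n.
  have m0 : (m n)%:R != 0 :> R by rewrite pnatr_eq0 -lt0n; near: n.
  by rewrite /= mulrC mulrA divfK.
have [ig c2] := convolution_cvg l_gt0 l_potter l_flat alpha01 (eta_bet r) F_ge0
  (u_ge0 r.+1) cF_gt0 c0 F_cvg rv moo hM hcv.
split; first exact: ig.
have [b0 _] := beta_mass_gt0 r.
have b0' : 0 < \int[lebesgue_measure]_(t in `]0, 1[) (t `^ (- alpha) * (1 - t) `^ (bet r.+1 - 1) * 1).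
  by apply: lt_le_trans b0 _; rewrite le_eqVlt; apply/orP; left; apply/eqP;
     apply: eq_Rintegral => z _; rewrite mulr1.
have d0 : cF * c * \int[lebesgue_measure]_(t in `]0, 1[)
    (t `^ (- alpha) * (1 - t) `^ (bet r.+1 - 1) * 1) != 0.
  by rewrite gt_eqF//; apply: mulr_gt0 b0'; exact: mulr_gt0.
rewrite /beta_mean.
have -> : beta_mass r = \int[lebesgue_measure]_(t in `]0, 1[)
    (t `^ (- alpha) * (1 - t) `^ (bet r.+1 - 1) * 1).
  by apply: eq_Rintegral => z _; rewrite mulr1.
have cc : cF * c != 0 by rewrite gt_eqF// mulr_gt0.
rewrite -[X in X / _](mulKf cc) -[X in _ / X](mulKf cc) -mulf_div divff ?invr_eq0// mul1r.
apply: cvg_trans (cvgM c2 (cvgV d0 c1)); apply: near_eq_cvg; near=> n.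
have m0 : 0 < (m n)%:R :> R by rewrite ltr0n; near: n.
rewrite /= -mulf_div divff ?mul1r.
  by congr (_ / _); apply: eq_bigr => k _; rewrite mulr1.
by rewrite gt_eqF// divr_gt0// powR_gt0.
Unshelve. all: by end_near. Qed.

Lemma chain_mass_bound phi g M N n r m s : (forall m s, (m <= N)%N -> 0 <= g m s <= M) ->
  (m <= N)%N -> 0 <= chain_mass phi g n r m s <= M * u r m.
Proof.
move=> gM; elim: n r m s => [|n IH] r m s mN /=.
  by have /andP[g0 g1] := gM m s mN; case: m mN g0 g1 => [|m] mN g0 g1;
     rewrite mulr_ge0//= mulrC ler_wpM2r.
case: m mN => [|m] mN.
  by have /andP[g0 g1] := gM 0%N s mN; rewrite mulr_ge0//= mulrC ler_wpM2r.
have m0 : 0 < m.+1%:R :> R by rewrite ltr0n.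
have IH' (k : 'I_m.+1) := IH r.+1 (m - k)%N (s + phi k.+1) (leq_trans (leq_subr k m) (ltnW mN)).
apply/andP; split.
  apply: mulr_ge0; first by rewrite invr_ge0 ltW.
  by apply: sumr_ge0 => k _; apply: mulr_ge0 => //; case/andP: (IH' k).
rewrite ler_pdivrMl// mulrCA size_bias mulr_sumr; apply: ler_sum => k _.
by rewrite mulrCA ler_wpM2l//; case/andP: (IH' k).
Qed.

(** Induction on the number of steps; continuous convergence is what the
    induction hypothesis has to provide at the random position after one
    step. *)
Lemma chain_mass_cvg (psi : R -> R) (g_ : nat -> nat -> R -> R) (g : R -> R -> R) (M : R) (n r : nat) :
  cvg_along g_ g -> (forall n m s, (m <= n)%N -> 0 <= g_ n m s <= M) ->
  (forall x, 0 < x -> {for x, continuous psi}) ->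
  cvg_along (fun N m s => chain_mass (fun x => psi (x%:R / N%:R)) (g_ N) n r m s / u r m)
    (chain_lim psi g n r).
Proof.
move=> gg gM cpsi; elim: n r => [|n IH] r m s y t mN y0 my st.
  apply: cvg_trans (gg m s y t mN y0 my st); apply: near_eq_cvg.
  have := ratio_cvgy y0 my => moo.
  have : \forall N \near \oo, 0 < u r (m N) by exact: (moo _ (u_pos r)).
  apply: filterS => N u0; rewrite /=; case: (m N) u0 => [|k] u0; by rewrite mulrC mulKf// gt_eqF.
have bd N k z : (k <= N)%N ->
    0 <= chain_mass (fun x => psi (x%:R / N%:R)) (g_ N) n r.+1 k z / u r.+1 k <= M.
  move=> kN; have /andP[h0 h1] := chain_mass_bound (fun x => psi (x%:R / N%:R)) n r.+1 z (gM N) kN.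
  rewrite divr_ge0//=; have := u_ge0 r.+1 k; rewrite le_eqVlt => /orP[/eqP <-|u0].
    have /andP[g0 g1] := gM N k z kN.
    by rewrite invr0 mulr0 (le_trans g0).
  by rewrite ler_pdivrMr.
have [_ c] := @chain_step_cvg r _ _ psi M m s y t (IH r.+1) bd cpsi mN y0 my st.
apply: cvg_trans c; apply: near_eq_cvg.
have moo := ratio_cvgy y0 my.
have mpos : \forall n \near \oo, (0 < m n)%N by exact: (cvgnyPgt _).1 moo 0%N.
apply: filterS mpos => N; move: (mN N); case: (m N) => // k kN _.
rewrite /= subn1/= -size_bias.
transitivity ((\sum_(i < k.+1) F i * chain_mass (fun x => psi (x%:R / N%:R)) (g_ N) n r.+1 (k - i)
   (s N + psi (i.+1%:R / N%:R))) / (k.+1%:R * u r k.+1)).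
  congr (_ / _); apply: eq_bigr => i _; rewrite -mulrA; congr (_ * _).
  have := u_ge0 r.+1 (k - i)%N; rewrite le_eqVlt => /orP[/eqP u0|u0]; last first.
    by rewrite mulrC divfK// gt_eqF.
  rewrite -u0 mul0r.
  have ki : (k - i <= N)%N by rewrite (leq_trans (leq_subr _ _) (ltnW kN)).
  have /andP[h0 h1] := chain_mass_bound (fun x => psi (x%:R / N%:R)) n r.+1
    (s N + psi (i.+1%:R / N%:R)) (gM N) ki.
  by apply/eqP; rewrite eq_le h0/=; move: h1; rewrite -u0 mulr0.
by rewrite invfM; ring.
Qed.

Lemma chain_lim_integrable (psi : R -> R) (g_ : nat -> nat -> R -> R) (g : R -> R -> R) (M : R)
    (n r : nat) (y t : R) :
  cvg_along g_ g -> (forall n m s, (m <= n)%N -> 0 <= g_ n m s <= M) ->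
  (forall x, 0 < x -> {for x, continuous psi}) -> 0 < y <= 1 ->
  lebesgue_measure.-integrable (`]0, 1[%classic : set R)
    (fun x => (beta_weight r x * chain_lim psi g n r.+1 (y * (1 - x)) (t + psi (y * x)))%:E).
Proof.
move=> gg gM cpsi /andP[y0 y1].
have bd N k z : (k <= N)%N ->
    0 <= chain_mass (fun x => psi (x%:R / N%:R)) (g_ N) n r.+1 k z / u r.+1 k <= M.
  move=> kN; have /andP[h0 h1] := chain_mass_bound (fun x => psi (x%:R / N%:R)) n r.+1 z (gM N) kN.
  rewrite divr_ge0//=; have := u_ge0 r.+1 k; rewrite le_eqVlt => /orP[/eqP <-|u0].
    have /andP[g0 g1] := gM N k z kN.
    by rewrite invr0 mulr0 (le_trans g0).
  by rewrite ler_pdivrMr.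
have mN N : (Num.truncn (N%:R * y) <= N)%N.
  have /andP[h _] := truncn_itv (mulr_ge0 (ler0n R N) (ltW y0)).
  by rewrite -(ler_nat R) (le_trans h)// ler_piMr.
have my : (Num.truncn (N%:R * y))%:R / N%:R @[N --> \oo] --> y.
  have i0 : n%:R^-1 @[n --> \oo] --> (0 : R).
    by apply/gtr0_cvgV0; [near=> N; rewrite ltr0n; near: N; exact: nbhs_infty_gt|exact: cvgr_idn].
  have := truncn_ratio_cvg (@cvgr_idn R) (ltW y0) => c.
  rewrite -[X in _ --> X]subr0; apply: cvg_trans (cvgB c i0).
  by apply: near_eq_cvg; apply: nearW => N; rewrite !fctE/= -natr1 mulrDl mul1r addrK.
by have [] := @chain_step_cvg r _ _ psi M _ (fun=> t) y t (@chain_mass_cvg psi g_ g M n r.+1 gg gM cpsi) bd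
  cpsi mN y0 my (cvg_cst t).
Unshelve. all: by end_near. Qed.

Definition residual_mean (r : nat) : R := beta_mean r (fun t => 1 - t).

Lemma cvg_along_linear : cvg_along (fun N m _ => m%:R / N%:R) (fun y _ => y).
Proof. by []. Qed.

Lemma linear_payoff_bound (N m : nat) (s : R) : (m <= N)%N ->
  0 <= (m%:R / N%:R : R) <= 1.
Proof.
move=> mN; rewrite divr_ge0//=; case: N mN => [|N] mN; first by rewrite invr0 mulr0 ler01.
by rewrite ler_pdivrMr// mul1r ler_nat.
Qed.

Lemma residual_integrable r : lebesgue_measure.-integrable (`]0, 1[%classic : set R)
  (fun t => (beta_weight r t * (1 - t))%:E).
Proof.
have c0 (x : R) : 0 < x -> {for x, continuous (fun=> 0 : R)}.
  by move=> _; exact: cst_continuous.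
have y1 : 0 < (1 : R) <= 1 by rewrite ltr01 lexx.
have := @chain_lim_integrable (fun=> 0) _ _ 1 0 r 1 0 cvg_along_linear linear_payoff_bound c0 y1.
by apply: eq_integrable => // x _ /=; rewrite mul1r.
Qed.

(** The mean remaining length is multiplicative. *)
Lemma chain_lim_linear psi n r y s :
  chain_lim psi (fun y _ => y) n r y s = y * \prod_(i < n) residual_mean (r + i)%N.
Proof.
elim: n r y s => [|n IH] r y s /=; first by rewrite big_ord0 mulr1.
rewrite big_ord_recl addn0 /residual_mean /beta_mean.
under eq_Rintegral do rewrite IH.
set c := \prod_(i < n) _.
rewrite (_ : \int[_]_(t in _) _ = \int[lebesgue_measure]_(t in `]0, 1[)
    (y * c * (beta_weight r t * (1 - t)))); last first.
  by apply: eq_Rintegral => t _; ring.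
rewrite RintegralZl//; last exact: residual_integrable.
have -> : \prod_(i < n) ((\int[lebesgue_measure]_(t in `]0, 1[)
    (beta_weight (r + lift ord0 i) t * (1 - t))) / beta_mass (r + lift ord0 i)) = c.
  by apply: eq_bigr => i _; rewrite lift0 -addSnnS.
by ring.
Qed.

Lemma residual_meanE r : 0 < bet r.+1 ->
  residual_mean r = bet r.+1 / (bet r.+1 + 1 - alpha).
Proof.
move=> b0; have [m0 ig] := beta_mass_gt0 r.
have H := beta_recursion alpha01 b0 ig (residual_integrable r).
have [_ a1] := andP alpha01.
have d0 : 0 < bet r.+1 + 1 - alpha by move: a1 b0; lra.
rewrite /residual_mean /beta_mean.
rewrite -[X in X / _ = _](mulKf (lt0r_neq0 d0)) (H : _ = _ * beta_mass r).
by field; rewrite !gt_eqF.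
Qed.

End chain.


(** * The chain of a Gibbs partition *)

Section gibbs_chain.
Context (R : realType) (l : R -> R) (eta : R).
Hypothesis l_gt0 : forall x, 0 < l x.
Hypothesis l_potter : potter eta l.
Hypothesis l_flat : asymptotically_flat l.
Hypothesis eta_gt0 : 0 < eta.
Context (alpha b cp : R) (p a : nat -> R).
Hypothesis alpha01 : 0 < alpha < 1.
Hypothesis b12 : 1 < b < 2.
Hypothesis eta_small : eta < alpha * (2 - b).
Hypothesis p_ge0 : forall x, 0 <= p x.
Hypothesis p_sum : (\sum_(0 <= x <oo) (p x)%:E = 1)%E.
Hypothesis cp_gt0 : 0 < cp.
Hypothesis p_cvg : p k.+1 * k.+1%:R `^ (1 + alpha) @[k --> \oo] --> cp.
Hypothesis a_ge0 : forall k, 0 <= a k.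
Hypothesis a_rv : regularly_varying l (- b) 1 (fun k => a k.+1).

Let L := power_arg l alpha.
Let L_gt0 x : 0 < L x. Proof. exact: l_gt0. Qed.
Let L_potter : potter eta L. Proof. exact: power_arg_potter. Qed.
Let L_flat : asymptotically_flat L. Proof. exact: (power_arg_flat alpha01). Qed.

Definition jump_weight (k : nat) : R := k.+1%:R * p k.+1.

(** Total weight of the unrevealed components after [r] of them have been
    revealed in size-biased order. *)
Definition gibbs_weight (r : nat) : nat -> R := pw_mix (descend a r) p.

(** The second parameter of the beta law of the fraction taken at step [r] is
    [stick_exponent r.+1], the first one being [1 - alpha]. *)
Definition stick_exponent (r : nat) : R := alpha * (r%:R + 1 - b).

Lemma jump_weight_ge0 k : 0 <= jump_weight k.
Proof. by rewrite mulr_ge0. Qed.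

Lemma jump_weight_cvg : jump_weight k * k.+1%:R `^ alpha @[k --> \oo] --> cp.
Proof.
apply: cvg_trans p_cvg; apply: near_eq_cvg; apply: nearW => k /=.
have k0 : 0 < k.+1%:R :> R by rewrite ltr0n.
by rewrite powRD ?(gt_eqF k0) ?implybT// powRr1// /jump_weight; ring.
Qed.

Lemma gibbs_weight_fin r m : (\sum_(0 <= j <oo) (descend a r j * pw p j m)%:E < +oo)%E.
Proof. exact: (descend_pw_fin l_gt0 l_potter l_flat eta_gt0 alpha01 b12 eta_small p_ge0 p_sum
  cp_gt0 p_cvg a_ge0 a_rv). Qed.

Lemma gibbs_weight_ge0 r m : 0 <= gibbs_weight r m.
Proof. by apply: pw_mix_ge0 => // j; exact: descend_ge0. Qed.

Lemma gibbs_weight_rv r : exists2 c, 0 < c & regularly_varying L (stick_exponent r - 1) c (gibbs_weight r).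
Proof. exact: (pw_mix_regularly_varying l_gt0 l_potter l_flat eta_gt0 alpha01 b12 eta_small p_ge0
  p_sum cp_gt0 p_cvg a_ge0 a_rv). Qed.

Lemma stick_exponent_gt r : eta < stick_exponent r.+1.
Proof.
apply: lt_le_trans eta_small _; rewrite /stick_exponent ler_pM2l; last by case/andP: alpha01.
by rewrite -natr1; have := ler0n R r; lra.
Qed.

Lemma gibbs_weight_size_bias r m :
  m.+1%:R * gibbs_weight r m.+1 = \sum_(k < m.+1) jump_weight k * gibbs_weight r.+1 (m - k)%N.
Proof.
rewrite /gibbs_weight pw_mix_size_bias//; last by move=> *; exact: gibbs_weight_fin.
by rewrite big_ord_recl/= !mul0r add0r.
Qed.

Lemma alpha_itv : 0 <= alpha < 1.
Proof. by case/andP: alpha01 => a0 ->; rewrite ltW. Qed.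

Local Notation mass := (chain_mass jump_weight gibbs_weight).

(** Stopping after [n] steps changes the payoff only if an unrevealed component
    has size at least [d * N]; the mass of this event is at most the remaining
    length divided by [d], by Markov's inequality. *)
Lemma chain_error (G : R -> R) (M d : R) (phi : nat -> R) (N n r m : nat) (s : R) :
  (forall s, 0 <= G s <= M) -> 0 < d -> (0 < N)%N ->
  (forall x, x%:R < d * N%:R -> phi x = 0) ->
  `|seq_mix (descend a r) p phi G m s - mass phi (fun _ s => G s) n r m s| <=
    M / d * mass phi (fun m _ => m%:R / N%:R) n r m s.
Proof.
move=> GM d0 N0 phi0.
have G0 t : 0 <= G t by case/andP: (GM t).
have NR : 0 < N%:R :> R by rewrite ltr0n.
have A0 r' j := descend_ge0 r' j a_ge0.
have base r' m' s' : `|seq_mix (descend a r') p phi G m' s' - gibbs_weight r' m' * G s'| <=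
    M / d * (gibbs_weight r' m' * (m'%:R / N%:R)).
  have u0 := gibbs_weight_ge0 r' m'.
  have [md|dm] := ltP (m'%:R : R) (d * N%:R).
    rewrite (@seq_mix_no_jump R _ _ _ _ m' s' p_ge0 (A0 r') (G0 s') (gibbs_weight_fin r' m')); last first.
      by move=> x xm; apply: phi0; rewrite (le_lt_trans _ md)// ler_nat.
    rewrite mulrC subrr normr0 mulr_ge0//.
      by rewrite divr_ge0 ?(ltW d0)// (le_trans (G0 0))//; case/andP: (GM 0).
    by rewrite mulr_ge0// divr_ge0.
  have M0 : 0 <= M by rewrite (le_trans (G0 0))//; case/andP: (GM 0).
  apply: (@le_trans _ _ (M * gibbs_weight r' m')).
    have h1 := seq_mix_le (A0 r') p_ge0 (gibbs_weight_fin r') phi GM m' s'.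
    have h0 := seq_mix_ge0 (A0 r') p_ge0 phi GM m' s'.
    have /andP[g0 g1] := GM s'.
    have : gibbs_weight r' m' * G s' <= M * gibbs_weight r' m' by rewrite mulrC ler_wpM2r.
    have : 0 <= gibbs_weight r' m' * G s' by rewrite mulr_ge0.
    rewrite -/(gibbs_weight r' m') in h1.
    by rewrite ler_norml; move: h0 h1; lra.
  rewrite -mulrA ler_wpM2l// mulrCA -[leLHS]mulr1 ler_wpM2l//.
  by rewrite -ler_pdivrMl ?invr_gt0// invrK mulr1 ler_pdivlMr.
elim: n r m s => [|n IH] r m s; first by case: m => [|m]; exact: base.
case: m => [|m]; first exact: base.
have m0 : 0 < m.+1%:R :> R by rewrite ltr0n.
have HE : seq_mix (descend a r) p phi G m.+1 s = m.+1%:R^-1 *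
    \sum_(k < m.+1) jump_weight k * seq_mix (descend a r.+1) p phi G (m - k) (s + phi k.+1).
  rewrite -[LHS](mulKf (lt0r_neq0 m0)); congr (_ * _).
  rewrite (@seq_mix_size_bias R a p phi G M r m.+1 s a_ge0 p_ge0 GM); last by move=> *; exact: gibbs_weight_fin.
  by rewrite big_ord_recl/= !mul0r add0r.
rewrite /= HE -mulrBr -sumrB normrM ger0_norm ?invr_ge0 ?(ltW m0)//.
rewrite mulrCA ler_wpM2l ?invr_ge0 ?(ltW m0)// mulr_sumr.
rewrite (le_trans (ler_norm_sum _ _ _))//; apply: ler_sum => k _.
rewrite -mulrBr normrM ger0_norm ?jump_weight_ge0// mulrCA ler_wpM2l ?jump_weight_ge0//.
Qed.

(** The mean remaining length after [n] steps is a product of ratios with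
    harmonically decaying defects. *)
Lemma residual_product_cvg0 : \prod_(i < n) residual_mean alpha stick_exponent i @[n --> \oo] --> (0 : R).
Proof.
have [a0 a1] := andP alpha01; have [b1 b2] := andP b12.
have x0 : 0 < alpha * (2 - b) by rewrite mulr_gt0// subr_gt0.
have d0 : 0 < 1 - alpha by rewrite subr_gt0.
have := prod_ratio_cvg0 a0 d0 x0; apply: cvg_trans; apply: near_eq_cvg; apply: nearW => n.
apply: eq_bigr => i _.
have be : stick_exponent i.+1 = alpha * i%:R + alpha * (2 - b).
  by rewrite /stick_exponent -natr1; ring.
rewrite (residual_meanE L_gt0 L_potter L_flat alpha_itv jump_weight_ge0 cp_gt0 jump_weight_cvg
  gibbs_weight_ge0 gibbs_weight_rv stick_exponent_gt gibbs_weight_size_bias); last first.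
  by rewrite (lt_trans eta_gt0)// stick_exponent_gt.
by rewrite be addrA.
Qed.

(** Finitely many steps converge by [chain_mass_cvg]; the error of stopping is
    [chain_error], itself controlled by the limit of the mean remaining
    length. *)
Lemma gibbs_chain_cvg (G psi : R -> R) (M d e : R) (n : nat) :
  continuous G -> (forall s, 0 <= G s <= M) ->
  (forall x, 0 < x -> {for x, continuous psi}) -> 0 < d -> (forall x, x < d -> psi x = 0) -> 0 < e ->
  \forall N \near \oo,
    `|seq_mix (descend a 0) p (fun x => psi (x%:R / N%:R)) G N 0 / gibbs_weight 0 N -
      chain_lim alpha stick_exponent psi (fun _ s => G s) n 0 1 0| <=
    M / d * \prod_(i < n) residual_mean alpha stick_exponent i + e.
Proof.
move=> cG GM cpsi d0 psi0 e0.
have M0 : 0 <= M by have /andP[g0 g1] := GM 0; exact: le_trans g1.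
have G_along : cvg_along (fun (_ _ : nat) s => G s) (fun _ s => G s).
  by move=> m s y t _ _ _ st; exact: (cvg_comp _ _ st (cG t)).
have one : (N%:R / N%:R : R) @[N --> \oo] --> (1 : R).
  apply: cvg_near_cst; near=> N; rewrite divff// pnatr_eq0 -lt0n.
  by near: N; exact: nbhs_infty_gt.
have cc := chain_mass_cvg L_gt0 L_potter L_flat alpha_itv jump_weight_ge0 cp_gt0 jump_weight_cvg
  gibbs_weight_ge0 gibbs_weight_rv stick_exponent_gt gibbs_weight_size_bias.
have c1 : mass (fun x => psi (x%:R / N%:R)) (fun _ s => G s) n 0 N 0 / gibbs_weight 0 N
    @[N --> \oo] --> chain_lim alpha stick_exponent psi (fun _ s => G s) n 0 1 0.
  exact: (cc psi _ _ M n 0%N G_along (fun _ _ s _ => GM s) cpsi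
  id (fun=> 0) 1 0 (fun N => leqnn N) ltr01 one (cvg_cst 0)).
have c2 : mass (fun x => psi (x%:R / N%:R)) (fun m _ => m%:R / N%:R) n 0 N 0 / gibbs_weight 0 N
    @[N --> \oo] --> chain_lim alpha stick_exponent psi (fun y _ => y) n 0 1 0.
  exact: (cc psi _ _ 1 n 0%N (@cvg_along_linear R) (@linear_payoff_bound R) cpsi
  id (fun=> 0) 1 0 (fun N => leqnn N) ltr01 one (cvg_cst 0)).
rewrite (chain_lim_linear L_gt0 L_potter L_flat alpha_itv jump_weight_ge0 cp_gt0 jump_weight_cvg
  gibbs_weight_ge0 gibbs_weight_rv stick_exponent_gt gibbs_weight_size_bias) mul1r in c2.
have Md : 0 <= M / d by rewrite divr_ge0// ltW.
have e1 : 0 < e / 2 by rewrite divr_gt0.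
have e2 : 0 < e / 2 / (M / d + 1) by rewrite divr_gt0// ltr_wpDl.
have [/cvgrPdist_le/(_ _ e1) d1 /cvgrPdist_le/(_ _ e2) d2] := conj c1 c2.
near=> N.
have N0 : (0 < N)%N by near: N; exact: nbhs_infty_gt.
have NR : 0 < N%:R :> R by rewrite ltr0n.
have : `|chain_lim alpha stick_exponent psi (fun _ s => G s) n 0 1 0 -
  mass (fun x => psi (x%:R / N%:R)) (fun _ s => G s) n 0 N 0 / gibbs_weight 0 N| <= e / 2 by near: N.
have : `|\prod_(i < n) residual_mean alpha stick_exponent (0 + i) -
  mass (fun x => psi (x%:R / N%:R)) (fun m _ => m%:R / N%:R) n 0 N 0 / gibbs_weight 0 N| <=
  e / 2 / (M / d + 1) by near: N.
set C := chain_lim _ _ _ _ _ _ _ _; set A := mass _ (fun _ s => G s) _ _ _ _.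
set B := mass _ _ _ _ _ _; set u := gibbs_weight 0 N; set H := seq_mix _ _ _ _ _ _.
set Pi := \prod_(i < n) _ => h2 h1.
have h3 : `|H - A| <= M / d * B.
  apply: chain_error => // x xd; apply: psi0.
  by rewrite ltr_pdivrMr.
have u0 : 0 <= u^-1 by rewrite invr_ge0 gibbs_weight_ge0.
have h4 : `|H / u - A / u| <= M / d * (B / u).
  by rewrite -mulrBl normrM (ger0_norm u0) mulrA ler_wpM2r.
have h5 : M / d * (B / u) <= M / d * Pi + e / 2.
  apply: (@le_trans _ _ (M / d * (Pi + e / 2 / (M / d + 1)))).
    by rewrite ler_wpM2l//; move: h2; rewrite ler_norml => /andP[]; lra.
  rewrite mulrDr lerD2l mulrCA -[leRHS]mulr1 ler_wpM2l ?(ltW e1)//.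
  by rewrite ler_pdivrMr ?ltr_wpDl// mul1r lerDl.
rewrite -/Pi.
have -> : H / u - C = (H / u - A / u) - (C - A / u) by ring.
rewrite (le_trans (ler_normB _ _))//.
by move: h1 h4 h5; lra.
Unshelve. all: by end_near. Qed.

End gibbs_chain.


(** * Two independent uniform variables from one *)

(** Rays generate the Borel sets and are stable under intersection. *)
Lemma finite_measure_rays_unique (R : realType)
    (m1 m2 : {measure set (measurableTypeR R) -> \bar R}) :
  (forall x : R, m1 (`]-oo, x[%classic : set (measurableTypeR R)) = m2 (`]-oo, x[%classic)) ->
  (forall x : R, (m1 (`]-oo, x[%classic : set (measurableTypeR R)) < +oo)%E) ->
  forall A : set (measurableTypeR R), measurable A -> m1 A = m2 A.
Proof.
move=> m12 fin A mA.
pose G : set (set (measurableTypeR R)) := @RGenInftyO.G R.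
pose g (n : nat) : set (measurableTypeR R) := `]-oo, n%:R[%classic.
apply: (@g_sigma_algebra_measure_unique _ R (measurableTypeR R) G _ g).
- by move=> _ [x ->]; exact: measurable_itv.
- by move=> n; exists n%:R.
- rewrite -subTset => x _; exists (Num.truncn `|x|).+1 => //; rewrite /g/= in_itv/=.
  by rewrite (le_lt_trans (ler_norm x))//; have /andP[] := truncn_itv (normr_ge0 x).
- move=> _ _ [x ->] [y ->]; exists (Num.min x y).
  by apply/seteqP; split => z /=; rewrite !in_itv/= lt_min; [move=> [-> ->]|move=> /andP[-> ->]].
- by move=> _ [x ->]; exact: m12.
- by move=> n; exact: fin.
- have E : @measurable _ (measurableTypeR R) = <<s G >> by exact: (@RGenInftyO.measurableE R).
  by rewrite -E.
Qed.

Section uniform_law.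
Context (R : realType).
Local Notation mR := (measurableTypeR R).
Local Notation U := (uniform_prob (@ltr01 R)).
Local Notation leb := (@lebesgue_measure R).

Lemma uniform01E (A : set mR) : measurable A -> U A = leb (A `&` `]0, 1[).
Proof.
move=> mA; rewrite /uniform_prob integral_uniform_pdf.
have m1 : measurable (A `&` `[0, 1] : set mR) by exact: measurableI.
have m2 : measurable (A `&` `]0, 1[ : set mR) by exact: measurableI.
rewrite (eq_integral (fun=> 1%E)); last first.
  by move=> x; rewrite inE/= => -[_]; rewrite in_itv/= /uniform_pdf => ->; rewrite subr0 invr1.
rewrite integral_cst//= mul1e; apply/eqP; rewrite eq_le; apply/andP; split; last first.
  apply: le_measure; rewrite ?inE//; apply: setIS.
  by move=> x /=; rewrite !in_itv/= => /andP[/ltW -> /ltW ->].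
apply: (@le_trans _ _ (leb ((A `&` `]0, 1[) `|` ([set 0] `|` [set 1])))).
  apply: le_measure; rewrite ?inE//; first by do 2 apply: measurableU => //.
  move=> x [Ax] /=; rewrite in_itv/= => /andP[x0 x1].
  have [x00|x00] := eqVneq x 0; first by right; left.
  have [x11|x11] := eqVneq x 1; first by right; right.
  by left; split => //; rewrite in_itv/= !lt_neqAle eq_sym x00 x0 x11 x1.
apply: (le_trans (measureU2 _ _ _)) => //; first exact: measurableU.
rewrite -[leRHS]adde0 leeD2l//.
apply: (@le_trans _ _ (leb [set 0%R] + leb [set 1%R])%E); first exact: measureU2.
by rewrite !lebesgue_measure_set1 adde0.
Qed.

(** Self-similarity of the uniform law under the two inverse branches of
    [doubling]. *)
Lemma uniform01_halves (A : set mR) : measurable A ->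
  U A = (2^-1%:E * U ((fun x : mR => (x : R) / 2)%R @^-1` A) +
         2^-1%:E * U ((fun x : mR => (1 + (x : R)) / 2)%R @^-1` A))%E.
Proof.
move=> mA.
have m0 : measurable_fun [set: mR] ((fun x => x / 2) : mR -> mR) by exact: measurable_funM.
have m1 : measurable_fun [set: mR] ((fun x => (1 + x) / 2) : mR -> mR).
  by apply: measurable_funM => //; apply: measurable_funD.
have half0 : (0 : R) < 2^-1 by rewrite invr_gt0.
have mA0 : measurable (A `&` `]0, 2^-1[ : set mR) by exact: measurableI.
have mA1 : measurable (A `&` `]2^-1, 1[ : set mR) by exact: measurableI.
rewrite !uniform01E//; last 2 first.
- by rewrite -[X in measurable X]setTI; exact: m1.
- by rewrite -[X in measurable X]setTI; exact: m0.
have -> : (fun x : mR => x / 2) @^-1` A `&` `]0, 1[ = (fun x : R => 2^-1 * x + 0) @^-1` (A `&` `]0, 2^-1[).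
  apply/seteqP; split => x /=; rewrite !in_itv/= addr0 (mulrC _ x) => -[Ax /andP[x0 x1]]; split => //.
    by rewrite divr_gt0//= -[ltRHS]mul1r ltr_pM2r.
  by apply/andP; split; rewrite -(ltr_pM2r half0) ?mul0r ?mul1r.
have -> : (fun x : mR => (1 + x) / 2) @^-1` A `&` `]0, 1[ =
    (fun x : R => 2^-1 * x + 2^-1) @^-1` (A `&` `]2^-1, 1[).
  have E (x : R) : 2^-1 * x + 2^-1 = (1 + x) / 2 by rewrite mulrDl mul1r mulrC addrC.
  apply/seteqP; split => x /=; rewrite !in_itv/= E => -[Ax /andP[x0 x1]]; split => //; lra.
rewrite !lebesgue_measure_affine// invrK !muleA -!EFinM mulVf// !mul1e -measureU//; last first.
  by apply/seteqP; split => // x [[_ /=]]; rewrite !in_itv/= => /andP[_ h1] [_ /andP[h2 _]];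
     have := lt_trans h1 h2; rewrite ltxx.
apply/eqP; rewrite eq_le; apply/andP; split; last first.
  apply: le_measure; rewrite ?inE//; [exact: measurableU|exact: measurableI|].
  by move=> x [] [Ax] /=; rewrite !in_itv/= => /andP[h1 h2]; split => //; apply/andP; split => //; move: h1 h2; lra.
apply: (@le_trans _ _ (leb ((A `&` `]0, 2^-1[ `|` A `&` `]2^-1, 1[) `|` [set 2^-1]))).
  apply: le_measure; rewrite ?inE//; [exact: measurableI|by do 2 apply: measurableU => //|].
  move=> x [Ax] /=; rewrite in_itv/= => /andP[x0 x1].
  by case: (ltgtP x 2^-1) => h; [left; left|left; right|right] => //; split => //; rewrite in_itv/= ?x0 ?x1 ?h.
pose B : set mR := A `&` `]0, 2^-1[ `|` A `&` `]2^-1, 1[.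
apply: (@le_trans _ _ (leb B + leb [set 2^-1%R])%E).
  by apply: measureU2 => //; exact: measurableU.
by rewrite lebesgue_measure_set1 adde0.
Qed.

End uniform_law.

Section digit_splitting.
Context (R : realType).
Local Notation mR := (measurableTypeR R).
Local Notation U := (uniform_prob (@ltr01 R)).

Definition first_digit (x : R) : R := if 2^-1 <= x then 1 else 0.

Definition doubling (x : R) : R := 2 * x - first_digit x.

Definition even_partial (n : nat) (x : R) : R :=
  \sum_(i < n) first_digit (iter (i + i) doubling x) / 2 ^+ i.+1.

(** The number whose binary expansion consists of the digits of [x] at even
    places. *)
Definition even_digits (x : R) : R := limn (even_partial ^~ x).

(** The doubling map shifts the binary expansion by one digit. *)
Definition odd_digits (x : R) : R := even_digits (doubling x).

Let first_digit01 x : 0 <= first_digit x <= 1.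
Proof. by rewrite /first_digit; case: ifP; rewrite ?lexx ?ler01. Qed.

Let even_partial_le n x : even_partial n x <= 1 - 2^-1 ^+ n.
Proof.
elim: n => [|n IH]; first by rewrite /even_partial big_ord0 expr0 subrr.
rewrite /even_partial big_ord_recr/=; apply: (le_trans (lerD IH (lexx _))).
have /andP[_ h] := first_digit01 (iter (n + n) doubling x).
have p0 : 0 < (2 : R)^-1 ^+ n.+1 by rewrite exprn_gt0// invr_gt0.
have : first_digit (iter (n + n) doubling x) / 2 ^+ n.+1 <= 2^-1 ^+ n.+1.
  by rewrite -exprVn ler_piMl// ltW.
have : (2 : R)^-1 ^+ n = 2 * 2^-1 ^+ n.+1 by rewrite exprS mulrA mulfV// mul1r.
by lra.
Qed.

Let even_partial_nd x : nondecreasing_seq (even_partial ^~ x).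
Proof.
apply/nondecreasing_seqP => n; rewrite /even_partial big_ord_recr/= lerDl.
by rewrite divr_ge0 ?exprn_ge0//; case/andP: (first_digit01 (iter (n + n) doubling x)).
Qed.

Let even_partial_cvg x : even_partial n x @[n --> \oo] --> even_digits x.
Proof.
apply: nondecreasing_is_cvgn; first exact: even_partial_nd.
exists 1 => _ [n _ <-]; rewrite (le_trans (even_partial_le n x))// gerBl exprn_ge0//.
Qed.

Lemma even_digits01 x : 0 <= even_digits x <= 1.
Proof.
apply/andP; split.
  apply: limr_ge; first by apply/cvg_ex; eexists; exact: even_partial_cvg.
  apply: nearW => n; apply: sumr_ge0 => i _; rewrite divr_ge0 ?exprn_ge0//.
  by case/andP: (first_digit01 (iter (i + i) doubling x)).
apply: limr_le; first by apply/cvg_ex; eexists; exact: even_partial_cvg.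
by apply: nearW => n; rewrite (le_trans (even_partial_le n x))// gerBl exprn_ge0.
Qed.

Lemma even_digits_rec x : even_digits x = (first_digit x + odd_digits (doubling x)) / 2.
Proof.
suff c : even_partial n.+1 x @[n --> \oo] --> (first_digit x + odd_digits (doubling x)) / 2.
  move: c; rewrite (cvg_shiftS (even_partial ^~ x)) => c.
  exact: (cvg_unique _ (even_partial_cvg (x := x)) c).
have -> : (fun n => even_partial n.+1 x) =
    (fun n => (first_digit x + even_partial n (doubling (doubling x))) / 2).
  apply/funext => n; rewrite /even_partial big_ord_recl/= expr1 mulrDl; congr (_ + _).
  rewrite mulr_suml; apply: eq_bigr => i _.
  have -> : iter (i + i) doubling (doubling (doubling x)) = doubling (iter (i + i.+1) doubling x).
    by rewrite addnS -!iterSr.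
  by rewrite /bump/= add0n add1n [in LHS]exprSr invfM mulrA.
by apply: cvgM; [apply: cvgD; [exact: cvg_cst|exact: even_partial_cvg]|exact: cvg_cst].
Qed.

Lemma measurable_doubling : measurable_fun [set: mR] (doubling : mR -> mR).
Proof.
apply: measurable_funB; first exact: measurable_funM.
rewrite /first_digit; apply: measurable_fun_if => //.
by apply: measurable_fun_ler.
Qed.

Lemma measurable_even_digits : measurable_fun [set: mR] (even_digits : mR -> mR).
Proof.
apply: (measurable_fun_cvg (h := even_partial)) => [n|x _]; last exact: even_partial_cvg.
rewrite /even_partial; apply: measurable_sum => i.
apply: measurable_funM => //.
have md : measurable_fun [set: mR] (first_digit : mR -> mR).
  rewrite /first_digit; apply: measurable_fun_if => //.
  by apply: measurable_fun_ler.
apply: (measurableT_comp md); elim: (i + i)%N => [|k IH] /=; first exact: measurable_id.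
exact: (measurableT_comp measurable_doubling IH).
Qed.

Lemma measurable_odd_digits : measurable_fun [set: mR] (odd_digits : mR -> mR).
Proof. exact: (measurableT_comp measurable_even_digits measurable_doubling). Qed.

Let first_half (x : R) : 0 < x < 1 -> first_digit (x / 2) = 0 /\ doubling (x / 2) = x.
Proof.
move=> /andP[x0 x1]; have E : first_digit (x / 2) = 0.
  by rewrite /first_digit ifF//; apply/negbTE; rewrite -ltNge; lra.
by split => //; rewrite /doubling E; field.
Qed.

Let second_half (x : R) : 0 < x < 1 ->
  first_digit ((1 + x) / 2) = 1 /\ doubling ((1 + x) / 2) = x.
Proof.
move=> /andP[x0 x1]; have E : first_digit ((1 + x) / 2) = 1.
  by rewrite /first_digit ifT//; lra.
by split => //; rewrite /doubling E; field.
Qed.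

Let digits_half (x : R) : 0 < x < 1 ->
  [/\ even_digits (x / 2) = odd_digits x / 2, odd_digits (x / 2) = even_digits x,
      even_digits ((1 + x) / 2) = (1 + odd_digits x) / 2 & odd_digits ((1 + x) / 2) = even_digits x].
Proof.
move=> x01; have [h1 h2] := first_half x01; have [h3 h4] := second_half x01.
split.
- by rewrite even_digits_rec h1 h2 add0r.
- by rewrite {1}/odd_digits h2.
- by rewrite even_digits_rec h3 h4.
- by rewrite {1}/odd_digits h4.
Qed.

Let corner (a b : R) : set mR := even_digits @^-1` `]-oo, a[ `&` odd_digits @^-1` `]-oo, b[.

Let corner_measurable a b : measurable (corner a b).
Proof.
apply: measurableI; rewrite -[X in measurable X]setTI.
  exact: (measurable_even_digits measurableT (measurable_itv _)).
exact: (measurable_odd_digits measurableT (measurable_itv _)).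
Qed.

Let corner_half a b (x : R) : 0 < x < 1 -> corner a b (x / 2) <-> corner b (2 * a) x.
Proof.
move=> x01; have [h1 h2 _ _] := digits_half x01.
by rewrite /corner/= !in_itv/= h1 h2; split => -[? ?]; split => //; lra.
Qed.

Let corner_shalf a b (x : R) : 0 < x < 1 -> corner a b ((1 + x) / 2) <-> corner b (2 * a - 1) x.
Proof.
move=> x01; have [_ _ h1 h2] := digits_half x01.
by rewrite /corner/= !in_itv/= h1 h2; split => -[? ?]; split => //; lra.
Qed.

Let D (a b : R) : R := fine (U (corner a b)).

Let DE a b : U (corner a b) = (D a b)%:E.
Proof. by rewrite fineK// fin_num_measure. Qed.

(** Conditioning on the first binary digit exchanges the roles of even and odd
    digits. *)
Let D_rec a b : D a b = 2^-1 * D b (2 * a) + 2^-1 * D b (2 * a - 1).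
Proof.
apply: EFin_inj; rewrite EFinD !EFinM -!DE uniform01_halves//.
have mp (f : mR -> mR) : measurable_fun [set: mR] f -> measurable (f @^-1` corner a b).
  by move=> mf; rewrite -[X in measurable X]setTI; exact: mf.
have m0 : measurable_fun [set: mR] ((fun x => x / 2) : mR -> mR) by exact: measurable_funM.
have m1 : measurable_fun [set: mR] ((fun x => (1 + x) / 2) : mR -> mR).
  by apply: measurable_funM => //; apply: measurable_funD.
congr (_ * _ + _ * _)%E; rewrite !uniform01E//; try exact: mp; congr lebesgue_measure;
  apply/seteqP; split => x [+ x01]; split => //; move: x01 => /=; rewrite in_itv/= => x01.
- by apply/(corner_half _ _ x01).
- by apply/(corner_half _ _ x01).
- by apply/(corner_shalf _ _ x01).
- by apply/(corner_shalf _ _ x01).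
Qed.

Let c (a : R) : R := fine (U (`]-oo, a[%classic : set mR)).

Let cE a : U (`]-oo, a[%classic : set mR) = (c a)%:E.
Proof. by rewrite fineK// fin_num_measure. Qed.

Let c_rec a : c a = 2^-1 * c (2 * a) + 2^-1 * c (2 * a - 1).
Proof.
apply: EFin_inj; rewrite EFinD !EFinM -!cE uniform01_halves//.
congr (_ * U _ + _ * U _)%E; apply/seteqP; split => x /=; rewrite !in_itv/=; lra.
Qed.

Let c_low a : a <= 0 -> c a = 0.
Proof.
move=> a0; apply: EFin_inj; rewrite -cE uniform01E// (_ : _ `&` _ = set0) ?measure0//.
by apply/seteqP; split => // x [] /=; rewrite !in_itv/=; lra.
Qed.

Let c_high a : 1 < a -> c a = 1.
Proof.
move=> a1; apply: EFin_inj; rewrite -cE uniform01E// (_ : _ `&` _ = `]0, 1[%classic).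
  by rewrite lebesgue_measure_itv/= lte_fin ltr01 sube0.
by apply/seteqP; split => [x []//|x /=]; rewrite !in_itv/=; split => //; lra.
Qed.

Let D_low a b : a <= 0 \/ b <= 0 -> D a b = 0.
Proof.
move=> ab0; apply: EFin_inj; rewrite -DE (_ : corner a b = set0) ?measure0//.
apply/seteqP; split => // x [] /=; rewrite !in_itv/=.
have /andP[e0 _] := even_digits01 x.
have /andP[od0 _] := even_digits01 (doubling x).
rewrite /odd_digits => ea ob; case: ab0 => h.
  by have := lt_le_trans (le_lt_trans e0 ea) h; rewrite ltxx.
by have := lt_le_trans (le_lt_trans od0 ob) h; rewrite ltxx.
Qed.

Let D_high a b : 1 < b -> D a b = D a 2.
Proof.
move=> b1; congr (fine (U _)); apply/seteqP; split => x [] /= h1 h2; split => //;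
  move: h2; rewrite /= !in_itv/= => _;
  have /andP[_ o1] := even_digits01 (doubling x); apply: (le_lt_trans o1) => //.
by rewrite ltr1n.
Qed.

Let D_one a : 1 < a -> D a 2 = 1.
Proof.
move=> a1; apply: EFin_inj; rewrite -DE (_ : corner a 2 = setT) ?probability_setT//.
apply/seteqP; split => // x _; split; rewrite /= in_itv/=.
  by have /andP[_ e1] := even_digits01 x; exact: (le_lt_trans e1).
have /andP[_ o1] := even_digits01 (doubling x); apply: (le_lt_trans o1).
by rewrite ltr1n.
Qed.

Let unit_itv (A : set mR) : measurable A -> 0 <= fine (U A) <= 1.
Proof.
move=> mA; apply/andP; split; first by rewrite fine_ge0.
by rewrite -lee_fin fineK ?probability_le1// fin_num_measure.
Qed.

Let null_of_halves (x : R) : (forall k, `|x| <= 2^-1 ^+ k) -> x = 0.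
Proof.
move=> H; apply/eqP; rewrite -normr_le0; apply/ler_addgt0Pr => e e0; rewrite add0r.
have [k _ /(_ k (leqnn _)) Hk] := near_infty_natSinv_expn_lt (PosNum e0).
by rewrite (le_trans (H k))// exprVn -[X in X <= _]mul1r ltW.
Qed.

(** The discrepancy satisfies a recursion that halves it: of the two terms in
    [D_rec] and [c_rec], one always vanishes. *)
Let marginal_zero b : D b 2 = c b.
Proof.
apply/eqP; rewrite -subr_eq0; apply/eqP; apply: null_of_halves => k.
elim: k b => [|k IH] b.
  have /andP[d0 d1] := unit_itv (corner_measurable b 2).
  have /andP[c0 c1] := unit_itv (measurable_itv `]-oo, b[ : measurable (`]-oo, b[%classic : set mR)).
  by rewrite expr0 ler_norml; move: d0 d1 c0 c1; rewrite -/(D b 2) -/(c b); lra.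
have two1 : 1 < (2 : R) by rewrite ltr1n.
have DD x : D 2 x = D x 2.
  rewrite (D_rec 2 x) (D_high x (_ : 1 < 2 * 2)) ?(D_high x (_ : 1 < 2 * 2 - 1)); try lra.
have -> : D b 2 - c b = 2^-1 * (D (2 * b) 2 - c (2 * b)) + 2^-1 * (D (2 * b - 1) 2 - c (2 * b - 1)).
  by rewrite {1}(D_rec b 2) {1}(c_rec b) !DD; ring.
have [h|h] := leP (2 * b) 1.
  rewrite (D_low (or_introl (_ : 2 * b - 1 <= 0))) ?(c_low (_ : 2 * b - 1 <= 0)); try lra.
  rewrite subrr mulr0 addr0 normrM ger0_norm ?invr_ge0// exprS ler_pM2l ?invr_gt0//.
rewrite (D_one h) (c_high h) subrr mulr0 add0r normrM ger0_norm ?invr_ge0//.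
by rewrite exprS ler_pM2l ?invr_gt0.
Qed.

(** The joint and the product distribution functions satisfy the same recursion,
    under which their distance is halved; being at most 1, it vanishes. *)
Let joint_product a b : D a b = c a * c b.
Proof.
apply/eqP; rewrite -subr_eq0; apply/eqP; apply: null_of_halves => k.
elim: k a b => [|k IH] a b.
  have /andP[d0 d1] := unit_itv (corner_measurable a b).
  have /andP[c0 c1] := unit_itv (measurable_itv `]-oo, a[ : measurable (`]-oo, a[%classic : set mR)).
  have /andP[c2 c3] := unit_itv (measurable_itv `]-oo, b[ : measurable (`]-oo, b[%classic : set mR)).
  have c4 : 0 <= c a * c b by exact: mulr_ge0.
  have c5 : c a * c b <= 1 by rewrite mulr_ile1.
  by rewrite expr0 ler_norml; move: d0 d1 c4 c5; rewrite -/(D a b); lra.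
have -> : D a b - c a * c b = 2^-1 * (D b (2 * a) - c b * c (2 * a)) +
    2^-1 * (D b (2 * a - 1) - c b * c (2 * a - 1)).
  by rewrite {1}(D_rec a b) {1}(c_rec a); ring.
(* One of 2 a and 2 a - 1 lies outside ]0, 1], where both distribution functions agree. *)
have [h|h] := leP (2 * a) 1.
  have h' : 2 * a - 1 <= 0 by lra.
  rewrite (@D_low b (2 * a - 1) (or_intror h')) (c_low h').
  by rewrite mulr0 subrr mulr0 addr0 normrM ger0_norm ?invr_ge0// exprS ler_pM2l ?invr_gt0.
rewrite (D_high b h) marginal_zero (c_high h) mulr1 subrr mulr0 add0r normrM ger0_norm ?invr_ge0//.
by rewrite exprS ler_pM2l ?invr_gt0.
Qed.

Let mpre (f : mR -> mR) (A : set mR) : measurable_fun [set: mR] f -> measurable A ->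
  measurable (f @^-1` A).
Proof. by move=> mf mA; rewrite -[X in measurable X]setTI; exact: mf. Qed.

(** Equality of the joint distribution functions extends to Borel sets one
    coordinate at a time. *)
Lemma even_odd_independent (A B : set mR) : measurable A -> measurable B ->
  U (even_digits @^-1` A `&` odd_digits @^-1` B) = (U A * U B)%E.
Proof.
move=> mA mB.
have me := measurable_even_digits; have mo := measurable_odd_digits.
have step (b : R) (A' : set mR) : measurable A' ->
    U (even_digits @^-1` A' `&` odd_digits @^-1` `]-oo, b[) = (U A' * U (`]-oo, b[%classic : set mR))%E.
  move=> mA'.
  have mO : measurable (odd_digits @^-1` (`]-oo, b[%classic : set mR)) by exact: mpre.
  have [c0 _] := andP (unit_itv (measurable_itv `]-oo, b[ : measurable (`]-oo, b[%classic : set mR))).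
  rewrite muleC cE.
  pose k : {nonneg R} := NngNum c0.
  have := @finite_measure_rays_unique R (pushforward (mrestr U mO) (even_digits : mR -> mR))
    (mscale k U) _ _ A' mA'.
  rewrite /pushforward /mrestr /mscale/=; apply => //.
    move=> x; transitivity (U (corner x b)) => //.
    rewrite [RHS](_ : _ = (c b)%:E * U (`]-oo, x[%classic : set mR))%E//.
    by rewrite DE joint_product cE EFinM muleC.
  move=> x; rewrite (le_lt_trans (probability_le1 _ _)) ?ltry//.
  by apply: measurableI => //; exact: mpre.
have mE : measurable (even_digits @^-1` A) by exact: mpre.
pose k : {nonneg R} := NngNum (fine_ge0 (measure_ge0 U A)).
have kE (X : set mR) : mscale k U X = (U A * U X)%E.
  by rewrite -[U A]fineK ?fin_num_measure.
transitivity (pushforward (mrestr U mE) (odd_digits : mR -> mR) B).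
  by rewrite /pushforward /mrestr setIC.
rewrite -kE; apply: finite_measure_rays_unique => // x.
  transitivity (U A * U (`]-oo, x[%classic : set mR))%E; last by rewrite -kE.
  by rewrite -step// setIC.
rewrite (le_lt_trans (probability_le1 _ _)) ?ltry//.
by apply: measurableI => //; exact: mpre.
Qed.

(** Hence one uniform variable carries two independent ones, and by iteration a
    sequence of them: this is why the limit can live on the unit interval. *)
Lemma integral_even_odd (f : mR * mR -> \bar R) : measurable_fun setT f -> (forall z, (0 <= f z)%E) ->
  (\int[U]_u f (even_digits u, odd_digits u) = \int[U]_x \int[U]_y f (x, y))%E.
Proof.
move=> mf f0.
have mp : measurable_fun [set: mR] (fun u : mR => (even_digits u : mR, odd_digits u : mR)).
  by apply: measurable_fun_pair; [exact: measurable_even_digits|exact: measurable_odd_digits].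
have := @product_measure_unique _ _ mR mR R U U
  (pushforward U (fun u : mR => (even_digits u : mR, odd_digits u : mR))) _.
move=> H; rewrite -(fubini_tonelli1 (m1 := U) (m2 := U) f mf f0).
transitivity (\int[pushforward U (fun u : mR => (even_digits u : mR, odd_digits u : mR))]_z f z)%E.
  by rewrite ge0_integral_pushforward.
apply: eq_measure_integral => A mA _; apply/esym; apply: H => //.
by move=> B C mB mC; rewrite -even_odd_independent.
Qed.

End digit_splitting.


(** * Quantile transform of a density *)

Lemma finite_measure_upper_rays_unique (R : realType)
    (m1 m2 : {measure set (measurableTypeR R) -> \bar R}) :
  (forall x : R, m1 (`]x, +oo[%classic : set (measurableTypeR R)) = m2 (`]x, +oo[%classic)) ->
  (forall x : R, (m1 (`]x, +oo[%classic : set (measurableTypeR R)) < +oo)%E) ->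
  forall A : set (measurableTypeR R), measurable A -> m1 A = m2 A.
Proof.
move=> m12 fin A mA.
pose opp : measurableTypeR R -> measurableTypeR R := fun x => - (x : R).
have mo : measurable_fun setT opp by exact: oppr_measurable.
have oray (x : R) : opp @^-1` `]-oo, x[ = (`]- x, +oo[%classic : set (measurableTypeR R)).
  by apply/seteqP; split => z /=; rewrite !in_itv/= andbT /opp ltrNl.
have AE : A = opp @^-1` (opp @^-1` A).
  by apply/seteqP; split => z /=; rewrite /opp opprK.
have mA' : measurable (opp @^-1` A) by rewrite -[X in measurable X]setTI; exact: mo.
rewrite AE; have := @finite_measure_rays_unique R (pushforward m1 opp) (pushforward m2 opp).
apply => // x; rewrite /pushforward/=.
  by transitivity (m1 (opp @^-1` `]-oo, x[)) => //; rewrite oray m12 -oray.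
rewrite (_ : _ `]-oo, x[%classic = m1 (opp @^-1` `]-oo, x[))// oray; exact: fin.
Qed.

Section quantile.
Context (R : realType).
Local Notation mR := (measurableTypeR R).
Local Notation U := (uniform_prob (@ltr01 R)).

(** The generalised inverse of the distribution function; the Galois connection
    [x < Q v <-> c x < v] follows from its right continuity. *)
Lemma quantile_transform (P : probability mR R) : exists2 Q : mR -> mR,
  measurable_fun setT Q & forall A : set mR, measurable A -> U (Q @^-1` A) = P A.
Proof.
have mid : measurable_fun [set: mR] (idfun : mR -> R) by exact: measurable_id.
pose X : {RV P >-> R} :=
  @mfun_Sub _ _ mR R idfun (mem_set (mid : @measurable_fun _ _ mR R setT idfun)).
pose c (x : R) : R := fine (P (`]-oo, x]%classic : set mR)).
have cE x : cdf X x = (c x)%:E.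
  by rewrite /c fineK ?fin_num_measure.
have c_nd x y : x <= y -> c x <= c y.
  by move=> xy; rewrite -lee_fin -!cE; exact: cdf_nondecreasing.
have fcE : fine \o cdf X = c by apply/funext => x; rewrite /= cE.
have cy : c x @[x --> +oo] --> (1 : R).
  by rewrite -fcE; exact: (fine_cvg (@cvg_cdfy1 _ _ _ P X : cdf X x @[x --> +oo%R] --> 1%:E)).
have cNy : c x @[x --> -oo] --> (0 : R).
  by rewrite -fcE; exact: (fine_cvg (@cvg_cdfNy0 _ _ _ P X : cdf X x @[x --> -oo%R] --> 0%:E)).
have cr a : c x @[x --> a^'+] --> c a.
  have := @cdf_right_continuous _ _ _ P X a; rewrite cE -fcE; exact: fine_cvg.
pose S v : set R := [set x | v <= c x].
have S0 v : v < 1 -> S v !=set0.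
  move=> v1; have : \forall x \near +oo, v <= c x by exact: (cvgr_ge _ cy).
  by move=> /(filter_ex (F := +oo)) [x vx]; exists x.
have Slb v : 0 < v -> has_lbound (S v).
  move=> v0; have : \forall x \near -oo, c x < v by exact: (cvgr_lt _ cNy).
  move=> /(filter_ex (F := -oo)) [x vx]; exists x => y /= vy.
  by rewrite leNgt; apply/negP => /ltW/c_nd; rewrite leNgt (lt_le_trans vx vy).
pose Q (v : mR) : mR := if (0 < v) && (v < 1) then inf (S v) else 0.
have key (v x : R) : 0 < v < 1 -> (x < Q v) = (c x < v).
  move=> v01; have [v0 v1] := andP v01; rewrite /Q v01.
  apply/idP/idP => [xQ|]; last first.
    apply: contraLR; rewrite -!leNgt => Qx; apply: le_trans (c_nd _ _ Qx).
    apply: (cvgr_to_ge (cr (inf (S v)))); near=> y.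
    have Qy : inf (S v) < y by near: y; exact: nbhs_right_gt.
    have yq : 0 < y - inf (S v) by rewrite subr_gt0.
    have [z Sz zy] := inf_adherent yq (conj (S0 _ v1) (Slb _ v0)).
    by rewrite addrC subrK in zy; rewrite (le_trans Sz)// c_nd// ltW.
  rewrite ltNge; apply/negP => vc; move: xQ; rewrite ltNge => /negP; apply.
  by apply: inf_lbound => //; exact: Slb.
pose I01 : set mR := `]0, 1[%classic.
have QE (x : R) : Q @^-1` `]x, +oo[ = (I01 `&` `]c x, +oo[) `|` (~` I01 `&` (if x < 0 then setT else set0)).
  apply/seteqP; split => v /=; rewrite /I01/= !in_itv/= !andbT.
    have [v01 |nv] := boolP ((0 < v) && (v < 1)); first by rewrite key//; left.
    by rewrite /Q (negbTE nv) => ->; right; split => //; exact/negP.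
  move=> [[v01]|[/negP nv]]; first by rewrite key.
  by rewrite /Q (negbTE nv); case: ifP.
have mQ : measurable_fun setT Q.
  apply: (measurability _ (@RGenOInfty.measurableE R)) => _ [_ [x ->] <-]; rewrite setTI QE.
  have mI : measurable I01 by exact: measurable_itv.
  apply: measurableU; first by apply: measurableI => //; exact: measurable_itv.
  by apply: measurableI; [exact: measurableC|case: ifP].
exists Q => // A mA.
have HH := @finite_measure_upper_rays_unique R (pushforward U Q) P _ _ A mA.
have mpre (B : set mR) : measurable B -> measurable (Q @^-1` B).
  by move=> mB; rewrite -[X in measurable X]setTI; exact: mQ.
apply: (HH mQ) => x; last first.
  exact: (le_lt_trans (probability_le1 U (mpre _ (measurable_itv _))) (ltry 1)).
have mray : measurable (Q @^-1` `]x, +oo[) by rewrite -[X in measurable X]setTI; exact: mQ.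
transitivity (U (Q @^-1` `]x, +oo[)) => //.
rewrite uniform01E//.
have -> : Q @^-1` `]x, +oo[ `&` `]0, 1[ = `]c x, 1[%classic.
  apply/seteqP; split => v /=; rewrite !in_itv/= andbT.
    by move=> [+ v01]; rewrite key// => ->; case/andP: v01.
  move=> /andP[cv v1]; have v01 : 0 < v < 1.
    by rewrite v1 andbT (le_lt_trans _ cv)// /c fine_ge0.
  by rewrite key.
have c1 : c x <= 1 by rewrite -lee_fin -cE cdf_le1.
have -> : (`]x, +oo[%classic : set mR) = ~` `]-oo, x]%classic.
  by rewrite setCitvl.
have PC : P (~` (`]-oo, x]%classic : set mR)) = (1 - P (`]-oo, x]%classic : set mR))%E.
  by apply: probability_setC; exact: measurable_itv.
have Pc : P (`]-oo, x]%classic : set mR) = (c x)%:E by exact: cE.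
transitivity (1 - (c x)%:E)%E; last by rewrite -Pc; exact/esym.
rewrite lebesgue_measure_itv/= lte_fin.
move: c1; rewrite le_eqVlt => /orP[/eqP ->|->]; last by rewrite -EFinB.
by rewrite ltxx -EFinB subrr.
Unshelve. all: by end_near. Qed.

End quantile.

Section density.
Context (R : realType).
Local Notation mR := (measurableTypeR R).
Local Notation U := (uniform_prob (@ltr01 R)).
Local Notation leb := (@lebesgue_measure R).
Context (f : R -> R).

Definition density_measure (_ : measurable_fun [set: mR] (f : mR -> mR))
    (_ : forall x, 0 <= f x) (A : set mR) : \bar R :=
  (\int[leb]_(x in A) (f x)%:E)%E.

Hypothesis mf : measurable_fun [set: mR] (f : mR -> mR).
Hypothesis f_ge0 : forall x, 0 <= f x.
Local Notation nu := (density_measure mf f_ge0).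

Let nu0 : nu set0 = 0%E.
Proof. by rewrite /density_measure integral_set0. Qed.

Let nu_ge0 A : (0 <= nu A)%E.
Proof. by apply: integral_ge0 => /= x Ax; rewrite lee_fin. Qed.

Let nu_sigma_additive : semi_sigma_additive nu.
Proof.
move=> /= F mF tF mUF; rewrite /density_measure; apply: cvg_toP.
  apply: ereal_nondecreasing_is_cvgn => m n mn.
  apply: lee_sum_nneg_natr => // k _ _.
  by apply: integral_ge0 => /= x Fkx; rewrite lee_fin.
rewrite ge0_integral_bigcup//=.
- by apply: measurable_funTS; exact/measurable_EFinP.
- by move=> x _; rewrite lee_fin.
Qed.

HB.instance Definition _ := isMeasure.Build _ _ _ nu nu0 nu_ge0 nu_sigma_additive.

(** The measure of a density of total mass 1, under a name of its own to carry
    the probability structure. *)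
Definition density_prob (_ : (\int[leb]_x (f x)%:E = 1)%E) : set mR -> \bar R := nu.

Hypothesis f_mass : (\int[leb]_x (f x)%:E = 1)%E.

HB.instance Definition _ := Measure.on (density_prob f_mass).

Let prob_setT : density_prob f_mass [set: _] = 1%:E.
Proof. exact: f_mass. Qed.

HB.instance Definition _ := @Measure_isProbability.Build _ _ R (density_prob f_mass) prob_setT.

Lemma density_quantile : exists2 Q : mR -> mR,
  measurable_fun setT Q & forall A : set mR, measurable A ->
    U (Q @^-1` A) = (\int[leb]_(x in A) (f x)%:E)%E.
Proof. by have [Q mQ QE] := quantile_transform (density_prob f_mass); exists Q. Qed.

End density.

Import HBNNSimple.

(** First for simple functions, then by monotone convergence. *)
Lemma integral_of_density (R : realType) d (T : measurableType d) (mu nu : {measure set T -> \bar R})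
    (f : T -> R) (g : T -> \bar R) :
  measurable_fun setT f -> (forall x, 0 <= f x) ->
  (forall A, measurable A -> nu A = \int[mu]_(x in A) (f x)%:E)%E ->
  measurable_fun setT g -> (forall x, 0 <= g x)%E ->
  (\int[nu]_x g x = \int[mu]_x ((f x)%:E * g x))%E.
Proof.
move=> mf f0 nuE mg g0.
have mfE : measurable_fun setT (EFin \o f) by exact/measurable_EFinP.
pose h := nnsfun_approx measurableT mg.
have hg x : (h n x)%:E @[n --> \oo] --> g x by exact: cvg_nnsfun_approx.
have mh n : measurable_fun setT (EFin \o h n) by exact/measurable_EFinP.
have h_nd x m n : (m <= n)%N -> h m x <= h n x by move=> mn; exact/lefP/nd_nnsfun_approx.
have simple n : (\int[nu]_x (h n x)%:E = \int[mu]_x ((f x)%:E * (h n x)%:E))%E.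
  under [LHS]eq_integral do rewrite fimfunE -fsumEFin//.
  rewrite [LHS]ge0_integral_fsum//; last 2 first.
  - by move=> r; exact/measurable_EFinP/measurableT_comp.
  - by move=> r x _; rewrite EFinM nnfun_muleindic_ge0.
  under [RHS]eq_integral.
    move=> x xD; rewrite fimfunE -fsumEFin// ge0_mule_fsumr; last first.
      by move=> r; rewrite EFinM nnfun_muleindic_ge0.
    over.
  rewrite [RHS]ge0_integral_fsum//; last 2 first.
  - by move=> r; apply: emeasurable_funM => //; apply/measurable_EFinP; exact: measurableT_comp.
  - by move=> r x _; rewrite mule_ge0 ?lee_fin// -lee_fin EFinM nnfun_muleindic_ge0.
  apply: eq_fsbigr => r _.
  have [r0|r0] := leP 0 r; last first.
    have -> : h n @^-1` [set r] = set0.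
      by apply/seteqP; split => // x /= hx; move: r0; rewrite -hx ltNge fun_ge0.
    by rewrite !integral0_eq// => x _; rewrite indicE in_set0 mulr0 ?mule0.
  under eq_integral do rewrite EFinM.
  rewrite ge0_integralZl//; last by exact/measurable_EFinP.
  under [RHS]eq_integral do rewrite EFinM muleCA.
  rewrite ge0_integralZl//; last 2 first.
  - by apply: emeasurable_funM => //; exact/measurable_EFinP.
  - by move=> x _; rewrite mule_ge0// lee_fin.
  congr (_ * _)%E; rewrite integral_indic// setIT nuE// integral_mkcond.
  by apply: eq_integral => x _; rewrite patchE indicE; case: ifPn => _; rewrite ?mule1 ?mule0.
transitivity (limn (fun n => \int[nu]_x (h n x)%:E))%E.
  rewrite -monotone_convergence//=.
  - by apply: eq_integral => x _; apply/esym/cvg_lim => //; exact: hg.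
  - by move=> n x _; rewrite lee_fin.
  - by move=> x _ m n mn; rewrite lee_fin h_nd.
transitivity (limn (fun n => \int[mu]_x ((f x)%:E * (h n x)%:E)))%E.
  by apply: congr_lim; apply/funext => n; exact: simple.
rewrite -monotone_convergence//=.
- by apply: eq_integral => x _; apply/cvg_lim => //; apply: cvgeZl => //; exact: hg.
- by move=> n; apply: emeasurable_funM => //; exact: mh.
- by move=> n x _; rewrite mule_ge0// lee_fin.
- by move=> x _ m n mn; rewrite lee_wpmul2l ?lee_fin// h_nd.
Qed.

(** [Q] is clamped to the open interval on a null set, so that strict bounds
    hold surely and not only almost surely. *)
Lemma weight_quantile (R : realType) (w : R -> R) :
  lebesgue_measure.-integrable (`]0, 1[%classic : set R) (fun t => (w t)%:E) ->
  (forall t, 0 < t < 1 -> 0 <= w t) ->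
  0 < \int[lebesgue_measure]_(t in `]0, 1[) w t ->
  exists Q : measurableTypeR R -> measurableTypeR R,
  [/\ measurable_fun setT Q, forall v, 0 < (Q v : R) < 1 &
    forall g : measurableTypeR R -> \bar R,
      measurable_fun (`]0, 1[%classic : set (measurableTypeR R)) g ->
      (forall t : R, (0 < t < 1)%R -> (0 <= g t)%E) ->
      (\int[uniform_prob (@ltr01 R)]_v g (Q v) =
       \int[lebesgue_measure]_(t in `]0%R, 1%R[)
         ((w t / \int[lebesgue_measure]_(t in `]0, 1[) w t)%R%:E * g t))%E].
Proof.
move=> iw w0 m0; set m := Rintegral _ _ _ in m0 *.
pose I01 : set (measurableTypeR R) := `]0, 1[%classic.
pose f : R -> R := (fun t : R => w t / m) \_ I01.
have f0 t : 0 <= f t.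
  rewrite /f patchE; case: ifPn => //; rewrite inE /I01/= in_itv/= => t01.
  by rewrite divr_ge0 ?w0// ltW.
have mw : measurable_fun I01 (w : measurableTypeR R -> measurableTypeR R).
  by apply/measurable_EFinP; exact: measurable_int iw.
have mf : measurable_fun setT (f : measurableTypeR R -> measurableTypeR R).
  apply/(measurable_restrictT _ _).1; first exact: measurable_itv.
  exact: measurable_funM.
have f_mass : (\int[lebesgue_measure]_x (f x)%:E = 1)%E.
  transitivity (\int[lebesgue_measure]_(x in I01) (w x / m)%:E)%E.
    by rewrite [RHS]integral_mkcond; apply: eq_integral => x _; rewrite /f !patchE; case: ifPn.
  under eq_integral do rewrite mulrC EFinM.
  transitivity (m^-1%:E * \int[lebesgue_measure]_(x in I01) (w x)%:E)%E.
    exact: (@integralZl _ _ R lebesgue_measure _ (measurable_itv _) _ iw m^-1).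
  have -> : (\int[lebesgue_measure]_(x in I01) (w x)%:E = m%:E)%E.
    by rewrite /m /Rintegral fineK//; exact: (@integrable_fin_num _ _ R lebesgue_measure _ (measurable_itv _) _ iw).
  by rewrite -EFinM mulVf// gt_eqF.
have [Q0 mQ0 Q0E] := density_quantile mf f0 f_mass.
pose clamp : measurableTypeR R -> measurableTypeR R :=
  fun t => if (0 < (t : R)) && ((t : R) < 1) then t else 2^-1.
have mclamp : measurable_fun setT clamp.
  apply: measurable_fun_if => //.
  by apply: measurable_and; apply: measurable_fun_ltr.
have clamp01 (z : R) : 0 < (clamp z : R) < 1.
  by rewrite /clamp; case: ifP => // _; lra.
have clampE (z : R) : 0 < z < 1 -> clamp z = z by rewrite /clamp => ->.
exists (clamp \o Q0); split.
- exact: measurableT_comp.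
- by move=> v; exact: clamp01.
move=> g mg g0.
have mgc : measurable_fun setT (g \o clamp).
  apply: (@measurable_comp _ _ _ _ _ _ I01) => //; first exact: measurable_itv.
  by move=> _ [t _ <-]; rewrite /I01/= in_itv/= clamp01.
transitivity (\int[pushforward (uniform_prob (@ltr01 R)) Q0]_t (g \o clamp) t)%E.
  by rewrite ge0_integral_pushforward// => t _; apply: g0.
rewrite (@integral_of_density R _ _ (@lebesgue_measure R) _ f)//; last first.
  by move=> t; apply: g0.
rewrite [RHS]integral_mkcond; apply: eq_integral => t _.
rewrite /f !patchE; case: ifPn => [|_]; last by rewrite mul0e.
by rewrite inE /I01/= in_itv/= => t01; rewrite clampE.
Qed.


(** * Stick breaking *)

Section stick_breaking.
Context (R : realType).
Local Notation mR := (measurableTypeR R).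
Local Notation U := (uniform_prob (@ltr01 R)).
Context (Q : nat -> mR -> mR).
Hypothesis mQ : forall j, measurable_fun setT (Q j).
Hypothesis Q01 : forall j v, 0 < (Q j v : R) < 1.

(** Length of the piece [i] of a unit stick, with fractions [Q j], [Q j.+1],
    and so on. The even digits of [u] drive the first break and the odd ones all
    the later breaks. *)
Fixpoint stick (i j : nat) (u : R) : R :=
  if i is i'.+1 then (1 - (Q j (even_digits u) : R)) * stick i' j.+1 (odd_digits u)
  else Q j (even_digits u).

Lemma measurable_stick i j : measurable_fun [set: mR] (stick i j : mR -> mR).
Proof.
have mQe k : measurable_fun [set: mR] (fun u : mR => Q k (even_digits u)).
  by exact: (measurableT_comp (mQ k) (@measurable_even_digits R)).
elim: i j => [|i IH] j /=; first exact: mQe.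
apply: measurable_funM; first by apply: measurable_funB => //; exact: mQe.
by apply: measurableT_comp; [exact: IH|exact: measurable_odd_digits].
Qed.

Lemma stick_gt0 i j u : 0 < stick i j u.
Proof.
elim: i j u => [|i IH] j u /=; first by have /andP[] := Q01 j (even_digits u).
by rewrite mulr_gt0// subr_gt0; have /andP[] := Q01 j (even_digits u).
Qed.

(** Some length is left after every break. *)
Lemma stick_sum_lt1 n j u : \sum_(i < n) stick i j u < 1.
Proof.
elim: n j u => [|n IH] j u; first by rewrite big_ord0.
rewrite big_ord_recl; under eq_bigr do rewrite lift0.
rewrite /= -mulr_sumr; have := IH j.+1 (odd_digits u); have := Q01 j (even_digits u).
move=> /andP[]; move: (Q j _ : R) (\sum_(i < n) _) => q S q0 q1 S1.
suff : (1 - q) * S < (1 - q) * 1 by lra.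
by rewrite ltr_pM2l// subr_gt0.
Qed.

Lemma measurable_comp_gt0 d (T : measurableType d) (psi : R -> R) (f : T -> mR) :
  (forall x, 0 < x -> {for x, continuous psi}) -> measurable_fun setT f -> (forall z, 0 < (f z : R)) ->
  measurable_fun setT ((psi : mR -> mR) \o f).
Proof.
move=> cpsi mf f0.
apply: (@measurable_comp _ _ _ _ _ _ (`]0, +oo[%classic : set mR)).
- exact: measurable_itv.
- by move=> _ [z _ <-] /=; rewrite in_itv/= andbT.
- apply: open_continuous_measurable_fun; first exact: interval_open.
  by move=> x; rewrite inE/= in_itv/= andbT => /cpsi.
- exact: mf.
Qed.

Context (alpha : R) (bet : nat -> R).
Hypothesis beta_pos : forall j, 0 < beta_mass alpha bet j.
Hypothesis QE : forall j (g : mR -> \bar R),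
  measurable_fun (`]0, 1[%classic : set mR) g ->
  (forall t : R, (0 < t < 1)%R -> (0 <= g t)%E) ->
  (\int[U]_v g (Q j v) = \int[lebesgue_measure]_(t in `]0%R, 1%R[)
     ((beta_weight alpha bet j t / beta_mass alpha bet j)%R%:E * g t))%E.

(** Conditioning on the first break: even and odd digits are independent, and
    the even ones give a fraction with the beta law of [chain_lim]. *)
Lemma stick_expectation (psi G : R -> R) n j y s :
  (forall x, 0 < x -> {for x, continuous psi}) -> continuous G -> (forall s, 0 <= G s) ->
  (forall n r y t, 0 < y <= 1 -> lebesgue_measure.-integrable (`]0, 1[%classic : set R)
    (fun x => (beta_weight alpha bet r x *
      chain_lim alpha bet psi (fun _ s => G s) n r.+1 (y * (1 - x)) (t + psi (y * x)))%:E)) ->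
  0 < y <= 1 ->
  (\int[U]_u (G (s + \sum_(i < n) psi (y * stick i j u)))%:E =
   (chain_lim alpha bet psi (fun _ s => G s) n j y s)%:E)%E.
Proof.
move=> cpsi cG G0 int; elim: n j y s => [|n IH] j y s y01.
  under eq_integral do rewrite big_ord0 addr0.
  rewrite integral_cst//; transitivity ((G s)%:E * 1)%E; last by rewrite mule1.
  by congr (_ * _)%E; exact: (probability_setT U).
pose K (t : R) := chain_lim alpha bet psi (fun _ s => G s) n j.+1 (y * (1 - t)) (s + psi (y * t)).
have y0 : 0 < y by case/andP: y01.
have y01t t : 0 < t < 1 -> 0 < y * (1 - t) <= 1.
  move=> /andP[t0 t1]; rewrite mulr_gt0 ?subr_gt0//=.
  by rewrite mulr_ile1 ?(ltW y0) ?subr_ge0 ?(ltW t1)//; [case/andP: y01|rewrite gerBl ltW].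
pose f (z : mR * mR) : \bar R :=
  (G (s + (psi (y * (Q j z.1 : R)) +
      \sum_(i < n) psi (y * (1 - (Q j z.1 : R)) * stick i j.+1 z.2))))%:E.
have mQ1 : measurable_fun [set: mR * mR] (fun z : mR * mR => Q j z.1).
  exact: measurableT_comp.
have mst i : measurable_fun [set: mR * mR] (fun z : mR * mR => stick i j.+1 z.2 : mR).
  by apply: measurableT_comp; [exact: measurable_stick|exact: measurable_snd].
have mf : measurable_fun setT f.
  apply/measurable_EFinP; apply: measurableT_comp; first exact: continuous_measurable_fun.
  apply: measurable_funD => //; apply: measurable_funD.
    apply: (@measurable_comp_gt0 _ _ psi (fun z : mR * mR => y * (Q j z.1 : R) : mR)) => //.
      exact: measurable_funM.
    by move=> z; rewrite mulr_gt0//; case/andP: (Q01 j z.1).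
  apply: measurable_sum => i.
  apply: (@measurable_comp_gt0 _ _ psi
    (fun z : mR * mR => y * (1 - (Q j z.1 : R)) * stick i j.+1 z.2 : mR)) => //.
    apply: measurable_funM; last exact: mst.
    apply: (@measurable_funM _ _ _ _ (fun=> y) (fun z : mR * mR => 1 - (Q j z.1 : R))) => //.
    exact: measurable_funB.
  by move=> z; rewrite !mulr_gt0 ?stick_gt0// subr_gt0; case/andP: (Q01 j z.1).
transitivity (\int[U]_u f (even_digits u, odd_digits u))%E.
  apply: eq_integral => u _; rewrite /f big_ord_recl; congr (G (s + (_ + _)))%:E.
  by apply: eq_bigr => i _; rewrite lift0/= mulrA.
rewrite integral_even_odd//; last by move=> z; rewrite lee_fin.
have fE (x : mR) : (\int[U]_z f (x, z) = (K (Q j x))%:E)%E.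
  rewrite /K -IH ?y01t//.
  by apply: eq_integral => z _; rewrite /f/= addrA.
under eq_integral do rewrite fE.
have K0 t : 0 < t < 1 -> 0 <= K t.
  move=> t01; rewrite -lee_fin /K -IH ?y01t//.
  by apply: integral_ge0 => z _; rewrite lee_fin.
have iK := int n j y s y01; rewrite -/K in iK.
rewrite (@QE j (fun t : mR => (K t)%:E)).
- rewrite /= /beta_mean /Rintegral -/K.
  transitivity ((beta_mass alpha bet j)^-1%:E *
    \int[lebesgue_measure]_(t in `]0%R, 1%R[) (beta_weight alpha bet j t * K t)%:E)%E.
    rewrite -(@integralZl _ _ R lebesgue_measure _ (measurable_itv _) _ iK).
    by apply: eq_integral => t _; rewrite -!EFinM -/(K t); congr EFin; ring.
  rewrite [in RHS]mulrC EFinM fineK//; rewrite -/K.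
  exact: (@integrable_fin_num _ _ R lebesgue_measure _ (measurable_itv _) _ iK).
- apply/measurable_EFinP.
  have mwK : measurable_fun (`]0, 1[%classic : set mR)
      ((fun t : R => beta_weight alpha bet j t * K t) : mR -> mR).
    by apply/measurable_EFinP; exact: measurable_int iK.
  apply: (@eq_measurable_fun _ _ mR mR _ (fun t : R => t `^ alpha * (1 - t) `^ (- (bet j.+1 - 1)) *
     (beta_weight alpha bet j t * K t))).
    move=> t; rewrite inE/= in_itv/= => /andP[t0 t1]; rewrite /beta_weight.
    have E : (t `^ alpha * t `^ (- alpha)) * ((1 - t) `^ (- (bet j.+1 - 1)) * (1 - t) `^ (bet j.+1 - 1)) = 1.
      by rewrite !powRN mulfV ?mulVf ?mul1r// gt_eqF// powR_gt0// subr_gt0.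
    have reorder (A B C D k : R) : A * B * (C * D) = 1 -> A * C * (B * D * k) = k.
      by move=> ABCD; transitivity ((A * B * (C * D)) * k); [ring|rewrite ABCD mul1r].
    exact: reorder E.
  apply: measurable_funM => //; apply: measurable_funTS; apply: measurable_funM.
    exact: measurable_powR.
  have m1x : measurable_fun [set: mR] ((fun x : R => 1 - x) : mR -> mR) by exact: measurable_funB.
  exact: (measurableT_comp (@measurable_powR R (- (bet j.+1 - 1))) m1x).
- by move=> t t01; rewrite lee_fin K0.
Qed.

End stick_breaking.


(** * Random atoms with bounded sum *)

Section atoms.
Context (R : realType).
Local Notation mR := (measurableTypeR R).
Context (x : nat -> R).
Hypothesis x_gt0 : forall i, 0 < x i.
Hypothesis x_sum : forall n, \sum_(i < n) x i < 1.
Let atoms : {measure set mR -> \bar R} := mseries (fun i => \d_(x i : mR)) 0.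

Lemma atom_itv i : x i \in `]0, 1].
Proof.
rewrite in_itv/= x_gt0/=; apply: le_trans (ltW (x_sum i.+1)).
by rewrite big_ord_recr/= lerDr sumr_ge0// => j _; exact: ltW.
Qed.

(** The atoms have a finite sum. *)
Lemma atoms_tail (d : R) : 0 < d -> exists N, forall i, (N <= i)%N -> x i < d.
Proof.
move=> d0; have nd : nondecreasing_seq (series x).
  by apply/nondecreasing_series => n _ _; exact: ltW.
have ub : has_ubound (range (series x)).
  by exists 1 => _ [n _ <-]; rewrite /series/= big_mkord ltW.
have x0 : x i @[i --> \oo] --> (0 : R).
  by apply: cvg_series_cvg_0; exact: nondecreasing_is_cvgn.
by have [N _ xN] := cvgr_lt 0 x0 _ d0; exists N => i; exact: xN.
Qed.

Let diracE (B : set mR) i : (\d_(x i : mR) B = ((x i \in B)%:R : R)%:E)%E.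
Proof. by rewrite diracE. Qed.

Let atomsE (B : set mR) : atoms B = (\sum_(0 <= i <oo) ((x i \in B)%:R : R)%:E)%E.
Proof. by rewrite /atoms/= /mseries; apply: eq_eseriesr => i _; exact: diracE. Qed.

Lemma atoms_finite (B : set mR) N : (forall i, (N <= i)%N -> ~ B (x i)) ->
  atoms B = ((\sum_(i < N) (x i \in B))%:R)%:E.
Proof.
move=> NB; rewrite atomsE.
rewrite (@nneseries_finite R (fun i => (x i \in B)%:R) N) ?natr_sum// => i /NB nB.
by rewrite memNset.
Qed.

Lemma atoms_infinite (B : set mR) : (forall N, exists2 i, (N <= i)%N & B (x i)) ->
  atoms B = +oo%E.
Proof.
move=> NB; rewrite atomsE; apply/eqyP => A A0.
have [n An] : exists n, (Num.truncn A).+1%:R <= \sum_(i < n) ((x i \in B)%:R : R).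
  elim: (_.+1) => [|m [n IH]]; first by exists 0%N; rewrite big_ord0.
  have [i ni Bi] := NB n; exists i.+1.
  rewrite big_ord_recr/= -natr1 mem_set// lerD//; apply: le_trans IH _.
  rewrite -(subnKC ni) big_split_ord/= lerDl sumr_ge0//.
apply: le_trans (nneseries_lim_ge n _); last by move=> i _ _; rewrite lee_fin.
by rewrite sumEFin lee_fin big_mkord (le_trans _ An)// ltW// truncnS_gt.
Qed.

(** Either infinitely many atoms lie in [B], or the mass is their number. *)
Lemma atoms_integer (B : set mR) : atoms B = +oo%E \/ exists m : nat, atoms B = (m%:R)%:E.
Proof.
have [[N NB]|] := pselect (exists N, forall i, (N <= i)%N -> ~ B (x i)).
  by right; eexists; exact: (atoms_finite NB).
move=> /forallNP nB; left; apply: atoms_infinite => N.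
by have /existsNP[i /not_implyP[Ni /contrapT Bi]] := nB N; exists i.
Qed.

Lemma atoms_outside : atoms (~` `]0, 1]) = 0%E.
Proof. by rewrite (@atoms_finite _ 0%N) ?big_ord0// => i _ /= /[!atom_itv]; apply. Qed.

(** A compact subset of the interval stays away from 0, where the atoms
    accumulate. *)
Lemma atoms_compact (C : set R) : compact C -> C `<=` `]0, 1] -> (atoms C < +oo)%E.
Proof.
move=> /compact_closed C_closed C01.
have /nbhs_ballP[d /= d0 dC] : nbhs (0 : R) (~` C).
  have oC : open (~` C) by rewrite openC; exact: C_closed.
  by apply: open_nbhs_nbhs; split => // /C01 /=; rewrite in_itv/= ltxx.
have [N xN] := atoms_tail d0.
rewrite (@atoms_finite C N) ?ltry// => i /xN xd; apply: dC.
by rewrite /ball/= sub0r normrN gtr0_norm.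
Qed.

(** Finitely many positions would have a least one, below which almost all atoms
    lie. *)
Lemma atoms_infinitely_many :
  infinite_set [set y : R | y \in `]0, 1] /\ (0 < atoms [set y])%E].
Proof.
move=> fin; have pos i : (0 < atoms [set x i])%E.
  have [->//|[[|m] mE]] := atoms_integer [set x i]; last by rewrite mE lte_fin.
  have [N Ni] : exists N, forall j, (N <= j)%N -> ~ [set x i] (x j).
    have [N xN] := atoms_tail (x_gt0 i).
    by exists N => j /xN + /= xE; rewrite xE ltxx.
  rewrite (atoms_finite Ni) lte_fin ltr0n lt0n.
  have iN : (i < N)%N by rewrite ltnNge; apply/negP => /Ni; apply.
  by rewrite sum_nat_eq0; apply/forallPn; exists (Ordinal iN); rewrite mem_set.
have [s sE] := (finite_seqP _).1 fin.
have [d d0 ds] : exists2 d : R, 0 < d & forall y, y \in s -> 0 < y -> d <= y.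
  elim: {sE} s => [|y s [d d0 ds]]; first by exists 1.
  have [y0|y0] := ltP 0 y; last first.
    by exists d => // z; rewrite inE => /orP[/eqP ->|]; [rewrite ltNge y0|exact: ds].
  exists (Num.min d y); first by rewrite lt_min d0.
  move=> z; rewrite inE => /orP[/eqP ->|zs z0]; first by rewrite ge_min lexx orbT.
  by rewrite ge_min ds.
have [N xN] := atoms_tail d0.
have : [set` s] (x N) by rewrite -sE /=; split; [exact: atom_itv|exact: pos].
by move=> /= /ds /(_ (x_gt0 _)); rewrite leNgt xN.
Qed.

Lemma atoms_integral (psi : R -> R) (d : R) N :
  measurable_fun (`]0, 1]%classic : set mR) (psi : mR -> mR) ->
  (forall y, y \in `]0, 1] -> 0 <= psi y) -> (forall y, 0 < y -> y < d -> psi y = 0) ->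
  (forall i, (N <= i)%N -> x i < d) ->
  \int[atoms]_(y in `]0, 1]) psi y = \sum_(i < N) psi (x i).
Proof.
move=> mpsi psi0 psid xN; rewrite /Rintegral ge0_integral_measure_series//; last first.
  exact/measurable_EFinP.
under eq_eseriesr => i _.
  rewrite integral_dirac//; last exact/measurable_EFinP.
  rewrite diracE mem_set ?mul1e; last exact: atom_itv.
  over.
rewrite (@nneseries_finite R (fun i => psi (x i)) N)// => i /xN xd.
by rewrite psid.
Qed.

End atoms.


(** * Sequences of sizes and functions of them *)

Section test_function_extension.
Context (R : realType).

(** A test function on the interval, continued by constants; when it has compact
    support in ]0, 1], the continuation is continuous on the positive half line
    and vanishes near 0. *)
Definition extend01 (psi : R -> R) (x : R) : R := if 0 < x then psi (Num.min x 1) else 0.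

Lemma extend01E psi x : x \in `]0, 1] -> extend01 psi x = psi x.
Proof. by rewrite in_itv/= /extend01 => /andP[-> x1]; rewrite min_l. Qed.

Let min01 (x : R) : 0 < x -> Num.min x 1 \in `]0, 1].
Proof. by move=> x0; rewrite in_itv/= lt_min x0 ltr01 ge_min lexx orbT. Qed.

Lemma extend01_continuous (psi : R -> R) : {within `]0, 1], continuous psi} ->
  forall x, 0 < x -> {for x, continuous (extend01 psi)}.
Proof.
move=> cpsi x x0.
have y01 := min01 x0; set y := Num.min x 1 in y01.
have psi_y : psi z @[z --> within [set` `]0, 1]] (nbhs y)] --> psi y.
  by move/subspace_continuousP: cpsi; apply.
have minc : Num.min z 1 @[z --> x] --> y.
  have idc : {for x, continuous (idfun : R -> R^o)} by exact: cvg_id.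
  have onec : {for x, continuous (cst 1 : R -> R^o)} by exact: cvg_cst.
  exact: (continuous_min idc onec).
suff : extend01 psi z @[z --> x] --> extend01 psi x by [].
have -> : extend01 psi x = psi y by rewrite /extend01 x0.
have E : {near x, (psi \o (fun z : R => Num.min z 1)) =1 extend01 psi}.
  near=> z; rewrite /extend01/= ifT//; near: z; exact: lt_nbhsr.
apply: cvg_trans (near_eq_cvg E) _.
apply: cvg_comp psi_y => A /= wA.
have xpos : \forall z \near x, 0 < z by exact: lt_nbhsr.
have mA : \forall z \near x, Num.min z 1 \in `]0, 1] -> A (Num.min z 1) := minc _ wA.
have nA : \forall z \near x, A (Num.min z 1).
  by apply: filterS2 xpos mA => z z0; apply; exact: min01.
exact: nA.
Unshelve. all: by end_near. Qed.

Lemma extend01_support psi (C : set R) : compact C -> C `<=` `]0, 1] ->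
  (forall x, x \in `]0, 1] -> ~ C x -> psi x = 0) ->
  exists2 d, 0 < d & forall x, x < d -> extend01 psi x = 0.
Proof.
move=> /compact_closed C_closed C01 psiC.
have /nbhs_ballP[d /= d0 dC] : nbhs (0 : R) (~` C).
  have oC : open (~` C) by rewrite openC; exact: C_closed.
  by apply: open_nbhs_nbhs; split => // /C01 /=; rewrite in_itv/= ltxx.
exists d => // x xd; rewrite /extend01; case: ltP => // x0.
apply: psiC; first exact: min01.
apply: dC; rewrite /ball/= sub0r normrN gtr0_norm; first by rewrite gt_min xd.
by have := min01 x0; rewrite in_itv/= => /andP[].
Qed.

End test_function_extension.

Fixpoint weak_compositions (k m : nat) : seq (seq nat) :=
  if k is k'.+1 then
    flatten [seq [seq x :: y | y <- weak_compositions k' (m - x)] | x <- iota 0 m.+1]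
  else if m == 0%N then [:: [::]] else [::].

Lemma weak_compositionsS k m : weak_compositions k.+1 m =
  [seq x :: y | x <- iota 0 m.+1, y <- weak_compositions k (m - x)].
Proof. by []. Qed.

Lemma mem_weak_compositions k m x :
  (x \in weak_compositions k m) = (size x == k) && (sumn x == m).
Proof.
elim: k m x => [|k IH] m x; first by case: m; case: x.
rewrite weak_compositionsS; apply/allpairsPdep/andP => [[z [y [+ + ->]]]|].
  rewrite mem_iota add0n/= ltnS IH eqSS => zm /andP[/eqP -> /eqP ->].
  by rewrite eqxx subnKC.
case: x => [|x y] [] //= /eqP[yk] /eqP xm.
exists x, y; split=> //; first by rewrite -[_ :: _]/(iota 0 m.+1) mem_iota add0n/= ltnS -xm leq_addr.
by rewrite IH yk eqxx/= -xm addKn.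
Qed.

Lemma uniq_weak_compositions k m : uniq (weak_compositions k m).
Proof.
elim: k m => [|k IH] m; first by case: m.
rewrite weak_compositionsS; apply: allpairs_uniq_dep; first exact: iota_uniq.
  by move=> x _; exact: IH.
by move=> [x y] [x' y'] _ _ /= [-> ->].
Qed.

Lemma sum_weak_compositions (R : realType) (p phi : nat -> R) (G : R -> R) k m s :
  \sum_(x <- weak_compositions k m) (\prod_(i <- x) p i) * G (s + \sum_(i <- x) phi i) =
  seq_sum p phi G k m s.
Proof.
elim: k m s => [|k IH] m s.
  by case: m => [|m]; rewrite ?big_nil//= big_seq1 !big_nil mul1r addr0.
rewrite weak_compositionsS big_allpairs_dep -[iota 0 m.+1]/(index_iota 0 m.+1) big_mkord /=.
apply: eq_bigr => x _; rewrite -IH mulr_sumr; apply: eq_bigr => y _.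
by rewrite !big_cons mulrA addrA.
Qed.

(** In a sequence of sum [n] no entry exceeds [n]. *)
Lemma sum_tuples_weak_compositions (V : nmodType) (F : seq nat -> V) (n k : nat) :
  \sum_(x : k.-tuple 'I_n.+1 | (\sum_(i < k) tnth x i == n)%N) F [seq val i | i <- x] =
  \sum_(x <- weak_compositions k n) F x.
Proof.
pose P (x : k.-tuple 'I_n.+1) := (\sum_(i < k) tnth x i == n)%N.
have sumE (x : k.-tuple 'I_n.+1) : (\sum_(i < k) tnth x i)%N = sumn [seq val i | i <- x].
  by rewrite sumnE big_map big_tuple.
transitivity (\sum_(x in P) F [seq val i | i <- x]); first by exact: eq_bigl.
rewrite -big_enum/= -(big_map (fun x : k.-tuple 'I_n.+1 => [seq val i | i <- x]) xpredT F).
apply: perm_big; apply: uniq_perm.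
- rewrite map_inj_in_uniq ?enum_uniq// => x y _ _ /= xy.
  by apply/val_inj/(inj_map val_inj).
- exact: uniq_weak_compositions.
move=> y; rewrite mem_weak_compositions; apply/mapP/andP => [[x + ->]|[/eqP yk /eqP yn]].
  rewrite mem_enum -[_ \in P]/(P x) /P sumE => ->; by rewrite size_map size_tuple eqxx.
have le_y i : i \in y -> (i <= n)%N.
  move=> iy; rewrite -yn sumnE (big_rem i)//= leq_addr//.
have sz : size [seq (inord i : 'I_n.+1) | i <- y] == k by rewrite size_map yk.
have yE : y = [seq val i | i <- Tuple sz].
  rewrite /= -map_comp -[LHS]map_id; apply/eq_in_map => i /le_y ily /=.
  by rewrite inordK.
by exists (Tuple sz) => //; rewrite mem_enum -[_ \in P]/(P _) /P sumE -yE yn.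
Qed.

(** Exponential tilting of the weights multiplies all sequences of the same
    length and total by the same factor. *)
Lemma seq_sum_scale (R : realType) (p w phi : nat -> R) (G : R -> R) (c r : R) k m s :
  (forall x, w x = c * p x * r ^+ x) ->
  seq_sum w phi G k m s = c ^+ k * r ^+ m * seq_sum p phi G k m s.
Proof.
move=> wE; elim: k m s => [|k IH] m s /=.
  by case: m => [|m]; rewrite ?mulr0// !expr0 !mul1r.
rewrite mulr_sumr; apply: eq_bigr => x _; rewrite IH wE.
have xm : (x <= m)%N by rewrite -ltnS.
have -> : r ^+ m = r ^+ x * r ^+ (m - x) by rewrite -exprD subnKC.
by rewrite exprS; ring.
Qed.

Section integral_countable.
Context d (T : measurableType d) (R : realType) (P : probability T R) (K : T -> seq nat).
Hypothesis mK : forall x : seq nat, measurable (K @^-1` [set x]).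

(** There are countably many sequences. *)
Lemma measurable_fibers (S : set (seq nat)) : measurable (K @^-1` S).
Proof.
have -> : K @^-1` S = \bigcup_(x : seq nat) (if x \in S then K @^-1` [set x] else set0).
  apply/seteqP; split => t => [SK|[x _]]; first by exists (K t) => //; rewrite mem_set.
  by case: ifPn => // /set_mem Sx Kx; move: Sx; rewrite -Kx.
by apply: countable_bigcupT_measurable => [|x]; [exact: countableP|case: ifP].
Qed.

Lemma measurable_function_of_sizes (h : seq nat -> R) : measurable_fun setT (fun t => h (K t)).
Proof. by move=> _ B mB; rewrite setTI; exact: (measurable_fibers [set x | B (h x)]). Qed.

Lemma integral_function_of_sizes (h : seq nat -> R) (s : seq (seq nat)) :
  (forall x, 0 <= h x) -> uniq s ->
  (\int[P]_(t in K @^-1` [set` s]) (h (K t))%:E =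
   \sum_(x <- s) (h x)%:E * P (K @^-1` [set x]))%E.
Proof.
move=> h0 us.
have -> : K @^-1` [set` s] = \big[setU/set0]_(x <- s) K @^-1` [set x].
  rewrite -bigcup_seq; apply/seteqP; split => t /=; first by move=> Ks; exists (K t).
  by move=> [x xs /= ->].
rewrite ge0_integral_bigsetU//=.
- apply: eq_bigr => x _.
  transitivity (\int[P]_(t in K @^-1` [set x]) (h x)%:E)%E.
    by apply: eq_integral => t; rewrite inE/= => ->.
  by rewrite integral_cst.
- by apply/trivIsetP => x y _ _ xy; rewrite -preimage_setI; apply/seteqP; split => t //= [-> yx]; rewrite yx eqxx in xy.
- by apply/measurable_EFinP/measurable_funTS/measurable_function_of_sizes.
- by move=> t _; rewrite lee_fin.
Qed.

End integral_countable.


(** * Gibbs weights and the law of the sizes *)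

Lemma equiv_ratio_cvg (R : realType) (f g : nat -> R) :
  f ~_\oo g -> (\forall n \near \oo, 0 < g n) -> f n / g n @[n --> \oo] --> (1 : R).
Proof.
move=> /eqaddoP fg g0; apply/cvgrPdist_le => e e0.
have := fg e e0; rewrite near_simpl => fge; near=> n.
have gn : 0 < g n by near: n.
rewrite -[1](@divff _ (g n)) ?gt_eqF// -mulrBl normrM normfV (gtr0_norm gn) ler_pdivrMr//.
rewrite -[in X in _ <= _ * X](gtr0_norm gn) distrC; near: n; exact: fge.
Unshelve. all: by end_near. Qed.

Section normalized_weights.
Context (R : realType) (v w : nat -> R) (rho_v rho_w : R).
Hypothesis rho_v_gt0 : 0 < rho_v.
Hypothesis rho_w_gt0 : 0 < rho_w.

(** A probability on the sizes, by criticality. *)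
Definition size_weight (x : nat) : R := w x * rho_w ^+ x / rho_v.
(** Zero at 0: a partition has at least one component. *)
Definition number_weight (k : nat) : R := if k is 0%N then 0 else v k * rho_v ^+ k.

Lemma size_weightE x : w x = rho_v * size_weight x * (rho_w^-1) ^+ x.
Proof.
rewrite /size_weight mulrCA divff ?gt_eqF// mulr1 -mulrA exprVn divff ?mulr1//.
by rewrite expf_neq0 // gt_eqF.
Qed.

Lemma size_weight_ge0 : (forall x, 0 <= w x) -> forall x, 0 <= size_weight x.
Proof. by move=> w0 x; rewrite divr_ge0 ?mulr_ge0 ?w0 ?exprn_ge0 ?(ltW rho_v_gt0) ?(ltW rho_w_gt0). Qed.

Lemma size_weight_sum : (forall x, 0 <= w x) ->
  (\sum_(0 <= i <oo) (w i * rho_w ^+ i)%:E)%E = rho_v%:E ->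
  (\sum_(0 <= x <oo) (size_weight x)%:E = 1)%E.
Proof.
move=> w0 crit; under eq_eseriesr do rewrite /size_weight mulrC EFinM.
rewrite nneseriesZl; last by move=> i _; rewrite lee_fin mulr_ge0 ?w0 ?exprn_ge0 ?(ltW rho_w_gt0).
by rewrite crit -EFinM mulVf ?gt_eqF.
Qed.

Lemma size_weight_cvg cw a : 0 < cw ->
  w ~_\oo (fun n : nat => cw * n%:R `^ (- a) * rho_w ^- n) ->
  size_weight k.+1 * k.+1%:R `^ a @[k --> \oo] --> cw / rho_v.
Proof.
move=> cw0 wE; set g := (fun n => _) in wE.
have g0 n : (0 < n)%N -> 0 < g n.
  by move=> n0; rewrite /g !mulr_gt0 ?powR_gt0 ?ltr0n ?invr_gt0 ?exprn_gt0.
have /(equiv_ratio_cvg wE) r1 : \forall n \near \oo, 0 < g n.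
  by exists 1%N => // n; exact: g0.
have r1S : w k.+1 / g k.+1 @[k --> \oo] --> (1 : R) by rewrite (cvg_shiftS (fun k => w k / g k)).
have -> : (fun k => size_weight k.+1 * k.+1%:R `^ a) =
    (fun k => w k.+1 / g k.+1 * (cw / rho_v)).
  apply/funext => k; rewrite /size_weight /g powRN.
  have rn : rho_w ^+ k.+1 != 0 by rewrite expf_neq0 // gt_eqF.
  have kn : k.+1%:R `^ a != 0 :> R by rewrite gt_eqF// powR_gt0.
  move: (rho_w ^+ _) rn (_ `^ a) kn => r rn z kn.
  by field; rewrite rn kn !gt_eqF.
rewrite -[X in _ --> X]mul1r; apply: cvgM; [exact: r1S|exact: cvg_cst].
Qed.

Lemma number_weight_ge0 : (forall n, (0 < n)%N -> 0 <= v n) -> forall k, 0 <= number_weight k.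
Proof. by move=> v0 [|k]//=; rewrite mulr_ge0 ?v0 ?exprn_ge0// ltW. Qed.

Lemma number_weight_rv (Lv l : R -> R) b X :
  (forall n, (0 < n)%N -> v n = Lv n%:R * n%:R `^ (- b) * rho_v ^- n) ->
  (forall x, 0 < l x) -> (forall x, X <= x -> l x = Lv x) ->
  regularly_varying l (- b) 1 (fun k => number_weight k.+1).
Proof.
move=> vE l0 lE; rewrite /regularly_varying; apply: cvg_near_cst; near=> k.
rewrite /number_weight vE// /rv_ref -lE; last first.
  near: k; exists (Num.truncn `|X|).+1 => //= k /= Xk; apply: le_trans (ler_norm X) _.
  by apply: le_trans (ltW (truncnS_gt _)) _; rewrite ler_nat ltnW.
by rewrite divfK ?expf_neq0 ?gt_eqF// [l _ * _]mulrC divff// mulf_neq0// gt_eqF// powR_gt0.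
Unshelve. all: by end_near. Qed.

Let p := size_weight.
Let a := number_weight.

(** The exponential factors depend only on the length and on the total. *)
Lemma gibbs_uE n : (forall x, 0 <= w x) -> (forall n, (0 < n)%N -> 0 <= v n) ->
  (forall m, \sum_(0 <= j <oo) (descend a 0 j * pw p j m)%:E < +oo)%E ->
  gibbs_u v w n = (rho_w^-1 ^+ n * gibbs_weight p a 0 n)%:E.
Proof.
move=> w0 v0 fin; have a0 := number_weight_ge0 v0; have p0 := size_weight_ge0 w0.
have d0 r j : 0 <= descend a r j by exact: descend_ge0.
rewrite /gibbs_u EFinM /gibbs_weight -pw_mixE// -nneseriesZl; last first.
  by move=> i _; rewrite lee_fin mulr_ge0 ?d0 ?pw_ge0.
rewrite [RHS]nneseries_recl//=; last first.
  by move=> i _; rewrite -EFinM lee_fin mulr_ge0 ?exprn_ge0 ?invr_ge0 ?(ltW rho_w_gt0) ?mulr_ge0 ?d0 ?pw_ge0.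
rewrite /descend/= !mul0r mule0 add0e eseries_cond [in RHS]eseries_cond.
apply: eq_eseriesr => k /= k1; rewrite -EFinM; congr EFin.
rewrite addn0 ffactn0 mulr1 /a.
have -> : \sum_(x : k.-tuple 'I_n.+1 | (\sum_(i < k) tnth x i == n)%N) \prod_(i < k) w (tnth x i) =
    seq_sum w (fun=> 0) (fun=> 1) k n 0.
  rewrite -sum_weak_compositions -(sum_tuples_weak_compositions _ n k).
  by apply: eq_bigr => x _; rewrite mulr1 big_map big_tuple.
rewrite (seq_sum_scale _ _ _ _ _ size_weightE) seq_sum_cst mul1r.
by case: k k1 => // k _ /=; ring.
Qed.

Context d (T : measurableType d) (P : probability T R) (K : T -> seq nat) (n : nat).
Hypothesis w_ge0 : forall x, 0 <= w x.
Hypothesis v_ge0 : forall n, (0 < n)%N -> 0 <= v n.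
Hypothesis weight_fin :
  (forall m, \sum_(0 <= j <oo) (descend a 0 j * pw p j m)%:E < +oo)%E.
Hypothesis K_gibbs : gibbs_sizes v w n P K.
Hypothesis n_gt0 : (0 < n)%N.
Hypothesis weight_gt0 : 0 < gibbs_weight p a 0 n.

Let a_ge0 := number_weight_ge0 v_ge0.
Let p_ge0 := size_weight_ge0 w_ge0.
Let d_ge0 r j : 0 <= descend a r j. Proof. exact: descend_ge0. Qed.

Let mK : forall x : seq nat, measurable (K @^-1` [set x]). Proof. exact: K_gibbs.1. Qed.

Let cell k := K @^-1` [set` weak_compositions k n].

Let cell_integral (H : seq nat -> R) (G : R -> R) (phi : nat -> R) k :
  (forall x, 0 <= H x) ->
  (forall x, sumn x = n -> H x = G (\sum_(i <- x) phi i)) ->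
  (\int[P]_(t in cell k) (H (K t))%:E =
   (descend a 0 k * seq_sum p phi G k n 0 / gibbs_weight p a 0 n)%:E)%E.
Proof.
move=> H0 HG; rewrite (integral_function_of_sizes P mK) ?uniq_weak_compositions//.
case: k => [|k].
  rewrite /= ifF; last by case: n n_gt0.
  by rewrite big_nil /descend/= !mul0r.
have u0 : fine (gibbs_u v w n) = rho_w^-1 ^+ n * gibbs_weight p a 0 n.
  by rewrite (gibbs_uE _ w_ge0 v_ge0 weight_fin).
transitivity (\sum_(x <- weak_compositions k.+1 n)
    (v k.+1 / fine (gibbs_u v w n) * (\prod_(i <- x) w i * G (0 + \sum_(i <- x) phi i)))%:E)%E.
  rewrite !big_seq; apply: eq_bigr => x.
  rewrite mem_weak_compositions => /andP[/eqP xk /eqP xn].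
  have -> : P (K @^-1` [set x]) = (v k.+1 * \prod_(i <- x) w i / fine (gibbs_u v w n))%:E.
    by rewrite -[in RHS]xk; apply: K_gibbs.2; rewrite ?xk.
  by rewrite HG// add0r -EFinM; congr EFin; ring.
rewrite sumEFin -mulr_sumr sum_weak_compositions (seq_sum_scale _ _ _ _ _ size_weightE) u0.
congr EFin; rewrite /descend addn0 ffactn0 mulr1 /a /=.
have rn : rho_w^-1 ^+ n != 0 by rewrite expf_neq0// invr_eq0 gt_eqF.
move: (rho_w^-1 ^+ n) rn => r rn.
by field; rewrite rn gt_eqF.
Qed.

Let cell_measurable k : measurable (cell k).
Proof. exact: measurable_fibers. Qed.

Let cells_integral (H : seq nat -> R) (G : R -> R) (M : R) (phi : nat -> R) :
  (forall x, 0 <= H x) -> (forall s, 0 <= G s <= M) ->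
  (forall x, sumn x = n -> H x = G (\sum_(i <- x) phi i)) ->
  (\int[P]_(t in \bigcup_k cell k) (H (K t))%:E =
   (seq_mix (descend a 0) p phi G n 0 / gibbs_weight p a 0 n)%:E)%E.
Proof.
move=> H0 G0 HG; rewrite ge0_integral_bigcup//; last 3 first.
- by apply/measurable_EFinP/measurable_funTS/measurable_function_of_sizes.
- by move=> t _; rewrite lee_fin.
- apply/trivIsetP => j k _ _ jk; apply/seteqP; split => // t [jt kt].
  have : K t \in weak_compositions k n := kt; have : K t \in weak_compositions j n := jt.
  rewrite !mem_weak_compositions => /andP[/eqP Kj _] /andP[/eqP Kk _].
  by rewrite -Kj -Kk eqxx in jk.
under eq_eseriesr do rewrite (cell_integral _ H0 HG) mulrC EFinM.
rewrite nneseriesZl; last first.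
  by move=> k _; rewrite lee_fin mulr_ge0// seq_sum_ge0// => s; case/andP: (G0 s).
by rewrite (seq_mixE (d_ge0 0) p_ge0 weight_fin _ G0) -EFinM mulrC.
Qed.

(** The sizes form, almost surely, one of countably many sequences with total
    [n], classified by their length; their weights are those of [seq_mix]. *)
Lemma gibbs_expectation (H : seq nat -> R) (G : R -> R) (M : R) (phi : nat -> R) :
  (forall x, 0 <= H x) -> (forall s, 0 <= G s <= M) ->
  (forall x, sumn x = n -> H x = G (\sum_(i <- x) phi i)) ->
  (\int[P]_t (H (K t))%:E =
   (seq_mix (descend a 0) p phi G n 0 / gibbs_weight p a 0 n)%:E)%E.
Proof.
move=> H0 G0 HG.
have mD : measurable (\bigcup_k cell k) by exact: bigcupT_measurable.
have PD : P (\bigcup_k cell k) = 1%E.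
  have := @cells_integral (fun=> 1) (fun=> 1) 1 (fun=> 0) _ _ _.
  rewrite integral_cst// mul1e => ->//.
  - by rewrite seq_mix_cst// mul1r divff ?gt_eqF.
  - by move=> _; rewrite ler01 lexx.
have PC : P (~` \bigcup_k cell k) = 0%E.
  by rewrite probability_setC// PD subee.
rewrite (ge0_negligible_integral (measurableC mD))//.
- by rewrite setTD setCK (cells_integral H0 G0 HG).
- exact/measurable_EFinP/measurable_function_of_sizes.
- by move=> t _; rewrite lee_fin.
Qed.

End normalized_weights.

(** A size 0 contributes to neither side: it carries no atom, and
    [extend01 psi] vanishes at 0. *)
Lemma sizes_measure_integral (R : realType) (psi : R -> R) (n : nat) (s : seq nat) :
  measurable_fun (`]0, 1]%classic : set (measurableTypeR R)) (psi : measurableTypeR R -> measurableTypeR R) ->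
  (forall y, y \in `]0, 1] -> 0 <= psi y) -> (0 < n)%N -> sumn s = n ->
  \int[sizes_measure R n s]_(y in `]0, 1]) psi y = \sum_(i <- s) extend01 psi (i%:R / n%:R).
Proof.
move=> mpsi psi0 n0 sn; rewrite /sizes_measure; set s' := [seq k <- s | (0 < k)%N].
have nR : 0 < n%:R :> R by rewrite ltr0n.
have s'01 k : k \in s' -> (k%:R / n%:R : R) \in `]0, 1].
  rewrite mem_filter => /andP[k0 ks]; rewrite in_itv/= divr_gt0 ?ltr0n//=.
  by rewrite ler_pdivrMr// mul1r ler_nat -sn sumnE (big_rem k)//= leq_addr.
rewrite /Rintegral ge0_integral_measure_sum//; last exact/measurable_EFinP.
transitivity (\sum_(k <- s') psi (k%:R / n%:R)).
  rewrite (big_nth 0%N) big_mkord.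
  rewrite (eq_bigr (fun i : 'I_(size s') => (psi ((nth 0%N s' i)%:R / n%:R))%:E)) ?sumEFin//.
  move=> i _; rewrite integral_dirac//; last exact/measurable_EFinP.
  by rewrite diracE mem_set ?mul1e//; apply: s'01; exact: mem_nth.
rewrite [LHS]big_seq (eq_bigr (fun k => extend01 psi (k%:R / n%:R))); last first.
  by move=> k /s'01 k01; rewrite extend01E.
rewrite -big_seq big_filter [LHS]big_mkcond; apply: eq_bigr => -[|k] _ //=.
by rewrite mul0r /extend01 ltxx.
Qed.


(** * Convergence of bounded functionals *)

Section gibbs_limit.
Context (R : realType) (l : R -> R) (eta : R).
Local Notation mR := (measurableTypeR R).
Local Notation U := (uniform_prob (@ltr01 R)).
Hypothesis l_gt0 : forall x, 0 < l x.
Hypothesis l_potter : potter eta l.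
Hypothesis l_flat : asymptotically_flat l.
Hypothesis eta_gt0 : 0 < eta.
Context (alpha b cp : R) (p a : nat -> R).
Hypothesis alpha01 : 0 < alpha < 1.
Hypothesis b12 : 1 < b < 2.
Hypothesis eta_small : eta < alpha * (2 - b).
Hypothesis p_ge0 : forall x, 0 <= p x.
Hypothesis p_sum : (\sum_(0 <= x <oo) (p x)%:E = 1)%E.
Hypothesis cp_gt0 : 0 < cp.
Hypothesis p_cvg : p k.+1 * k.+1%:R `^ (1 + alpha) @[k --> \oo] --> cp.
Hypothesis a_ge0 : forall k, 0 <= a k.
Hypothesis a_rv : regularly_varying l (- b) 1 (fun k => a k.+1).

Let L := power_arg l alpha.
Let bet := stick_exponent alpha b.
Let L_gt0 x : 0 < L x. Proof. exact: power_arg_gt0. Qed.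
Let L_potter : potter eta L. Proof. exact: power_arg_potter. Qed.
Let L_flat : asymptotically_flat L. Proof. exact: power_arg_flat. Qed.
Let weight_rv := gibbs_weight_rv l_gt0 l_potter l_flat eta_gt0 alpha01 b12 eta_small p_ge0 p_sum
  cp_gt0 p_cvg a_ge0 a_rv.
Let weight_ge0 := gibbs_weight_ge0 p_ge0 a_ge0.

(** The beta laws are realised on the unit interval by [weight_quantile]. *)
Lemma stick_fractions_exist : exists Q : nat -> mR -> mR,
  [/\ forall j, measurable_fun setT (Q j), forall j v, 0 < (Q j v : R) < 1 &
   forall j (g : mR -> \bar R),
     measurable_fun (`]0, 1[%classic : set mR) g ->
     (forall t : R, (0 < t < 1)%R -> (0 <= g t)%E) ->
     (\int[U]_v g (Q j v) = \int[lebesgue_measure]_(t in `]0%R, 1%R[)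
       ((beta_weight alpha bet j t / beta_mass alpha bet j)%R%:E * g t))%E].
Proof.
have ex j : exists Q : mR -> mR,
  [/\ measurable_fun setT Q, forall v, 0 < (Q v : R) < 1 &
   forall g : mR -> \bar R,
     measurable_fun (`]0, 1[%classic : set mR) g ->
     (forall t : R, (0 < t < 1)%R -> (0 <= g t)%E) ->
     (\int[U]_v g (Q v) = \int[lebesgue_measure]_(t in `]0%R, 1%R[)
       ((beta_weight alpha bet j t / beta_mass alpha bet j)%R%:E * g t))%E].
  have [m0 im] := beta_mass_gt0 L_gt0 L_potter L_flat (alpha_itv alpha01) (jump_weight_ge0 p_ge0)
    cp_gt0 (jump_weight_cvg p_cvg) weight_ge0 weight_rv (stick_exponent_gt alpha01 eta_small) j.
  apply: (weight_quantile im _ m0) => t _.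
  by rewrite mulr_ge0 ?powR_ge0.
have [Q QE] := choice ex.
by exists Q; split => j; have [mQ Q01 QQ] := QE j; [exact: mQ|exact: Q01|exact: QQ].
Qed.

Context (Q : nat -> mR -> mR).
Hypothesis mQ : forall j, measurable_fun setT (Q j).
Hypothesis Q01 : forall j v, 0 < (Q j v : R) < 1.
Hypothesis QE : forall j (g : mR -> \bar R),
  measurable_fun (`]0, 1[%classic : set mR) g ->
  (forall t : R, (0 < t < 1)%R -> (0 <= g t)%E) ->
  (\int[U]_v g (Q j v) = \int[lebesgue_measure]_(t in `]0%R, 1%R[)
     ((beta_weight alpha bet j t / beta_mass alpha bet j)%R%:E * g t))%E.

(** The truncated chain approximates both sides: the finite partition by
    [gibbs_chain_cvg], the stick-breaking sequence by [stick_expectation] and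
    dominated convergence. *)
Lemma stick_limit (G psi : R -> R) (M d : R) (X : mR -> R) :
  continuous G -> (forall s, 0 <= G s <= M) ->
  (forall x, 0 < x -> {for x, continuous psi}) -> 0 < d -> (forall x, x < d -> psi x = 0) ->
  (forall u, exists N, forall n, (N <= n)%N -> \sum_(i < n) psi (stick Q i 0 u) = X u) ->
  exists2 I : R, (\int[U]_u (G (X u))%:E = I%:E)%E &
    seq_mix (descend a 0) p (fun x => psi (x%:R / N%:R)) G N 0 / gibbs_weight p a 0 N
      @[N --> \oo] --> I.
Proof.
move=> cG GM cpsi d0 psi0 XE.
have M0 : 0 <= M by have /andP[g0 g1] := GM 0; exact: le_trans g1.
pose E r := chain_lim alpha bet psi (fun _ s => G s) r 0 1 0.
have G_along : cvg_along (fun (_ _ : nat) s => G s) (fun _ s => G s).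
  by move=> m s y t _ _ _ st; exact: (cvg_comp _ _ st (cG t)).
have EE r : (\int[U]_u (G (\sum_(i < r) psi (stick Q i 0 u)))%:E = (E r)%:E)%E.
  rewrite /E -(stick_expectation mQ Q01 QE)//.
  - by apply: eq_integral => u _; rewrite add0r; under [in RHS]eq_bigr do rewrite mul1r.
  - by move=> s; case/andP: (GM s).
  - move=> n r' y t y01; exact: (chain_lim_integrable L_gt0 L_potter L_flat (alpha_itv alpha01)
      (jump_weight_ge0 p_ge0) cp_gt0 (jump_weight_cvg p_cvg) weight_ge0 weight_rv
      (stick_exponent_gt alpha01 eta_small)
      (gibbs_weight_size_bias l_gt0 l_potter l_flat eta_gt0 alpha01 b12 eta_small p_ge0 p_sum
         cp_gt0 p_cvg a_ge0 a_rv) n r' t G_along (fun _ _ s _ => GM s) cpsi y01).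
  - by rewrite ltr01 lexx.
have mS r : measurable_fun [set: mR] (fun u : mR => (G (\sum_(i < r) psi (stick Q i 0 u)))%:E).
  apply/measurable_EFinP; apply: measurableT_comp; first exact: continuous_measurable_fun.
  apply: measurable_sum => i; apply: (measurable_comp_gt0 cpsi); first exact: measurable_stick.
  by move=> u; exact: stick_gt0.
have lim_u (u : mR) : ((G (\sum_(i < r) psi (stick Q i 0 u)))%:E @[r --> \oo] --> (G (X u))%:E)%E.
  apply: cvg_near_cst; have [N NX] := XE u.
  by exists N => // n /= Nn; rewrite NX.
have iM : U.-integrable [set: mR] (cst M%:E).
  exact: (finite_measure_integrable_cst U M).
have c1 : (\int[U]_u (G (\sum_(i < r) psi (stick Q i 0 u)))%:E @[r --> \oo] --> \int[U]_u (G (X u))%:E)%E.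
  apply: (@dominated_cvg _ mR R U setT measurableT _ _ (cst M%:E)) => //.
  by move=> r u _; rewrite gee0_abs ?lee_fin; case/andP: (GM (\sum_(i < r) psi (stick Q i 0 u))).
have fin : (\int[U]_u (G (X u))%:E \is a fin_num)%E.
  apply/fin_numPlt/andP; split.
    by apply: lt_le_trans (integral_ge0 _ _) => // u _; rewrite lee_fin; case/andP: (GM (X u)).
  apply: (@le_lt_trans _ _ M%:E); last exact: ltry.
  apply: (cvge_to_le c1); near=> r.
  rewrite -[M%:E]mule1 -[X in (_ <= _ * X)%E](probability_setT U) -integral_cst//.
  apply: ge0_le_integral => //.
  - by move=> u _; rewrite lee_fin; case/andP: (GM (\sum_(i < r) psi (stick Q i 0 u))).
  - by move=> u _; rewrite lee_fin; case/andP: (GM (\sum_(i < r) psi (stick Q i 0 u))).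
exists (fine (\int[U]_u (G (X u))%:E)%E); first by rewrite fineK.
set I := fine _.
have c2 : E r @[r --> \oo] --> I.
  have c1E : ((E r)%:E @[r --> \oo] --> I%:E)%E.
    have <- : (fun r => \int[U]_u (G (\sum_(i < r) psi (stick Q i 0 u)))%:E)%E = (fun r => (E r)%:E).
      by apply/funext => r; exact: EE.
    by rewrite /I fineK.
  exact: (fine_cvg c1E).
have c3 := residual_product_cvg0 l_gt0 l_potter l_flat eta_gt0 alpha01 b12 eta_small p_ge0 p_sum
  cp_gt0 p_cvg a_ge0 a_rv.
have Md : 0 <= M / d by rewrite divr_ge0// ltW.
apply/cvgrPdist_le => e e0.
have e3 : 0 < e / 3 by lra.
have e4 : 0 < e / 3 / (M / d + 1) by rewrite divr_gt0// ltr_wpDl.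
(* The number r of steps is fixed before N tends to infinity. *)
have [r [Er pr]] : exists r, `|I - E r| <= e / 3 /\
    \prod_(i < r) residual_mean alpha bet i <= e / 3 / (M / d + 1).
  have [/cvgrPdist_le/(_ _ e3) [r1 _ h1] /cvgr_le h2] := conj c2 c3.
  have [r2 _ {}h2] := h2 _ e4.
  exists (maxn r1 r2); split; [apply: h1|apply: h2]; rewrite /= ?leq_maxl ?leq_maxr//.
have := gibbs_chain_cvg l_gt0 l_potter l_flat eta_gt0 alpha01 b12 eta_small p_ge0 p_sum
  cp_gt0 p_cvg a_ge0 a_rv r cG GM cpsi d0 psi0 e3.
apply: filterS => N; rewrite -/bet -/(E r).
set S := _ / _; move=> SE.
have MP : M / d * \prod_(i < r) residual_mean alpha bet i <= e / 3.
  apply: le_trans (ler_wpM2l Md pr) _.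
  rewrite mulrCA ler_piMr//; first exact: ltW.
  by rewrite ler_pdivrMr ?ltr_wpDl// mul1r lerDl.
have -> : I - S = (I - E r) + (E r - S) by ring.
apply: le_trans (ler_normD _ _) _; rewrite [`|E r - S|]distrC.
lra.
Unshelve. all: by end_near. Qed.

End gibbs_limit.


(** * Convergence of the point processes *)

Section stick_process.
Context (R : realType).
Local Notation mR := (measurableTypeR R).
Context (Q : nat -> mR -> mR).
Hypothesis mQ : forall j, measurable_fun setT (Q j).
Hypothesis Q01 : forall j v, 0 < (Q j v : R) < 1.

Definition stick_process : R.-ker mR ~> mR := kseries (fun i => kdirac (measurable_stick mQ i 0)).

Let pos u i : 0 < stick Q i 0 u. Proof. exact: stick_gt0. Qed.
Let sum u n : \sum_(i < n) stick Q i 0 u < 1. Proof. exact: stick_sum_lt1. Qed.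

Let processE u : stick_process u = mseries (fun i => \d_(stick Q i 0 u : mR)) 0 :> (set mR -> \bar R).
Proof. by []. Qed.

Lemma stick_process_point_process : point_process stick_process.
Proof.
move=> u; split.
- by rewrite processE; exact: (atoms_outside (pos u) (sum u)).
- by move=> C cC C01; rewrite processE; exact: (atoms_compact (pos u) (sum u)).
- by move=> B mB; rewrite processE; exact: atoms_integer.
Qed.

Lemma stick_process_infinite u :
  infinite_set [set x : R | x \in `]0, 1] /\ (0 < stick_process u [set x])%E].
Proof. exact: (atoms_infinitely_many (pos u) (sum u)). Qed.

Lemma stick_process_integral (psi : R -> R) (d : R) (u : mR) :
  measurable_fun (`]0, 1]%classic : set mR) (psi : mR -> mR) ->
  (forall y, y \in `]0, 1] -> 0 <= psi y) -> 0 < d -> (forall y, y < d -> extend01 psi y = 0) ->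
  exists N, forall n, (N <= n)%N ->
    \sum_(i < n) extend01 psi (stick Q i 0 u) = \int[stick_process u]_(y in `]0, 1]) psi y.
Proof.
move=> mpsi psi0 d0 psid; have [N xN] := atoms_tail (pos u) (sum u) d0.
exists N => n Nn.
transitivity (\sum_(i < n) psi (stick Q i 0 u)).
  by apply: eq_bigr => i _; rewrite extend01E//; exact: (atom_itv (pos u) (sum u)).
apply/esym; apply: (@atoms_integral R _ (pos u) (sum u) psi (Num.min d 1) n mpsi psi0).
  move=> y y0; rewrite lt_min => /andP[yd y1]; rewrite -extend01E ?psid//.
  by rewrite in_itv/= y0 ltW.
move=> i ni; rewrite lt_min xN ?(leq_trans Nn)//=.
by apply: le_lt_trans (sum u i.+1); rewrite big_ord_recr/= lerDr sumr_ge0// => j _; exact: ltW.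
Qed.

End stick_process.

(** Reduces bounded test functions to non-negative ones. *)
Lemma expectation_shift d (T : measurableType d) (R : realType) (P : probability T R)
    (X : T -> R) (M : R) : measurable_fun setT X -> (forall t, `|X t| <= M) ->
  expectation P X = (\int[P]_t (X t + M)%:E - M%:E)%E.
Proof.
move=> mX XM; have iM : P.-integrable [set: T] (cst M%:E) by exact: finite_measure_integrable_cst.
have iX : P.-integrable [set: T] (EFin \o X).
  apply: le_integrable iM => //; first exact/measurable_EFinP.
  by move=> t _ /=; rewrite lee_fin (le_trans (XM t))// ler_norm.
rewrite unlock; under [in RHS]eq_integral do rewrite EFinD.
rewrite integralD//; transitivity ((\int[P]_t (X t)%:E + M%:E) - M%:E)%E.
  by rewrite addeK.
congr (_ + _ - _)%E; rewrite integral_cst//; transitivity (M%:E * 1)%E; first by rewrite mule1.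
by congr (_ * _)%E; exact/esym/(probability_setT P).
Qed.

Section gibbs_convergence.
Context (R : realType) (l : R -> R) (eta : R).
Local Notation mR := (measurableTypeR R).
Local Notation U := (uniform_prob (@ltr01 R)).
Hypothesis l_gt0 : forall x, 0 < l x.
Hypothesis l_potter : potter eta l.
Hypothesis l_flat : asymptotically_flat l.
Hypothesis eta_gt0 : 0 < eta.
Context (alpha b cp : R) (v w : nat -> R) (rho_v rho_w : R).
Let p := size_weight w rho_v rho_w.
Let a := number_weight v rho_v.
Hypothesis alpha01 : 0 < alpha < 1.
Hypothesis b12 : 1 < b < 2.
Hypothesis eta_small : eta < alpha * (2 - b).
Hypothesis rho_v_gt0 : 0 < rho_v.
Hypothesis rho_w_gt0 : 0 < rho_w.
Hypothesis v_ge0 : forall n, (0 < n)%N -> 0 <= v n.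
Hypothesis w_ge0 : forall x, 0 <= w x.
Hypothesis p_sum : (\sum_(0 <= x <oo) (p x)%:E = 1)%E.
Hypothesis cp_gt0 : 0 < cp.
Hypothesis p_cvg : p k.+1 * k.+1%:R `^ (1 + alpha) @[k --> \oo] --> cp.
Hypothesis a_rv : regularly_varying l (- b) 1 (fun k => a k.+1).
Context (d : nat -> measure_display) (T : forall n, measurableType (d n))
    (P : forall n, probability (T n) R) (K : forall n, T n -> seq nat).
Hypothesis K_gibbs : forall n, (0 < n)%N -> (0 < gibbs_u v w n)%E ->
  gibbs_sizes v w n (P n) (@K n).

Let p_ge0 : forall x, 0 <= p x. Proof. exact: size_weight_ge0. Qed.
Let a_ge0 : forall k, 0 <= a k. Proof. exact: number_weight_ge0. Qed.
Let weight_fin := gibbs_weight_fin l_gt0 l_potter l_flat eta_gt0 alpha01 b12 eta_small p_ge0 p_sum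
  cp_gt0 p_cvg a_ge0 a_rv 0.

Let weight_gt0 : \forall n \near \oo, 0 < gibbs_weight p a 0 n.
Proof.
have [c c0 rv] := gibbs_weight_rv l_gt0 l_potter l_flat eta_gt0 alpha01 b12 eta_small p_ge0 p_sum
  cp_gt0 p_cvg a_ge0 a_rv 0.
near=> n; have : 0 < gibbs_weight p a 0 n / rv_ref (power_arg l alpha) (stick_exponent alpha b 0 - 1) n.
  by near: n; exact: (cvgr_gt _ rv).
by rewrite pmulr_lgt0// invr_gt0 rv_ref_gt0// => x; exact: power_arg_gt0.
Unshelve. all: by end_near. Qed.

(** The partition function is positive for large [n], by its asymptotics. *)
Lemma gibbs_sizes_eventually : \forall n \near \oo,
  [/\ (0 < n)%N, 0 < gibbs_weight p a 0 n & gibbs_sizes v w n (P n) (@K n)].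
Proof.
near=> n; have n0 : (0 < n)%N by near: n; exact: nbhs_infty_gt.
have gn : 0 < gibbs_weight p a 0 n by near: n; exact: weight_gt0.
split => //; apply: K_gibbs => //.
rewrite (gibbs_uE rho_v_gt0 rho_w_gt0 n w_ge0 v_ge0)//.
by rewrite lte_fin mulr_gt0// exprn_gt0 ?invr_gt0.
Unshelve. all: by end_near. Qed.

Context (Q : nat -> mR -> mR).
Hypothesis mQ : forall j, measurable_fun setT (Q j).
Hypothesis Q01 : forall j v, 0 < (Q j v : R) < 1.
Hypothesis QE : forall j (g : mR -> \bar R),
  measurable_fun (`]0, 1[%classic : set mR) g ->
  (forall t : R, (0 < t < 1)%R -> (0 <= g t)%E) ->
  (\int[U]_v g (Q j v) = \int[lebesgue_measure]_(t in `]0%R, 1%R[)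
     ((beta_weight alpha (stick_exponent alpha b) j t /
       beta_mass alpha (stick_exponent alpha b) j)%R%:E * g t))%E.

(** Test functions with compact support vanish near 0, so their integrals
    against either process are finite sums over the atoms, to which
    [stick_limit] applies. *)
Lemma gibbs_cvg_point_process :
  cvg_point_process P (fun n t => sizes_measure R n (@K n t)) U (stick_process mQ).
Proof.
move=> psi cpsi psi0 [C [cC C01 psiC]] f cf [M fM].
have [del del0 psid] := extend01_support cC C01 psiC.
have cpsi' := extend01_continuous cpsi.
have mpsi : measurable_fun (`]0, 1]%classic : set mR) (psi : mR -> mR).
  exact: (subspace_continuous_measurable_fun (measurable_itv _) cpsi).
have GM s : 0 <= f s + M <= M + M.
  by rewrite lerD2r; have := fM s; rewrite ler_norml; lra.
have cG : continuous (fun s => f s + M).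
  by move=> s; apply: cvgD; [exact: cf|exact: cvg_cst].
have XE u := stick_process_integral mQ Q01 u mpsi psi0 del0 psid.
have [I IE cI] := stick_limit l_gt0 l_potter l_flat eta_gt0 alpha01 b12 eta_small p_ge0 p_sum
  cp_gt0 p_cvg a_ge0 a_rv mQ Q01 QE cG GM cpsi' del0 psid XE.
have mX : measurable_fun [set: mR] (fun u : mR => \int[stick_process mQ u]_(y in `]0, 1]) psi y : mR).
  apply: (@measurable_fun_cvg _ mR R setT (fun n (u : mR) => \sum_(i < n) extend01 psi (stick Q i 0 u))).
    move=> n; apply: measurable_sum => i; apply: (measurable_comp_gt0 cpsi').
      exact: measurable_stick.
    by move=> u; exact: stick_gt0.
  move=> u _; apply: cvg_near_cst; have [N NX] := XE u.
  by exists N => // n /= Nn; rewrite NX.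
have -> : expectation U (f \o (fun u : mR => \int[stick_process mQ u]_(y in `]0, 1]) psi y)) =
    (I%:E - M%:E)%E.
  rewrite -IE; apply: (@expectation_shift _ mR R U _ M); last by move=> u; exact: fM.
  by apply: measurableT_comp => //; exact: continuous_measurable_fun.
rewrite -EFinB.
have SE : \forall n \near \oo,
    expectation (P n) (f \o (fun t => \int[sizes_measure R n (@K n t)]_(x in `]0, 1]) psi x)) =
    (seq_mix (descend a 0) p (fun x => extend01 psi (x%:R / n%:R)) (fun s => f s + M) n 0 /
      gibbs_weight p a 0 n - M)%:E.
  apply: filterS gibbs_sizes_eventually => n [n0 gn Kn].
  pose H (x : seq nat) := f (\int[sizes_measure R n x]_(y in `]0, 1]) psi y) + M.
  transitivity (\int[P n]_t (H (@K n t))%:E - M%:E)%E.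
    apply: (@expectation_shift _ _ R (P n) _ M); last by move=> t; exact: fM.
    exact: (measurable_function_of_sizes Kn.1 (fun x => f (\int[sizes_measure R n x]_(y in `]0, 1]) psi y))).
  rewrite EFinB; congr (_ - _)%E.
  apply: (gibbs_expectation rho_v_gt0 rho_w_gt0 w_ge0 v_ge0 weight_fin Kn n0 gn (H := H) _ GM).
    by move=> x; case/andP: (GM (\int[sizes_measure R n x]_(y in `]0, 1]) psi y)).
  by move=> x xn; rewrite /H (sizes_measure_integral mpsi psi0 n0 xn).
have lim : ((seq_mix (descend a 0) p (fun x => extend01 psi (x%:R / n%:R)) (fun s => f s + M) n 0 /
      gibbs_weight p a 0 n - M)%:E @[n --> \oo] --> (I - M)%:E)%E.
  apply: cvg_EFin; first by near=> n.
  by apply: cvgB; [exact: cI|exact: cvg_cst].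
apply: cvg_trans lim; apply: near_eq_cvg.
by apply: filterS SE => n ->.
Unshelve. all: by end_near. Qed.

End gibbs_convergence.


(** * Linear functionals and uniqueness of measures *)

(** The accumulated value only takes values between [s] and [s + C * m]. *)
Lemma seq_sum_eq_between (R : realType) (p phi : nat -> R) (G G' : R -> R) (C : R) k m s :
  (forall x, 0 <= phi x <= C * x%:R) ->
  (forall t, s <= t <= s + C * m%:R -> G t = G' t) ->
  seq_sum p phi G k m s = seq_sum p phi G' k m s.
Proof.
move=> phiC; elim: k m s => [|k IH] m s GG /=.
  by case: eqP GG => // -> GG; apply: GG; rewrite mulr0 addr0 lexx.
apply: eq_bigr => x _; congr (_ * _); apply: IH => t /andP[st tle]; apply: GG.
have xm : (x <= m)%N by rewrite -ltnS.
have /andP[f0 f1] := phiC x; apply/andP; split; first by lra.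
rewrite (le_trans tle)// natrB// mulrBr -addrA lerD2l.
by rewrite -lerBrDr; lra.
Qed.

(** Mean number of components of each size: a component of size [x] can be
    removed at any of the [j] places, which leaves the weight with one component
    revealed. *)
Lemma seq_mix_linear (R : realType) (a p phi : nat -> R) (G : R -> R) (C : R) (m : nat) :
  (forall k, 0 <= a k) -> (forall x, 0 <= p x) ->
  (forall r m, (\sum_(0 <= j <oo) (descend a r j * pw p j m)%:E < +oo)%E) ->
  (forall x, 0 <= phi x <= C * x%:R) -> (forall t, 0 <= t <= C * m%:R -> G t = t) ->
  seq_mix (descend a 0) p phi G m 0 =
  \sum_(x < m.+1) phi x * p x * gibbs_weight p a 1 (m - x).
Proof.
move=> a0 p0 fin phiC GC; have A0 r j := descend_ge0 r j a0.
have phi0 x : 0 <= phi x by case/andP: (phiC x).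
have sumE j : seq_sum p phi G j m 0 = j%:R * \sum_(x < m.+1) phi x * p x * pw p j.-1 (m - x).
  rewrite (@seq_sum_eq_between R p phi G id C)//; last by move=> t; rewrite add0r; exact: GC.
  by rewrite seq_sum_linear mul0r add0r.
have inner0 j : 0 <= \sum_(x < m.+1) phi x * p x * pw p j (m - x).
  by apply: sumr_ge0 => x _; rewrite !mulr_ge0// pw_ge0.
have term0 j : (0 <= (descend a 0 j * seq_sum p phi G j m 0)%:E)%E.
  by rewrite lee_fin sumE !mulr_ge0.
apply: EFin_inj; rewrite /seq_mix.
have series : (\sum_(0 <= j <oo) (descend a 0 j * seq_sum p phi G j m 0)%:E =
    (\sum_(x < m.+1) phi x * p x * gibbs_weight p a 1 (m - x))%:E)%E.
  rewrite (nneseries_split 0 1)// add0n big_nat1 sumE mul0r mulr0 add0e.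
  rewrite -(nneseries_addn 1)//.
  transitivity (\sum_(0 <= j <oo) \sum_(x < m.+1)
      (phi x * p x * (descend a 1 j * pw p j (m - x)))%:E)%E.
    apply: eq_eseriesr => j _; rewrite sumE addn1/= sumEFin.
    congr EFin; rewrite descendS mulrA mulr_sumr; apply: eq_bigr => x _; ring.
  rewrite nneseries_sum; last by move=> x j _; rewrite lee_fin !mulr_ge0// pw_ge0.
  rewrite -sumEFin; apply: eq_bigr => x _.
  rewrite EFinM -(pw_mixE (A0 1%N) p0 (fin 1%N)) -nneseriesZl.
    by apply: eq_eseriesr => j _; rewrite -EFinM.
  by move=> j _; rewrite lee_fin mulr_ge0// pw_ge0.
by rewrite series.
Qed.

(** Increasing limits of the test functions give all rays ]y, +oo[ with y > 0,
    on which the measures are finite; restrictions away from 0 are then equal,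
    and exhaust every Borel set of positive numbers. *)
Lemma measures_eq_of_test (R : realType) (m1 m2 : {measure set (measurableTypeR R) -> \bar R}) :
  (forall (psi : R -> R) (d : R), continuous psi -> (forall x, 0 <= psi x <= 1) -> 0 < d ->
     (forall x, x < d -> psi x = 0) ->
     (\int[m1]_x (psi x)%:E = \int[m2]_x (psi x)%:E)%E /\ (\int[m2]_x (psi x)%:E < +oo)%E) ->
  forall B : set (measurableTypeR R), measurable B -> B `<=` `]0, +oo[ -> m1 B = m2 B.
Proof.
move=> test.
(* Continuous functions that increase with n to the indicator of ]y, +oo[. *)
pose psi (y : R) (n : nat) (x : R) : R := Num.min 1 (n%:R * Num.max 0 (x - y)).
have psi_cont y n : continuous (psi y n).
  move=> x.
  have zeroc : {for x, continuous (cst 0 : R -> R^o)} by exact: cvg_cst.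
  have onec : {for x, continuous (cst 1 : R -> R^o)} by exact: cvg_cst.
  have subc : {for x, continuous ((fun z => z - y) : R -> R^o)}.
    by apply: cvgB; [exact: cvg_id|exact: cvg_cst].
  have maxc := continuous_max zeroc subc.
  have mulc : {for x, continuous ((fun z => n%:R * Num.max 0 (z - y)) : R -> R^o)}.
    by apply: cvgM; [exact: cvg_cst|exact: maxc].
  exact: (continuous_min onec mulc).
have psi01 y n x : 0 <= psi y n x <= 1.
  by rewrite /psi le_min ler01/= ge_min lexx andbT mulr_ge0// le_max lexx.
have psi0 y n x : x <= y -> psi y n x = 0.
  by move=> xy; rewrite /psi max_l ?subr_le0// mulr0 min_r.
have psi_nd y x m n : (m <= n)%N -> psi y m x <= psi y n x.
  move=> mn; rewrite /psi le_min ge_min lexx/= ge_min; apply/orP; right.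
  by rewrite ler_wpM2r ?ler_nat// le_max lexx.
have psi_lim (y x : R) : ((psi y n x)%:E @[n --> \oo] --> (\1_(`]y, +oo[%classic : set R) x)%:E)%E.
  rewrite indicE; have [xy|yx] := leP x y.
    rewrite memNset/= ?in_itv/= ?andbT; last by rewrite ltNge xy.
    by apply: cvg_near_cst; near=> n; rewrite psi0.
  rewrite mem_set/= ?in_itv/= ?andbT//.
  apply: cvg_near_cst; near=> n; rewrite /psi max_r ?subr_ge0 ?(ltW yx)// min_l//.
  rewrite -ler_pdivrMr ?subr_gt0// mul1r.
  near: n; exists (Num.truncn (x - y)^-1).+1 => // n /= Nn.
  by apply: le_trans (ltW (truncnS_gt _)) _; rewrite ler_nat.
have mpsi y n : measurable_fun [set: measurableTypeR R] (fun x : measurableTypeR R => (psi y n x)%:E).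
  by apply/measurable_EFinP; exact: continuous_measurable_fun.
have mono (m : {measure set (measurableTypeR R) -> \bar R}) (y : R) :
    (\int[m]_x (psi y n x)%:E @[n --> \oo] --> m (`]y, +oo[%classic))%E.
  have -> : m (`]y, +oo[%classic) = (\int[m]_x limn (fun n => (psi y n x)%:E))%E.
    under eq_integral => x _ do rewrite (cvg_lim _ (psi_lim y x))//.
    by rewrite integral_indic ?setIT//; exact: measurable_itv.
  apply: cvg_monotone_convergence => //.
  - by move=> n x _; rewrite lee_fin; case/andP: (psi01 y n x).
  - by move=> x _ i j ij; rewrite lee_fin psi_nd.
have rays y : 0 < y -> m1 (`]y, +oo[%classic) = m2 (`]y, +oo[%classic).
  move=> y0; apply: cvg_unique (mono m1 y) _ => //.
  have -> : (fun n => \int[m1]_x (psi y n x)%:E)%E = (fun n => \int[m2]_x (psi y n x)%:E)%E.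
    apply/funext => n; apply: (test _ y (psi_cont y n) (psi01 y n) y0 _).1 => x xy.
    by rewrite psi0// ltW.
  exact: mono.
have fin2 y : 0 < y -> (m2 (`]y, +oo[%classic) < +oo)%E.
  move=> y0; have y2 : 0 < y / 2 by lra.
  pose n := (Num.truncn (y / 2)^-1).+1.
  have [_ pfin] := test _ _ (psi_cont (y / 2) n) (psi01 (y / 2) n) y2
    (fun x xy => psi0 (y / 2) n x (ltW xy)).
  apply: le_lt_trans pfin.
  have <- : (\int[m2]_x (\1_(`]y, +oo[%classic : set (measurableTypeR R)) x)%:E = m2 (`]y, +oo[%classic))%E.
    by rewrite integral_indic ?setIT//; exact: measurable_itv.
  apply: ge0_le_integral => //.
    by apply/measurable_EFinP; apply: measurable_indic; exact: measurable_itv.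
  move=> x _; rewrite lee_fin indicE; have [xy|_] := boolP (x \in _); last first.
    by case/andP: (psi01 (y / 2) n x).
  move/set_mem: xy; rewrite /= in_itv/= andbT => xy.
  rewrite /psi le_min lexx/= max_r; last by lra.
  apply: (@le_trans _ _ (n%:R * (y / 2))); last by apply: ler_wpM2l => //; lra.
  by rewrite -ler_pdivrMr// mul1r ltW// truncnS_gt.
move=> B mB B0.
pose r (k : nat) : R := k.+1%:R^-1.
have r0 k : 0 < r k by rewrite invr_gt0 ltr0n.
pose D (k : nat) : set (measurableTypeR R) := `]r k, +oo[%classic.
have mD k : measurable (D k) by exact: measurable_itv.
have DP k (z : R) : D k z <-> r k < z by rewrite /D/= in_itv/= andbT.
have rayD (m : set (measurableTypeR R) -> \bar R) k (x : R) :
    m (`]x, +oo[%classic `&` D k) = m (`]Num.max x (r k), +oo[%classic).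
  congr m; apply/seteqP; split => z /=; rewrite !in_itv/= !andbT gt_max.
    by move=> [-> /DP].
  by move=> /andP[-> rz]; split => //; exact/DP.
have maxr0 k (x : R) : 0 < Num.max x (r k) by rewrite lt_max r0 orbT.
have agree k : m1 (B `&` D k) = m2 (B `&` D k).
  apply: (@finite_measure_upper_rays_unique R (mrestr m1 (mD k)) (mrestr m2 (mD k)) _ _ B mB) => x.
    by have := rays _ (maxr0 k x); rewrite -(rayD m1) -(rayD m2).
  by have := fin2 _ (maxr0 k x); rewrite -rays// -(rayD m1).
have BE : \bigcup_k (B `&` D k) = B.
  apply/seteqP; split => [z [k _ []]//|z Bz].
  have /= := B0 _ Bz; rewrite in_itv/= andbT => z0.
  exists (Num.truncn z^-1) => //; split => //; apply/DP.
  by rewrite -[X in _ < X]invrK ltf_pV2 ?posrE ?invr_gt0// truncnS_gt.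
have nd : nondecreasing_seq (fun k => B `&` D k).
  move=> i j ij; apply/subsetPset => z [Bz] /DP iz; split => //; apply/DP.
  by apply: le_lt_trans iz; rewrite lef_pV2 ?posrE ?ltr0n// ler_nat.
have lim (m : {measure set (measurableTypeR R) -> \bar R}) : m (B `&` D k) @[k --> \oo] --> m B.
  rewrite -[in X in _ --> X]BE; apply: nondecreasing_cvg_mu => //.
  - by move=> k; apply: measurableI.
  - by rewrite BE.
apply: cvg_unique (lim m1) _ => //.
have -> : (fun k => m1 (B `&` D k)) = (fun k => m2 (B `&` D k)) by apply/funext.
exact: lim.
Unshelve. all: by end_near. Qed.


(** * The intensity of the limit *)

(** The mean measure is the sum of the laws of the atoms. *)
Lemma mean_measure_of_atoms d (T : measurableType d) (R : realType)
    (mu : {measure set T -> \bar R}) (x : nat -> T -> measurableTypeR R) :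
  (forall i, measurable_fun setT (x i)) ->
  exists m : {measure set (measurableTypeR R) -> \bar R},
    (forall B, measurable B -> m B = \int[mu]_t \sum_(0 <= i <oo) \d_(x i t) B)%E /\
    (forall f : measurableTypeR R -> \bar R, measurable_fun setT f -> (forall y, 0 <= f y)%E ->
       (\int[m]_y f y = \int[mu]_t \sum_(0 <= i <oo) f (x i t))%E).
Proof.
move=> mx; pose push_series := mseries (fun i => pushforward mu (x i)) 0.
exists (push_series mx); split => [B mB|f mf f0].
  have mpre i : measurable (x i @^-1` B) by rewrite -[X in measurable X]setTI; exact: mx.
  transitivity (\int[mu]_t \sum_(0 <= i <oo) (\1_(x i @^-1` B) t)%:E)%E; last first.
    by apply: eq_integral => t _; apply: eq_eseriesr => i _; exact/esym/diracE.
  rewrite integral_nneseries//; last by move=> i; apply/measurable_EFinP/measurable_indic.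
  by apply: eq_eseriesr => i _; rewrite integral_indic// setIT.
rewrite ge0_integral_measure_series// integral_nneseries//; last first.
  by move=> i; exact: measurableT_comp.
by apply: eq_eseriesr => i _; rewrite ge0_integral_pushforward.
Qed.

Section gibbs_intensity.
Context (R : realType) (l : R -> R) (eta : R).
Local Notation mR := (measurableTypeR R).
Local Notation U := (uniform_prob (@ltr01 R)).
Hypothesis l_gt0 : forall x, 0 < l x.
Hypothesis l_potter : potter eta l.
Hypothesis l_flat : asymptotically_flat l.
Hypothesis eta_gt0 : 0 < eta.
Context (alpha b cp : R) (p a : nat -> R).
Hypothesis alpha01 : 0 < alpha < 1.
Hypothesis b12 : 1 < b < 2.
Hypothesis eta_small : eta < alpha * (2 - b).
Hypothesis p_ge0 : forall x, 0 <= p x.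
Hypothesis p_sum : (\sum_(0 <= x <oo) (p x)%:E = 1)%E.
Hypothesis cp_gt0 : 0 < cp.
Hypothesis p_cvg : p k.+1 * k.+1%:R `^ (1 + alpha) @[k --> \oo] --> cp.
Hypothesis a_ge0 : forall k, 0 <= a k.
Hypothesis a_rv : regularly_varying l (- b) 1 (fun k => a k.+1).

Let L := power_arg l alpha.
Let bet := stick_exponent alpha b.
Let L_gt0 x : 0 < L x. Proof. exact: power_arg_gt0. Qed.
Let L_potter : potter eta L. Proof. exact: power_arg_potter. Qed.
Let L_flat : asymptotically_flat L. Proof. exact: power_arg_flat. Qed.
Let weight_rv := gibbs_weight_rv l_gt0 l_potter l_flat eta_gt0 alpha01 b12 eta_small p_ge0 p_sum
  cp_gt0 p_cvg a_ge0 a_rv.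
Let weight_ge0 := gibbs_weight_ge0 p_ge0 a_ge0.

Context (Q : nat -> mR -> mR).
Hypothesis mQ : forall j, measurable_fun setT (Q j).
Hypothesis Q01 : forall j v, 0 < (Q j v : R) < 1.
Hypothesis QE : forall j (g : mR -> \bar R),
  measurable_fun (`]0, 1[%classic : set mR) g ->
  (forall t : R, (0 < t < 1)%R -> (0 <= g t)%E) ->
  (\int[U]_v g (Q j v) = \int[lebesgue_measure]_(t in `]0%R, 1%R[)
     ((beta_weight alpha bet j t / beta_mass alpha bet j)%R%:E * g t))%E.


Let weight_fin := gibbs_weight_fin l_gt0 l_potter l_flat eta_gt0 alpha01 b12 eta_small p_ge0 p_sum
  cp_gt0 p_cvg a_ge0 a_rv.

(** One step of the chain with payoff [psi x / x]: summing [psi] over all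
    components is the same as averaging [psi x / x] over a size-biased
    component. *)
Lemma mean_jump_cvg (psi G : R -> R) (d : R) :
  continuous psi -> (forall x, 0 <= psi x <= 1) -> 0 < d -> (forall x, x < d -> psi x = 0) ->
  continuous G -> (forall s, 0 <= G s <= d^-1) -> (forall s, 0 <= s <= d^-1 -> G s = s) ->
  seq_mix (descend a 0) p (fun x => psi (x%:R / N%:R)) G N 0 / gibbs_weight p a 0 N
    @[N --> \oo] --> beta_mean alpha bet 0 (fun x => psi x / x).
Proof.
move=> cpsi psi01 d0 psid cG GM Gid.
have psi_le x : 0 <= x -> psi x <= d^-1 * x.
  move=> x0; have [xd|dx] := ltP x d; first by rewrite psid// mulr_ge0// invr_ge0 ltW.
  by rewrite mulrC (le_trans (y := 1))//; [case/andP: (psi01 x)|rewrite ler_pdivlMr// mul1r].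
pose psi2 (x : R) := psi x / x.
have psi2_01 x : 0 < x -> 0 <= psi2 x <= d^-1.
  move=> x0; rewrite /psi2 divr_ge0 ?(ltW x0)//=; last by case/andP: (psi01 x).
  by rewrite ler_pdivrMr// psi_le// ltW.
have cpsi2 x : 0 < x -> {for x, continuous psi2}.
  move=> x0; apply: cvgM; first exact: cpsi.
  by apply: cvgV; [rewrite gt_eqF|exact: cvg_id].
have G_along : cvg_along (fun (_ _ : nat) s => G s) (fun _ s => G s).
  by move=> m s y t _ _ _ st; exact: (cvg_comp _ _ st (cG t)).
have one : (N%:R / N%:R : R) @[N --> \oo] --> (1 : R).
  apply: cvg_near_cst; near=> N; rewrite divff// pnatr_eq0 -lt0n.
  by near: N; exact: nbhs_infty_gt.
have [_ lim] := chain_step_cvg L_gt0 L_potter L_flat (alpha_itv alpha01)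
      (jump_weight_ge0 p_ge0) cp_gt0 (jump_weight_cvg p_cvg) weight_ge0 weight_rv
      (stick_exponent_gt alpha01 eta_small)
      0 G_along (fun _ _ s _ => GM s) cpsi2
      (fun n => leqnn n) ltr01 one (cvg_cst (0 : R)).
have -> : beta_mean alpha bet 0 (fun x => psi x / x) =
    beta_mean alpha bet 0 (fun x => G (0 + psi2 (1 * x))).
  rewrite /beta_mean; congr (_ / _); apply: eq_Rintegral => x; rewrite inE/= in_itv/= => /andP[x0 _].
  by rewrite add0r mul1r Gid// psi2_01.
apply: cvg_trans lim; apply: near_eq_cvg; near=> N.
have N0 : (0 < N)%N by near: N; exact: nbhs_infty_gt.
have NR : 0 < N%:R :> R by rewrite ltr0n.
have weight0 : N%:R * gibbs_weight p a 0 N = \sum_(k < N) jump_weight p k * gibbs_weight p a 1 (N - 1 - k).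
  rewrite -(prednK N0) (gibbs_weight_size_bias l_gt0 l_potter l_flat eta_gt0 alpha01 b12 eta_small p_ge0 p_sum
         cp_gt0 p_cvg a_ge0 a_rv).
  by apply: eq_bigr => k _; rewrite subn1.
rewrite (@seq_mix_linear R a p _ G (d^-1 / N%:R))//; last 2 first.
- move=> x; have /andP[-> _]/= := psi01 (x%:R / N%:R).
  by rewrite -mulrA [N%:R^-1 * _]mulrC psi_le// divr_ge0.
- by move=> t; rewrite divfK ?gt_eqF//; exact: Gid.
rewrite big_ord_recl/= mul0r psid// mul0r mul0r add0r.
rewrite -weight0 invfM mulrA; congr (_ / _).
rewrite mulr_suml; apply: eq_bigr => k _.
have kN : 0 < (k.+1%:R / N%:R : R) by rewrite divr_gt0 ?ltr0n.
rewrite add0r Gid ?psi2_01// /psi2 /bump/= /jump_weight -subnDA add1n.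
have cancel (i m y q g : R) : i != 0 -> m != 0 -> i * q * g * (y / (i / m)) / m = y * q * g.
  by move=> i0 m0; field; rewrite ?i0 ?m0.
by apply: cancel; rewrite ?pnatr_eq0// gt_eqF.
Unshelve. all: by end_near. Qed.

(** [stick_limit] is about bounded functions of the sum. As [psi] vanishes below
    [d] and is at most 1, its sum over lengths of total at most 1 never exceeds
    [d^-1], and the identity may be clipped there. *)
Lemma mean_stick_sum (psi : R -> R) (d : R) :
  continuous psi -> (forall x, 0 <= psi x <= 1) -> 0 < d -> (forall x, x < d -> psi x = 0) ->
  (\int[U]_u \sum_(0 <= i <oo) (psi (stick Q i 0 u))%:E =
   (beta_mean alpha bet 0 (fun x => psi x / x))%:E)%E.
Proof.
move=> cpsi psi01 d0 psid.
(* The identity, clipped to the range of the sums. *)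
pose G (s : R) := Num.max 0 (Num.min s d^-1).
have di : 0 <= d^-1 by rewrite invr_ge0 ltW.
have cG : continuous G.
  move=> x.
  have idc : {for x, continuous (idfun : R -> R^o)} by exact: cvg_id.
  have dc : {for x, continuous (cst d^-1 : R -> R^o)} by exact: cvg_cst.
  have zeroc : {for x, continuous (cst 0 : R -> R^o)} by exact: cvg_cst.
  exact: (continuous_max zeroc (continuous_min idc dc)).
have GM s : 0 <= G s <= d^-1.
  by rewrite /G le_max lexx/= ge_max di ge_min lexx orbT.
have Gid s : 0 <= s <= d^-1 -> G s = s.
  by move=> /andP[s0 s1]; rewrite /G min_l// max_r.
pose X (u : mR) := fine (\sum_(0 <= i <oo) (psi (stick Q i 0 u))%:E)%E.
have psi_le x : 0 <= x -> psi x <= d^-1 * x.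
  move=> x0; have [xd|dx] := ltP x d; first by rewrite psid// mulr_ge0.
  by rewrite mulrC (le_trans (y := 1))//; [case/andP: (psi01 x)|rewrite ler_pdivlMr// mul1r].
have finite_sum u : exists N, forall n, (N <= n)%N ->
    (\sum_(0 <= i <oo) (psi (stick Q i 0 u))%:E = (\sum_(i < n) psi (stick Q i 0 u))%:E)%E.
  have [N xN] := atoms_tail (fun i => stick_gt0 Q01 i 0 u) (fun n => stick_sum_lt1 Q01 n 0 u) d0.
  exists N => n Nn; apply: (@nneseries_finite R (fun i => psi (stick Q i 0 u))) => i ni.
  by rewrite psid// xN// (leq_trans Nn).
have XE u : exists N, forall n, (N <= n)%N -> \sum_(i < n) psi (stick Q i 0 u) = X u.
  by have [N NE] := finite_sum u; exists N => n Nn; rewrite /X (NE n).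
have X01 u : 0 <= X u <= d^-1.
  have [N NE] := XE u; rewrite -(NE N)// sumr_ge0/=; last by move=> i _; case/andP: (psi01 (stick Q i 0 u)).
  apply: (@le_trans _ _ (\sum_(i < N) d^-1 * stick Q i 0 u)).
    by apply: ler_sum => i _; apply: psi_le; rewrite ltW// stick_gt0.
  by rewrite -mulr_sumr ler_piMr// ltW// stick_sum_lt1.
have [I IE cI] := stick_limit l_gt0 l_potter l_flat eta_gt0 alpha01 b12 eta_small p_ge0 p_sum
  cp_gt0 p_cvg a_ge0 a_rv mQ Q01 QE cG GM (fun x _ => cpsi x) d0 psid XE.
have <- : I = beta_mean alpha bet 0 (fun x => psi x / x).
  exact: (cvg_unique _ cI (mean_jump_cvg cpsi psi01 d0 psid cG GM Gid)).
rewrite -IE; apply: eq_integral => u _; rewrite Gid//.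
by have [N NE] := finite_sum u; rewrite /X (NE N).
Qed.

(** By [mean_stick_sum] both measures give the same integrals to test functions:
    the size-biased length has the beta density, and division by the length
    gives the intensity. *)
Lemma stick_intensity : has_intensity U (stick_process mQ)
  (fun x => x `^ (- alpha - 1) * (1 - x) `^ (alpha * (2 - b) - 1) / euler_beta (1 - alpha) (alpha * (2 - b))).
Proof.
set h := (fun x => _).
have mass0 : 0 < beta_mass alpha bet 0.
  by have [] := beta_mass_gt0 L_gt0 L_potter L_flat (alpha_itv alpha01) (jump_weight_ge0 p_ge0)
    cp_gt0 (jump_weight_cvg p_cvg) weight_ge0 weight_rv (stick_exponent_gt alpha01 eta_small) 0.
have bet1 : bet 1 = alpha * (2 - b) by rewrite /bet /stick_exponent; ring.
have eulerE : euler_beta (1 - alpha) (alpha * (2 - b)) = beta_mass alpha bet 0.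
  rewrite /euler_beta /beta_mass /beta_weight bet1; apply: eq_Rintegral => t _.
  by congr (_ `^ _ * _); ring.
have h0 x : 0 <= h x by rewrite /h eulerE divr_ge0 ?mulr_ge0 ?powR_ge0 ?(ltW mass0).
pose I01 : set mR := `]0, 1]%classic.
have mI : measurable I01 by exact: measurable_itv.
have mh : measurable_fun [set: mR] (h : mR -> mR).
  have m1x : measurable_fun [set: mR] ((fun x : R => 1 - x) : mR -> mR) by exact: measurable_funB.
  apply: measurable_funM => //; apply: measurable_funM; first exact: measurable_powR.
  exact: (measurableT_comp (@measurable_powR R _) m1x).
pose f : R -> R := h \_ I01.
have f0 x : 0 <= f x by rewrite /f patchE; case: ifP.
have mf : measurable_fun [set: mR] (f : mR -> mR).
  by apply/(measurable_restrictT _ _).1 => //; exact: measurable_funTS.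
have [m1 [m1E m1_int]] := @mean_measure_of_atoms _ mR R U _ (fun i => measurable_stick mQ i 0).
pose m2 : {measure set mR -> \bar R} := density_measure mf f0.
move=> B mB B01.
have -> : (\int[lebesgue_measure]_(x in B) (h x)%:E = m2 B)%E.
  by apply: eq_integral => x /set_mem/B01 xI; rewrite /f patchE mem_set.
have -> : (\int[U]_u stick_process mQ u B = m1 B)%E by rewrite m1E.
apply: (@measures_eq_of_test R m1 m2 _ B mB); last first.
  by move=> x /B01; rewrite /= !in_itv/= andbT => /andP[].
move=> psi d cpsi psi01 d0 psid.
have mpsi : measurable_fun [set: mR] (fun x : mR => (psi x)%:E).
  by apply/measurable_EFinP; exact: continuous_measurable_fun.
have psiE0 x : (0 <= (psi x)%:E)%E by rewrite lee_fin; case/andP: (psi01 x).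
have int1 : (\int[m1]_x (psi x)%:E = (beta_mean alpha bet 0 (fun x => psi x / x))%:E)%E.
  by rewrite m1_int// (mean_stick_sum cpsi psi01 d0 psid).
have int2 : (\int[m2]_x (psi x)%:E = (beta_mean alpha bet 0 (fun x => psi x / x))%:E)%E.
  rewrite (@integral_of_density R _ _ (@lebesgue_measure R) m2 f)//.
  transitivity (\int[lebesgue_measure]_(x in I01) (h x * psi x)%:E)%E.
    by rewrite [RHS]integral_mkcond; apply: eq_integral => x _; rewrite /f !patchE; case: ifP => _; rewrite ?mul0e.
  have mhpsi : measurable_fun [set: mR] ((fun x : R => h x * psi x) : mR -> mR).
    by apply: measurable_funM => //; exact: continuous_measurable_fun.
  have <- : (\int[lebesgue_measure]_(x in `]0%R, 1%R[) (h x * psi x)%:E =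
      \int[lebesgue_measure]_(x in I01) (h x * psi x)%:E)%E.
    by apply: integral_itv_bndo_bndc; apply: measurable_funTS; exact/measurable_EFinP.
  have iw : lebesgue_measure.-integrable (`]0, 1[%classic : set mR)
      (fun x => (beta_weight alpha bet 0 x * (psi x / x))%:E).
    have [_ iw0] := beta_mass_gt0 L_gt0 L_potter L_flat (alpha_itv alpha01) (jump_weight_ge0 p_ge0)
      cp_gt0 (jump_weight_cvg p_cvg) weight_ge0 weight_rv (stick_exponent_gt alpha01 eta_small) 0.
    have iwd := @integrableZl _ _ R lebesgue_measure _ (measurable_itv _) d^-1 _ iw0.
    apply: le_integrable iwd; first exact: measurable_itv.
      apply/measurable_EFinP; apply: measurable_funM; first by apply/measurable_EFinP; exact: measurable_int iw0.
      apply: measurable_funM; first by apply: measurable_funTS; exact: continuous_measurable_fun.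
      apply: open_continuous_measurable_fun; first exact: interval_open.
      by move=> x; rewrite inE/= in_itv/= => /andP[x0 _]; apply: cvgV; [rewrite gt_eqF|exact: cvg_id].
    move=> x; rewrite /= in_itv/= => /andP[x0 x1].
    have w0 : 0 <= beta_weight alpha bet 0 x by rewrite mulr_ge0 ?powR_ge0.
    have di : 0 <= d^-1 by rewrite invr_ge0 ltW.
    have [p0 p1] := andP (psi01 x).
    have q1 : psi x / x <= d^-1.
      rewrite ler_pdivrMr//; have [xd|dx] := ltP x d; first by rewrite psid// mulr_ge0// ltW.
      by rewrite mulrC (le_trans p1)// ler_pdivlMr// mul1r.
    have q0 : 0 <= psi x / x by rewrite divr_ge0// ltW.
    rewrite /= lee_fin [X in X <= _]ger0_norm; last exact: mulr_ge0 w0 q0.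
    rewrite [X in _ <= X]ger0_norm; last exact: mulr_ge0 di w0.
    by rewrite mulrC; exact: ler_wpM2r w0 _ _ q1.
  transitivity (\int[lebesgue_measure]_(x in `]0%R, 1%R[)
      ((beta_mass alpha bet 0)^-1%:E * (beta_weight alpha bet 0 x * (psi x / x))%:E))%E.
    apply: eq_integral => x; rewrite inE/= in_itv/= => /andP[x0 x1].
    rewrite -EFinM /h eulerE /beta_weight bet1.
    have -> : x `^ (- alpha - 1) = x `^ (- alpha) / x.
      by rewrite powRD ?(gt_eqF x0) ?implybT// powR_inv1// ltW.
    have reorder (y z m q s : R) : y / s * z / m * q = m^-1 * (y * z * (q / s)) by ring.
    by congr EFin; exact: reorder.
  rewrite (@integralZl _ _ R lebesgue_measure _ (measurable_itv _) _ iw).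
  rewrite /beta_mean /Rintegral mulrC EFinM fineK//.
  exact: (@integrable_fin_num _ _ R lebesgue_measure _ (measurable_itv _) _ iw).
by split; rewrite ?int1 int2// ltry.
Qed.

End gibbs_intensity.


(** * Convergence of Gibbs partitions to stick breaking *)

Theorem corollary3p15 (R : realType) (v w : nat -> R)
    (rho_v rho_w : R) (Lv : R -> R) (cw a b : R)
    (v_ge0 : forall n, (0 < n)%N -> 0 <= v n)
    (w_ge0 : forall n, 0 <= w n)
    (rho_v_gt0 : 0 < rho_v) (rho_w_gt0 : 0 < rho_w)
    (radius_v : conv_radius v = rho_v%:E)
    (radius_w : conv_radius w = rho_w%:E)
    (critical : (\sum_(0 <= i <oo) (w i * rho_w ^+ i)%:E)%E = rho_v%:E)
    (Lv_sv : slowly_varying Lv)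
    (cw_gt0 : 0 < cw)
    (a_gt1 : 1 < a) (a_lt2 : a < 2) (b_gt1 : 1 < b) (b_lt2 : b < 2)
    (v_eq : forall n, (0 < n)%N ->
       v n = Lv n%:R * n%:R `^ (- b) * rho_v ^- n)
    (w_equiv : w ~_\oo (fun n : nat => cw * n%:R `^ (- a) * rho_w ^- n))
    (d : nat -> measure_display) (T : forall n, measurableType (d n))
    (P : forall n, probability (T n) R)
    (K : forall n, T n -> seq nat)
    (K_gibbs : forall n, (0 < n)%N -> (0 < gibbs_u v w n)%E ->
       gibbs_sizes v w n (P n) (K n)) :
  let alpha := a - 1 in
  exists (d' : measure_display) (T' : measurableType d')
    (P' : probability T' R) (Upsilon : R.-ker T' ~> measurableTypeR R),
  [/\ point_process Upsilon,
      cvg_point_process P (fun n t => sizes_measure R n (K n t)) P' Upsilon,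
      has_intensity P' Upsilon
        (fun x => x `^ (- alpha - 1) * (1 - x) `^ (alpha * (2 - b) - 1)
                  / euler_beta (1 - alpha) (alpha * (2 - b))) &
      {ae P', forall t,
         infinite_set [set x : R | x \in `]0, 1] /\ (0 < Upsilon t [set x])%E]}].

Proof.
set alpha := a - 1 => /=.
have alpha01 : 0 < alpha < 1 by rewrite /alpha; apply/andP; split; lra.
have b12 : 1 < b < 2 by rewrite b_gt1.
(* Potter exponents must be smaller than alpha (2 - b), the second parameter of the first beta law. *)
pose eta := alpha * (2 - b) / 2.
have ab0 : 0 < alpha * (2 - b) by rewrite mulr_gt0 ?subr_gt0//; case/andP: alpha01.
have eta_gt0 : 0 < eta by rewrite /eta; lra.
have eta_small : eta < alpha * (2 - b) by rewrite /eta; lra.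
have [l [l_gt0 l_potter l_flat [X lE]]] := slowly_varying_regularize Lv_sv eta_gt0.
have p_ge0 := size_weight_ge0 rho_v_gt0 rho_w_gt0 w_ge0.
have p_sum := size_weight_sum rho_v_gt0 rho_w_gt0 w_ge0 critical.
have cp_gt0 : 0 < cw / rho_v by rewrite divr_gt0.
have p_cvg := size_weight_cvg rho_v_gt0 rho_w_gt0 cw_gt0 w_equiv.
have aE : a = 1 + alpha by rewrite /alpha addrC subrK.
rewrite aE in p_cvg.
have n_ge0 := number_weight_ge0 rho_v_gt0 v_ge0.
have n_rv := number_weight_rv rho_v_gt0 v_eq l_gt0 lE.
have [Q [mQ Q01 QE]] := stick_fractions_exist l_gt0 l_potter l_flat eta_gt0 alpha01 b12 eta_small
  p_ge0 p_sum cp_gt0 p_cvg n_ge0 n_rv.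
exists _, (measurableTypeR R), (uniform_prob (@ltr01 R)), (stick_process mQ); split.
- exact: stick_process_point_process.
- exact: (gibbs_cvg_point_process l_gt0 l_potter l_flat eta_gt0 alpha01 b12 eta_small
    rho_v_gt0 rho_w_gt0 v_ge0 w_ge0 p_sum cp_gt0 p_cvg n_rv K_gibbs Q01 QE).
- exact: (stick_intensity l_gt0 l_potter l_flat eta_gt0 alpha01 b12 eta_small
    p_ge0 p_sum cp_gt0 p_cvg n_ge0 n_rv mQ Q01 QE).
- by apply: aeW => u; exact: stick_process_infinite.
Qed.
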